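(* Let $A>0$. For all positive real numbers $x$ and $Q$ satisfying $x(\log x)^{-A}\le Q\le x$, \[\sum_{q\le Q}\ \sum_{\substack{a\le q\\ (a,q)=1}}\ \max_{\pi\in\mathcal{P}_x}\ \sum_{I\in\pi}\left(\theta(I;q,a)-\frac{|I|}{\phi(q)}\right)^2 \ll_A xQ\log^3(x),\] where the implied constant depends only on $A$.
   Context: $\phi$ is Euler's totient function and $\log$ is the natural logarithm. For an interval $I$ and positive integers $q,a$, $\theta(I;q,a)=\sum_{p\in I,\ p\equiv a \bmod q}\log p$, the sum over primes $p$. $|I|$ denotes the number of integers contained in $I$. $\mathcal{P}_x$ denotes the set of all partitions of $\{1,2,\ldots,\lfloor x\rfloor\}$ into disjoint intervals (of consecutive integers). *)

(* Defs.v *)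
From HB Require Import structures.
From mathcomp Require Import all_boot all_order all_algebra.
From mathcomp Require Import all_classical all_reals exp.
Set Implicit Arguments. Unset Strict Implicit. Unset Printing Implicit Defensive.
Import Order.TTheory GRing.Theory Num.Theory.
Local Open Scope ring_scope.

(* Integers 1..N are represented inside the finite type 'I_N.+1
   (the element 0 is not part of the ground set). *)
Definition ground (N : nat) : {set 'I_N.+1} := [set i : 'I_N.+1 | (0 < i)%N].

Definition is_interval (N : nat) (B : {set 'I_N.+1}) : bool :=
  [forall i : 'I_N.+1, forall j : 'I_N.+1, forall k : 'I_N.+1,
     [&& i \in B, k \in B, (i <= j)%N & (j <= k)%N] ==> (j \in B)].

Definition interval_partition (N : nat) (P : {set {set 'I_N.+1}}) : bool :=
  finset.partition P (ground N) && [forall B in P, is_interval B].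

Definition theta (R : realType) (N : nat) (I : {set 'I_N.+1}) (q a : nat) : R :=
  \sum_(p in I | prime p && (p == a %[mod q])) ln (p%:R : R).

Definition part_sum (R : realType) (N : nat) (P : {set {set 'I_N.+1}}) (q a : nat) : R :=
  \sum_(I in P) (theta R I q a - (#|I|%:R) / (totient q)%:R) ^+ 2.

(* max over all partitions of {1..N} into intervals (values are >= 0 and
   the set of such partitions is nonempty, so the max with 0 is the true max) *)
Definition max_part (R : realType) (N : nat) (q a : nat) : R :=
  \big[Num.max/0]_(P : {set {set 'I_N.+1}} | interval_partition P) part_sum R P q a.

(* Main.v *)
Require Import Defs.
From HB Require Import structures.
From mathcomp Require Import all_boot all_order all_algebra.
From mathcomp Require Import all_classical all_reals exp.
From mathcomp Require Import interval_inference topology normedtype sequences.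
From mathcomp Require Import derive realfun trigo.
From mathcomp Require Import complex.
From mathcomp Require Import all_fingroup cyclic all_field.
From mathcomp Require Import ring lra zify.
Set Implicit Arguments. Unset Strict Implicit. Unset Printing Implicit Defensive.
Import Order.TTheory GRing.Theory Num.Theory.
Import numFieldNormedType.Exports.
Local Open Scope ring_scope.
Local Open Scope complex_scope.
Local Notation Re := (@complex.Re _).
Local Notation Im := (@complex.Im _).

(* The proof has two parts.  The analytic part is the Siegel-Walfisz theorem, obtained without contour
   integration: powers of ln n times Lambda(n) chi(n) have Dirichlet series given by derivatives of
   L'/L, which stay small up to the line Re s = 1 thanks to a lower bound for L (the 3-4-1 inequality away
   from the real axis, Siegel's theorem near it), and a discretised Fejer kernel turns these bounds
   into bounds for partial sums.

   The elementary part works on a block J of length L >= W = floor Q.  For moduli V < r <= W with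
   V = W / M0, expanding the square produces pairs of primes p < p' in J with p' - p = r m; here
   m <= L / V is at most a power of log x, so Siegel-Walfisz modulo m evaluates the sum over p', and
   the main terms cancel because both are averages of 1 / phi.  A modulus q <= V is compared with the
   moduli q m, m prime, V < q m <= W.  An arbitrary interval is cut along a grid of step W: its two
   short ends are bounded trivially, and its core is split into dyadic grid blocks with only a
   power of log log x lost.  A block lies in at most one interval of a partition, hence the bound is
   uniform in the partition. *)

(** * Real-valued modulus on C, real and imaginary parts, and the unit circle *)

Section ComplexNorm.
Variable R : realType.
Local Notation C := R[i].
Implicit Types (z w : C) (x y : R).

(** The three logarithms in the bound are spent as follows. On a block the diagonal costs one.
    Passing from small moduli q to multiples q m costs a second, since r = q m is charged with total
    weight at most ln r. The third pays for (log log x)^4: two factors come from averages of 1 / phi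
    over the complementary modulus, two from the dyadic decomposition. The lower bound on Q makes x
    / Q, which controls both the range of m and the number of dyadic scales, at most a power of log
    x. Siegel-Walfisz is invoked with exponent 2A + 1, so that its error stays below W even after
    summation over m.

    In the analytic part s is always real and larger than 1. Imaginary parts live in the
    coefficients as twists n^(-it), and relations between derivatives of L and of L'/L are
    coefficientwise identities between Dirichlet convolutions, so no analytic continuation is
    required. The derivative of order 4K + 9 is the one for which, at s = 1 + 1 / ln x, the
    truncation argument ends with a saving of (ln x)^K. *)

Definition cn z : R := Normc.normc z.

Lemma cnE z : cn z = Num.sqrt (Re z ^+ 2 + Im z ^+ 2).
Proof. by case: z. Qed.

Lemma cn_ge0 z : 0 <= cn z. Proof. by rewrite cnE sqrtr_ge0. Qed.
Lemma cn0 : cn 0 = 0. Proof. exact: Normc.normc0. Qed.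
Lemma cn1 : cn 1 = 1. Proof. exact: Normc.normc1. Qed.
Lemma cnM z w : cn (z * w) = cn z * cn w. Proof. exact: Normc.normcM. Qed.
Lemma cnV z : cn z^-1 = (cn z)^-1. Proof. exact: Normc.normcV. Qed.
Lemma cnN z : cn (- z) = cn z. Proof. exact: normcN. Qed.
Lemma cnD z w : cn (z + w) <= cn z + cn w. Proof. exact: le_normcD. Qed.
Lemma cn_eq0 z : (cn z == 0) = (z == 0).
Proof. by apply/eqP/eqP => [/Normc.eq0_normc|->]; rewrite ?cn0. Qed.

Lemma cnB z w : cn (z - w) <= cn z + cn w.
Proof. by rewrite -(cnN w); exact: cnD. Qed.
Lemma cnBC z w : cn (z - w) = cn (w - z).
Proof. by rewrite -cnN opprB. Qed.
Lemma cnBge z w : cn z - cn w <= cn (z - w).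
Proof. by rewrite lerBlDr; apply: le_trans (cnD _ _); rewrite subrK. Qed.
Lemma cn_dist_trans z w v : cn (z - v) <= cn (z - w) + cn (w - v).
Proof. by apply: le_trans (cnD _ _); rewrite addrA subrK. Qed.

Lemma cnX z n : cn (z ^+ n) = cn z ^+ n.
Proof. by elim: n => [|n IH]; rewrite ?expr0 ?cn1 // !exprS cnM IH. Qed.

Lemma cn_real x : cn x%:C = `|x|.
Proof. by rewrite cnE /= expr0n addr0 sqrtr_sqr. Qed.

Lemma cn_nat n : cn n%:R = n%:R.
Proof.
have -> : n%:R = (n%:R)%:C :> C by rewrite rmorph_nat.
by rewrite cn_real ger0_norm.
Qed.

Lemma cn_sqr z : cn z ^+ 2 = Re z ^+ 2 + Im z ^+ 2.
Proof. by rewrite cnE sqr_sqrtr // addr_ge0 ?sqr_ge0. Qed.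

Lemma Re_le_cn z : `|Re z| <= cn z.
Proof. by rewrite cnE -sqrtr_sqr ler_wsqrtr // lerDl sqr_ge0. Qed.
Lemma Im_le_cn z : `|Im z| <= cn z.
Proof. by rewrite cnE -sqrtr_sqr ler_wsqrtr // lerDr sqr_ge0. Qed.

Lemma cn_le_ReIm z : cn z <= `|Re z| + `|Im z|.
Proof.
rewrite -(ler_pXn2r (n := 2)) ?nnegrE ?addr_ge0 ?cn_ge0 //.
rewrite cn_sqr -(real_normK (num_real (Re z))) -(real_normK (num_real (Im z))).
have := normr_ge0 (Re z); have := normr_ge0 (Im z); nra.
Qed.

Lemma cn_sum (I : Type) (r : seq I) (P : pred I) (F : I -> C) :
  cn (\sum_(i <- r | P i) F i) <= \sum_(i <- r | P i) cn (F i).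
Proof.
elim/big_rec2: _ => [|i y x _ IH]; first by rewrite cn0.
by apply: le_trans (cnD _ _) _; rewrite lerD2l.
Qed.

Lemma cReM_real x z : Re (x%:C * z) = x * Re z.
Proof. by case: z => a b /=; rewrite mul0r subr0. Qed.
Lemma cImM_real x z : Im (x%:C * z) = x * Im z.
Proof. by case: z => a b /=; rewrite mul0r addr0. Qed.
Lemma cReD z w : Re (z + w) = Re z + Re w. Proof. by case: z; case: w. Qed.
Lemma cImD z w : Im (z + w) = Im z + Im w. Proof. by case: z; case: w. Qed.
Lemma cReN z : Re (- z) = - Re z. Proof. by case: z. Qed.
Lemma cImN z : Im (- z) = - Im z. Proof. by case: z. Qed.
Lemma cReM z w : Re (z * w) = Re z * Re w - Im z * Im w.
Proof. by case: z; case: w. Qed.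
Lemma cImM z w : Im (z * w) = Re z * Im w + Im z * Re w.
Proof. by case: z; case: w. Qed.

Lemma cRe_sum (I : Type) (r : seq I) (P : pred I) (F : I -> C) :
  Re (\sum_(i <- r | P i) F i) = \sum_(i <- r | P i) Re (F i).
Proof. by elim/big_rec2: _ => [//|i y x _ <-]; rewrite cReD. Qed.
Lemma cIm_sum (I : Type) (r : seq I) (P : pred I) (F : I -> C) :
  Im (\sum_(i <- r | P i) F i) = \sum_(i <- r | P i) Im (F i).
Proof. by elim/big_rec2: _ => [//|i y x _ <-]; rewrite cImD. Qed.
Lemma complexP z w : Re z = Re w -> Im z = Im w -> z = w.
Proof. by case: z; case: w => a b c d /= -> ->. Qed.

Definition cis x : C := cos x +i* sin x.

Lemma cisD x y : cis (x + y) = cis x * cis y.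
Proof. by rewrite /cis cosD sinD; apply: complexP => //=; rewrite addrC. Qed.
Lemma cis0 : cis 0 = 1. Proof. by rewrite /cis cos0 sin0. Qed.
Lemma cn_cis x : cn (cis x) = 1.
Proof. by rewrite cnE /cis /= cos2Dsin2 sqrtr1. Qed.
Lemma cisMn x n : cis (x *+ n) = cis x ^+ n.
Proof. by elim: n => [|n IH]; rewrite ?mulr0n ?cis0 // mulrS cisD IH exprS. Qed.

Lemma sin_le_norm x : `|sin x| <= `|x|.
Proof.
wlog x0 : x / 0 <= x.
  move=> H; case: (leP 0 x) => [/H //|/ltW x0].
  by rewrite -normrN -sinN -(normrN x); apply: H; lra.
have [->|xn0] := eqVneq x 0; first by rewrite sin0.
have xp : 0 < x by rewrite lt_def xn0.
have [|c _] := @MVT_segment R (@sin R) (@cos R) 0 x (ltW xp).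
  by apply: continuous_subspaceT => y; exact: continuous_sin.
rewrite sin0 !subr0 => ->; rewrite normrM ler_piMl //.
by rewrite ler_norml cos_geN1 cos_le1.
Qed.

(** Pulling out the phase of the midpoint leaves [2 i sin] of the half difference. *)
Lemma cn_cisB x y : cn (cis x - cis y) <= `|x - y|.
Proof.
pose u := (x + y) / 2; pose v := (x - y) / 2.
have -> : x = u + v by rewrite /u /v; field.
have -> : y = u - v by rewrite /u /v; field.
rewrite !cisD -mulrBr cnM cn_cis mul1r.
have -> : cis v - cis (- v) = ((2 * sin v)%:C * 'i)%C.
  by rewrite /cis cosN sinN; apply: complexP => /=; ring.
rewrite cnM cn_real.
have -> : cn 'i%C = 1 by rewrite cnE /= expr0n expr1n add0r sqrtr1.
have -> : u + v - (u - v) = 2 * v by ring.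
by rewrite mulr1 2!normrM; apply: ler_wpM2l => //; exact: sin_le_norm.
Qed.

End ComplexNorm.

Arguments cn : simpl never.
Arguments cis : simpl never.

(** * Logarithms against powers, and sums of real powers n^(-s) *)

Section RealEstimates.
Variable R : realType.
Implicit Types (x y s d : R) (m n : nat).

Lemma expRN_le x : 0 <= x -> x <= 1 -> expR (- x) <= 1 - x / 2.
Proof.
move=> x0 x1; rewrite expRN.
have h : 1 + x <= expR x := expR_ge1Dx x.
rewrite -div1r ler_pdivrMr ?expR_gt0 //; nra.
Qed.

Lemma ln_le_sub1 x : 0 < x -> ln x <= x - 1.
Proof.
move=> x0; have := @le_ln1Dx R (x - 1); rewrite (_ : 1 + (x - 1) = x); last by ring.
by apply; lra.
Qed.

Lemma powRE x d : 0 < x -> x `^ d = expR (d * ln x).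
Proof. by move=> x0; rewrite /powR gt_eqF. Qed.

Lemma ln_le_powR x d : 0 < d -> 1 <= x -> ln x <= x `^ d / d.
Proof.
move=> d0 x1; rewrite ler_pdivlMr // mulrC -ln_powR.
have := @ln_sublinear R (x `^ d); rewrite powR_gt0 ?(lt_le_trans ltr01) //.
by move=> /(_ isT) /ltW.
Qed.

Lemma lnX_le_powR k d : 0 < d ->
  exists2 c : R, 1 <= c & forall x, 1 <= x -> (ln x) ^+ k <= c * x `^ d.
Proof.
(* Dividing by [k.+1] instead of [k] also covers [k = 0]; the k-th power of [x ^ e] is still at most
   [x ^ d]. *)
move=> d0; pose e := d / (k.+1)%:R.
have e0 : 0 < e by rewrite divr_gt0 ?ltr0n.
exists (Num.max 1 (e^-1 ^+ k)); first by rewrite le_max lexx.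
move=> x x1.
have x0 : 0 < x by apply: lt_le_trans x1.
have h := ln_le_powR e0 x1; have l0 := ln_ge0 x1.
apply: le_trans (_ : (x `^ e / e) ^+ k <= _).
  by rewrite lerXn2r // nnegrE // divr_ge0 ?powR_ge0 // ltW.
rewrite exprMn mulrC; apply: ler_pM; rewrite ?exprn_ge0 ?invr_ge0 ?powR_ge0 ?(ltW e0) //.
  by rewrite le_max lexx orbT.
rewrite -powR_mulrn ?powR_ge0 // -powRrM ler_powR //.
by rewrite /e mulrAC ler_pdivrMr ?ltr0n // ler_wpM2l ?ler_nat // ltW.
Qed.

Definition pw s n : R := n%:R `^ (- s).

Lemma pw_ge0 s n : 0 <= pw s n. Proof. exact: powR_ge0. Qed.
Lemma pw_gt0 s n : (0 < n)%N -> 0 < pw s n.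
Proof. by move=> n0; rewrite powR_gt0 ?ltr0n. Qed.
Lemma pw1 s : pw s 1 = 1. Proof. by rewrite /pw powR1. Qed.
Lemma pwM s m n : pw s (m * n) = pw s m * pw s n.
Proof. by rewrite /pw natrM powRM. Qed.
Lemma pwD s d n : (0 < n)%N -> pw (s + d) n = pw s n * pw d n.
Proof. by move=> n0; rewrite /pw opprD powRD // pnatr_eq0 -lt0n n0 implybT. Qed.
Lemma pw_le s d n : (0 < n)%N -> s <= d -> pw d n <= pw s n.
Proof. by move=> n0 sd; rewrite /pw ler_powR ?ler1n // lerN2. Qed.
Lemma pw_le1 s n : 0 <= s -> (0 < n)%N -> pw s n <= 1.
Proof. by move=> s0 n0; apply: le_trans (pw_le n0 s0) _; rewrite /pw oppr0 powRr0. Qed.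
Lemma pwE s n : (0 < n)%N -> pw s n = expR (- s * ln n%:R).
Proof. by move=> n0; rewrite /pw powRE ?ltr0n. Qed.
Lemma pw_oneE n : (0 < n)%N -> pw 1 n = n%:R^-1.
Proof. by move=> n0; rewrite /pw powR_inv1. Qed.
Lemma pw_nat k n : pw k%:R n = n%:R ^- k.
Proof. by rewrite /pw powR_invn. Qed.
Lemma pwMn s m n : (m <= n)%N -> (0 < m)%N -> 0 <= s -> pw s n <= pw s m.
Proof.
move=> mn m0 s0; rewrite /pw !powRN lef_pV2 ?posrE ?powR_gt0 ?ltr0n ?(leq_trans m0) //.
by rewrite ge0_ler_powR ?nnegrE ?ler_nat.
Qed.

Lemma ln_succ_ge n : (0 < n)%N -> n.+1%:R^-1 <= ln n.+1%:R - ln n%:R :> R.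
Proof.
move=> n0; have p1 : (0 : R) < n%:R by rewrite ltr0n.
have p2 : (0 : R) < n.+1%:R by rewrite ltr0n.
rewrite -lerN2 opprB -ln_div ?posrE //; apply: le_trans (ln_le_sub1 _) _; first by rewrite divr_gt0.
rewrite lerBlDr -[n.+1%:R^-1]div1r -mulNr -[X in _ <= _ + X](divff (lt0r_neq0 p2)) -mulrDl.
by rewrite div1r ler_pM2r ?invr_gt0 // -natr1 addrC addrK.
Qed.

Lemma ln_succ_le n : (0 < n)%N -> ln n.+1%:R - ln n%:R <= n%:R^-1 :> R.
Proof.
move=> n0; have p1 : (0 : R) < n%:R by rewrite ltr0n.
have p2 : (0 : R) < n.+1%:R by rewrite ltr0n.
rewrite -ln_div ?posrE //; apply: le_trans (ln_le_sub1 _) _; first by rewrite divr_gt0.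
by rewrite lerBlDr -natr1 mulrDl divff ?gt_eqF // div1r addrC.
Qed.

(** Discrete form of integrating the derivative of [- t ^ (- d)]: it is [1 + u <= e ^ u] at
    [u = d ln ((n + 1) / n)], where [u >= d / (n + 1)]. *)
Lemma pw_tele d n : 0 < d -> (0 < n)%N -> d * pw (1 + d) n.+1 <= pw d n - pw d n.+1.
Proof.
move=> d0 n0; rewrite lerBrDr addrC pwD // [pw 1 _]pw_oneE //.
have N0 : (0 : R) < n.+1%:R by rewrite ltr0n.
have n0' : (0 : R) < n%:R by rewrite ltr0n.
rewrite (_ : _ + _ = pw d n.+1 * (1 + d / n.+1%:R)); last by ring.
rewrite !pwE // -ler_pdivlMl ?expR_gt0 // -expRN -expRD.
apply: le_trans (expR_ge1Dx _); rewrite lerD2l.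
have -> : - (- d * ln n.+1%:R) + - d * ln n%:R = d * (ln n.+1%:R - ln n%:R) by ring.
by rewrite ler_pM2l // ln_succ_ge.
Qed.

Lemma sum_pw_tail d M N : 0 < d -> (0 < M)%N ->
  \sum_(M.+1 <= n < N) pw (1 + d) n <= pw d M / d.
Proof.
move=> d0 M0; rewrite ler_pdivlMr // mulr_suml.
apply: le_trans (_ : \sum_(M.+1 <= n < N) (pw d n.-1 - pw d n) <= _).
  rewrite big_nat [X in _ <= X]big_nat; apply: ler_sum => n /andP[h _].
  by rewrite mulrC; case: n h => // n h; apply: pw_tele => //; lia.
case: (leqP N M.+1) => h; first by rewrite big_geq // pw_ge0.
have -> : \sum_(M.+1 <= n < N) (pw d n.-1 - pw d n) = pw d M - pw d N.-1.
  case: N h => // N h; rewrite (@telescope_sumr_eq _ _ _ (fun n => - pw d n.-1)) 1?ltnW //=.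
    by rewrite opprK addrC.
  by move=> k _; rewrite opprK addrC.
by rewrite lerBlDr lerDl pw_ge0.
Qed.

Lemma sum_pw_bound d N : 0 < d -> \sum_(1 <= n < N) pw (1 + d) n <= 1 + d^-1.
Proof.
move=> d0; case: N => [|[|N]]; try by rewrite big_geq // addr_ge0 ?invr_ge0 ?ltW.
rewrite big_ltn // pw1 lerD2l; apply: le_trans (sum_pw_tail N.+2 d0 (ltn0Sn 0)) _.
by rewrite pw1 div1r.
Qed.

(** The factor 1/2 is the price of the linear bound [e ^ (- u) <= 1 - u / 2] on [0, 1]. The case
    [n = 1] is separate because [n.-1 = 0] has only a default logarithm. *)
Lemma powR_tele d n : 0 < d -> d <= 1 -> (0 < n)%N ->
  d / 2 * pw (1 - d) n <= n%:R `^ d - n.-1%:R `^ d.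
Proof.
move=> d0 d1; case: n => // -[_|n _] /=.
  by rewrite pw1 powR1 powR0 ?gt_eqF //; lra.
set m := n.+2; have m0 : (0 : R) < m%:R by rewrite ltr0n.
have n0 : (0 : R) < n.+1%:R by rewrite ltr0n.
have -> : pw (1 - d) m = m%:R `^ d / m%:R.
  by rewrite /pw opprB powRD ?powR_inv1 ?(ltW m0) // (lt0r_neq0 m0) implybT.
have -> : n.+1%:R `^ d = m%:R `^ d * expR (d * (ln n.+1%:R - ln m%:R)).
  by rewrite !powRE // -expRD; congr expR; ring.
have h : ln n.+1%:R - ln m%:R <= - m%:R^-1 :> R.
  by rewrite -lerN2 opprK opprB ln_succ_ge.
have i0 : 0 < m%:R^-1 :> R by rewrite invr_gt0.
have i1 : m%:R^-1 <= 1 :> R by rewrite invf_le1 // ler1n.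
have h2 : expR (d * (ln n.+1%:R - ln m%:R)) <= 1 - d * m%:R^-1 / 2.
  apply: le_trans (expRN_le _ _); [|nra|nra].
  by rewrite ler_expR -mulrN ler_pM2l.
have := powR_gt0 d m0; nra.
Qed.

Lemma sum_pw_head d N : 0 < d -> d <= 1 ->
  \sum_(1 <= n < N.+1) pw (1 - d) n <= 2 / d * N%:R `^ d.
Proof.
move=> d0 d1; elim: N => [|N IH].
  by rewrite big_geq // mulr_ge0 ?powR_ge0 // divr_ge0 // ltW.
rewrite big_nat_recr //=.
have h := powR_tele d0 d1 (ltn0Sn N); rewrite /= in h.
rewrite -ler_pdivrMl ?divr_gt0 // invf_div mulrDr.
rewrite -[N.+1%:R `^ d](subrK (N%:R `^ d)) addrC lerD //.
by rewrite -ler_pdivlMl ?divr_gt0 // ?invf_div.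
Qed.

Lemma harmonic_le N : (0 < N)%N ->
  \sum_(1 <= n < N.+1) (n%:R^-1 : R) <= 1 + ln N%:R.
Proof.
elim: N => // -[|N] IH _; first by rewrite big_nat1 invr1 ln1 addr0.
rewrite big_nat_recr //=; apply: le_trans (lerD (IH _) (lexx _)) _ => //.
by rewrite -addrA lerD2l -lerBrDl ln_succ_ge.
Qed.

End RealEstimates.

(** * Dirichlet convolution over a commutative ring *)

Section Convolution.
Variable T : comNzRingType.
Implicit Types (a b c lg : nat -> T) (n d e M N : nat).

Lemma sum_divisors (F : nat -> T) n M : (0 < n)%N -> (n <= M)%N ->
  \sum_(d <- divisors n) F d = \sum_(1 <= d < M.+1 | (d %| n)%N) F d.
Proof.
move=> n0 nM; rewrite -[RHS]big_filter; apply: perm_big; apply: uniq_perm.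
- exact: divisors_uniq.
- by rewrite filter_uniq // iota_uniq.
move=> d; rewrite mem_filter mem_index_iota -dvdn_divisors //.
case dn: (d %| n)%N => //=; rewrite (dvdn_gt0 n0 dn) /= ltnS.
by rewrite (leq_trans (dvdn_leq n0 dn) nM).
Qed.

Lemma sum_multiples (F : nat -> T) d N : (0 < d)%N ->
  \sum_(1 <= n < N.+1 | (d %| n)%N) F n = \sum_(1 <= e < (N %/ d).+1) F (d * e)%N.
Proof.
move=> d0; elim: N => [|N IH]; first by rewrite div0n !big_geq.
rewrite [in LHS]big_mkcond big_nat_recr //= -big_mkcond /= IH divnS //.
case dN: (d %| N.+1)%N; last by rewrite addr0 add0n.
rewrite add1n [in RHS]big_nat_recr //=; congr (_ + F _).
by rewrite -[(N %/ d).+1]add1n -{1}[1%N]/(nat_of_bool true) -dN -divnS // mulnC divnK.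
Qed.

Definition conv a b n : T := \sum_(d <- divisors n) a d * b (n %/ d)%N.

Lemma sum_conv (F : nat -> nat -> T) N :
  \sum_(1 <= n < N.+1) \sum_(d <- divisors n) F d (n %/ d)%N =
  \sum_(1 <= d < N.+1) \sum_(1 <= e < (N %/ d).+1) F d e.
Proof.
transitivity (\sum_(1 <= n < N.+1) \sum_(1 <= d < N.+1 | (d %| n)%N) F d (n %/ d)%N).
  by apply: eq_big_nat => n /andP[n0 nN]; rewrite (sum_divisors _ n0 (M := N)).
rewrite (exchange_big_dep xpredT) //=; apply: eq_big_nat => d /andP[d0 _].
rewrite (sum_multiples (fun n => F d (n %/ d)%N)) //; apply: eq_bigr => e _.
by rewrite mulKn.
Qed.

(** The free bound [M] lets convolutions at different arguments be expanded over one common square,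
    which turns commutativity and associativity into exchanges of sums. *)
Lemma convE a b n M : (0 < n)%N -> (n <= M)%N ->
  conv a b n = \sum_(1 <= d < M.+1) \sum_(1 <= e < M.+1 | (d * e == n)%N) a d * b e.
Proof.
move=> n0 nM; rewrite /conv (sum_divisors _ n0 nM) big_mkcond /=.
apply: eq_big_nat => d /andP[d0 dM].
case dn: (d %| n)%N; last first.
  by rewrite big1 // => e /eqP h; move: dn; rewrite -h dvdn_mulr.
rewrite (eq_bigl (fun e => e == n %/ d)%N); last first.
  by move=> e; rewrite eqn_div // mulnC.
rewrite big_nat1_eq divn_gt0 // (dvdn_leq n0 dn) /= ltnS.
by rewrite (leq_trans (leq_div _ _) nM).
Qed.

Lemma convC a b n : (0 < n)%N -> conv a b n = conv b a n.
Proof.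
case: n => // n _; rewrite !(@convE _ _ n.+1 n.+1) // (exchange_big_dep xpredT) //=.
apply: eq_bigr => d _; apply: eq_big => [e|e _]; [by rewrite mulnC|exact: mulrC].
Qed.

Lemma eq_conv a a' b b' n : (0 < n)%N ->
  (forall d, (d %| n)%N -> a d = a' d) -> (forall d, (d %| n)%N -> b d = b' d) ->
  conv a b n = conv a' b' n.
Proof.
move=> n0 ha hb; apply: eq_big_seq => d; rewrite -dvdn_divisors // => dn.
by rewrite ha // hb // dvdn_div.
Qed.

Lemma convA a b c n : (0 < n)%N -> conv a (conv b c) n = conv (conv a b) c n.
Proof.
case: n => // n _; set N := n.+1.
pose S := \sum_(1 <= d < N.+1) \sum_(1 <= e < N.+1) \sum_(1 <= f < N.+1 | (d * e * f == N)%N)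
   a d * b e * c f.
transitivity S.
  rewrite (@convE _ _ N N) //; apply: eq_big_nat => d /andP[d0 _].
  transitivity (\sum_(1 <= m < N.+1 | (d * m == N)%N)
     \sum_(1 <= e < N.+1) \sum_(1 <= f < N.+1 | (e * f == m)%N) a d * b e * c f).
    rewrite big_nat_cond [RHS]big_nat_cond; apply: eq_bigr => m /andP[/andP[m0 mN] _].
    rewrite (@convE _ _ m N) // mulr_sumr; apply: eq_bigr => e _.
    by rewrite mulr_sumr; apply: eq_bigr => f _; rewrite mulrA.
  rewrite (exchange_big_dep xpredT) //=; apply: eq_big_nat => e /andP[e0 _].
  rewrite (exchange_big_dep xpredT) //=.
  rewrite [RHS]big_mkcond; apply: eq_big_nat => f /andP[f0 _].
  rewrite (eq_bigl (fun m => (m == e * f)%N && (d * (e * f) == N)%N)); last first.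
    by move=> m; rewrite andbT andbC (eq_sym m); case: eqP => [<-|].
  rewrite -mulnA; case h: (d * (e * f) == N)%N; last by rewrite big1 // => m; rewrite andbF.
  under eq_bigl do rewrite andbT.
  by rewrite big_nat1_eq muln_gt0 e0 f0 ltnS -(eqP h) leq_pmull.
transitivity (\sum_(1 <= m < N.+1) \sum_(1 <= f < N.+1 | (m * f == N)%N)
     \sum_(1 <= d < N.+1) \sum_(1 <= e < N.+1 | (d * e == m)%N) a d * b e * c f).
  rewrite /S; symmetry.
  transitivity (\sum_(1 <= m < N.+1) \sum_(1 <= d < N.+1) \sum_(1 <= f < N.+1 | (m * f == N)%N)
     \sum_(1 <= e < N.+1 | (d * e == m)%N) a d * b e * c f).
    by apply: eq_bigr => m _; rewrite exchange_big.
  rewrite exchange_big; apply: eq_big_nat => d /andP[d0 _].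
  transitivity (\sum_(1 <= m < N.+1) \sum_(1 <= e < N.+1 | (d * e == m)%N)
     \sum_(1 <= f < N.+1 | (m * f == N)%N) a d * b e * c f).
    by apply: eq_bigr => m _; rewrite exchange_big.
  rewrite (exchange_big_dep xpredT) //=; apply: eq_big_nat => e /andP[e0 _].
  rewrite (eq_bigl (fun m => m == d * e)%N); last by move=> m; rewrite eq_sym.
  rewrite big_nat1_eq muln_gt0 d0 e0 ltnS /=; case: leqP => // h.
  rewrite big_nat_cond big1 // => f /andP[/andP[f0 _] /eqP h2].
  by move: h; rewrite -h2 ltnNge leq_pmulr.
rewrite (@convE _ _ N N) //; apply: eq_big_nat => m /andP[m0 mN].
apply: eq_bigr => f _; rewrite (@convE _ _ m N) // mulr_suml.
by apply: eq_bigr => d _; rewrite mulr_suml.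
Qed.

Lemma convDl a a' b n : conv (fun m => a m + a' m) b n = conv a b n + conv a' b n.
Proof. by rewrite /conv -big_split; apply: eq_bigr => d _; rewrite mulrDl. Qed.

Definition lgadd lg := forall d e, (0 < d)%N -> (0 < e)%N -> lg (d * e)%N = lg d + lg e.

(** Multiplication by an additive function is a derivation of the convolution ring: write
    [lg n = lg d + lg (n / d)] and expand the k-th power by the binomial theorem. *)
Lemma conv_leibniz lg a b n k : lgadd lg -> (0 < n)%N ->
  lg n ^+ k * conv a b n =
  \sum_(i < k.+1) conv (fun m => lg m ^+ (k - i) * a m) (fun m => lg m ^+ i * b m) n *+ 'C(k, i).
Proof.
move=> h n0; rewrite mulr_sumr.
transitivity (\sum_(d <- divisors n) \sum_(i < k.+1)
   (lg d ^+ (k - i) * a d * (lg (n %/ d)%N ^+ i * b (n %/ d)%N)) *+ 'C(k, i)).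
  apply: eq_big_seq => d; rewrite -dvdn_divisors // => dn.
  rewrite -{1}(divnK dn) mulnC h ?divn_gt0 ?(dvdn_gt0 n0 dn) ?(dvdn_leq n0 dn) //.
  rewrite exprDn mulr_suml; apply: eq_bigr => i _.
  by rewrite mulrnAl mulrACA.
by rewrite exchange_big /=; apply: eq_bigr => i _; rewrite sumrMnl.
Qed.

Lemma conv_deriv lg a b n : lgadd lg -> (0 < n)%N ->
  lg n * conv a b n = conv (fun m => lg m * a m) b n + conv a (fun m => lg m * b m) n.
Proof.
move=> h n0; have := conv_leibniz a b 1 h n0.
rewrite expr1 => ->; rewrite !big_ord_recl big_ord0 addr0 /= bin0 bin1 !mulr1n.
by congr (_ + _); apply: eq_conv => // d _; rewrite ?subn0 ?expr1 ?expr0 ?mul1r.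
Qed.

End Convolution.

(** * The von Mangoldt function *)

Section Mangoldt.
Variable R : realType.

Lemma lgadd_ln : lgadd (fun n => ln (n%:R : R)).
Proof. by move=> d e d0 e0; rewrite natrM lnM // posrE ltr0n. Qed.

Lemma ln_nat_ge0 n : 0 <= ln (n%:R : R).
Proof. by case: n => [|n]; [rewrite ln0|rewrite ln_ge0 ?ler1n]. Qed.

(** Von Mangoldt's function, written as a double sum with at most one nonzero term, so that sums
    over n can be exchanged with sums over primes and exponents. *)
Definition vM (n : nat) : R :=
  \sum_(1 <= p < n.+1 | prime p) \sum_(1 <= k < n.+1 | n == (p ^ k)%N) ln p%:R.

Lemma vM_ge0 n : 0 <= vM n.
Proof. by apply: sumr_ge0 => p _; apply: sumr_ge0 => k _; exact: ln_nat_ge0. Qed.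

Lemma vME n M : (0 < n)%N -> (n <= M)%N ->
  vM n = \sum_(1 <= p < M.+1 | prime p) \sum_(1 <= k < M.+1 | n == (p ^ k)%N) ln p%:R.
Proof.
move=> n0 nM.
have ext (P : pred nat) (F : nat -> R) :
    (forall i, (n < i)%N -> P i -> F i = 0) ->
    \sum_(1 <= i < n.+1 | P i) F i = \sum_(1 <= i < M.+1 | P i) F i.
  move=> h; rewrite (big_cat_nat (n := n.+1) (p := M.+1)) //=.
  rewrite [X in _ = _ + X]big_nat_cond [X in _ = _ + X]big1 ?addr0 //.
  by move=> i /andP[/andP[h1 _] h2]; exact: h.
rewrite /vM ext; last first.
  move=> p np pp; rewrite big_nat_cond big1 // => k /andP[/andP[k0 _] /eqP e].
  by move: np; rewrite e ltnNge -{1}(expn1 p) leq_exp2l ?prime_gt1 // k0.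
apply: eq_bigr => p pp; apply: ext => k nk /eqP e.
by move: nk; rewrite e ltnNge ltnW // ltn_expl ?prime_gt1.
Qed.

Lemma ln_prod (I : Type) (r : seq I) (P : pred I) (F : I -> nat) :
  (forall i, P i -> (0 < F i)%N) ->
  ln (\prod_(i <- r | P i) F i)%:R = \sum_(i <- r | P i) ln (F i)%:R :> R.
Proof.
move=> h; suff [] : ln (\prod_(i <- r | P i) F i)%:R = \sum_(i <- r | P i) ln (F i)%:R :> R /\
   (0 < \prod_(i <- r | P i) F i)%N by [].
elim/big_rec2: _ => [|i y x Pi [IH x0]]; first by rewrite ln1.
by rewrite lgadd_ln ?h // IH muln_gt0 h.
Qed.

Lemma ln_primes n M : (0 < n)%N -> (n <= M)%N ->
  ln n%:R = \sum_(1 <= p < M.+1 | prime p) (logn p n)%:R * ln p%:R :> R.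
Proof.
move=> n0 nM; rewrite {1}(prod_prime_decomp n0) prime_decompE big_map ln_prod; last first.
  by move=> p _; rewrite expn_gt0 /=; case: p => // ; rewrite logn0.
rewrite /= (eq_bigr (fun p => (logn p n)%:R * ln p%:R)); last first.
  move=> p _; rewrite natrX; case: p => [|p]; first by rewrite lognE /= expr0 ln1 mul0r.
  by rewrite lnXn ?ltr0n // mulr_natl.
have -> : \sum_(1 <= p < M.+1 | prime p) (logn p n)%:R * ln p%:R =
   \sum_(1 <= p < M.+1 | p \in primes n) (logn p n)%:R * ln p%:R :> R.
  rewrite [LHS]big_mkcond [RHS]big_mkcond; apply: eq_bigr => p _.
  rewrite mem_primes n0 /=; case pp: (prime p) => //=; case: ifP => // h.
  by rewrite lognE pp n0 h mul0r.
rewrite -[RHS]big_filter; apply: perm_big; apply: uniq_perm.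
- exact: primes_uniq.
- by rewrite filter_uniq // iota_uniq.
move=> p; rewrite mem_filter mem_index_iota mem_primes n0 /=.
case pp: (prime p) => //=; rewrite prime_gt0 // andbC; case dn: (p %| n)%N; rewrite ?andbF ?andbT //.
by rewrite ltnS (leq_trans (dvdn_leq n0 dn) nM).
Qed.

Lemma sum_vM n : (0 < n)%N -> \sum_(d <- divisors n) vM d = ln n%:R.
Proof.
move=> n0; rewrite (sum_divisors _ n0 (leqnn n)) (ln_primes n0 (leqnn n)).
transitivity (\sum_(1 <= d < n.+1 | (d %| n)%N) \sum_(1 <= p < n.+1 | prime p)
    \sum_(1 <= k < n.+1 | d == (p ^ k)%N) ln (p%:R : R)).
  rewrite big_nat_cond [RHS]big_nat_cond; apply: eq_bigr => d /andP[/andP[d0 dn] _].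
  exact: vME.
rewrite (exchange_big_dep prime) //=; apply: eq_bigr => p pp.
rewrite (exchange_big_dep xpredT) //=.
transitivity (\sum_(1 <= k < n.+1 | (k <= logn p n)%N) ln (p%:R : R)).
  rewrite [RHS]big_mkcond; apply: eq_big_nat => k /andP[k0 _].
  rewrite (eq_bigl (fun d => (d == p ^ k)%N && (p ^ k %| n)%N)); last first.
    by move=> d; rewrite pp andbT andbC; case: eqP => [->|].
  rewrite pfactor_dvdn //; case h: (k <= logn p n)%N; last by rewrite big1 // => d; rewrite andbF.
  under eq_bigl do rewrite andbT.
  rewrite big_nat1_eq expn_gt0 prime_gt0 // ltnS dvdn_leq //.
  by rewrite pfactor_dvdn.
rewrite big_const_seq [RHS]mulr_natl iter_addr_0; congr (_ *+ _).
have h : (logn p n <= n)%N by rewrite ltnW // ltn_logl.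
transitivity (count (fun k => (k <= logn p n)%N) (iota 1 (logn p n) ++ iota (logn p n).+1 (n - logn p n))).
  by rewrite -iotaD subnKC //= /index_iota subn1.
rewrite count_cat (eq_in_count (a2 := xpredT)); last by move=> k; rewrite mem_iota ltnS => /andP[].
rewrite count_predT size_iota (eq_in_count (a2 := xpred0)) ?count_pred0 ?addn0 //.
by move=> k; rewrite mem_iota => /andP[h1 _]; rewrite /= leqNgt h1.
Qed.

Lemma vM_le n : (0 < n)%N -> vM n <= ln n%:R.
Proof.
move=> n0; rewrite -sum_vM // (bigD1_seq n) ?divisors_uniq -?dvdn_divisors //=.
by rewrite lerDl sumr_ge0 // => d _; exact: vM_ge0.
Qed.

(** The identity Lambda * 1 = ln, twisted by a completely multiplicative function. The morphism [f]
    makes one statement serve real and complex coefficients. *)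
Lemma conv_vM (T : comNzRingType) (f : {rmorphism R -> T}) (psi : nat -> T) n :
  (forall d e, psi (d * e)%N = psi d * psi e) -> (0 < n)%N ->
  conv (fun m => psi m * f (vM m)) psi n = psi n * f (ln n%:R).
Proof.
move=> h n0; rewrite -sum_vM // rmorph_sum mulr_sumr; apply: eq_big_seq => d.
rewrite -dvdn_divisors // => dn.
by rewrite mulrAC -h mulnC divnK.
Qed.

End Mangoldt.

(** * Limits of complex sequences and absolutely convergent series *)

Section Limits.
Variable R : realType.
Local Notation C := R[i].
Implicit Types (s u : nat -> C) (l : C) (e B : R).

Definition psum u N : C := \sum_(1 <= n < N.+1) u n.

Definition clim s l := forall e, 0 < e -> exists N0, forall N, (N0 <= N)%N -> cn (s N - l) <= e.

Lemma le_eps x y : (forall e, 0 < e -> x <= y + e) -> x <= y :> R.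
Proof. by move=> h; apply/ler_addgt0Pr => e /h. Qed.

Lemma clim_le s l B N1 : clim s l -> (forall N, (N1 <= N)%N -> cn (s N) <= B) -> cn l <= B.
Proof.
move=> h hB; apply: le_eps => e /h[N0 hN].
have := hN (maxn N0 N1) (leq_maxl _ _); have := hB (maxn N0 N1) (leq_maxr _ _).
have := cnBge l (s (maxn N0 N1)); rewrite cnBC; lra.
Qed.

Lemma clim_unique s l l' : clim s l -> clim s l' -> l = l'.
Proof.
move=> h h'; apply/eqP; rewrite -subr_eq0 -cn_eq0 eq_le cn_ge0 andbT.
apply: le_eps => e e0; rewrite add0r.
have e2 : 0 < e / 2 by rewrite divr_gt0.
have [N0 hN] := h _ e2; have [N1 hN1] := h' _ e2.
have := hN (maxn N0 N1) (leq_maxl _ _); have := hN1 (maxn N0 N1) (leq_maxr _ _).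
have := cn_dist_trans l (s (maxn N0 N1)) l'; rewrite (cnBC l (s _)); lra.
Qed.

Lemma clim_ext s s' l N1 : (forall N, (N1 <= N)%N -> s N = s' N) -> clim s l -> clim s' l.
Proof.
move=> hs h e /h[N0 hN]; exists (maxn N0 N1) => N; rewrite geq_max => /andP[h0 h1].
by rewrite -hs // hN.
Qed.

Lemma climD s l s' l' : clim s l -> clim s' l' -> clim (fun N => s N + s' N) (l + l').
Proof.
move=> h h' e e0; have e2 : 0 < e / 2 by rewrite divr_gt0.
have [N0 hN] := h _ e2; have [N1 hN1] := h' _ e2.
exists (maxn N0 N1) => N; rewrite geq_max => /andP[/hN H0 /hN1 H1].
rewrite opprD addrACA; apply: le_trans (cnD _ _) _; lra.
Qed.

Lemma climZ s l c : clim s l -> clim (fun N => c * s N) (c * l).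
Proof.
move=> h e e0; have d0 : 0 < e / (cn c + 1) by rewrite divr_gt0 ?ltr_wpDl ?cn_ge0.
have [N0 hN] := h _ d0; exists N0 => N /hN; rewrite -mulrBr cnM => H.
have c0 := cn_ge0 c.
apply: le_trans (ler_wpM2l c0 H) _; rewrite mulrA ler_pdivrMr; nra.
Qed.

Lemma climM s l s' l' : clim s l -> clim s' l' -> clim (fun N => s N * s' N) (l * l').
Proof.
move=> h h' e e0.
have a0 : 0 < cn l + 1 by rewrite ltr_wpDl ?cn_ge0.
have b0 : 0 < cn l' + 1 by rewrite ltr_wpDl ?cn_ge0.
have d0 : 0 < Num.min 1 (e / 2 / (cn l' + 1)) by rewrite lt_min ltr01 /= !divr_gt0.
have d1 : 0 < e / 2 / (cn l + 1) by rewrite !divr_gt0.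
have [N0 hN] := h _ d0; have [N1 hN1] := h' _ d1.
exists (maxn N0 N1) => N; rewrite geq_max => /andP[/hN H0 /hN1 H1].
move: H0; rewrite le_min => /andP[H0 H0'].
have -> : s N * s' N - l * l' = s N * (s' N - l') + (s N - l) * l' by ring.
apply: le_trans (cnD _ _) _; rewrite !cnM.
have hs : cn (s N) <= cn l + 1 by have := cnBge (s N) l; lra.
have := cn_ge0 l'; have := cn_ge0 (s' N - l'); have := cn_ge0 (s N); have := cn_ge0 (s N - l).
rewrite ler_pdivlMr // in H0'; rewrite ler_pdivlMr // in H1; nra.
Qed.

Lemma clim_const l : clim (fun=> l) l.
Proof. by move=> e e0; exists 0%N => N _; rewrite subrr cn0 ltW. Qed.

(** Real and imaginary parts are summed as real series starting at index 1; the value is meaningful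
    under convergence, in practice under [absum]. *)
Definition csum u : C :=
  limn (series (fun n => Re (u n.+1))) +i* limn (series (fun n => Im (u n.+1))).

Lemma seriesE1 (v : nat -> R) N : series (fun n => v n.+1) N = \sum_(1 <= n < N.+1) v n.
Proof. by rewrite /series /= [RHS]big_add1. Qed.

Lemma abs_series (v : nat -> R) B : (forall N, \sum_(1 <= n < N.+1) `|v n| <= B) ->
  cvgn (series (fun n => v n.+1)).
Proof.
move=> hB; apply: normed_cvg.
apply: nondecreasing_is_cvgn.
  by apply: nondecreasing_series => n _ _; exact: normr_ge0.
exists B => _ [N _ <-]; have := hB N.
by rewrite -(seriesE1 (fun n => `|v n|)).
Qed.

Lemma csumP u B : (forall N, \sum_(1 <= n < N.+1) cn (u n) <= B) -> clim (psum u) (csum u).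
Proof.
move=> hB.
have hRe : cvgn (series (fun n => Re (u n.+1))).
  apply: (@abs_series (fun n => Re (u n)) B) => N; apply: le_trans (hB N).
  by apply: ler_sum => n _; exact: Re_le_cn.
have hIm : cvgn (series (fun n => Im (u n.+1))).
  apply: (@abs_series (fun n => Im (u n)) B) => N; apply: le_trans (hB N).
  by apply: ler_sum => n _; exact: Im_le_cn.
move=> e e0; have e2 : 0 < e / 2 by rewrite divr_gt0.
move/cvgrPdist_le : hRe => /(_ _ e2) [N0 _ hN0].
move/cvgrPdist_le : hIm => /(_ _ e2) [N1 _ hN1].
exists (maxn N0 N1) => N; rewrite geq_max => /andP[/hN0 H0 /hN1 H1].
apply: le_trans (cn_le_ReIm _) _.
rewrite cReD cImD cReN cImN /=.
rewrite /= (seriesE1 (fun n => Re (u n))) -cRe_sum in H0.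
rewrite /= (seriesE1 (fun n => Im (u n))) -cIm_sum in H1.
by rewrite (distrC (Re _)) (distrC (Im _)) /psum; lra.
Qed.

Definition absum u := exists B, forall N, \sum_(1 <= n < N.+1) cn (u n) <= B.

Lemma absumP u : absum u -> clim (psum u) (csum u).
Proof. by move=> [B /csumP]. Qed.

Lemma psumD u v N : psum (fun n => u n + v n) N = psum u N + psum v N.
Proof. exact: big_split. Qed.
Lemma psumZ c u N : psum (fun n => c * u n) N = c * psum u N.
Proof. by rewrite /psum mulr_sumr. Qed.

Lemma absumD u v : absum u -> absum v -> absum (fun n => u n + v n).
Proof.
move=> [B hB] [B' hB']; exists (B + B') => N; apply: le_trans (lerD (hB N) (hB' N)).
by rewrite -big_split; apply: ler_sum => n _; exact: cnD.
Qed.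
Lemma absumZ c u : absum u -> absum (fun n => c * u n).
Proof.
move=> [B hB]; exists (cn c * B) => N.
under eq_bigr do rewrite cnM; rewrite -mulr_sumr ler_wpM2l ?cn_ge0 //.
Qed.
Lemma absum_le u v : (forall n, (0 < n)%N -> cn (u n) <= cn (v n)) -> absum v -> absum u.
Proof.
move=> h [B hB]; exists B => N; apply: le_trans (hB N).
by rewrite big_nat [X in _ <= X]big_nat; apply: ler_sum => n /andP[n0 _]; exact: h.
Qed.
Lemma absum_ext u v : (forall n, (0 < n)%N -> u n = v n) -> absum v -> absum u.
Proof. by move=> h; apply: absum_le => n /h ->. Qed.
Lemma csum_ext u v : (forall n, (0 < n)%N -> u n = v n) -> absum v -> csum u = csum v.
Proof.
move=> h hv; apply: clim_unique (absumP (absum_ext h hv)) _.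
apply: (@clim_ext _ _ _ 0) (absumP hv) => N _.
by apply: eq_big_nat => n /andP[/h ->].
Qed.
Lemma csumD u v : absum u -> absum v -> csum (fun n => u n + v n) = csum u + csum v.
Proof.
move=> hu hv; apply: clim_unique (absumP (absumD hu hv)) _.
by apply: (@clim_ext _ _ _ 0) (climD (absumP hu) (absumP hv)) => N _; rewrite psumD.
Qed.
Lemma csumZ c u : absum u -> csum (fun n => c * u n) = c * csum u.
Proof.
move=> hu; apply: clim_unique (absumP (absumZ c hu)) _.
by apply: (@clim_ext _ _ _ 0) (climZ c (absumP hu)) => N _; rewrite psumZ.
Qed.
Lemma csum_bound u B N1 : absum u -> (forall N, (N1 <= N)%N -> cn (psum u N) <= B) -> cn (csum u) <= B.
Proof. by move=> /absumP h; exact: clim_le h. Qed.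
Lemma csum_abs_bound u B : (forall N, \sum_(1 <= n < N.+1) cn (u n) <= B) -> cn (csum u) <= B.
Proof.
move=> h; apply: (@csum_bound _ _ 0); first by exists B.
by move=> N _; apply: le_trans (cn_sum _ _ _) (h N).
Qed.
Lemma csum_bigD (I : Type) (r : seq I) (u : I -> nat -> C) : (forall i, absum (u i)) ->
  csum (fun n => \sum_(i <- r) u i n) = \sum_(i <- r) csum (u i) /\
  absum (fun n => \sum_(i <- r) u i n).
Proof.
move=> h; have a0 : absum (fun=> 0 : C).
  by exists 0 => N; rewrite big1 // => *; rewrite cn0.
elim: r => [|i r [IH1 IH2]].
  have a1 : absum (fun n => \sum_(i <- [::]) u i n) by apply: absum_ext a0 => n _; rewrite big_nil.
  split=> //; rewrite big_nil; apply: clim_unique (absumP a1) _.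
  by apply: (@clim_ext _ _ _ 0) (clim_const 0) => N _; rewrite /psum big1 // => *; rewrite big_nil.
have e n : (0 < n)%N -> \sum_(j <- i :: r) u j n = u i n + \sum_(j <- r) u j n by rewrite big_cons.
split; last by apply: absum_ext e _; exact: absumD.
by rewrite (csum_ext e) ?big_cons ?csumD ?IH1 //; exact: absumD.
Qed.

Lemma absum_tail u e : absum u -> 0 < e -> exists M, forall N, \sum_(M.+1 <= n < N.+1) cn (u n) <= e.
Proof.
move=> [B hB] e0.
have h : cvgn (series (fun n => cn (u n.+1))).
  apply: (@abs_series (fun n => cn (u n)) B) => N; apply: le_trans (hB N).
  by apply: ler_sum => n _; rewrite ger0_norm // cn_ge0.
have e2 : 0 < e / 2 by rewrite divr_gt0.
move/cvgrPdist_le : h => /(_ _ e2) [M _ hM].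
have sE N : series (fun n => cn (u n.+1)) N = \sum_(1 <= n < N.+1) cn (u n).
  by rewrite /series /= -(big_add1 _ _ 0 N.+1 xpredT (fun n => cn (u n))).
exists M => N; case: (leqP N M) => NM; first by rewrite big_geq ?ltW //.
have := hM M (leqnn M); have := hM N (ltnW NM); rewrite /= !sE => h1 h2.
move: h1 h2; rewrite [X in _ - X](big_cat_nat (n := M.+1)) //= ?ltnS 1?ltnW //.
by rewrite !ler_norml => /andP[h1 h2] /andP[h3 h4]; lra.
Qed.

End Limits.

Arguments csum : simpl never.

(** * Dirichlet series at a real argument *)

Section DirichletSeries.
Variable R : realType.
Local Notation C := R[i].
Implicit Types (a b : nat -> C) (s d h : R).

(** The argument [s] is real; the imaginary part of the usual complex variable is carried by the
    coefficients, through the twists [tw] below. *)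
Definition tm a s n : C := a n * (pw s n)%:C.
Definition DS a s : C := csum (tm a s).
Definition absD a s := absum (tm a s).
Definition lnc (n : nat) : C := (ln n%:R)%:C.

Lemma cn_tm a s n : cn (tm a s n) = cn (a n) * pw s n.
Proof. by rewrite cnM cn_real ger0_norm // pw_ge0. Qed.

Lemma cn_lnc n : cn (lnc n) = ln n%:R.
Proof. by rewrite cn_real ger0_norm // ln_nat_ge0. Qed.

Lemma lgadd_lnc : lgadd lnc.
Proof. by move=> d e d0 e0; rewrite /lnc lgadd_ln // rmorphD. Qed.

Lemma psum_tm_conv a b s N : psum (tm (conv a b) s) N =
  \sum_(1 <= d < N.+1) \sum_(1 <= e < (N %/ d).+1) tm a s d * tm b s e.
Proof.
rewrite -sum_conv; apply: eq_big_nat => n /andP[n0 _].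
rewrite /tm /conv mulr_suml; apply: eq_big_seq => d; rewrite -dvdn_divisors // => dn.
by rewrite -{2}(divnK dn) mulnC pwM rmorphM mulrACA.
Qed.

Lemma absD_conv a b s : absD a s -> absD b s -> absD (conv a b) s.
Proof.
move=> [A hA] [B hB]; exists (A * B) => N.
have A0 : 0 <= A by apply: le_trans (hA 0%N); rewrite big_geq.
apply: le_trans (_ : \sum_(1 <= n < N.+1) \sum_(d <- divisors n)
    cn (tm a s d) * cn (tm b s (n %/ d)%N) <= _).
  rewrite big_nat [X in _ <= X]big_nat; apply: ler_sum => n /andP[n0 _].
  rewrite /tm /conv mulr_suml; apply: le_trans (cn_sum _ _ _) _.
  rewrite big_seq [X in _ <= X]big_seq; apply: ler_sum => d; rewrite -dvdn_divisors // => dn.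
  have -> : pw s n = pw s d * pw s (n %/ d)%N by rewrite -pwM mulnC divnK.
  by rewrite rmorphM (mulrACA (a d)) [X in X <= _]cnM.
rewrite (@sum_conv R (fun d e : nat => cn (tm a s d) * cn (tm b s e))).
apply: le_trans (_ : \sum_(1 <= d < N.+1) cn (tm a s d) * B <= _).
  by apply: ler_sum => d _; rewrite -mulr_sumr ler_wpM2l ?cn_ge0.
by rewrite -mulr_suml ler_wpM2r //; apply: le_trans (hB 0%N); rewrite big_geq.
Qed.

(** The product of partial sums exceeds the partial sum of the convolution by the pairs with
    [d e > N]. Once [N > M ^ 2] such a pair has [d > M] or [e > M], so the excess is controlled by
    the two tails. *)
Lemma DS_conv a b s : absD a s -> absD b s -> DS (conv a b) s = DS a s * DS b s.
Proof.
move=> ha hb; apply: clim_unique (absumP (absD_conv ha hb)) _.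
have [A hA] := ha; have [B hB] := hb.
have A0 : 0 <= A by apply: le_trans (hA 0%N); rewrite big_geq.
have B0 : 0 <= B by apply: le_trans (hB 0%N); rewrite big_geq.
have hP := climM (absumP ha) (absumP hb).
move=> e e0; have e2 : 0 < e / 2 by rewrite divr_gt0.
have [N0 hN0] := hP _ e2.
pose r := e / 2 / (A + B + 1).
have r0 : 0 < r by rewrite /r !divr_gt0 //; lra.
have [M1 hM1] := absum_tail ha r0; have [M2 hM2] := absum_tail hb r0.
pose M := maxn M1 M2.
have tl (u : nat -> C) M' : (M' <= M)%N -> (forall N, \sum_(M'.+1 <= n < N.+1) cn (u n) <= r) ->
   forall K N, (M <= K)%N -> \sum_(K.+1 <= n < N.+1) cn (u n) <= r.
  move=> hM' hr K N hK; apply: le_trans (hr N).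
  case: (leqP N K) => h; first by rewrite big_geq // sumr_ge0 // => *; exact: cn_ge0.
  rewrite [X in _ <= X](big_cat_nat (n := K.+1)) /=; try lia.
  by rewrite lerDr sumr_ge0 // => *; exact: cn_ge0.
exists (maxn N0 (M * M).+1) => N; rewrite geq_max => /andP[/hN0 H NM].
apply: le_trans (cn_dist_trans _ (psum (tm a s) N * psum (tm b s) N) _) _.
suff: cn (psum (tm (conv a b) s) N - psum (tm a s) N * psum (tm b s) N) <= e / 2 by lra.
rewrite psum_tm_conv /psum mulr_suml -sumrB.
apply: le_trans (_ : \sum_(1 <= d < N.+1) cn (tm a s d) * \sum_((N %/ d).+1 <= n < N.+1) cn (tm b s n) <= _).
  apply: le_trans (cn_sum _ _ _) _.
  rewrite big_nat [X in _ <= X]big_nat; apply: ler_sum => d /andP[d0 dN].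
  rewrite -mulr_sumr -mulrBr cnM ler_wpM2l ?cn_ge0 //.
  rewrite [X in _ - X](big_cat_nat (n := (N %/ d).+1)) //= ?ltnS ?leq_div //.
  by rewrite opprD addrA subrr add0r cnN cn_sum.
rewrite (big_cat_nat (n := M.+1)) //=; last by move: NM; rewrite /M; nia.
apply: le_trans (_ : A * r + r * B <= _); last first.
  have : r * (A + B + 1) = e / 2 by rewrite /r divfK // gt_eqF //; lra.
  nra.
apply: lerD.
  apply: le_trans (_ : \sum_(1 <= d < M.+1) cn (tm a s d) * r <= _).
    rewrite big_nat [X in _ <= X]big_nat; apply: ler_sum => d /andP[d0 dM].
    rewrite ler_wpM2l ?cn_ge0 // (tl (tm b s) M2) ?leq_maxr //.
    rewrite leq_divRL //; apply: leq_trans (ltnW NM).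
    by rewrite leq_mul2l; move: dM; rewrite ltnS => ->; rewrite orbT.
  by rewrite -mulr_suml ler_wpM2r // ltW.
apply: le_trans (_ : \sum_(M.+1 <= d < N.+1) cn (tm a s d) * B <= _).
  apply: ler_sum => d _; rewrite ler_wpM2l ?cn_ge0 //.
  apply: le_trans (hB N); rewrite [X in _ <= X](big_cat_nat (n := (N %/ d).+1)) //= ?ltnS ?leq_div //.
  by rewrite lerDr sumr_ge0 // => *; exact: cn_ge0.
by rewrite -mulr_suml ler_wpM2r // (tl (tm a s) M1) ?leq_maxl.
Qed.

(** Half of [d] absorbs the logarithms, by [ln n <= n ^ e / e] with [e = d / (2 (k + 1))], at the
    cost of [e ^ (- k)]; the other half keeps the series convergent and costs one more factor
    [1 / d]. *)
Lemma logsum k : exists2 c : R, 0 < c & forall d N, 0 < d -> d <= 1 ->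
  \sum_(1 <= n < N.+1) (ln n%:R) ^+ k * pw (1 + d) n <= c * d^-1 ^+ k.+1.
Proof.
exists (3 * (2 * k.+1%:R) ^+ k); first by rewrite mulr_gt0 // exprn_gt0 // mulr_gt0 // ltr0n.
move=> d N d0 d1; pose e := d / (2 * k.+1%:R).
have K0 : (0 : R) < 2 * k.+1%:R by rewrite mulr_gt0 // ltr0n.
have e0 : 0 < e by rewrite divr_gt0.
have d2 : 0 < d / 2 by rewrite divr_gt0.
apply: le_trans (_ : \sum_(1 <= n < N.+1) e^-1 ^+ k * pw (1 + d / 2) n <= _).
  rewrite big_nat [X in _ <= X]big_nat; apply: ler_sum => n /andP[n0 _].
  have n1 : (1 : R) <= n%:R by rewrite ler1n.
  have -> : pw (1 + d / 2) n = (n%:R `^ (d / 2)) * pw (1 + d) n.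
    rewrite /pw -powRD; last by rewrite pnatr_eq0 -lt0n n0 implybT.
    by congr (_ `^ _); field.
  rewrite mulrA ler_wpM2r ?pw_ge0 //.
  apply: le_trans (_ : (n%:R `^ e / e) ^+ k <= _).
    by apply: lerXn2r; [rewrite nnegrE ln_ge0|rewrite nnegrE divr_ge0 ?powR_ge0 // ltW|exact: ln_le_powR].
  rewrite exprMn mulrC ler_wpM2l ?exprn_ge0 ?invr_ge0 ?(ltW e0) //.
  rewrite -powR_mulrn ?powR_ge0 // -powRrM ler_powR //.
  have <- : e * k.+1%:R = d / 2 by rewrite /e invfM mulrA -mulrA mulVf ?mulr1 ?pnatr_eq0.
  by rewrite ler_pM2l // ler_nat.
rewrite -mulr_sumr; apply: le_trans (ler_wpM2l _ (sum_pw_bound N.+1 d2)) _.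
  by rewrite exprn_ge0 // invr_ge0 ltW.
rewrite exprS /e invf_div.
rewrite (expr_div_n (2 * k.+1%:R) d k) exprVn.
set z := (_ ^+ k)^-1; set w := _ ^+ k.
have z0 : 0 <= z by rewrite invr_ge0 exprn_ge0 // ltW.
have w0 : 0 <= w by rewrite exprn_ge0 // ltW.
have -> : w * z * (1 + (d / 2)^-1) = (w * z) * (1 + 2 / d) by rewrite invf_div.
have -> : 3 * w * (d^-1 * z) = (w * z) * (3 / d) by ring.
rewrite ler_wpM2l ?mulr_ge0 //.
by rewrite -[X in X + _ <= _](divff (lt0r_neq0 d0)) -mulrDl ler_pM2r ?invr_gt0 //; lra.
Qed.

Lemma absD_log a (c : R) k s : (forall n, (0 < n)%N -> cn (a n) <= c * (1 + ln n%:R) ^+ k) ->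
  1 < s -> absD a s.
Proof.
move=> h s1.
pose d := (s - 1) / 2.
have d0 : 0 < d by rewrite divr_gt0 // subr_gt0.
have [c1 c10 hc1] := @lnX_le_powR R k d d0.
have c0 : 0 <= c.
  have := h 1%N isT; rewrite ln1 addr0 expr1n mulr1 => /(le_trans _); apply; exact: cn_ge0.
pose E := c * (c1 * (expR 1) `^ d).
exists (E * (1 + d^-1)) => N.
have e1 : (1 : R) <= expR 1 by rewrite -expR0 ler_expR.
apply: le_trans (_ : \sum_(1 <= n < N.+1) E * pw (1 + d) n <= _); last first.
  rewrite -mulr_sumr ler_wpM2l ?sum_pw_bound //.
  by rewrite /E !mulr_ge0 ?powR_ge0 // ltW // (lt_le_trans ltr01).
rewrite big_nat [X in _ <= X]big_nat; apply: ler_sum => n /andP[n0 _].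
rewrite cn_tm.
have -> : pw (1 + d) n = n%:R `^ d * pw s n.
  rewrite /pw -powRD; last by rewrite pnatr_eq0 -lt0n n0 implybT.
  by congr (_ `^ _); rewrite /d; field.
rewrite mulrA ler_wpM2r ?pw_ge0 //; apply: le_trans (h n n0) _.
rewrite /E -!mulrA ler_wpM2l // -powRM ?expR_ge0 //.
have -> : 1 + ln n%:R = ln (expR 1 * n%:R) :> R.
  by rewrite lnM ?posrE ?expR_gt0 ?ltr0n // expRK.
apply: hc1; have n1 : (1 : R) <= n%:R by rewrite ler1n.
nra.
Qed.

Lemma expR_taylor2 (z : R) : `|expR z - 1 - z| <= z ^+ 2 * expR `|z|.
Proof.
have h1 : 1 + z <= expR z := expR_ge1Dx z.
rewrite ger0_norm; last by lra.
have h2 : 1 - z <= expR (- z) := expR_ge1Dx (- z).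
have p : 0 < expR z := expR_gt0 z.
have q : expR z * expR (- z) = 1 := expRxMexpNx_1 z.
have h3 : expR z * (1 - z) <= 1 by rewrite -[X in _ <= X]q ler_pM2l.
case: (leP 0 z) => z0.
  rewrite ger0_norm //; nra.
rewrite ltr0_norm //.
have h4 : 1 <= expR (- z) by rewrite -expR0 ler_expR; lra.
have : z ^+ 2 <= z ^+ 2 * expR (- z) by rewrite ler_peMr ?sqr_ge0.
nra.
Qed.

(** Second order Taylor expansion of [n ^ (- h)] in each term. The series of second derivatives
    still converges at [1 + (s - 1) / 2], and the spare [(s - 1) / 2] absorbs [n ^ |h|] in the
    remainder. *)
Lemma DS_taylor a (c : R) k s : (forall n, (0 < n)%N -> cn (a n) <= c * (1 + ln n%:R) ^+ k) ->
  1 < s -> exists K, forall h, `|h| <= (s - 1) / 2 ->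
  cn (DS a (s + h) - DS a s + h%:C * DS (fun n => lnc n * a n) s) <= K * h ^+ 2.
Proof.
move=> ha s1.
have c0 : 0 <= c.
  have := ha 1%N isT; rewrite ln1 addr0 expr1n mulr1 => /(le_trans _); apply; exact: cn_ge0.
pose d := (s - 1) / 2.
have d0 : 0 < d by rewrite divr_gt0 // subr_gt0.
have hla : forall n, (0 < n)%N -> cn (lnc n * a n) <= c * (1 + ln n%:R) ^+ k.+1.
  move=> n n0; rewrite cnM cn_lnc exprS mulrCA.
  have := ln_nat_ge0 R n; have := ha n n0; have := cn_ge0 (a n); nra.
have hlla : forall n, (0 < n)%N -> cn (lnc n ^+ 2 * a n) <= c * (1 + ln n%:R) ^+ k.+2.
  move=> n n0; rewrite cnM cnX cn_lnc mulrC -[k.+2]addn2 exprD mulrA.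
  have := ln_nat_ge0 R n; have := ha n n0; have := cn_ge0 (a n) => h0 h1 h2.
  apply: ler_pM => //; first exact: exprn_ge0.
  by rewrite lerXn2r ?nnegrE //; lra.
have [B hB] : absD (fun n => lnc n ^+ 2 * a n) (1 + d).
  by apply: absD_log hlla _; lra.
exists B => h hh.
have s2 : 1 < s + h by move: hh; rewrite ler_norml => /andP[h1 _]; rewrite /d in d0; lra.
have h1 : absD a (s + h) by exact: absD_log ha _.
have h2 : absD a s by exact: absD_log ha _.
have h3 : absD (fun n => lnc n * a n) s by exact: absD_log hla _.
rewrite /DS -[- csum _]mulN1r -!csumZ // -!csumD //; try exact: absumZ.
  2: by apply: absumD => //; exact: absumZ.
apply: csum_abs_bound => N; apply: le_trans (_ : \sum_(1 <= n < N.+1) h ^+ 2 *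
   cn (tm (fun n => lnc n ^+ 2 * a n) (1 + d) n) <= _); last first.
  by rewrite -mulr_sumr mulrC ler_wpM2r ?sqr_ge0.
rewrite big_nat [X in _ <= X]big_nat; apply: ler_sum => n /andP[n0 _].
rewrite /tm.
have -> : a n * (pw (s + h) n)%:C + -1 * (a n * (pw s n)%:C) + h%:C * (lnc n * a n * (pw s n)%:C) =
   a n * (pw (s + h) n - pw s n + h * ln n%:R * pw s n)%:C.
  by rewrite /lnc !rmorphD rmorphN !rmorphM /=; ring.
rewrite cnM cn_real.
have -> : pw (s + h) n - pw s n + h * ln n%:R * pw s n =
   pw s n * (expR (- h * ln n%:R) - 1 - (- h * ln n%:R)).
  by rewrite pwD // (pwE h) //; ring.
rewrite normrM (ger0_norm (pw_ge0 _ _)) cnM cnM cnX cn_lnc cn_real (ger0_norm (pw_ge0 _ _)).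
have := expR_taylor2 (- h * ln n%:R); set E := `|_|; rewrite exprMn sqrrN normrM normrN (ger0_norm (ln_nat_ge0 R n)).
move=> hE.
have : pw s n * expR (`|h| * ln n%:R) <= pw (1 + d) n.
  rewrite !pwE // -expRD ler_expR -mulrDl ler_wpM2r ?ln_nat_ge0 //.
  by rewrite /d in hh *; lra.
move=> h4; have p := pw_ge0 s n.
have -> : h ^+ 2 * (ln n%:R ^+ 2 * cn (a n) * pw (1 + d) n) =
    cn (a n) * (h ^+ 2 * ln n%:R ^+ 2 * pw (1 + d) n) by ring.
rewrite ler_wpM2l ?cn_ge0 //.
apply: le_trans (ler_wpM2l p hE) _.
by rewrite mulrCA ler_wpM2l // mulr_ge0 ?sqr_ge0.
Qed.

End DirichletSeries.

(** * Differentiation of Dirichlet series and mean value estimates *)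

Section Derivatives.
Variable R : realType.
Local Notation C := R[i].

Lemma is_derive_quad (f : R -> R) (x df K r : R) : 0 < r ->
  (forall h, `|h| <= r -> `|f (x + h) - f x - h * df| <= K * h ^+ 2) -> is_derive x 1 f df.
Proof.
move=> r0 H.
have K0 : 0 <= K.
  have rr : `|r| <= r by rewrite gtr0_norm.
  by have := le_trans (normr_ge0 _) (H r rr); rewrite pmulr_lge0 // exprn_gt0.
have hc : ((fun h : R => h^-1 *: (f (h *: (1 : R) + x) - f x)) @ 0^' --> df)%classic.
  apply/cvgrPdist_le => e e0.
  exists (Num.min r (e / (K + 1))) => /=.
    by rewrite lt_min r0 divr_gt0 //; lra.
  move=> h; rewrite /= sub0r normrN lt_min => /andP[h1 h2] h0.
  rewrite /GRing.scale /= mulr1 (addrC h) -(opprB _ df) normrN.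
  have -> : h^-1 * (f (x + h) - f x) - df = h^-1 * (f (x + h) - f x - h * df).
    by rewrite [in RHS]mulrBr mulKf.
  rewrite normrM normfV ler_pdivrMl ?normr_gt0 //.
  apply: le_trans (H h (ltW h1)) _; rewrite -real_normK ?num_real // expr2 mulrCA ler_wpM2l //.
  rewrite ltr_pdivlMr in h2; last by lra.
  have := normr_ge0 h; nra.
by apply: DeriveDef; [apply/cvg_ex; exists df|apply/cvg_lim].
Qed.

Lemma MVT_closed (f df : R -> R) (a b : R) : a <= b ->
  (forall x, a <= x -> x <= b -> is_derive x 1 f (df x)) ->
  exists c, [/\ a <= c, c <= b & f b - f a = df c * (b - a)].
Proof.
rewrite le_eqVlt => /predU1P[->|ab] h.
  by exists b; rewrite !subrr mulr0.
have [|| c] := @MVT R f df a b ab.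
- by move=> x; rewrite in_itv /= => /andP[/ltW h1 /ltW h2]; exact: h.
- apply: derivable_within_continuous => x; rewrite in_itv /= => /andP[h1 h2].
  by have [] := h x h1 h2.
by rewrite in_itv /= => /andP[/ltW h1 /ltW h2] e; exists c.
Qed.

Lemma derive_sqr_sum (f g : R -> R) (x df dg : R) : is_derive x 1 f df -> is_derive x 1 g dg ->
  is_derive x 1 (fun y => f y ^+ 2 + g y ^+ 2) (2 * (f x * df + g x * dg)).
Proof.
move=> hf hg; have -> : (fun y => f y ^+ 2 + g y ^+ 2) = f ^+ 2 + g ^+ 2 by [].
have d1 := @is_deriveX _ _ f 2 x 1 df hf; have d2 := @is_deriveX _ _ g 2 x 1 dg hg.
by apply: is_derive_eq (is_deriveD d1 d2) _; rewrite /GRing.scale /=; ring.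
Qed.

(** Logarithmic derivatives add up. Here [f], [g], [h] stand for squared moduli of L-functions, and
    the [r] for real parts of -L'/L. *)
Lemma derive_341 (f g h : R -> R) (x r0 r1 r2 : R) :
  is_derive x 1 f (- 2 * r0 * f x) -> is_derive x 1 g (- 2 * r1 * g x) ->
  is_derive x 1 h (- 2 * r2 * h x) ->
  is_derive x 1 (fun y => f y ^+ 3 * g y ^+ 4 * h y)
    (- 2 * (3 * r0 + 4 * r1 + r2) * (f x ^+ 3 * g x ^+ 4 * h x)).
Proof.
move=> hf hg hh; have -> : (fun y => f y ^+ 3 * g y ^+ 4 * h y) = f ^+ 3 * g ^+ 4 * h by [].
apply: is_derive_eq; rewrite /GRing.scale /=.
have -> : (f ^+ 3 * g ^+ 4) x = f x ^+ 3 * g x ^+ 4 by [].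
have -> : (f ^+ 3) x = f x ^+ 3 by [].
have -> : (g ^+ 4) x = g x ^+ 4 by [].
by ring.
Qed.

Section OneSeries.
Variables (a : nat -> C) (c : R) (k : nat).
Hypothesis ha : forall n, (0 < n)%N -> cn (a n) <= c * (1 + ln n%:R) ^+ k.

Lemma is_derive_ReDS (s : R) : 1 < s ->
  is_derive s 1 (fun x => Re (DS a x)) (- Re (DS (fun n => lnc R n * a n) s)).
Proof.
move=> s1; have [K hK] := DS_taylor ha s1.
apply: (@is_derive_quad _ _ _ K ((s - 1) / 2)); first by rewrite divr_gt0 // subr_gt0.
move=> h /hK; apply: le_trans; apply: le_trans (Re_le_cn _).
by rewrite !cReD cReN cReM_real mulrN opprK.
Qed.

Lemma is_derive_ImDS (s : R) : 1 < s ->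
  is_derive s 1 (fun x => Im (DS a x)) (- Im (DS (fun n => lnc R n * a n) s)).
Proof.
move=> s1; have [K hK] := DS_taylor ha s1.
apply: (@is_derive_quad _ _ _ K ((s - 1) / 2)); first by rewrite divr_gt0 // subr_gt0.
move=> h /hK; apply: le_trans; apply: le_trans (Im_le_cn _).
by rewrite !cImD cImN cImM_real mulrN opprK.
Qed.

Lemma DS_lip (s s' B : R) : 1 < s -> s <= s' ->
  (forall x, s <= x -> x <= s' -> cn (DS (fun n => lnc R n * a n) x) <= B) ->
  cn (DS a s' - DS a s) <= 2 * B * (s' - s).
Proof.
move=> s1 ss hB; apply: le_trans (cn_le_ReIm _) _; rewrite cReD cReN cImD cImN.
have [|x [x1 x2 ->]] := @MVT_closed (fun s => Re (DS a s)) (fun s => - Re (DS (fun n => lnc R n * a n) s)) _ _ ss.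
  by move=> x x1 _; apply: is_derive_ReDS; apply: lt_le_trans x1.
have [|y [y1 y2 ->]] := @MVT_closed (fun s => Im (DS a s)) (fun s => - Im (DS (fun n => lnc R n * a n) s)) _ _ ss.
  by move=> y y1 _; apply: is_derive_ImDS; apply: lt_le_trans y1.
rewrite !normrM !normrN (ger0_norm (_ : 0 <= s' - s)) ?subr_ge0 // -mulrDl ler_wpM2r ?subr_ge0 //.
rewrite mulr_natl mulr2n; apply: lerD.
  by apply: le_trans (Re_le_cn _) _; exact: hB.
by apply: le_trans (Im_le_cn _) _; exact: hB.
Qed.

End OneSeries.
End Derivatives.

(** * L-functions of completely multiplicative functions; the 3-4-1 inequality *)

Section CompletelyMultiplicative.
Variable R : realType.
Local Notation C := R[i].
Implicit Types (psi : nat -> C) (s t : R).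

Definition cmult psi :=
  [/\ psi 1%N = 1, forall d e, psi (d * e)%N = psi d * psi e & forall n, cn (psi n) <= 1].

(* Up to the sign (-1)^j, the j-th derivatives of L(s, psi) and of -L'/L(s, psi). *)
Definition LL psi j s := DS (fun n => lnc R n ^+ j * psi n) s.
Definition FF psi j s := DS (fun n => lnc R n ^+ j * (psi n * (vM R n)%:C)) s.

Lemma LL_coef psi j n : cmult psi -> (0 < n)%N ->
  cn (lnc R n ^+ j * psi n) <= 1 * (1 + ln n%:R) ^+ j.
Proof.
move=> [_ _ h] n0; rewrite cnM cnX cn_lnc mul1r.
have l0 := ln_nat_ge0 R n; have p0 := exprn_ge0 j l0.
apply: le_trans (_ : ln n%:R ^+ j <= _); first by rewrite ler_piMr.
by rewrite lerXn2r ?nnegrE //; lra.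
Qed.

Lemma FF_coef psi j n : cmult psi -> (0 < n)%N ->
  cn (lnc R n ^+ j * (psi n * (vM R n)%:C)) <= 1 * (1 + ln n%:R) ^+ j.+1.
Proof.
move=> h n0; rewrite mulrA cnM exprSr mulrA.
apply: ler_pM; rewrite ?cn_ge0 //; first exact: LL_coef.
rewrite cn_real ger0_norm ?vM_ge0 //; apply: le_trans (vM_le R n0) _; lra.
Qed.

Lemma absD_LL psi j s : cmult psi -> 1 < s -> absD (fun n => lnc R n ^+ j * psi n) s.
Proof. by move=> h; apply: absD_log => n n0; exact: LL_coef. Qed.
Lemma absD_FF psi j s : cmult psi -> 1 < s ->
  absD (fun n => lnc R n ^+ j * (psi n * (vM R n)%:C)) s.
Proof. by move=> h; apply: absD_log => n n0; exact: FF_coef. Qed.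

Lemma DS_ext (a b : nat -> C) s : (forall n, (0 < n)%N -> a n = b n) -> absD b s -> DS a s = DS b s.
Proof. by move=> h; apply: csum_ext => n n0; rewrite /tm h. Qed.

(** Coefficientwise this is [conv_leibniz] applied to [psi ln = (psi Lambda) * psi]. It determines
    the derivatives of L'/L recursively from those of L, without differentiating a quotient. *)
Lemma LL_leibniz psi k s : cmult psi -> 1 < s ->
  LL psi k.+1 s = \sum_(i < k.+1) FF psi (k - i) s * LL psi i s *+ 'C(k, i).
Proof.
move=> h s1; have [p1 pM ple] := h.
pose u i := conv (fun m => lnc R m ^+ (k - i) * (psi m * (vM R m)%:C))
   (fun m => lnc R m ^+ i * psi m).
have hu i : absD (u i) s by apply: absD_conv; [exact: absD_FF|exact: absD_LL].
pose v i n := tm (u i) s n *+ 'C(k, i).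
have e n : (0 < n)%N -> tm (fun n => lnc R n ^+ k.+1 * psi n) s n = \sum_(i <- index_enum 'I_k.+1) v i n.
  move=> n0; rewrite /tm exprS.
  have -> : lnc R n * lnc R n ^+ k * psi n = lnc R n ^+ k * (psi n * lnc R n) by ring.
  rewrite -(@conv_vM R _ (real_complex R) psi n pM n0) (conv_leibniz _ _ _ (@lgadd_lnc R) n0).
  by rewrite mulr_suml; apply: eq_bigr => i _; rewrite /v /tm mulrnAl.
have hv i : absum (v i).
  by apply: absum_ext (absumZ 'C(k, i)%:R (hu i)) => n _; rewrite mulr_natl.
have [h1 h2] := csum_bigD (index_enum 'I_k.+1) hv.
rewrite {1}/LL /DS (csum_ext e) // h1; apply: eq_bigr => i _.
rewrite -DS_conv; [|exact: absD_FF|exact: absD_LL].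
rewrite -mulr_natl -[DS _ _]/(csum (tm (u i) s)) -csumZ; last exact: hu.
by apply: csum_ext => [n _|]; [rewrite mulr_natl|apply: absumZ; exact: hu].
Qed.

Lemma LL1_FF psi s : cmult psi -> 1 < s -> LL psi 1 s = FF psi 0 s * LL psi 0 s.
Proof. by move=> h s1; rewrite LL_leibniz // big_ord1 bin0 mulr1n. Qed.

Lemma LL0E psi s : cmult psi -> 1 < s -> LL psi 0 s = DS psi s.
Proof.
move=> h s1; apply: DS_ext => [n _|]; first by rewrite expr0 mul1r.
by apply: absD_log s1 => n n0; rewrite -[psi n]mul1r; exact: (LL_coef 0 h n0).
Qed.

(** The squared modulus is differentiable even where L vanishes; its derivative is twice the real
    part of the conjugate of L times L', and L' is minus [FF psi 0] times L. *)
Lemma is_derive_cn2 psi s : cmult psi -> 1 < s ->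
  is_derive s 1 (fun x => cn (LL psi 0 x) ^+ 2) (- 2 * Re (FF psi 0 s) * cn (LL psi 0 s) ^+ 2).
Proof.
move=> h s1.
have hc n : (0 < n)%N -> cn (lnc R n ^+ 0 * psi n) <= 1 * (1 + ln n%:R) ^+ 0 by exact: LL_coef.
have dR := is_derive_ReDS hc s1; have dI := is_derive_ImDS hc s1.
have e : DS (fun n => lnc R n * (lnc R n ^+ 0 * psi n)) s = LL psi 1 s.
  apply: DS_ext => [n _|]; first by rewrite mulrA -exprS.
  exact: absD_LL.
rewrite e LL1_FF // in dR dI.
have -> : (fun x => cn (LL psi 0 x) ^+ 2) =
  (fun x => Re (LL psi 0 x) ^+ 2 + Im (LL psi 0 x) ^+ 2).
  by apply/funext => x; rewrite cn_sqr.
apply: is_derive_eq (derive_sqr_sum dR dI) _.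
by rewrite cn_sqr cReM cImM -/(LL psi 0 s); ring.
Qed.

Lemma Re_FF psi s : cmult psi -> 1 < s ->
  clim (psum (fun n => (Re (psi n) * vM R n * pw s n)%:C)) (Re (FF psi 0 s))%:C.
Proof.
move=> h s1; have hF := absumP (absD_FF 0 h s1).
move=> e /hF[N0 hN]; exists N0 => N /hN; apply: le_trans.
rewrite /psum -rmorph_sum -rmorphB cn_real; apply: le_trans (Re_le_cn _).
rewrite (_ : \sum_(1 <= n < N.+1) _ =
  Re (psum (tm (fun n => lnc R n ^+ 0 * (psi n * (vM R n)%:C)) s) N)); last first.
  rewrite /psum cRe_sum; apply: eq_bigr => n _.
  rewrite /tm expr0 mul1r.
  have -> : psi n * (vM R n)%:C * (pw s n)%:C = (vM R n * pw s n)%:C * psi n.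
    by rewrite rmorphM /=; ring.
  by rewrite cReM_real; ring.
by rewrite cReD cReN.
Qed.

Definition one_c (n : nat) : C := 1.
Lemma cmult_one : cmult one_c.
Proof. by split=> [//|d e|n]; rewrite /one_c ?mulr1 ?cn1. Qed.

Lemma sum_inv_sq_le (M : nat) : \sum_(2 <= i < M.+1) pw 2 i <= 3 / 4 :> R.
Proof.
case: M => [|[|M]]; try by rewrite big_geq //; lra.
rewrite big_ltn //; have t0 : (0 : R) < 1 by [].
have := sum_pw_tail M.+3 t0 (_ : 0 < 2)%N => /(_ isT).
rewrite (_ : 1 + 1 = 2) // (pw_oneE _ (_ : 0 < 2)%N) // (pw_nat R 2 2).
by move=> h2; apply: le_trans (lerD (lexx _) h2) _; lra.
Qed.

(** At [s = 2] the term [n = 1] dominates: all others together have modulus at most 1/4 + 1/2. *)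
Lemma LL2_lower psi : cmult psi -> 1 / 4 <= cn (LL psi 0 2).
Proof.
move=> h; have [p1 _ ple] := h.
have s1 : (1 : R) < 2 by lra.
have hL := absumP (absD_LL 0 h s1).
apply: le_eps => e e0; have [N0 hN] := hL _ e0.
have {hN} := hN (maxn N0 1) (leq_maxl _ _).
set N := maxn N0 1; have N1 : (0 < N)%N by exact: leq_maxr.
rewrite -/(DS _ _) -/(LL _ _ _) => hN.
have : 1 / 4 <= cn (psum (tm (fun n => lnc R n ^+ 0 * psi n) 2) N).
  rewrite /psum big_ltn ?ltnS // /tm expr0 mul1r p1 pw1 mulr1 {p1}.
  set S := \sum_(2 <= i < N.+1) _.
  have hS : cn S <= 3 / 4.
    apply: le_trans (cn_sum _ _ _) _.
    apply: le_trans (_ : \sum_(2 <= i < N.+1) pw 2 i <= _).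
      apply: ler_sum => n _; rewrite expr0 mul1r cnM cn_real (ger0_norm (pw_ge0 _ _)).
      by rewrite ler_piMl ?pw_ge0.
    exact: sum_inv_sq_le.
  have -> : 1 * (1 : R)%:C + S = 1 - - S by rewrite opprK mul1r.
  have := cnBge 1 (- S); rewrite cn1 cnN; lra.
have := cnBge (psum (tm (fun n => lnc R n ^+ 0 * psi n) 2) N) (LL psi 0 2); clear p1; lra.
Qed.

(* 3 + 4 cos + cos 2 >= 0 makes this product nonincreasing in s on ]1, 2]. *)
Lemma three_four_one psi1 psi2 s : cmult psi1 -> cmult psi2 ->
  (forall n, psi1 n = 0 \/ cn (psi1 n) = 1 /\ psi2 n = psi1 n ^+ 2) ->
  1 < s -> s <= 2 ->
  (1 / 4) ^+ 16 <= cn (LL one_c 0 s) ^+ 6 * cn (LL psi1 0 s) ^+ 8 * cn (LL psi2 0 s) ^+ 2.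
Proof.
move=> h1 h2 h12 s1 s2.
pose N0 x := cn (LL one_c 0 x) ^+ 2; pose N1 x := cn (LL psi1 0 x) ^+ 2.
pose N2 x := cn (LL psi2 0 x) ^+ 2.
pose G (x : R) := N0 x ^+ 3 * N1 x ^+ 4 * N2 x.
have GE x : G x = cn (LL one_c 0 x) ^+ 6 * cn (LL psi1 0 x) ^+ 8 * cn (LL psi2 0 x) ^+ 2.
  by rewrite /G /N0 /N1 /N2 -!exprM.
rewrite -GE.
pose w x := 3 * Re (FF one_c 0 x) + 4 * Re (FF psi1 0 x) + Re (FF psi2 0 x).
have dG (x : R) : 1 < x -> is_derive x 1 G (- 2 * w x * G x).
  move=> x1.
  exact: (derive_341 (is_derive_cn2 cmult_one x1) (is_derive_cn2 h1 x1) (is_derive_cn2 h2 x1)).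
have w0 (x : R) : 1 < x -> 0 <= w x.
  move=> x1; rewrite -[w x]opprK oppr_ge0.
  have L0 := climZ 3 (Re_FF cmult_one x1); have L1 := climZ 4 (Re_FF h1 x1).
  have L2 := Re_FF h2 x1; have L := climD (climD L0 L1) L2.
  apply: le_eps => e /L[M hM]; have {hM} := hM M (leqnn M).
  set S := psum _ M; set S1 := psum _ M; set S2 := psum _ M.
  rewrite add0r => hM.
  pose T := \sum_(1 <= n < M.+1) (3 + 4 * Re (psi1 n) + Re (psi2 n)) * vM R n * pw x n.
  have ST : 3 * S + 4 * S1 + S2 = T%:C.
    rewrite /S /S1 /S2 /psum !mulr_sumr -!big_split /T rmorph_sum; apply: eq_bigr => n _.
    by rewrite /one_c /= -[3]/(3%:R) -[4]/(4%:R) -!(rmorph_nat (real_complex R)) -!rmorphM -!rmorphD; congr (_%:C); ring.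
  have T0 : 0 <= T.
    apply: sumr_ge0 => n _; rewrite !mulr_ge0 ?vM_ge0 ?pw_ge0 //.
    have [_ _ /(_ n) b2] := h2; have := Re_le_cn (psi2 n).
    (* Where [psi1] vanishes, [3 + Re psi2 >= 2]. Elsewhere [psi1 n] is a unit and the expression
       equals [2 (1 + Re psi1) ^ 2]. *)
    case: (h12 n) => [->|[b1 ->]].
      by rewrite mulr0 addr0 ler_norml => /andP[]; lra.
    have := cn_sqr (psi1 n); rewrite b1 expr1n => q _.
    rewrite expr2 cReM; clear -ST b2 b1 q; nra.
  move: hM; rewrite ST.
  have -> : 3 * (Re (FF one_c 0 x))%:C + 4 * (Re (FF psi1 0 x))%:C + (Re (FF psi2 0 x))%:C = (w x)%:C.
    by rewrite /w !rmorphD !rmorphM !rmorph_nat.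
  by rewrite -rmorphB cn_real => /(le_trans (ler_norm _)); lra.
have [|c [c1 c2 hc]] := @MVT_closed R G (fun x => - 2 * w x * G x) s 2 s2.
  by move=> x x1 _; apply: dG; apply: lt_le_trans x1.
have c1' : 1 < c by apply: lt_le_trans c1.
have G0 : 0 <= G c by rewrite GE !mulr_ge0 ?exprn_ge0 ?cn_ge0.
(* At [s = 2] each of the 6 + 8 + 2 factors is at least 1/4. *)
have G2 : (1 / 4) ^+ 16 <= G 2.
  rewrite GE -[16%N]/(6 + 8 + 2)%N !exprD.
  by rewrite !ler_pM ?lerXn2r ?nnegrE ?cn_ge0 ?mulr_ge0 ?exprn_ge0 ?LL2_lower //; try exact: cmult_one; lra.
apply: le_trans G2 _; have h20 : 0 <= 2 - s by rewrite subr_ge0.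
have := mulr_ge0 (mulr_ge0 (w0 c c1') G0) h20.
move: (G 2) (G s) (G c) (w c) hc => g2 gs gc wc; lra.
Qed.

End CompletelyMultiplicative.

(** * Characters of a finite abelian group *)

Section GroupCharacters.
Variable R : realType.
Local Notation C := R[i].
Variable gT : finGroupType.
Hypothesis gab : forall x y : gT, (x * y = y * x)%g.

(* Simultaneous diagonalisation of the regular representation yields all characters at once. *)
Lemma abelian_characters : exists n (chi : 'I_n -> gT -> C),
  [/\ n = #|gT|, forall i, chi i 1%g = 1, forall i x y, chi i (x * y)%g = chi i x * chi i y
    & forall x, \sum_i chi i x = if x == 1%g then #|gT|%:R else 0].
Proof.
have [n' en] : exists n', #|gT| = n'.+1.
  by exists #|gT|.-1; rewrite prednK //; apply/card_gt0P; exists 1%g.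
pose g (i : 'I_n'.+1) : gT := enum_val (cast_ord (esym en) i).
pose f (x : gT) : 'I_n'.+1 := cast_ord en (enum_rank x).
have fK x : g (f x) = x by rewrite /g /f cast_ordK enum_rankK.
have gK i : f (g i) = i by rewrite /g /f enum_valK cast_ordKV.
have geq i x : (g i == x) = (i == f x) by rewrite -(inj_eq (can_inj fK)) gK.
(* Right multiplication by [x], as a permutation matrix. *)
pose M x : 'M[C]_n'.+1 := \matrix_(i, j) (g i * x == g j)%g%:R.
have MM x y : M x *m M y = M (x * y)%g.
  apply/matrixP => i j; rewrite !mxE (bigD1 (f (g i * x)%g)) //= !mxE fK eqxx mul1r.
  rewrite mulgA big1 ?addr0 // => k kn; rewrite !mxE eq_sym geq (negbTE kn) mul0r //.
have M1 : M 1%g = 1.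
  by apply/matrixP => i j; rewrite !mxE mulg1 geq gK.
have MX x k : M x ^+ k = M (x ^+ k)%g.
  by elim: k => [|k IH]; rewrite ?expr0 ?expg0 ?M1 // exprS expgS IH -MM.
have MN x : M x ^+ n'.+1 = 1.
  have e1 : (x ^+ n'.+1)%g = 1%g by rewrite -en -cardsT expg_cardG ?inE.
  by rewrite MX e1 M1.
(* [M x] is a root of X^|G| - 1, which splits over C and is separable in characteristic 0. Commuting
   diagonalisable matrices are then diagonalised by one base change [P]. *)
have dM x : diagonalizable (M x).
  apply/diagonalizableP.
  have [rs hrs] := closed_field_poly_normal ('X^(n'.+1) - 1 : {poly C}).
  have lc : lead_coef ('X^(n'.+1) - 1 : {poly C}) = 1.
    by apply/monicP; rewrite -[1]/(1%:P) monicXnsubC.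
  rewrite lc scale1r in hrs; exists rs.
    by rewrite -separable_prod_XsubC -hrs cyclotomic.separable_Xn_sub_1 // pnatr_eq0.
  rewrite -hrs; apply: mxminpoly_min.
  by rewrite rmorphB rmorph1 rmorphXn /= horner_mx_X MN subrr.
have [P Pu /allP hP] : codiagonalizable [seq M x | x <- enum gT].
  apply/codiagonalizableP; split.
    by move=> _ _ /mapP[x _ ->] /mapP[y _ ->]; rewrite /comm_mx !MM gab.
  by move=> _ /mapP[x _ ->]; exact: dM.
pose D x := P *m M x *m invmx P.
have Dd x : is_diag_mx (D x).
  have := hP (M x); rewrite /= /mxred.similar_to mxred.conjumx //; apply.
  by apply: map_f; rewrite mem_enum.
have DM x y : D x *m D y = D (x * y)%g.
  by rewrite /D -MM; move: (M x) (M y) => A B; rewrite !mulmxA mulmxKV.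
exists n'.+1, (fun i x => D x i i); split=> //.
- by move=> i; rewrite /D M1 mulmx1 mulmxV // mxE eqxx.
- move=> i x y; rewrite -DM mxE (bigD1 i) //= big1 ?addr0 // => k ki.
  by move/is_diag_mxP: (Dd x) => ->; rewrite ?mul0r // eq_sym.
(* Orthogonality is the trace of the regular representation: multiplication by [x] other than 1 has
   no fixed point. *)
move=> x; transitivity (\tr (D x)) => //.
rewrite /D mxtrace_mulC mulmxA mulVmx // mul1mx /mxtrace.
case: eqP => [->|xn].
  by rewrite M1; under eq_bigr do rewrite mxE eqxx; rewrite sumr_const card_ord en.
rewrite big1 // => i _; rewrite mxE -{2}(mulg1 (g i)) (inj_eq (mulgI _)).
by move/eqP/negbTE: xn => ->.
Qed.

End GroupCharacters.

(** * Dirichlet characters: existence, orthogonality, partial sums *)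

Section DirichletCharacters.
Variable R : realType.
Local Notation C := R[i].
Implicit Types (chi : nat -> C) (q n : nat).

Definition dchar q chi :=
  [/\ cmult chi, forall n, chi (n %% q)%N = chi n,
      forall n, coprime n q -> cn (chi n) = 1 & forall n, ~~ coprime n q -> chi n = 0].

Definition principal q chi := forall n, coprime n q -> chi n = 1.

Lemma dirichlet_characters q : (0 < q)%N -> exists chi : 'I_(totient q) -> nat -> C,
  (forall i, dchar q (chi i)) /\
  forall n, coprime n q -> \sum_i chi i n = if (n == 1 %[mod q])%N then (totient q)%:R else 0.
Proof.
(* The modulus 1 is treated by hand, because the type ['Z_1] has two elements. *)
case: q => // -[_|q _].
  exists (fun _ _ => 1); split=> [i|n _].
    split=> //; last by move=> n; rewrite coprimen1.
      exact: cmult_one.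
    by move=> n _; rewrite cn1.
  by rewrite !modn1 eqxx sumr_const card_ord.
set Q := q.+2.
have Q1 : (1 < Q)%N by [].
have cardu : #|{: {unit 'Z_Q}}| = totient Q by rewrite -card_units_Zp // -cardsT.
have [|k [chi [ek chi1 chiM chis]]] := @abelian_characters R {unit 'Z_Q}.
  by move=> x y; apply: val_inj => /=; rewrite mulrC.
rewrite {}ek cardu in chi chi1 chiM chis.
(* On non-units [u] takes the default value 1, which the test [coprime n Q] in the witness masks. *)
pose u n : {unit 'Z_Q} := odflt (1%g : {unit 'Z_Q}) (insub (n%:R : 'Z_Q)).
have uv n : coprime n Q -> val (u n) = n%:R.
  by move=> h; rewrite /u insubT /= ?unitZpE // coprime_sym.
have uM m n : coprime m Q -> coprime n Q -> u (m * n)%N = (u m * u n)%g.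
  move=> hm hn; apply: val_inj; rewrite /= !uv // ?natrM //.
  by rewrite coprimeMl hm.
exists (fun i n => if coprime n Q then chi i (u n) else 0); split=> [i|n hn].
  have c1 n : coprime n Q -> cn (chi i (u n)) = 1.
    move=> h; have hX m (x : {unit 'Z_Q}) : chi i (x ^+ m)%g = chi i x ^+ m.
      by elim: m => [|m IH]; rewrite ?expg0 ?expr0 // expgS exprS chiM IH.
    have : cn (chi i (u n)) ^+ #|{: {unit 'Z_Q}}| = 1.
      by rewrite -cnX -hX -cardsT expg_cardG ?inE // chi1 cn1.
    move/eqP; rewrite pexpr_eq1 ?cn_ge0 //; first by move/eqP.
    by apply/card_gt0P; exists 1%g.
  split.
  - split=> [|d e|n].
    + rewrite coprime1n (_ : u 1%N = 1%g) ?chi1 //.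
      by apply: val_inj; rewrite uv ?coprime1n.
    + rewrite coprimeMl; case hd: (coprime d Q) => /=; last by rewrite mul0r.
      by case he: (coprime e Q) => /=; rewrite ?mulr0 // uM.
    + by case: ifP => [/c1 ->|_]; rewrite ?cn0.
  - by move=> n; rewrite coprime_modl /u Zp_nat_mod.
  - by move=> n h; rewrite h c1.
  by move=> n /negbTE ->.
rewrite hn chis; congr (if _ then _ else _).
apply/eqP/eqP => [/(congr1 val)|e].
  by rewrite uv // => /(congr1 val); rewrite /= val_Zp_nat // => ->; rewrite modn_small.
by apply: val_inj; rewrite uv // -(Zp_nat_mod Q1 n) e Zp_nat_mod.
Qed.

Lemma dchar_period q chi n k : dchar q chi -> chi (n + k * q)%N = chi n.
Proof. by move=> [_ h _ _]; rewrite -h addnC modnMDl h. Qed.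

(** Multiplication by a unit [a] with [chi a <> 1] permutes the residues and multiplies the sum by
    [chi a]. *)
Lemma dchar_period_sum q chi : (0 < q)%N -> dchar q chi -> ~ principal q chi ->
  \sum_(0 <= n < q) chi n = 0.
Proof.
move=> q0 [[_ cM _] hp _ h0] np.
have [a [ca na]] : exists a, coprime a q /\ chi a <> 1.
  apply: contra_notP np => h n hn; apply: contra_notP h => hh; by exists n.
case: q q0 => // q _ in hp h0 ca np *.
rewrite big_mkord; set S := \sum_i _.
pose h (i : 'I_q.+1) : 'I_q.+1 := inord ((a * i) %% q.+1)%N.
have hv i : (h i : nat) = ((a * i) %% q.+1)%N by rewrite inordK // ltn_pmod.
have hinj : injective h.
  move=> i j e; apply: val_inj => /=.
  wlog ij : i j e / (i <= j)%N.
    by move=> H; case: (leqP i j) => [|/ltnW] ij; [exact: H|symmetry; exact: H].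
  have /eqP : ((a * j) %% q.+1 = (a * i) %% q.+1)%N by rewrite -!hv e.
  rewrite eqn_mod_dvd ?leq_mul2l ?ij ?orbT // -mulnBr Gauss_dvdr 1?coprime_sym //.
  move=> /dvdn_leq; case: (posnP (j - i)%N) => [h1 _|h1 /(_ isT)]; first by lia.
  by have := ltn_ord j; lia.
have e : chi a * S = S.
  rewrite {2}/S (reindex_inj hinj) /= mulr_sumr; apply: eq_bigr => i _.
  by rewrite hv hp cM.
have : (chi a - 1) * S = 0 by rewrite mulrBl e mul1r subrr.
by move/eqP; rewrite mulf_eq0 subr_eq0 => /orP[/eqP|/eqP].
Qed.

(** Whole periods sum to zero, which leaves fewer than [q] terms. *)
Lemma dchar_partial q chi m k : (0 < q)%N -> dchar q chi -> ~ principal q chi ->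
  cn (\sum_(m <= n < m + k) chi n) <= q%:R.
Proof.
move=> q0 hc np; have [[_ _ cle] hp _ _] := hc.
have shift1 i : \sum_(i <= n < i + q) chi n = 0.
  elim: i => [|i IH]; first by rewrite add0n dchar_period_sum.
  move: IH; rewrite big_ltn; last by rewrite -[X in (X < _)%N]addn0 ltn_add2l.
  rewrite addSn big_nat_recr /=; last by rewrite -[X in (X < _)%N]addn0 ltn_add2l.
  by rewrite addrC -(dchar_period i 1 hc) mul1n.
elim/ltn_ind: k => k IH; case: (ltnP k q) => kq.
  apply: le_trans (cn_sum _ _ _) _.
  apply: le_trans (_ : \sum_(m <= n < m + k) (1 : R) <= _); first exact: ler_sum.
  by rewrite sumr_const_nat addKn ler_nat ltnW.
rewrite (big_cat_nat (n := (m + (k - q))%N)) /= ?leq_addr ?leq_add2l ?leq_subr //.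
have -> : (m + k = m + (k - q) + q)%N by lia.
by rewrite shift1 addr0; apply: IH; lia.
Qed.

Lemma dchar_mul q r chi chi' : dchar q chi -> dchar r chi' ->
  dchar (q * r) (fun n => chi n * chi' n).
Proof.
move=> [[a1 a2 a3] b1 c1 d1] [[a1' a2' a3'] b1' c1' d1']; split.
- split=> [|d e|n]; first by rewrite a1 a1' mulr1.
    by rewrite a2 a2' mulrACA.
  by rewrite cnM mulr_ile1 ?cn_ge0.
- by move=> n; rewrite -b1 -b1' modn_dvdm ?dvdn_mulr // b1 modn_dvdm ?dvdn_mull // b1'.
- by move=> n; rewrite coprimeMr => /andP[h1 h2]; rewrite cnM c1 ?c1' ?mulr1.
by move=> n; rewrite coprimeMr negb_and => /orP[/d1|/d1'] ->; rewrite ?mul0r ?mulr0.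
Qed.

(** Double count of the sum of [chi i n] over all [i] and one period: orthogonality leaves [phi q],
    from the residue of 1, while every principal character contributes [phi q] and every other one
    0. *)
Lemma principal_count q (chi : 'I_(totient q) -> nat -> C) : (0 < q)%N ->
  (forall i, dchar q (chi i)) ->
  (forall n, coprime n q -> \sum_i chi i n = if (n == 1 %[mod q])%N then (totient q)%:R else 0) ->
  exists i0, principal q (chi i0) /\ forall i, i != i0 -> ~ principal q (chi i).
Proof.
move=> q0 hd hs.
have tot : \sum_(i < totient q) \sum_(0 <= n < q) chi i n = (totient q)%:R.
  rewrite exchange_big /=.
  rewrite (eq_big_nat _ _ (F2 := fun n => if (n == 1 %% q)%N then (totient q)%:R else 0)); last first.
    move=> n /andP[_ nq]; case cnq: (coprime n q).
      by rewrite hs // (modn_small nq).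
    rewrite big1 => [|i _]; last by have [_ _ _ ->] := hd i; rewrite ?cnq.
    case: eqP cnq => // ->; case: q q0 nq {hd hs chi} => // -[|q] // _ _.
    by rewrite modn_small // coprime1n.
  by rewrite -big_mkcond big_nat1_eq /= ltn_pmod.
have pr i : principal q (chi i) -> \sum_(0 <= n < q) chi i n = (totient q)%:R.
  move=> h; rewrite totient_count_coprime natr_sum; apply: eq_big_nat => n _.
  case cnq: (coprime q n); first by rewrite h // coprime_sym.
  by have [_ _ _ ->] := hd i; rewrite // coprime_sym cnq.
pose P := [pred i | `[< principal q (chi i) >]].
have : \sum_(i < totient q) \sum_(0 <= n < q) chi i n = (#|P| * totient q)%:R.
  rewrite natrM -sum1_card natr_sum mulr_suml big_mkcond [RHS]big_mkcond /=.
  apply: eq_bigr => i _; rewrite mul1r; case: ifP => /asboolP h; first exact: pr.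
  exact: dchar_period_sum.
rewrite tot => /eqP; rewrite eqr_nat -{1}(mul1n (totient q)) eqn_pmul2r ?totient_gt0 // eq_sym.
move=> /card1P[i0 hi0]; exists i0; split.
  by have := hi0 i0; rewrite !inE eqxx => /asboolP.
by move=> i ii0 h; have := hi0 i; rewrite !inE (negbTE ii0); move/asboolP: h => ->.
Qed.

End DirichletCharacters.

(** * Upper bounds for nonprincipal L-functions and their derivatives *)

Section UpperBounds.
Variable R : realType.
Local Notation C := R[i].
Implicit Types (chi psi : nat -> C) (q n : nat) (s t d u v w : R).

Lemma expX_diff j (a b : R) : 0 <= b -> b <= a -> a <= 1 + b ->
  a ^+ j - b ^+ j <= j%:R * (1 + b) ^+ j * (a - b).
Proof.
move=> b0 ba ab; elim: j => [|j IH]; first by rewrite subrr !mul0r.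
have c0 : 0 <= (1 + b) ^+ j by rewrite exprn_ge0 //; lra.
have bj : b ^+ j <= (1 + b) ^+ j by rewrite lerXn2r ?nnegrE //; lra.
have -> : a ^+ j.+1 - b ^+ j.+1 = a * (a ^+ j - b ^+ j) + b ^+ j * (a - b) by rewrite !exprS; ring.
rewrite exprS -natr1; apply: le_trans (lerD (ler_wpM2l (le_trans b0 ba) IH) (lexx _)) _.
have j0 : (0 : R) <= j%:R by [].
set P := (1 + b) ^+ j in IH c0 bj *; set B := b ^+ j in bj *.
have h1 : 0 <= a - b by lra.
have h2 : 0 <= j%:R * P * (a - b) by rewrite !mulr_ge0.
have h3 : a * (j%:R * P * (a - b)) <= (1 + b) * (j%:R * P * (a - b)) by rewrite ler_wpM2r.
have h4 : B * (a - b) <= (1 + b) * P * (a - b) by rewrite ler_wpM2r //; nra.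
nra.
Qed.

Lemma lnD1X_le_powR k d : 0 < d ->
  exists2 c : R, 1 <= c & forall n, (0 < n)%N -> (1 + ln n%:R) ^+ k <= c * n%:R `^ d.
Proof.
move=> d0; have [c1 c11 hc1] := @lnX_le_powR R k d d0.
have e1 : (1 : R) <= expR 1 by rewrite -expR0 ler_expR.
exists (c1 * (expR 1) `^ d).
  apply: (le_trans c11); rewrite ler_peMr ?(le_trans ler01 c11) //.
  by rewrite -[X in X <= _](powRr0 (expR 1)) ler_powR // ltW.
move=> n n0; have n1 : (1 : R) <= n%:R by rewrite ler1n.
rewrite -mulrA -powRM ?expR_ge0 //.
have -> : 1 + ln n%:R = ln (expR 1 * n%:R) :> R.
  by rewrite lnM ?posrE ?expR_gt0 ?ltr0n // expRK.
by apply: hc1; nra.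
Qed.

(** The coefficient [ln ^ j n * n ^ (- s - i t)] as a function of the real variable [v = ln n]. *)
Definition GG j s t v : C := (v ^+ j)%:C * cis (- t * v) * (expR (- s * v))%:C.

Lemma cn_GG j s t v : 0 <= v -> cn (GG j s t v) = v ^+ j * expR (- s * v).
Proof. by move=> v0; rewrite !cnM cn_cis mulr1 !cn_real !ger0_norm ?expR_ge0 ?exprn_ge0. Qed.

Lemma GG_lip j s t u v : 0 <= s -> s <= 2 -> 0 <= u -> u <= v -> v <= 1 + u ->
  cn (GG j s t v - GG j s t u) <=
  j.+1%:R * (`|t| + 2) * (1 + u) ^+ j * expR (- s * u) * (v - u).
Proof.
move=> s0 s2 u0 uv vu.
pose A := (v ^+ j)%:C : C; pose A0 := (u ^+ j)%:C : C.
pose T := cis (- t * v); pose T0 := cis (- t * u).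
pose P := (expR (- s * v))%:C : C; pose P0 := (expR (- s * u))%:C : C.
have -> : GG j s t v - GG j s t u = (A - A0) * T * P + A0 * (T - T0) * P + A0 * T0 * (P - P0).
  by rewrite /GG -/A -/A0 -/T -/T0 -/P -/P0; ring.
have c0 : 0 <= (1 + u) ^+ j by rewrite exprn_ge0 //; lra.
have uj : u ^+ j <= (1 + u) ^+ j by rewrite lerXn2r ?nnegrE //; lra.
have e0 := expR_gt0 (- s * u).
have e1 : expR (- s * v) <= expR (- s * u) by rewrite ler_expR; nra.
have e2 : expR (- s * u) - expR (- s * v) <= expR (- s * u) * (2 * (v - u)).
  have -> : - s * v = - s * u + - (s * (v - u)) by ring.
  rewrite expRD -[X in X - _]mulr1 -mulrBr ler_pM2l //.
  have := expR_ge1Dx (- (s * (v - u))); nra.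
have hA : cn (A - A0) <= j%:R * (1 + u) ^+ j * (v - u).
  rewrite -rmorphB cn_real ger0_norm; first exact: expX_diff.
  by rewrite subr_ge0 lerXn2r ?nnegrE //; lra.
have hT : cn (T - T0) <= `|t| * (v - u).
  apply: le_trans (cn_cisB _ _) _; rewrite -mulrBr normrM normrN ler_wpM2l //.
  by rewrite ger0_norm //; lra.
apply: le_trans (cnD _ _) _; apply: le_trans (lerD (cnD _ _) (lexx _)) _.
have hP : cn (P - P0) <= expR (- s * u) * (2 * (v - u)).
  by rewrite -rmorphB cn_real distrC ger0_norm // subr_ge0.
have cP : cn P = expR (- s * v) by rewrite cn_real ger0_norm ?expR_ge0.
have cA0 : cn A0 = u ^+ j by rewrite cn_real ger0_norm ?exprn_ge0.
rewrite !cnM !cn_cis !mulr1 cP cA0.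
set E := expR (- s * u) in e0 e1 e2 *; set E' := expR _ in e1 e2 *.
set Pj := (1 + u) ^+ j in c0 uj hA *; set uj' := u ^+ j in uj *.
have uj0 : 0 <= uj' by exact: exprn_ge0.
have vu0 : 0 <= v - u by clear -s0 s2 u0 uv; lra.
have E'0 : 0 <= E' by exact: expR_ge0.
have t0 := normr_ge0 t.
have k1 : cn (A - A0) * E' <= j%:R * Pj * (v - u) * E.
  by apply: ler_pM => //; exact: cn_ge0.
have k2 : uj' * cn (T - T0) * E' <= Pj * (`|t| * (v - u)) * E.
  by apply: ler_pM => //; rewrite ?mulr_ge0 ?cn_ge0 //; apply: ler_pM => //; exact: cn_ge0.
have k3 : uj' * cn (P - P0) <= Pj * (E * (2 * (v - u))).
  by apply: ler_pM => //; exact: cn_ge0.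
apply: le_trans (lerD (lerD k1 k2) k3) _.
rewrite -natr1; have j0 : (0 : R) <= j%:R by [].
have h0 : 0 <= Pj * E * (v - u) by rewrite !mulr_ge0 // ltW.
have : 0 <= j%:R * `|t| * (Pj * E * (v - u)) by rewrite mulr_ge0 // mulr_ge0.
have : 0 <= j%:R * (Pj * E * (v - u)) by rewrite mulr_ge0.
clear -s0 s2 u0; lra.
Qed.

(* n ^ (- i t), with the junk value 0 at n = 0 *)
Definition tw t n : C := if n == 0%N then 0 else cis (- t * ln n%:R).
Definition gg j s t n : C := lnc R n ^+ j * tw t n * (pw s n)%:C.

Lemma ggE j s t n : (0 < n)%N -> gg j s t n = GG j s t (ln n%:R).
Proof. by case: n => // n _; rewrite /gg /GG /lnc /tw -rmorphXn pwE. Qed.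

Lemma cmult_tw t : cmult (tw t).
Proof.
split=> [|[|d] [|e]|[|n]]; rewrite /tw ?muln0 ?mul0n ?mul0r ?mulr0 ?cn0 ?cn_cis //=.
  by rewrite ln1 mulr0 cis0.
by rewrite lgadd_ln // mulrDr cisD.
Qed.

Lemma twD t t' n : tw t n * tw t' n = tw (t + t') n.
Proof. by case: n => [|n]; rewrite /tw ?mul0r //= -cisD opprD mulrDl. Qed.

Lemma tw0 n : (0 < n)%N -> tw 0 n = 1.
Proof. by case: n => // n _; rewrite /tw /= oppr0 mul0r cis0. Qed.

Lemma cmultM psi psi' : cmult psi -> cmult psi' -> cmult (fun n => psi n * psi' n).
Proof.
move=> [a1 a2 a3] [a1' a2' a3']; split=> [|d e|n]; first by rewrite a1 a1' mulr1.
  by rewrite a2 a2' mulrACA.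
by rewrite cnM mulr_ile1 ?cn_ge0.
Qed.

(** The logarithms are absorbed into [n ^ d], uniformly in [s] and [t]; a difference of consecutive
    terms gains a factor [(|t| + 2) / n]. *)
Lemma gg_bound j d : 0 < d -> exists2 K : R, 1 <= K & forall s t n, 1 <= s -> s <= 2 -> (0 < n)%N ->
  cn (gg j s t n) <= K * pw (1 - d) n /\
  cn (gg j s t n.+1 - gg j s t n) <= K * (`|t| + 2) * pw (2 - d) n.
Proof.
move=> d0; have [c c1 hc] := lnD1X_le_powR j d0.
have jc : (1 : R) <= j.+1%:R by rewrite ler1n.
exists (j.+1%:R * c); first by nra.
move=> s t n s1 s2 n0.
have N0 : (0 : R) < n%:R by rewrite ltr0n.
have l0 := ln_nat_ge0 R n.
have hp k : (n%:R `^ d) * pw k%:R n = pw (k%:R - d) n.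
  by rewrite /pw -powRD ?opprB // pnatr_eq0 -lt0n n0 implybT.
have es : expR (- s * ln n%:R) <= pw 1 n by rewrite -pwE // pw_le.
rewrite !ggE //; split.
  rewrite cn_GG //; apply: le_trans (_ : (1 + ln n%:R) ^+ j * pw 1 n <= _).
    apply: ler_pM; rewrite ?exprn_ge0 ?expR_ge0 //.
    by rewrite lerXn2r ?nnegrE //; lra.
  rewrite -(hp 1%N) mulrA ler_wpM2r ?pw_ge0 //; apply: le_trans (hc n n0) _.
  by rewrite ler_wpM2r ?powR_ge0 // ler_peMl //; lra.
have d1 := ln_succ_le R n0; have d1' := ln_succ_ge R n0.
have i0 : 0 < n.+1%:R^-1 :> R by rewrite invr_gt0 ltr0n.
have i1 : n%:R^-1 <= 1 :> R by rewrite invf_le1 // ler1n.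
have v1 : ln n%:R <= ln n.+1%:R :> R by rewrite -subr_ge0 (le_trans _ d1') // ltW.
have v2 : ln n.+1%:R <= 1 + ln n%:R :> R by rewrite -lerBlDr (le_trans d1).
apply: le_trans (GG_lip j t _ s2 l0 v1 v2) _; first by lra.
rewrite -(hp 2%N).
have -> : pw 2%:R n = pw 1 n * n%:R^-1 :> R.
  by rewrite pw_nat pw_oneE // -exprVn expr2.
have -> : j.+1%:R * c * (`|t| + 2) * (n%:R `^ d * (pw 1 n * n%:R^-1)) =
   j.+1%:R * (`|t| + 2) * (c * n%:R `^ d) * pw 1 n * n%:R^-1 by ring.
have t0 := normr_ge0 t.
apply: ler_pM => //; rewrite ?mulr_ge0 ?expR_ge0 ?exprn_ge0 //; try (clear -l0 v1; lra).
apply: ler_pM => //; rewrite ?mulr_ge0 ?expR_ge0 ?exprn_ge0 //; try (clear -l0; lra).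
by apply: ler_wpM2l; [rewrite mulr_ge0 //; lra|exact: hc].
Qed.

(** Abel summation; the boundary value of [g] is taken one index past the range. *)
Lemma abel_bound (a g : nat -> C) (B : R) m k : (forall k, cn (\sum_(m <= n < m + k) a n) <= B) ->
  cn (\sum_(m <= n < m + k) a n * g n) <=
  B * (cn (g (m + k)%N) + \sum_(m <= n < m + k) cn (g n.+1 - g n)).
Proof.
move=> hB.
have e : \sum_(m <= n < m + k) a n * g n = (\sum_(m <= n < m + k) a n) * g (m + k)%N -
    \sum_(m <= n < m + k) (\sum_(m <= i < m + (n.+1 - m)) a i) * (g n.+1 - g n).
  elim: k => [|k IH]; first by rewrite addn0 !big_geq // mul0r subr0.
  rewrite addnS !big_nat_recr ?leq_addr //= IH subnKC 1?leqW ?leq_addr //.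
  by rewrite [in X in _ - (_ + X * _)]big_nat_recr ?leq_addr //=; ring.
rewrite e; apply: le_trans (cnB _ _) _; rewrite mulrDr; apply: lerD.
  by rewrite cnM ler_wpM2r ?cn_ge0.
apply: le_trans (cn_sum _ _ _) _; rewrite mulr_sumr; apply: ler_sum => n _.
by rewrite cnM ler_wpM2r ?cn_ge0.
Qed.

Lemma powR2_le u d : 0 <= u -> 0 <= d -> d <= 1 -> (2 * u) `^ d <= 2 * u `^ d.
Proof.
move=> u0 d0 d1; rewrite powRM // ler_wpM2r ?powR_ge0 //.
by apply: ler1_powR => //; lra.
Qed.

Lemma nat_above u : 1 <= u -> exists N : nat, [/\ (0 < N)%N, u <= N%:R & N%:R <= 2 * u].
Proof.
move=> u1; exists (Num.truncn u).+1; split=> //.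
  by rewrite ltW // truncnS_gt.
rewrite -natr1; have : (Num.truncn u)%:R <= u by rewrite truncn_le //; lra.
lra.
Qed.

(** Terms up to about [q (|t| + 2)] are bounded trivially; beyond that point Abel summation with
    partial sums at most [q] is just as good. Working with partial sums keeps the bound valid at
    [s = 1] itself. *)
Lemma chi_upper j d : 0 < d -> d <= 1 / 2 -> exists2 K : R, 1 <= K &
  forall q chi t s N, (0 < q)%N -> dchar q chi -> ~ principal q chi -> 1 <= s -> s <= 2 ->
  cn (psum (tm (fun n => lnc R n ^+ j * (chi n * tw t n)) s) N) <= K * (q%:R * (`|t| + 2)) `^ d.
Proof.
move=> d0 d2; have [K K1 hK] := gg_bound j d0.
exists (2 * (K * (2 / d) + K + K * 2)).
  have : 0 < K * (2 / d) by rewrite mulr_gt0 ?divr_gt0 //; lra.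
  by lra.
move=> q chi t s N q0 hc np s1 s2.
have [[_ _ cle] _ _ _] := hc.
have t0 := normr_ge0 t.
pose u : R := q%:R * (`|t| + 2).
have q1 : (1 : R) <= q%:R by rewrite ler1n.
have u1 : 1 <= u by rewrite /u; nra.
have [N0 [N00 uN Nu]] := nat_above u1.
have NN0 : (0 : R) < N0%:R by rewrite ltr0n.
have eE n : tm (fun n => lnc R n ^+ j * (chi n * tw t n)) s n = chi n * gg j s t n.
  by rewrite /tm /gg; ring.
have head M : (M <= N0)%N -> cn (\sum_(1 <= n < M.+1) chi n * gg j s t n) <= K * (2 / d) * N0%:R `^ d.
  move=> MN; apply: le_trans (cn_sum _ _ _) _.
  apply: le_trans (_ : \sum_(1 <= n < M.+1) K * pw (1 - d) n <= _).
    rewrite big_nat [X in _ <= X]big_nat; apply: ler_sum => n /andP[n0 _].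
    rewrite cnM; have [h _] := hK s t n s1 s2 n0; apply: le_trans h.
    by rewrite ler_piMl ?cn_ge0.
  rewrite -mulr_sumr -mulrA ler_wpM2l //; first by clear -d0 d2 K1; lra.
  apply: le_trans (sum_pw_head M d0 _) _; first by clear -d0 d2 K1 q0 s1 s2 t0; lra.
  apply: ler_wpM2l; first by rewrite divr_ge0 // ltW.
  by rewrite ge0_ler_powR ?nnegrE ?ler_nat // ltW.
have NdN : 2 * (K * (2 / d) + K + K * 2) * u `^ d >= (K * (2 / d) + K + K * 2) * N0%:R `^ d.
  rewrite [X in _ <= X * _]mulrC -[X in _ <= X]mulrA ler_wpM2l //.
    have : 0 < K * (2 / d) by rewrite mulr_gt0 ?divr_gt0 //; clear -d0 d2 K1; lra.
    by clear -d0 d2 K1 q0 s1 s2; lra.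
  apply: le_trans (powR2_le _ (ltW d0) _); [|(clear -d2 u1; lra)|(clear -d2 u1; lra)].
  by rewrite ge0_ler_powR ?nnegrE //; clear -d0 u1; lra.
apply: le_trans NdN.
have Nd0 : 0 <= N0%:R `^ d by exact: powR_ge0.
have dp : 0 < K * (2 / d) by rewrite mulr_gt0 ?divr_gt0 //; clear -d0 d2 K1; lra.
rewrite /psum; under eq_bigr do rewrite eE.
case: (leqP N N0) => NN; first by apply: le_trans (head N NN) _; clear -K1 Nd0; nra.
rewrite (big_cat_nat (n := N0.+1)) //=; last by rewrite ltnS ltnW.
apply: le_trans (cnD _ _) _.
have {}head := head N0 (leqnn _).
suff: cn (\sum_(N0.+1 <= n < N.+1) chi n * gg j s t n) <= (K + K * 2) * N0%:R `^ d by clear -Nd0 dp NN head; nra.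
have -> : N.+1 = (N0.+1 + (N - N0))%N by rewrite addSn subnKC // ltnW.
apply: le_trans (abel_bound _ _ (fun k => dchar_partial N0.+1 k q0 hc np)) _.
have p1 : pw (1 - d) N0 * u <= N0%:R `^ d.
  have -> : pw (1 - d) N0 = N0%:R `^ d / N0%:R.
    by rewrite /pw opprB powRD ?powR_inv1 ?(ltW NN0) // (lt0r_neq0 NN0) implybT.
  by rewrite mulrAC ler_pdivrMr // ler_wpM2l.
have h1 : cn (gg j s t (N0.+1 + (N - N0))%N) <= K * pw (1 - d) N0.
  have [] := hK s t (N0.+1 + (N - N0))%N s1 s2 => // [h _]; apply: le_trans h _.
  by rewrite ler_wpM2l ?pwMn //; [(clear -d2 K1; lra)|rewrite (leq_trans (leqnSn _)) // leq_addr|(clear -d2 K1; lra)].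
have h2 : \sum_(N0.+1 <= n < N0.+1 + (N - N0)) cn (gg j s t n.+1 - gg j s t n) <=
   K * (`|t| + 2) * (pw (1 - d) N0 * 2).
  apply: le_trans (_ : \sum_(N0.+1 <= n < N0.+1 + (N - N0)) K * (`|t| + 2) * pw (1 + (1 - d)) n <= _).
    rewrite big_nat [X in _ <= X]big_nat; apply: ler_sum => n /andP[n0 _].
    have [] := hK s t n s1 s2; first exact: leq_trans n0.
    by rewrite (_ : 1 + (1 - d) = 2 - d) //; ring.
  rewrite -mulr_sumr ler_wpM2l //; first by rewrite mulr_ge0 //; clear -K1; lra.
  apply: le_trans (sum_pw_tail _ _ N00) _; first by clear -d0 d2 K1 q0 s1 s2 t0 q1 u1; lra.
  rewrite ler_pdivrMr; last by clear -d0 d2 K1 q0 s1 s2 t0 q1 u1; lra.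
  have := pw_ge0 (1 - d) N0; clear -d0 d2 K1 q0; nra.
apply: le_trans (ler_wpM2l _ (lerD h1 h2)) _; first by clear -s2 t0 q1 u1 N00; lra.
have pp := pw_ge0 (1 - d) N0.
have q2 : q%:R <= u by rewrite /u; clear -s2 t0 q1 u1 N00; nra.
have -> : q%:R * (K * pw (1 - d) N0 + K * (`|t| + 2) * (pw (1 - d) N0 * 2)) =
  K * (q%:R * pw (1 - d) N0) + K * 2 * (pw (1 - d) N0 * u) by rewrite /u; ring.
rewrite mulrDl; apply: lerD; rewrite ler_wpM2l //; try (clear -K1; lra).
by apply: le_trans p1; rewrite mulrC ler_wpM2l.
Qed.

End UpperBounds.

(** * Complex-valued functions of a real variable *)

Section ComplexDerivative.
Variable R : realType.
Local Notation C := R[i].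
Implicit Types (f g : R -> C) (x y : R).

Definition cder f (df : C) x :=
  is_derive x 1 (fun y => Re (f y)) (Re df) /\ is_derive x 1 (fun y => Im (f y)) (Im df).

Lemma cderD f df g dg x : cder f df x -> cder g dg x -> cder (fun y => f y + g y) (df + dg) x.
Proof.
move=> [f1 f2] [g1 g2]; split; rewrite ?cReD ?cImD.
  rewrite (_ : (fun y => _) = (fun y => Re (f y)) \+ (fun y => Re (g y))); first exact: is_deriveD.
  by apply/funext => y; rewrite cReD.
rewrite (_ : (fun y => _) = (fun y => Im (f y)) \+ (fun y => Im (g y))); first exact: is_deriveD.
by apply/funext => y; rewrite cImD.
Qed.

Lemma is_derive_mul (a b : R -> R) (x da db : R) : is_derive x 1 a da -> is_derive x 1 b db ->
  is_derive x 1 (fun y => a y * b y) (a x * db + b x * da).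
Proof. by move=> ha hb; exact: is_deriveM. Qed.

Lemma is_derive_sub (a b : R -> R) (x da db : R) : is_derive x 1 a da -> is_derive x 1 b db ->
  is_derive x 1 (fun y => a y - b y) (da - db).
Proof. by move=> ha hb; exact: is_deriveB. Qed.

Lemma is_derive_add (a b : R -> R) (x da db : R) : is_derive x 1 a da -> is_derive x 1 b db ->
  is_derive x 1 (fun y => a y + b y) (da + db).
Proof. by move=> ha hb; exact: is_deriveD. Qed.

Lemma cderM f df g dg x : cder f df x -> cder g dg x ->
  cder (fun y => f y * g y) (df * g x + f x * dg) x.
Proof.
move=> [f1 f2] [g1 g2]; split.
  rewrite (_ : (fun y => _) = (fun y => Re (f y) * Re (g y) - Im (f y) * Im (g y))); last first.
    by apply/funext => y; rewrite cReM.
  apply: is_derive_eq (is_derive_sub (is_derive_mul f1 g1) (is_derive_mul f2 g2)) _.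
  by rewrite cReD !cReM; ring.
rewrite (_ : (fun y => _) = (fun y => Re (f y) * Im (g y) + Im (f y) * Re (g y))); last first.
  by apply/funext => y; rewrite cImM.
apply: is_derive_eq (is_derive_add (is_derive_mul f1 g2) (is_derive_mul f2 g1)) _.
by rewrite cImD !cImM; ring.
Qed.

Lemma cder_const (z : C) x : cder (fun=> z) 0 x.
Proof. by split; exact: is_derive_cst. Qed.

Lemma cder_real (a : R -> R) da x : is_derive x 1 a da -> cder (fun y => (a y)%:C) da%:C x.
Proof. by move=> h; split => //=; exact: is_derive_cst. Qed.

Lemma cder_eq f df df' x : cder f df x -> df = df' -> cder f df' x.
Proof. by move=> h <-. Qed.

Lemma is_derive_scale (a : R -> R) (c x da : R) : is_derive (c * x) 1 a da ->
  is_derive x 1 (fun y => a (c * y)) (c * da).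
Proof.
move=> h.
have hc : is_derive x 1 (fun y : R => c * y) c.
  apply: (@is_derive_quad R _ x c 0 1) => // h' _.
  by rewrite (_ : _ - _ = 0) ?normr0 ?mul0r //; ring.
by apply: is_derive_eq (@is_derive1_comp R a (fun y => c * y) x da c h hc) _; rewrite /GRing.scale /= mulrC.
Qed.

Lemma cder_cis (t x : R) : cder (fun y => cis (t * y)) ((0 +i* t) * cis (t * x)) x.
Proof.
split; rewrite /cis /=.
  apply: is_derive_eq (is_derive_scale (is_derive_cos (t * x))) _; ring.
apply: is_derive_eq (is_derive_scale (is_derive_sin (t * x))) _; ring.
Qed.

Lemma cder_exp (a x : R) : cder (fun y => (expR (a * y))%:C) (a * expR (a * x))%:C x.
Proof. by apply: cder_real; apply: is_derive_scale; exact: is_derive_expR. Qed.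

Lemma cder_pow j x : cder (fun y => (y ^+ j)%:C) (j%:R * x ^+ j.-1)%:C x.
Proof.
apply: cder_real; elim: j => [|j IH].
  rewrite (_ : (fun y => y ^+ 0) = cst 1) ?mul0r; first exact: is_derive_cst.
  by apply/funext => y; rewrite expr0.
rewrite (_ : (fun y => y ^+ j.+1) = (fun y => y * y ^+ j)); last first.
  by apply/funext => y; rewrite exprS.
apply: is_derive_eq (@is_derive_mul id _ x 1 _ (is_derive_id _ _) IH) _.
by case: j {IH} => [|j] /=; rewrite -natr1 ?expr0 ?exprS; ring.
Qed.

(** The mean value theorem is applied to the real and the imaginary part at different points, whence
    the factor 2. *)
Lemma cder_lip f (df : R -> C) (a b B : R) : a <= b ->
  (forall x, a <= x -> x <= b -> cder f (df x) x) ->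
  (forall x, a <= x -> x <= b -> cn (df x) <= B) -> cn (f b - f a) <= 2 * B * (b - a).
Proof.
move=> ab h hB; apply: le_trans (cn_le_ReIm _) _; rewrite cReD cReN cImD cImN.
have [|x [x1 x2 ->]] := @MVT_closed R (fun y => Re (f y)) (fun y => Re (df y)) _ _ ab.
  by move=> x x1 x2; have [] := h x x1 x2.
have [|y [y1 y2 ->]] := @MVT_closed R (fun y => Im (f y)) (fun y => Im (df y)) _ _ ab.
  by move=> y y1 y2; have [] := h y y1 y2.
rewrite !normrM (ger0_norm (_ : 0 <= b - a)) ?subr_ge0 // -mulrDl ler_wpM2r ?subr_ge0 //.
rewrite mulr_natl mulr2n; apply: lerD.
  by apply: le_trans (Re_le_cn _) _; exact: hB.
by apply: le_trans (Im_le_cn _) _; exact: hB.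
Qed.

End ComplexDerivative.

(** * The zeta function near the line Re s = 1: polar part and growth *)

Section Zeta.
Variable R : realType.
Local Notation C := R[i].
Implicit Types (s t d v : R) (j n : nat).

(* H_j is the primitive -H_j' = v^j e^{-wv}, w = (s - 1) + it, vanishing at infinity when s > 1. *)
Definition EE s t v : C := cis (- t * v) * (expR (- (s - 1) * v))%:C.
Definition ww s t : C := (s - 1) +i* t.

Fixpoint HH j s t v : C := match j with
  | 0 => EE s t v / ww s t
  | j'.+1 => ((v ^+ j)%:C * EE s t v + j%:R * HH j' s t v) / ww s t
  end.

Lemma ww_neq0 s t : 1 < s -> ww s t != 0.
Proof. by move=> s1; rewrite /ww eq_complex /= negb_and gt_eqF //; lra. Qed.

Lemma cder_EE s t v : cder (EE s t) (- ww s t * EE s t v) v.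
Proof.
apply: cder_eq (cderM (cder_cis (- t) v) (cder_exp (- (s - 1)) v)) _.
rewrite /EE rmorphM /= (_ : - ww s t = (0 +i* - t) + (- (s - 1))%:C); first by ring.
by apply: complexP; rewrite /ww /=; ring.
Qed.

Lemma cder_HH j s t v : 1 < s -> cder (HH j s t) (- ((v ^+ j)%:C * EE s t v)) v.
Proof.
move=> s1; have w0 := ww_neq0 t s1; elim: j => [|j IH] /=.
  apply: cder_eq (cderM (cder_EE s t v) (cder_const (ww s t)^-1 v)) _.
  by rewrite expr0 rmorph1 mulr0 addr0; field.
apply: cder_eq (cderM (cderD (cderM (cder_pow j.+1 v) (cder_EE s t v))
   (cderM (cder_const (j.+1%:R : C) v) IH)) (cder_const (ww s t)^-1 v)) _.
rewrite /= rmorphM rmorph_nat /= mul0r add0r mulr0 addr0.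
by field.
Qed.

(** This is the polar part of the j-th derivative of zeta, up to the sign [(-1) ^ j]. *)
Lemma HH0 j s t : 1 < s -> HH j s t 0 = (j`!)%:R / ww s t ^+ j.+1.
Proof.
move=> s1; have w0 := ww_neq0 t s1; elim: j => [|j IH] /=.
  by rewrite /EE !mulr0 cis0 expR0 mulr1 expr1.
rewrite expr0n /= mul0r add0r IH factS natrM [ww s t ^+ j.+2]exprS invfM; ring.
Qed.

Lemma cn_EE s t v : cn (EE s t v) = expR (- (s - 1) * v).
Proof. by rewrite cnM cn_cis mul1r cn_real ger0_norm ?expR_ge0. Qed.

Lemma cn_HH j s t v c : 0 < c -> c <= 1 -> c <= cn (ww s t) -> 0 <= v ->
  cn (HH j s t v) <= j.+1`!%:R * (1 + v) ^+ j * expR (- (s - 1) * v) / c ^+ j.+1.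
Proof.
move=> c0 c1 cw v0; have w0 : 0 < cn (ww s t) by apply: lt_le_trans cw.
have E0 := expR_gt0 (- (s - 1) * v).
have iw : (cn (ww s t))^-1 <= c^-1 by rewrite lef_pV2.
have ic : 1 <= c^-1 by rewrite invf_ge1.
elim: j => [|j IH].
  rewrite -[HH 0 s t v]/(EE s t v / ww s t).
  by rewrite cnM cnV cn_EE expr0 mulr1 mul1r expr1 ler_wpM2l // ltW.
rewrite -[HH j.+1 s t v]/(((v ^+ j.+1)%:C * EE s t v + j.+1%:R * HH j s t v) / ww s t).
have -> : j.+2`!%:R * (1 + v) ^+ j.+1 * expR (- (s - 1) * v) / c ^+ j.+2 =
  (j.+2`!%:R * (1 + v) ^+ j.+1 * expR (- (s - 1) * v) / c ^+ j.+1) / c.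
  by rewrite [c ^+ j.+2]exprSr invfM mulrA.
rewrite cnM cnV; apply: ler_pM; rewrite ?cn_ge0 ?invr_ge0 ?cn_ge0 //.
apply: le_trans (cnD _ _) _; rewrite (cnM _ (EE s t v)) (cnM _ (HH j s t v)) cn_EE cn_nat cn_real ger0_norm ?exprn_ge0 //.
apply: le_trans (lerD (lexx _) (ler_wpM2l _ IH)) _ => //.
have v1 : v ^+ j.+1 <= (1 + v) ^+ j.+1 by rewrite lerXn2r ?nnegrE //; lra.
have p0 : 0 <= (1 + v) ^+ j by rewrite exprn_ge0 //; lra.
have p1 : (1 + v) ^+ j <= (1 + v) ^+ j.+1 by rewrite exprS ler_peMl //; lra.
have q1 : 1 <= (c ^+ j.+1)^-1 by rewrite -exprVn exprn_ege1.
set Q := (c ^+ j.+1)^-1 in IH q1 *; set E := expR _ in E0 *.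
set P := (1 + v) ^+ j.+1 in v1 p1 *; set V := v ^+ j.+1 in v1 *.
have V0 : 0 <= V by exact: exprn_ge0.
have F1 : (1 : R) <= j.+1`!%:R by rewrite ler1n fact_gt0.
have -> : j.+2`!%:R = j.+2%:R * j.+1`!%:R :> R by rewrite factS natrM.
have -> : j.+2%:R = 1 + j.+1%:R :> R by rewrite -natr1 addrC.
set F := j.+1`!%:R in F1 *; set J := j.+1%:R.
have J0 : 0 <= J by [].
have k1 : V * E <= F * P * E * Q.
  apply: le_trans (_ : P * E <= _); first by rewrite ler_wpM2r // ltW.
  have PE : 0 <= P * E by rewrite mulr_ge0 ?(le_trans V0 v1) // ltW.
  have FQ : 1 <= F * Q by nra.
  have -> : F * P * E * Q = (F * Q) * (P * E) by ring.
  by rewrite ler_peMl.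
have k2 : J * (F * (1 + v) ^+ j * E * Q) <= J * (F * P * E * Q).
  rewrite ler_wpM2l // ler_wpM2r ?(le_trans ler01) // ler_wpM2r ?(ltW E0) //.
  by rewrite ler_wpM2l ?(le_trans ler01).
apply: le_trans (lerD k1 k2) _.
by rewrite le_eqVlt; apply/orP; left; apply/eqP; ring.
Qed.

(** The difference of [HH] is the integral of [ln ^ j x * x ^ (- s - i t)] over [n, n + 1], compared
    here with the value of the integrand at [n]. *)
Lemma zeta_step j s t n : 1 < s -> s <= 2 -> (0 < n)%N ->
  cn (HH j s t (ln n%:R) - HH j s t (ln n.+1%:R) - gg j s t n) <=
  4 * j.+1%:R * (`|t| + 2) * ((1 + ln n%:R) ^+ j * pw 2 n).
Proof.
move=> s1 s2 n0.
have N0 : (0 : R) < n%:R by rewrite ltr0n.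
have N1 : (0 : R) < n.+1%:R by rewrite ltr0n.
have l0 := ln_nat_ge0 R n.
have d1 := ln_succ_le R n0; have d1' := ln_succ_ge R n0.
have i0 : 0 < n.+1%:R^-1 :> R by rewrite invr_gt0 ltr0n.
have i1 : n%:R^-1 <= 1 :> R by rewrite invf_le1 // ler1n.
have v1 : ln n%:R <= ln n.+1%:R :> R by rewrite -subr_ge0 (le_trans _ d1') // ltW.
have v2 : ln n.+1%:R <= 1 + ln n%:R :> R by rewrite -lerBlDr (le_trans d1).
set a := ln n%:R in l0 d1 d1' v1 v2 *; set b := ln n.+1%:R in d1 d1' v1 v2 *.
(* The exponential increases by exactly 1 between [ln n] and [ln (n + 1)], so the increment of [f]
   is minus the error and its derivative is a difference of nearby values of [GG], times [e ^ v]. *)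
pose f v := HH j s t v + gg j s t n * (expR (1 * v))%:C.
pose df v := - ((v ^+ j)%:C * EE s t v) + (0 * (expR (1 * v))%:C + gg j s t n * (1 * expR (1 * v))%:C) : C.
pose B := j.+1%:R * (`|t| + 2) * (1 + a) ^+ j * (n%:R^-1) * (b - a) * n.+1%:R.
have t0 := normr_ge0 t.
have -> : HH j s t a - HH j s t b - gg j s t n = - (f b - f a).
  rewrite /f !mul1r /a /b !lnK ?posrE // -natr1 rmorphD !rmorph1; ring.
rewrite cnN.
have Efact v : (v ^+ j)%:C * EE s t v = GG j s t v * (expR v)%:C :> C.
  rewrite /GG /EE -!mulrA -rmorphM -expRD; congr (_ * (_ * (expR _)%:C)); ring.
apply: le_trans (@cder_lip R f df a b B v1 _ _) _.
- move=> x x1 x2; apply: cderD; first exact: cder_HH.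
  exact: cderM (cder_const _ _) (cder_exp _ _).
- move=> x x1 x2; rewrite /df mul0r add0r !mul1r Efact ggE // -/a -mulNr -mulrDl cnM cn_real.
  rewrite (ger0_norm (expR_ge0 _)) addrC cnBC.
  have e1 : expR x <= n.+1%:R by rewrite -[n.+1%:R]lnK ?posrE // ler_expR.
  rewrite /B; apply: ler_pM; rewrite ?cn_ge0 ?expR_ge0 //.
  apply: le_trans (GG_lip j t _ s2 l0 x1 _) _; [(clear -s1 s2 v1 v2 x2; lra)|(clear -s1 s2 v1 v2 x2; lra)|].
  have es : expR (- s * a) <= n%:R^-1 by rewrite -pw_oneE // -pwE // pw_le // ltW.
  have P0 : 0 <= j.+1%:R * (`|t| + 2) * (1 + a) ^+ j.
    by rewrite !mulr_ge0 ?exprn_ge0 //; clear -N1 i0 i1 l0; lra.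
  apply: ler_pM; [by rewrite mulr_ge0 ?expR_ge0|by rewrite subr_ge0|by rewrite ler_wpM2l|].
  by rewrite lerD2r.
have ba : b - a <= n%:R^-1 by exact: d1.
have ba0 : 0 <= b - a by clear -l0 d1 d1' v1 v2 t0 ba; lra.
have n2 : n.+1%:R <= 2 * n%:R :> R by rewrite -natrM ler_nat mul2n -addnn -addn1 leq_add2l.
rewrite /B (pw_nat R 2 n) -exprVn.
set X := n%:R^-1 in i1 ba *; have X0 : 0 < X by rewrite /X invr_gt0.
have nX : n%:R * X = 1 by rewrite /X mulfV // gt_eqF.
have P0 : 0 <= j.+1%:R * (`|t| + 2) * (1 + a) ^+ j by rewrite !mulr_ge0 ?exprn_ge0 //; clear -i0 l0; lra.
set P := j.+1%:R * _ * _ in P0 *.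
have -> : 4 * j.+1%:R * (`|t| + 2) * ((1 + a) ^+ j * X ^+ 2) = 4 * P * X ^+ 2 by rewrite /P; ring.
have k1 : (b - a) * (b - a) <= X * X by apply: ler_pM.
have k2 : X * n.+1%:R <= 2.
  have := ler_wpM2l (ltW X0) n2; rewrite (_ : X * (2 * n%:R) = 2) //.
  by rewrite mulrCA (mulrC X) nX mulr1.
have k3 : (b - a) * (b - a) * (X * n.+1%:R) <= X * X * 2.
  apply: ler_pM => //; rewrite ?mulr_ge0 // ltW //.
have -> : 2 * (P * X * (b - a) * n.+1%:R) * (b - a) = 2 * P * ((b - a) * (b - a) * (X * n.+1%:R)) by ring.
have -> : 4 * P * X ^+ 2 = 2 * P * (X * X * 2) by ring.
by rewrite ler_wpM2l // mulr_ge0.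
Qed.

Lemma pw_to0 (b e : R) : 0 < b -> 0 < e -> exists N0, forall N, (N0 <= N)%N -> pw b N <= e.
Proof.
move=> b0 e0; pose y := (e^-1) `^ (b^-1).
have y0 : 0 < y by rewrite powR_gt0 // invr_gt0.
exists (Num.truncn y).+1 => N hN.
have yN : y <= N%:R by rewrite (le_trans (ltW (truncnS_gt _))) // ler_nat.
rewrite /pw powRN -[e]invrK lef_pV2 ?posrE ?invr_gt0 //; last first.
  by rewrite powR_gt0 // (lt_le_trans y0).
have -> : e^-1 = y `^ b by rewrite /y -powRrM mulVf ?gt_eqF // powRr1 // invr_ge0 ltW.
by rewrite ge0_ler_powR ?nnegrE // ltW.
Qed.

Lemma HH_to0 j s t : 1 < s -> forall e, 0 < e ->
  exists N0, forall N, (N0 <= N)%N -> (0 < N)%N -> cn (HH j s t (ln N%:R)) <= e.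
Proof.
move=> s1 e e0; pose c := Num.min 1 (cn (ww s t)).
have w0 : 0 < cn (ww s t) by rewrite lt_def cn_ge0 andbT cn_eq0 ww_neq0.
have c0 : 0 < c by rewrite lt_min ltr01.
have c1 : c <= 1 by rewrite ge_min lexx.
have cw : c <= cn (ww s t) by rewrite ge_min lexx orbT.
have b0 : 0 < (s - 1) / 2 by rewrite divr_gt0 // subr_gt0.
have [K K1 hK] := lnD1X_le_powR j b0.
pose A := j.+1`!%:R * K / c ^+ j.+1.
have A0 : 0 < A.
  by rewrite /A divr_gt0 ?exprn_gt0 // mulr_gt0 ?ltr0n ?fact_gt0 // (lt_le_trans ltr01).
have [N0 hN] := pw_to0 b0 (divr_gt0 e0 A0).
exists N0 => N /hN h n0; have := cn_HH j c0 c1 cw (ln_nat_ge0 R N); move/le_trans; apply.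
rewrite ler_pdivlMr // in h; apply: le_trans h.
have -> : pw ((s - 1) / 2) N = N%:R `^ ((s - 1) / 2) * expR (- (s - 1) * ln N%:R).
  rewrite -pwE // /pw -powRD; last by rewrite pnatr_eq0 -lt0n n0 implybT.
  by congr (_ `^ _); field.
rewrite [X in _ <= X]mulrC /A.
set X := expR _; set c' := (c ^+ j.+1)^-1; set F := _%:R.
have -> : F * K / c ^+ j.+1 * (N%:R `^ ((s - 1) / 2) * X) = F * (K * N%:R `^ ((s - 1) / 2)) * X * c'.
  by rewrite /c'; ring.
rewrite ler_wpM2r ?invr_ge0 ?exprn_ge0 ?(ltW c0) //.
by rewrite ler_wpM2r ?expR_ge0 // ler_wpM2l // hK.
Qed.

(* (-1)^j times the j-th derivative of zeta at s + it *)
Definition zz j s t : C := DS (fun n => lnc R n ^+ j * tw t n) s.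

(** The errors of [zeta_step] are summed from [M] to infinity while [HH] telescopes. The cut [M]
    remains free: 1 isolates the pole, and [|t| + 2] gives the growth in [t]. *)
Lemma zeta_approx j d : 0 < d -> d <= 1 / 2 -> exists2 K : R, 1 <= K &
  forall s t M, 1 < s -> s <= 2 -> (0 < M)%N ->
  cn (zz j s t - \sum_(1 <= n < M) gg j s t n - HH j s t (ln M%:R)) <= K * (`|t| + 2) * pw (1 - d) M.
Proof.
move=> d0 d2; have [c c1 hc] := lnD1X_le_powR j d0.
have jc : (1 : R) <= j.+1%:R by rewrite ler1n.
exists (12 * (j.+1%:R * c)); first by nra.
move=> s t M s1 s2 M0.
have t0 := normr_ge0 t.
pose A := 4 * j.+1%:R * (`|t| + 2).
have A0 : 0 <= A by rewrite /A; nra.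
have hz := absumP (absD_LL j (cmult_tw t) s1).
apply: le_eps => e e0; have e2 : 0 < e / 2 by rewrite divr_gt0.
have [N0 hN0] := hz _ e2; have [N1 hN1] := HH_to0 j t s1 e2.
pose N := maxn (maxn N0 N1) M.
have {}hN0 := hN0 N (leq_trans (leq_maxl _ _) (leq_maxl _ _)).
have {}hN1 := hN1 N.+1 (leqW (leq_trans (leq_maxr _ _) (leq_maxl _ _))) isT.
have MN : (M <= N.+1)%N by rewrite leqW // leq_maxr.
pose E n := HH j s t (ln n%:R) - HH j s t (ln n.+1%:R) - gg j s t n.
have tele : \sum_(M <= n < N.+1) E n =
   HH j s t (ln M%:R) - HH j s t (ln N.+1%:R) - \sum_(M <= n < N.+1) gg j s t n.
  rewrite /E big_split sumrN /=; congr (_ - _).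
  rewrite (@telescope_sumr_eq _ _ _ (fun n => - HH j s t (ln n%:R))) //.
    by rewrite opprK addrC.
  by move=> k _; rewrite opprK addrC.
have hE : cn (\sum_(M <= n < N.+1) E n) <= A * c * (pw (1 - d) M * 3).
  apply: le_trans (cn_sum _ _ _) _.
  apply: le_trans (_ : \sum_(M <= n < N.+1) A * c * pw (1 + (1 - d)) n <= _).
    rewrite big_nat [X in _ <= X]big_nat; apply: ler_sum => n /andP[n0 _].
    have {}n0 : (0 < n)%N by exact: leq_trans n0.
    apply: le_trans (zeta_step j t s1 s2 n0) _; rewrite -/A -[X in _ <= X]mulrA ler_wpM2l //.
    have -> : pw (1 + (1 - d)) n = n%:R `^ d * pw 2 n.
      rewrite /pw -powRD; last by rewrite pnatr_eq0 -lt0n n0 implybT.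
      by congr (_ `^ _); ring.
    by rewrite mulrA ler_wpM2r ?pw_ge0 // hc.
  rewrite -mulr_sumr; apply: ler_wpM2l; first by rewrite mulr_ge0 //; lra.
  have pM := pw_ge0 (1 - d) M.
  have d1 : 0 < 1 - d by clear -d0 d2 c1 jc s1 s2 M0 t0; lra.
  have tl := sum_pw_tail N.+1 d1 M0.
  have fst : pw (1 + (1 - d)) M <= pw (1 - d) M by apply: pw_le => //; clear -d0 d2 c1 jc; lra.
  have : pw (1 - d) M / (1 - d) <= 2 * pw (1 - d) M by rewrite ler_pdivrMr //; clear -d0 d2 c1 jc tele pM; nra.
  by rewrite big_ltn ?ltnS ?leq_maxr //; clear -pM d1 tl fst; lra.
have Z : zz j s t - \sum_(1 <= n < M) gg j s t n - HH j s t (ln M%:R) =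
   - (psum (tm (fun n => lnc R n ^+ j * tw t n) s) N - zz j s t) - HH j s t (ln N.+1%:R)
   - \sum_(M <= n < N.+1) E n.
  have -> : psum (tm (fun n => lnc R n ^+ j * tw t n) s) N =
      \sum_(1 <= n < M) gg j s t n + \sum_(M <= n < N.+1) gg j s t n.
    by rewrite /psum (big_cat_nat (n := M)).
  by rewrite tele; ring.
rewrite Z; apply: le_trans (cnB _ _) _; apply: le_trans (lerD (cnB _ _) (lexx _)) _.
rewrite cnN -/(zz j s t) in hN0 *.
have -> : 12 * (j.+1%:R * c) * (`|t| + 2) * pw (1 - d) M = A * c * (pw (1 - d) M * 3).
  by rewrite /A; ring.
clear -hN1 MN tele hE hN0; lra.
Qed.

Lemma zeta_small j : exists2 K : R, 1 <= K & forall s t, 1 < s -> s <= 2 ->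
  cn (zz j s t - (j`!)%:R / ww s t ^+ j.+1) <= K * (`|t| + 2).
Proof.
have d0 : (0 : R) < 1 / 2 by lra.
have [K K1 hK] := zeta_approx j d0 (lexx _); exists K => // s t s1 s2.
have := hK s t 1%N s1 s2 isT.
by rewrite big_geq // subr0 pw1 mulr1 ln1 HH0.
Qed.

(** The cut [M] is of size [|t| + 2], where head and remainder balance; [|t| >= c] keeps the polar
    term bounded. *)
Lemma zeta_large j d c : 0 < d -> d <= 1 / 2 -> 0 < c -> c <= 1 -> exists2 K : R, 1 <= K &
  forall s t, 1 < s -> s <= 2 -> c <= `|t| -> cn (zz j s t) <= K * (`|t| + 2) `^ d.
Proof.
move=> d0 d2 c0 c1; have [K K1 hK] := zeta_approx j d0 d2.
have [K2 K21 hK2] := @gg_bound R j d d0; have [K3 K31 hK3] := lnD1X_le_powR j d0.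
pose F := j.+1`!%:R * K3 / c ^+ j.+1.
have F0 : 0 < F.
  by rewrite /F divr_gt0 ?exprn_gt0 // mulr_gt0 ?ltr0n ?fact_gt0 // (lt_le_trans ltr01).
have dp : 0 < K2 * (2 / d) by rewrite mulr_gt0 ?divr_gt0 //; lra.
exists (2 * (K + K2 * (2 / d) + F)); first by lra.
move=> s t s1 s2 ct; pose u := `|t| + 2.
have u1 : 1 <= u by rewrite /u; have := normr_ge0 t; clear -d0 d2 c0 c1 K1 K21; lra.
have [M [M0 uM Mu]] := nat_above u1.
have MM0 : (0 : R) < M%:R by rewrite ltr0n.
have cw : c <= cn (ww s t) by apply: le_trans ct _; exact: (Im_le_cn (ww s t)).
apply: le_trans (_ : (K + K2 * (2 / d) + F) * M%:R `^ d <= _); last first.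
  rewrite [X in _ <= X * _]mulrC -[X in _ <= X]mulrA ler_wpM2l //; first by clear -K1 F0 dp; lra.
  apply: le_trans (powR2_le _ (ltW d0) _); [|(clear -d0 d2 c0 ct; lra)|(clear -d0 d2 c0 ct; lra)].
  by rewrite ge0_ler_powR ?nnegrE //; clear -d0 d2 c0 c1; lra.
have h1 : K * u * pw (1 - d) M <= K * M%:R `^ d.
  rewrite -mulrA ler_wpM2l //; first by clear -d0 d2 K1 K21; lra.
  have -> : pw (1 - d) M = M%:R `^ d / M%:R.
    by rewrite /pw opprB powRD ?powR_inv1 ?(ltW MM0) // (lt0r_neq0 MM0) implybT.
  by rewrite mulrCA -[X in _ <= X]mulr1 ler_wpM2l ?powR_ge0 // ler_pdivrMr // mul1r.
have h2 : cn (\sum_(1 <= n < M) gg j s t n) <= K2 * (2 / d) * M%:R `^ d.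
  apply: le_trans (cn_sum _ _ _) _.
  apply: le_trans (_ : \sum_(1 <= n < M.+1) K2 * pw (1 - d) n <= _).
    rewrite [X in _ <= X]big_nat_recr //=; apply: ler_wpDr.
      by rewrite mulr_ge0 ?pw_ge0 //; clear -K21 K31 F0 dp; lra.
    rewrite big_nat [X in _ <= X]big_nat; apply: ler_sum => n /andP[n0 _].
    by have [] := hK2 s t n (ltW s1) s2 n0.
  rewrite -mulr_sumr -mulrA ler_wpM2l //; first by clear -K21 K31 F0 dp; lra.
  by apply: sum_pw_head => //; clear -d0 d2 c0 c1; lra.
have h3 : cn (HH j s t (ln M%:R)) <= F * M%:R `^ d.
  apply: le_trans (cn_HH j c0 c1 cw (ln_nat_ge0 R M)) _.
  have -> : F * M%:R `^ d = j.+1`!%:R * (K3 * M%:R `^ d) / c ^+ j.+1 by rewrite /F; ring.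
  rewrite ler_wpM2r ?invr_ge0 ?exprn_ge0 ?(ltW c0) //.
  apply: le_trans (_ : j.+1`!%:R * (1 + ln M%:R) ^+ j <= _).
    rewrite ler_piMr ?mulr_ge0 ?exprn_ge0 ?addr_ge0 ?ln_nat_ge0 //.
    by rewrite -[X in _ <= X]expR0 ler_expR mulNr oppr_le0 mulr_ge0 ?ln_nat_ge0 // subr_ge0 ltW.
  by rewrite ler_wpM2l // hK3.
have h4 := hK s t M s1 s2 M0.
have -> : zz j s t = (zz j s t - \sum_(1 <= n < M) gg j s t n - HH j s t (ln M%:R)) +
   \sum_(1 <= n < M) gg j s t n + HH j s t (ln M%:R) by ring.
apply: le_trans (cnD _ _) _; apply: le_trans (lerD (cnD _ _) (lexx _)) _.
rewrite -/u in h4; rewrite !mulrDl; clear -h1 h2 h3 h4; lra.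
Qed.

End Zeta.

(** * Hyperbola method and partial sums of zeta to the left of 1 *)

Section RealSums.
Variable R : realType.
Implicit Types (x g h : nat -> R) (b c e y : R) (q m n N M : nat).

Lemma sum_uniq_sub (T : eqType) (s1 s2 : seq T) (F : T -> R) :
  uniq s1 -> uniq s2 -> {subset s1 <= s2} -> (forall i, i \in s2 -> 0 <= F i) ->
  \sum_(i <- s1) F i <= \sum_(i <- s2) F i.
Proof.
move=> u1 u2 s12 F0.
have -> : \sum_(i <- s1) F i = \sum_(i <- s2 | i \in s1) F i.
  rewrite -[RHS]big_filter; apply: perm_big; apply: uniq_perm; rewrite ?filter_uniq //.
  by move=> i; rewrite mem_filter; case h: (i \in s1) => //=; rewrite s12.
rewrite big_mkcond /= big_seq_cond [X in _ <= X]big_seq_cond; apply: ler_sum => i /andP[/F0 h _].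
by case: ifP.
Qed.

(** The intervals of centre [u M] and radius [eps M] meet pairwise, so the supremum of their left
    ends lies in all of them. *)
Lemma cauchy_limit (u eps : nat -> R) :
  (forall M N, (0 < M)%N -> (M <= N)%N -> `|u N - u M| <= eps M) ->
  exists l : R, forall M, (0 < M)%N -> `|u M - l| <= eps M.
Proof.
move=> h.
have e0 M : (0 < M)%N -> 0 <= eps M by move=> M0; have := h M M M0 (leqnn M); apply: le_trans.
have hh M N : (0 < M)%N -> (0 < N)%N -> u M - eps M <= u N + eps N.
  move=> M0 N0; have := e0 M M0; have := e0 N N0.
  case: (leqP M N) => [MN|/ltnW NM] h1 h2.
    by have := h M N M0 MN; rewrite ler_norml => /andP[h3 h4]; lra.
  by have := h N M N0 NM; rewrite ler_norml => /andP[h3 h4]; lra.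
pose S : set R := [set z | exists M, (0 < M)%N /\ z = u M - eps M]%classic.
have S0 : has_sup S.
  split; first by exists (u 1%N - eps 1%N); exists 1%N.
  by exists (u 1%N + eps 1%N) => _ [M [M0 ->]]; exact: hh.
exists (sup S) => M M0; rewrite ler_norml; apply/andP; split.
  suff: sup S <= u M + eps M by lra.
  apply: ge_sup; first by have [] := S0.
  by move=> _ [N [N0 ->]]; exact: hh.
rewrite lerBlDr -lerBlDl; apply: ub_le_sup; first by have [] := S0.
by exists M.
Qed.

(** Hyperbola method: pairs with [d > m] are grouped by [e], which is then at most [N / m]. *)
Lemma sum_divisor_pairs (F : nat -> nat -> R) N m : (0 < m)%N -> (m <= N)%N ->
  \sum_(1 <= d < N.+1) \sum_(1 <= e < (N %/ d).+1) F d e =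
  \sum_(1 <= d < m.+1) \sum_(1 <= e < (N %/ d).+1) F d e +
  \sum_(1 <= e < (N %/ m).+1) \sum_(m.+1 <= d < (N %/ e).+1) F d e.
Proof.
move=> m0 mN; rewrite (big_cat_nat (n := m.+1)) //=; congr (_ + _).
have cut a K (G : nat -> R) : (K <= N)%N ->
    \sum_(a <= i < K.+1) G i = \sum_(a <= i < N.+1 | (i <= K)%N) G i.
  move=> KN; case: (leqP a K.+1) => aK; last first.
    rewrite big_geq; last exact: ltnW.
    rewrite big_nat_cond big1 // => i /andP[/andP[h1 _] h2].
    by have := leq_trans (ltnW aK) (leq_trans h1 h2); rewrite ltnn.
  rewrite [RHS](big_cat_nat (n := K.+1)) //=.
  rewrite [X in _ = _ + X]big_nat_cond [X in _ = _ + X]big1 ?addr0; last first.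
    by move=> i /andP[/andP[h1 _]]; rewrite leqNgt h1.
  rewrite big_nat_cond [RHS]big_nat_cond; apply: eq_bigl => i.
  by rewrite andbT ltnS; case: (i <= K)%N; rewrite ?andbF ?andbT.
transitivity (\sum_(m.+1 <= d < N.+1) \sum_(1 <= e < N.+1 | (d * e <= N)%N) F d e).
  apply: eq_big_nat => d /andP[d0 _]; rewrite cut ?leq_div //; apply: eq_bigl => e.
  by rewrite leq_divRL 1?mulnC // (leq_ltn_trans _ d0).
rewrite (exchange_big_dep xpredT) //=.
rewrite [RHS]cut ?leq_div // [RHS]big_mkcond; apply: eq_big_nat => e /andP[e0 _].
case: leqP => he.
  rewrite cut ?leq_div //; apply: eq_bigl => d; by rewrite leq_divRL.
rewrite big_nat_cond big1 // => d /andP[/andP[h1 _] h2].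
move: he; rewrite ltn_divLR // => he.
by have := leq_trans he (leq_trans (leq_mul (leqnn e) (ltnW h1)) _); rewrite mulnC => /(_ _ h2); rewrite ltnn.
Qed.

Lemma nat_sqrt N : (0 < N)%N -> exists m, [/\ (0 < m)%N, (m * m <= N)%N & (N <= 4 * (m * m))%N].
Proof.
elim: N => // -[|N] IH _; first by exists 1%N.
have [//|m [m0 h1 h2]] := IH.
case: (leqP (N.+2) (4 * (m * m))) => h; first by exists m; split=> //; lia.
by exists m.+1; split=> //; nia.
Qed.

Lemma powR_MVT c (u v : R) : 0 < c -> c <= 1 -> 0 < u -> u <= v ->
  c * v `^ (c - 1) * (v - u) <= v `^ c - u `^ c /\ v `^ c - u `^ c <= c * u `^ (c - 1) * (v - u).
Proof.
move=> c0 c1 u0 uv.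
have dp (x : R) : 0 < x -> is_derive x 1 (fun z => z `^ c) (c * x `^ (c - 1)).
  move=> x0; have hx : x \in `]0, +oo[ by rewrite in_itv /= andbT.
  apply: DeriveDef; first exact: derivable_powR.
  by have := powR_derive1 c hx; rewrite derive1E.
have [|z [z1 z2 ->]] := @MVT_closed R (fun z => z `^ c) (fun z => c * z `^ (c - 1)) u v uv.
  by move=> x x1 _; apply: dp; exact: lt_le_trans x1.
have z0 : 0 < z by exact: lt_le_trans z1.
have mono (p r : R) : 0 < p -> p <= r -> r `^ (c - 1) <= p `^ (c - 1).
  move=> p0 pr; rewrite -(opprB 1 c) !powRN lef_pV2 ?posrE ?powR_gt0 ?(lt_le_trans p0) //.
  by rewrite ge0_ler_powR ?nnegrE ?subr_ge0 // ltW // (lt_le_trans p0).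
have d0 : 0 <= v - u by rewrite subr_ge0.
by split; rewrite ler_wpM2r // ler_pM2l // mono.
Qed.

(** [z] plays the role of zeta(b). Its sign follows because the normalised sums decrease from
    [1 - 1 / (1 - b) <= 0]; it is what makes Siegel's argument work when L(b) is nonnegative. A real
    [y] between [n] and [n + 1] allows [y = N / d] later. *)
Lemma sum_pw_zeta b : 0 < b -> b < 1 -> exists z : R, z <= 0 /\
  forall (n : nat) y, (0 < n)%N -> n%:R <= y -> y <= n.+1%:R ->
  `|\sum_(1 <= i < n.+1) pw b i - y `^ (1 - b) / (1 - b) - z| <= 2 * pw b n.
Proof.
move=> b0 b1; pose c := 1 - b.
have c0 : 0 < c by rewrite /c; lra.
have c1 : c <= 1 by rewrite /c; lra.
have cb : c - 1 = - b by rewrite /c; ring.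
pose u n := \sum_(1 <= i < n.+1) pw b i - n%:R `^ c / c.
have step n : (0 < n)%N -> u n.+1 - u n <= 0 /\ - (pw b n - pw b n.+1) <= u n.+1 - u n.
  move=> n0; rewrite /u big_nat_recr //=.
  have n0' : (0 : R) < n%:R by rewrite ltr0n.
  have nn : n%:R <= n.+1%:R :> R by rewrite ler_nat.
  have [] := powR_MVT c0 c1 n0' nn; rewrite cb -/(pw b n) -/(pw b n.+1).
  have -> : n.+1%:R - n%:R = 1 :> R by rewrite -natr1 addrC addKr.
  rewrite !mulr1 => h1 h2.
  set S := \sum_(_ <= i < _) _; set A := _ `^ c in h1 h2 *; set B := _ `^ c in h1 h2 *.
  have -> : S + pw b n.+1 - A / c - (S - B / c) = pw b n.+1 - (A - B) / c by ring.
  have h3 : pw b n.+1 <= (A - B) / c by rewrite ler_pdivlMr // mulrC.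
  have h4 : (A - B) / c <= pw b n by rewrite ler_pdivrMr // mulrC.
  by split; clear -h3 h4; lra.
have cau M N : (0 < M)%N -> (M <= N)%N -> u N - u M <= 0 /\ - (pw b M - pw b N) <= u N - u M.
  move=> M0; elim: N => [|N IH]; first by rewrite leqn0 => /eqP h; rewrite h in M0.
  rewrite leq_eqVlt => /predU1P[->|]; first by rewrite !subrr oppr0.
  rewrite ltnS => MN; have [h1 h2] := IH MN; have [] := step N (leq_trans M0 MN).
  clear -h1 h2; by move=> h3 h4; split; lra.
have [|z hz] := @cauchy_limit u (pw b).
  move=> M N M0 MN; have [h1 h2] := cau M N M0 MN; rewrite ler_norml.
  clear -h1 h2; by have := pw_ge0 b N; move=> h; apply/andP; split; have := pw_ge0 b M; lra.
exists z; split.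
  apply: le_eps => e e0; have [N0 hN] := pw_to0 b0 e0.
  have N1 : (0 < maxn N0 1)%N by exact: leq_maxr.
  have := hN _ (leq_maxl N0 1); have := hz _ N1; have [h _] := cau 1%N _ (isT) N1.
  move: h; rewrite {2}/u big_nat1 pw1 powR1 ler_norml => h /andP[h1 _] h2.
  have : 1 <= 1 / c by rewrite ler_pdivlMr // mul1r.
  lra.
move=> n y n0 ny yn; have n0' : (0 : R) < n%:R by rewrite ltr0n.
have [_] := powR_MVT c0 c1 n0' ny; rewrite cb -/(pw b n) => h1.
have h0 : n%:R `^ c <= y `^ c by rewrite ge0_ler_powR ?nnegrE ?(ltW c0) // (le_trans _ ny).
have h2 : y - n%:R <= 1 by rewrite lerBlDl natr1.
have p0 := pw_gt0 b n0.
have h3 : (y `^ c - n%:R `^ c) / c <= pw b n.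
  rewrite ler_pdivrMr //; apply: le_trans h1 _.
  by rewrite mulrC [c * _]mulrC -[X in _ <= X]mul1r ler_wpM2r // mulr_ge0 // ltW.
have h4 : 0 <= (y `^ c - n%:R `^ c) / c by rewrite divr_ge0 ?subr_ge0 // ltW.
clear -hz n0 h3 h4; have := hz n n0; rewrite /u -/c !ler_norml => /andP[h5 h6]; apply/andP; split; lra.
Qed.

End RealSums.

(** * Real characters and the asymptotics of 1 * chi *)

Section RealCharacters.
Variable R : realType.
Implicit Types (x g h : nat -> R) (b c y : R) (q m n N M : nat).

(** The properties of a real nonprincipal character on which the real-variable argument rests.
    Periodicity is replaced by a bound on partial sums, a form that passes easily to functions with
    Euler factors removed. *)
Definition rchar q x := [/\ (0 < q)%N, x 1%N = 1, forall d e, x (d * e)%N = x d * x e,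
  forall n, if coprime n q then x n ^+ 2 = 1 else x n = 0 &
  forall m k, `|\sum_(m <= n < m + k) x n| <= q%:R].

(* l = L(b, x), characterised by the rate of convergence of the partial sums, so that no limit
   has to be taken when b <= 1. *)
Definition isL q x b l := forall N, (0 < N)%N ->
  `|\sum_(1 <= n < N.+1) x n * pw b n - l| <= 2 * q%:R * pw b N.

Lemma rchar_le1 q x n : rchar q x -> `|x n| <= 1.
Proof.
move=> [_ _ _ /(_ n)]; case: ifP => _ h _; last by rewrite h normr0.
by rewrite -(@ler_pXn2r _ 2) ?nnegrE // real_normK ?num_real // h expr1n.
Qed.

Lemma abel_real (a g : nat -> R) (B : R) m k : (forall k, `|\sum_(m <= n < m + k) a n| <= B) ->
  `|\sum_(m <= n < m + k) a n * g n| <=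
  B * (`|g (m + k)%N| + \sum_(m <= n < m + k) `|g n.+1 - g n|).
Proof.
move=> hB; have := @abel_bound R (fun n => (a n)%:C) (fun n => (g n)%:C) B m k.
rewrite (_ : \sum_(m <= n < m + k) (a n)%:C * (g n)%:C = (\sum_(m <= n < m + k) a n * g n)%:C); last first.
  by rewrite rmorph_sum; apply: eq_bigr => n _; rewrite rmorphM.
have -> : \sum_(m <= n < m + k) cn ((g n.+1)%:C - (g n)%:C) = \sum_(m <= n < m + k) `|g n.+1 - g n|.
  by apply: eq_bigr => n _; rewrite -rmorphB cn_real.
rewrite !cn_real.
by apply => l; rewrite -rmorph_sum cn_real.
Qed.

Lemma rchar_tail q x b m k : rchar q x -> 0 < b -> (0 < m)%N ->
  `|\sum_(m.+1 <= n < m.+1 + k) x n * pw b n| <= 2 * q%:R * pw b m.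
Proof.
move=> [q0 _ _ _ hs] b0 m0; apply: le_trans (abel_real _ _ (hs m.+1)) _.
have q0' : (0 : R) <= q%:R by [].
have -> : \sum_(m.+1 <= n < m.+1 + k) `|pw b n.+1 - pw b n| = pw b m.+1 - pw b (m.+1 + k)%N.
  rewrite (@eq_big_nat _ _ _ _ _ _ (fun n => - pw b n.+1 - - pw b n)); last first.
    move=> n /andP[n0 _]; rewrite ler0_norm; first by ring.
    by rewrite subr_le0 pwMn // ?ltW // (leq_trans _ n0).
  by rewrite telescope_sumr ?leq_addr // opprK addrC.
rewrite ger0_norm ?pw_ge0 // addrC subrK.
have h := pwMn (leqnSn m) m0 (ltW b0).
apply: le_trans (ler_wpM2l q0' h) _; rewrite -mulrA ler_peMl ?mulr_ge0 ?pw_ge0 //; lra.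
Qed.

Lemma isL_exists q x b : rchar q x -> 0 < b -> exists l, isL q x b l.
Proof.
move=> hx b0; apply: (@cauchy_limit R (fun N => \sum_(1 <= n < N.+1) x n * pw b n)
   (fun N => 2 * q%:R * pw b N)) => M N M0 MN.
rewrite (big_cat_nat (n := M.+1)) //= ?ltnS // addrAC subrr add0r.
have -> : N.+1 = (M.+1 + (N - M))%N by rewrite addSn subnKC.
exact: rchar_tail.
Qed.

Lemma isL_diff q x b l M N : rchar q x -> isL q x b l -> 0 < b -> (0 < M)%N ->
  `|\sum_(M.+1 <= n < N.+1) x n * pw b n| <= 2 * q%:R * pw b M.
Proof.
move=> hx _ b0 M0; case: (leqP N M) => NM.
  by rewrite big_geq // normr0 !mulr_ge0 ?pw_ge0.
have -> : N.+1 = (M.+1 + (N - M))%N by rewrite addSn subnKC // ltnW.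
exact: rchar_tail.
Qed.

Definition onef (n : nat) : R := 1.

Lemma divn_real (N d : nat) : (0 < d)%N ->
  (N %/ d)%:R <= N%:R / d%:R :> R /\ N%:R / d%:R <= (N %/ d).+1%:R :> R.
Proof.
move=> d0; have d0' : (0 : R) < d%:R by rewrite ltr0n.
rewrite ler_pdivlMr // ler_pdivrMr // -!natrM !ler_nat; split; first exact: leq_trunc_div.
by rewrite ltnW // -ltn_divLR.
Qed.

Lemma powR_quot N d c : (0 < d)%N -> (N%:R / d%:R) `^ c = N%:R `^ c * pw c d :> R.
Proof.
move=> d0; rewrite powRM ?invr_ge0 //; congr (_ * _).
by rewrite -powR_inv1 // -powRrM mulN1r.
Qed.

(** Hyperbola method at the square root of [N] for the coefficients of zeta(s) L(s, x): a main term
    from the pole of zeta and the constant zeta(b) L(b, x). Both [z] and [C] depend on [b] alone. *)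
Lemma two_factor b : 1 / 2 <= b -> b < 1 -> exists z C : R, [/\ z <= 0, 0 <= C &
  forall q x l1 lb N, rchar q x -> isL q x 1 l1 -> isL q x b lb -> (0 < N)%N ->
  `|\sum_(1 <= n < N.+1) conv x onef n * pw b n - (l1 * N%:R `^ (1 - b) / (1 - b) + z * lb)|
   <= C * q%:R * pw (b - 1 / 2) N].
Proof.
move=> b12 b1; have b0 : 0 < b by lra.
have [z [z0 hz]] := sum_pw_zeta b0 b1.
pose c := 1 - b; have c0 : 0 < c by rewrite /c; lra.
have c1 : c <= 1 by rewrite /c; lra.
pose C0 := 8 / c - 2 * z + 4 + 32 / c.
have ic : 0 < c^-1 by rewrite invr_gt0.
have C00 : 0 <= C0 by rewrite /C0; lra.
exists z, (2 * C0); split => //; first by lra.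
move=> q x l1 lb N hx h1 hb N0.
have [q0 _ _ _ _] := hx; have q1 : (1 : R) <= q%:R by rewrite ler1n.
have [m [m0 mN Nm]] := nat_sqrt N0.
have m0' : (0 : R) < m%:R by rewrite ltr0n.
have m1' : (1 : R) <= m%:R by rewrite ler1n.
have N0' : (0 : R) < N%:R by rewrite ltr0n.
have mN' : m%:R * m%:R <= N%:R :> R by rewrite -natrM ler_nat.
have Nm' : N%:R <= 4 * (m%:R * m%:R) :> R by rewrite -!natrM ler_nat.
have mleN : (m <= N)%N by apply: leq_trans mN; rewrite leq_pmulr.
pose w := pw (2 * b - 1) m.
have w0 : 0 < w by exact: pw_gt0.
have wN : w <= 2 * pw (b - 1 / 2) N.
  have k0 : 0 <= b - 1 / 2 by clear -b12 b1 b0 z0 c0; lra.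
  have := pwMn Nm N0 k0; rewrite (_ : 4 * (m * m) = (2 * m) * (2 * m))%N; last by rewrite mulnACA.
  rewrite pwM -pwD ?muln_gt0 ?m0 // (_ : b - 1 / 2 + (b - 1 / 2) = 2 * b - 1); last by field.
  rewrite pwM -/w.
  have k3 : 1 / 2 <= pw (2 * b - 1) 2 by rewrite div1r -pw_oneE // pw_le //; clear -b1; lra.
  by have := pw_ge0 (b - 1 / 2) N; clear -k0 k3; nra.
apply: le_trans (_ : C0 * q%:R * w <= _); last first.
  have : 0 <= C0 * q%:R by rewrite mulr_ge0.
  by clear -w0 wN; nra.
have -> : \sum_(1 <= n < N.+1) conv x onef n * pw b n =
   \sum_(1 <= d < N.+1) \sum_(1 <= e < (N %/ d).+1) (x d * pw b d) * pw b e.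
  rewrite -(@sum_conv R (fun d e => x d * pw b d * pw b e)); apply: eq_big_nat => n /andP[n0 _].
  rewrite /conv mulr_suml; apply: eq_big_seq => d; rewrite -dvdn_divisors // => dn.
  by rewrite /onef mulr1 -mulrA -pwM mulnC divnK.
rewrite (sum_divisor_pairs _ m0 mleN).
pose S1 := \sum_(1 <= d < m.+1) x d * pw 1 d; pose Sb := \sum_(1 <= d < m.+1) x d * pw b d.
pose E d := \sum_(1 <= e < (N %/ d).+1) pw b e - (N%:R / d%:R) `^ c / c - z.
have T1 : \sum_(1 <= d < m.+1) \sum_(1 <= e < (N %/ d).+1) (x d * pw b d) * pw b e =
   N%:R `^ c / c * S1 + z * Sb + \sum_(1 <= d < m.+1) x d * pw b d * E d.
  rewrite /S1 /Sb !mulr_sumr -!big_split /=; apply: eq_big_nat => d /andP[d0 _].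
  rewrite -mulr_sumr /E; have d0' : (0 : R) < d%:R by rewrite ltr0n.
  rewrite powR_quot // (_ : pw 1 d = pw b d * pw c d); first by ring.
  by rewrite -pwD //; congr pw; rewrite /c; ring.
rewrite T1.
have e1 := h1 m m0; rewrite -/S1 in e1; have eb := hb m m0; rewrite -/Sb in eb.
have mw : m%:R * pw (2 * b) m = w.
  rewrite -[X in X * _]powRr1 // /w /pw -powRD; last by rewrite (lt0r_neq0 m0') implybT.
  by congr (_ `^ _); ring.
have eE : `|\sum_(1 <= d < m.+1) x d * pw b d * E d| <= 4 * w.
  apply: le_trans (ler_norm_sum _ _ _) _.
  apply: le_trans (_ : \sum_(1 <= d < m.+1) 4 * pw (2 * b) m <= _); last first.
    by rewrite sumr_const_nat subn1 /= -[_ *+ m]mulr_natl mulrCA mw.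
  rewrite big_nat [X in _ <= X]big_nat; apply: ler_sum => d /andP[d0 dm].
  have dN : (0 < N %/ d)%N by rewrite divn_gt0 // (leq_trans _ mleN).
  have [f1 f2] := divn_real N d0.
  have := hz _ _ dN f1 f2; rewrite -/c -/(E d) => hE.
  rewrite !normrM (ger0_norm (pw_ge0 _ _)).
  have xd := rchar_le1 d hx.
  apply: le_trans (_ : pw b d * (2 * pw b (N %/ d)%N) <= _).
    apply: ler_pM; rewrite ?mulr_ge0 ?pw_ge0 //.
    by rewrite ler_piMl ?pw_ge0.
  rewrite mulrCA -pwM.
  have k1 : (m * m <= 2 * (d * (N %/ d)))%N.
    apply: leq_trans mN _; have := ltn_ceil N d0; rewrite mulSn [(N %/ d * d)%N]mulnC.
    by move=> /ltnW/leq_trans; apply; rewrite mul2n -addnn leq_add2r leq_pmulr.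
  have k2 : pw b (2 * (d * (N %/ d)))%N <= pw b (m * m)%N.
    by apply: pwMn => //; [rewrite muln_gt0 m0|exact: ltW].
  have k3 : 1 / 2 <= pw b 2.
    by rewrite div1r -pw_oneE // pw_le // ltW.
  rewrite pwM in k2; rewrite (_ : pw (2 * b) m = pw b (m * m)%N); last first.
    by rewrite pwM -pwD //; congr pw; ring.
  have := pw_ge0 b (d * (N %/ d))%N; clear -k3 k2; nra.
have eT : `|\sum_(1 <= e < (N %/ m).+1) \sum_(m.+1 <= d < (N %/ e).+1) x d * pw b d * pw b e|
   <= 16 / c * q%:R * w.
  apply: le_trans (ler_norm_sum _ _ _) _.
  apply: le_trans (_ : \sum_(1 <= e < (N %/ m).+1) 2 * q%:R * pw b m * pw (1 - c) e <= _).
    apply: ler_sum => e _; rewrite -mulr_suml normrM (ger0_norm (pw_ge0 _ _)).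
    rewrite (_ : 1 - c = b); last by rewrite /c; ring.
    by rewrite ler_wpM2r ?pw_ge0 // (isL_diff _ hx hb).
  rewrite -mulr_sumr; apply: le_trans (ler_wpM2l _ (sum_pw_head _ c0 c1)) _.
    by rewrite !mulr_ge0 ?pw_ge0.
  have k1 : (N %/ m)%:R `^ c <= 4 * m%:R `^ c.
    have k0 : (N %/ m)%:R <= 4 * m%:R :> R.
      rewrite -natrM ler_nat; apply: leq_trans (leq_div2r m Nm) _.
      by rewrite mulnA mulnK.
    apply: le_trans (_ : (4 * m%:R) `^ c <= _).
      by rewrite ge0_ler_powR ?nnegrE ?mulr_ge0 // ltW.
    by rewrite powRM // ler_wpM2r ?powR_ge0 //; apply: ler1_powR => //; clear; lra.
  have k2 : m%:R `^ c * pw b m = w.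
    rewrite /w /pw -powRD; last by rewrite (lt0r_neq0 m0') implybT.
    by congr (_ `^ _); rewrite /c; ring.
  apply: le_trans (ler_wpM2l _ (ler_wpM2l _ k1)) _; rewrite ?mulr_ge0 ?pw_ge0 ?(ltW ic) //.
  by rewrite -k2 le_eqVlt; apply/orP; left; apply/eqP; field; rewrite gt_eqF.
have e2 : `|N%:R `^ c / c * (S1 - l1)| <= 8 / c * q%:R * w.
  rewrite normrM ger0_norm; last by rewrite divr_ge0 ?powR_ge0 // ltW.
  have k1 : N%:R `^ c <= 4 * (m%:R `^ c * m%:R `^ c).
    rewrite -powRM //; apply: le_trans (_ : (4 * (m%:R * m%:R)) `^ c <= _).
      by rewrite ge0_ler_powR ?nnegrE ?mulr_ge0 // ltW.
    by rewrite powRM ?mulr_ge0 // ler_wpM2r ?powR_ge0 //; apply: ler1_powR => //; clear; lra.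
  have k2 : m%:R `^ c * m%:R `^ c * pw 1 m = w.
    rewrite /w /pw -!powRD; try by rewrite (lt0r_neq0 m0') implybT.
    by congr (_ `^ _); rewrite /c; ring.
  apply: le_trans (ler_pM _ _ (ler_wpM2r _ k1) e1) _; rewrite ?divr_ge0 ?powR_ge0 ?invr_ge0 ?(ltW c0) //.
  by rewrite -k2 le_eqVlt; apply/orP; left; apply/eqP; field; rewrite gt_eqF.
have e3 : `|z * (Sb - lb)| <= - 2 * z * q%:R * w.
  rewrite normrM ler0_norm //.
  have k1 : pw b m <= w by apply: pw_le => //; clear -b12 b1 b0 z0 c0 c1 ic; lra.
  have k2 : 2 * q%:R * pw b m <= 2 * q%:R * w by rewrite ler_wpM2l // mulr_ge0.
  have := le_trans eb k2; clear -b12 b1 b0 z0 c0; nra.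
rewrite -/c.
rewrite (_ : _ - _ = N%:R `^ c / c * (S1 - l1) + z * (Sb - lb) +
  \sum_(1 <= d < m.+1) x d * pw b d * E d +
  \sum_(1 <= e < (N %/ m).+1) \sum_(m.+1 <= d < (N %/ e).+1) x d * pw b d * pw b e); last by ring.
apply: le_trans (ler_normD _ _) _; apply: le_trans (lerD (ler_normD _ _) (lexx _)) _.
apply: le_trans (lerD (lerD (ler_normD _ _) (lexx _)) (lexx _)) _.
have w4 : 4 * w <= 4 * q%:R * w by clear -N0 q0 q1 m0 mN Nm w0 wN; nra.
have w5 : 16 / c * q%:R * w <= 32 / c * q%:R * w.
  have : 0 <= c^-1 * q%:R * w by rewrite !mulr_ge0 ?(ltW ic) ?(ltW w0).
  by clear -b12 b1 b0 z0 c0 c1 ic; lra.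
rewrite /C0; clear -eE eT e2 e3 w4 w5; lra.
Qed.

End RealCharacters.

(** * Positivity of L(1, chi) for real chi *)

Section NonVanishing.
Variable R : realType.
Implicit Types (x f u v : nat -> R) (q m n N M : nat).
Local Notation lnn n := (ln (n%:R : R)).

Lemma vM1 : vM R 1 = 0.
Proof. by apply/eqP; rewrite eq_le vM_ge0 andbT -(ln1 R) vM_le. Qed.

(** Substitute for an Euler product: a Dirichlet series whose logarithmic derivative has nonnegative
    coefficients [k] has nonnegative coefficients. As [k 1 = 0], the recursion only calls smaller
    arguments. *)
Lemma nonneg_rec f (k : nat -> R) : 0 <= f 1%N -> (forall n, (0 < n)%N -> lnn n * f n = conv k f n) ->
  (forall n, 0 <= k n) -> k 1%N = 0 -> forall n, (0 < n)%N -> 0 <= f n.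
Proof.
move=> f1 hf k0 k1; elim/ltn_ind => n IH n0.
case: (leqP n 1) => n1; first by have -> : n = 1%N by lia.
have l0 : 0 < lnn n by rewrite ln_gt0 // ltr1n.
rewrite -(pmulr_rge0 _ l0) hf // /conv big_seq_cond; apply: sumr_ge0 => d.
rewrite andbT -dvdn_divisors // => dn.
have [->|d1] := eqVneq d 1%N; first by rewrite k1 mul0r.
have d0 := dvdn_gt0 n0 dn.
rewrite mulr_ge0 // IH ?divn_gt0 ?(dvdn_leq n0 dn) //.
by rewrite ltn_Pdiv //; lia.
Qed.

Lemma conv_vM_real x n : (forall d e, x (d * e)%N = x d * x e) -> (0 < n)%N ->
  conv (fun m => x m * vM R m) x n = lnn n * x n.
Proof. by move=> h n0; rewrite (@conv_vM R R idfun x n h n0) mulrC. Qed.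

(** The logarithmic derivative of a product of two L-series, on coefficients: [u Lambda] and
    [v Lambda] add up. *)
Lemma ln_conv_mul u v n : (forall d e, u (d * e)%N = u d * u e) ->
  (forall d e, v (d * e)%N = v d * v e) -> (0 < n)%N ->
  lnn n * conv u v n = conv (fun m => (u m + v m) * vM R m) (conv u v) n.
Proof.
move=> hu hv n0; rewrite (conv_deriv _ _ (@lgadd_ln R) n0).
have h1 : conv (fun m => lnn m * u m) v n = conv (fun m => u m * vM R m) (conv u v) n.
  rewrite convA //; apply: eq_conv => // d dn; rewrite conv_vM_real //.
  exact: dvdn_gt0 dn.
have h2 : conv u (fun m => lnn m * v m) n = conv (fun m => v m * vM R m) (conv u v) n.
  rewrite [RHS]convC // -convA //; apply: eq_conv => // d dn.
  by rewrite -conv_vM_real ?(dvdn_gt0 n0 dn) // convC ?(dvdn_gt0 n0 dn).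
by rewrite h1 h2 -convDl; apply: eq_conv => // d _; rewrite mulrDl.
Qed.

Lemma ln_conv_one x n : (forall d e, x (d * e)%N = x d * x e) -> (0 < n)%N ->
  lnn n * conv x (onef R) n = conv (fun m => (1 + x m) * vM R m) (conv x (onef R)) n.
Proof.
move=> hx n0; rewrite ln_conv_mul //; last by move=> d e; rewrite /onef mulr1.
by apply: eq_conv => // d _; rewrite /onef addrC.
Qed.

Lemma conv1 (f g : nat -> R) : conv f g 1 = f 1%N * g 1%N.
Proof. by rewrite /conv big_seq1. Qed.

Lemma rchar_ge q x n : rchar q x -> -1 <= x n.
Proof. by move=> /(rchar_le1 n); rewrite ler_norml => /andP[]. Qed.

Lemma conv_one_ge0 q x n : rchar q x -> (0 < n)%N -> 0 <= conv x (onef R) n.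
Proof.
move=> hx; have [_ x1 xM _ _] := hx.
apply: (@nonneg_rec _ (fun m => (1 + x m) * vM R m)).
- by rewrite conv1 x1 mul1r.
- by move=> m m0; exact: ln_conv_one.
- by move=> m; rewrite mulr_ge0 ?vM_ge0 //; have := rchar_ge m hx; lra.
- by rewrite vM1 mulr0.
Qed.

Lemma vM_sq_ge e : (0 < e)%N -> vM R e <= vM R (e * e).
Proof.
move=> e0; have ee : (e <= e * e)%N by rewrite leq_pmulr.
rewrite (vME R e0 ee) (@vME R (e * e) (e * e)) ?muln_gt0 ?e0 //.
apply: ler_sum => p pp; have p1 := prime_gt1 pp.
case: (boolP (has (fun k => e == p ^ k)%N (index_iota 1 (e * e).+1))) => [/hasP[k]|/hasPn h]; last first.
  rewrite big_seq_cond big1; first by apply: sumr_ge0 => i _; exact: ln_nat_ge0.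
  by move=> i /andP[hi]; rewrite (negbTE (h i hi)).
rewrite mem_index_iota => /andP[k0 _] /eqP ek.
rewrite (eq_bigl (fun i => i == k)); last by move=> i; rewrite ek eqn_exp2l // eq_sym.
rewrite [X in _ <= X](eq_bigl (fun i => i == k + k)%N); last first.
  by move=> i; rewrite ek -expnD eqn_exp2l // eq_sym.
rewrite !big_nat1_eq k0 addn_gt0 k0 /= !ltnS.
have h : (k + k <= e * e)%N by rewrite ek -expnD ltnW // ltn_expl.
by rewrite h (leq_trans (leq_addr k k) h).
Qed.

(** Induction through the logarithmic recursion, where only the divisors [e ^ 2] of [k ^ 2] are
    kept: there [1 + x (e ^ 2) = 2], [Lambda (e ^ 2) >= Lambda e], and the [Lambda e] sum to
    [ln k]. *)
Lemma conv_one_square q x k : rchar q x -> coprime k q -> (0 < k)%N -> 1 <= conv x (onef R) (k * k).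
Proof.
move=> hx; have [_ x1 xM xv _] := hx.
elim/ltn_ind: k => k IH ck k0.
case: (leqP k 1) => k1.
  have -> : k = 1%N by lia.
  by rewrite conv1 x1 mul1r.
have l0 : 0 < lnn k by rewrite ln_gt0 // ltr1n.
have kk0 : (0 < k * k)%N by rewrite muln_gt0 k0.
suff: 2 * lnn k <= 2 * lnn k * conv x (onef R) (k * k).
  by rewrite -{1}[2 * lnn k]mulr1 ler_pM2l // mulr_gt0.
have -> : 2 * lnn k * conv x (onef R) (k * k) = lnn (k * k) * conv x (onef R) (k * k).
  by rewrite natrM lnM ?posrE ?ltr0n // mulr_natl mulr2n.
rewrite ln_conv_one // /conv -/(conv x (onef R)).
set F := fun d => (1 + x d) * vM R d * conv x (onef R) (k * k %/ d)%N.
have F0 d : (d %| k * k)%N -> 0 <= F d.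
  move=> dk; rewrite mulr_ge0 ?(conv_one_ge0 hx) ?divn_gt0 ?(dvdn_gt0 kk0 dk) ?(dvdn_leq kk0 dk) //.
  by rewrite mulr_ge0 ?vM_ge0 //; have := rchar_ge d hx; lra.
apply: le_trans (_ : \sum_(d <- [seq (e * e)%N | e <- divisors k]) F d <= _); last first.
  apply: sum_uniq_sub; rewrite ?divisors_uniq //.
  - rewrite map_inj_in_uniq ?divisors_uniq // => a b _ _ /eqP.
    by rewrite !mulnn eqn_exp2r // => /eqP.
  - move=> w /mapP[e hek ->]; move: hek; rewrite -!dvdn_divisors // => ek.
    exact: dvdn_mul.
  by move=> d; rewrite -dvdn_divisors //; exact: F0.
rewrite big_map -(sum_vM R k0) mulr_sumr big_seq [X in _ <= X]big_seq; apply: ler_sum => e.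
rewrite -dvdn_divisors // => ek; have e0 := dvdn_gt0 k0 ek.
have ce : coprime e q by exact: coprime_dvdl ek ck.
rewrite /F xM; have := xv e; rewrite ce expr2 => ->.
have -> : 1 + 1 = 2 :> R by [].
have [->|e1] := eqVneq e 1%N; first by rewrite muln1 vM1 !mulr0 mul0r.
have hv := vM_sq_ge e0.
have -> : (k * k %/ (e * e) = (k %/ e) * (k %/ e))%N.
  by rewrite -{1 2}(divnK ek) mulnACA mulnK // muln_gt0 e0.
have g1 : 1 <= conv x (onef R) ((k %/ e) * (k %/ e)).
  apply: IH; rewrite ?divn_gt0 ?(dvdn_leq k0 ek) //; first by rewrite ltn_Pdiv //; lia.
  by apply: coprime_dvdl ck; apply: dvdn_div.
have := vM_ge0 R (e * e); nra.
Qed.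

Lemma ln_le_harmonic I : ln I.+1%:R <= \sum_(1 <= i < I.+1) (i%:R^-1 : R).
Proof.
elim: I => [|I IH]; first by rewrite big_geq // ln1.
rewrite big_nat_recr //=; apply: le_trans (lerD IH (lexx _)).
by rewrite -lerBlDl ln_succ_le.
Qed.

(** Mertens' argument at the exponent 1/2, where the error in [two_factor] is bounded. If [l1 <= 0],
    the sums of [(1 * x)(n) / sqrt n] stay bounded, whereas the squares of the integers [1 + q i]
    alone contribute a harmonic series. *)
Lemma L1_gt0 q x l1 : rchar q x -> isL q x 1 l1 -> 0 < l1.
Proof.
move=> hx h1; rewrite ltNge; apply/negP => l0.
have [q0 _ _ _ _] := hx; have q0' : (0 : R) < q%:R by rewrite ltr0n.
have [z [C [z0 C0 hC]]] := @two_factor R (1 / 2) (lexx _) (ltac:(lra)).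
have h2 : (0 : R) < 1 / 2 by lra.
have [lb hb] := isL_exists hx h2.
pose B := z * lb + C * q%:R.
(* Large enough for the harmonic sum up to [I], divided by [q], to exceed the supposed bound by
   1. *)
pose I := Num.truncn (expR (q%:R * (B + 1))).
pose k i := (1 + q * i)%N.
pose N := (k I * k I)%N.
have k0 i : (0 < k i)%N by rewrite /k add1n.
have N0 : (0 < N)%N by rewrite muln_gt0 k0.
have := hC q x l1 lb N hx h1 hb N0.
rewrite subrr {2}/pw oppr0 powRr0 mulr1 => /(le_trans (ler_norm _)).
rewrite lerBlDr => hG.
have hG2 : \sum_(1 <= n < N.+1) conv x (onef R) n * pw (1 / 2) n <= B.
  apply: le_trans hG _; rewrite /B.
  suff: l1 * N%:R `^ (1 - 1 / 2) / (1 - 1 / 2) <= 0 by lra.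
  by rewrite -mulrA mulr_le0_ge0 // mulr_ge0 ?powR_ge0 // invr_ge0; lra.
suff: B + 1 <= \sum_(1 <= n < N.+1) conv x (onef R) n * pw (1 / 2) n by lra.
apply: le_trans (_ : \sum_(n <- [seq (k i * k i)%N | i <- iota 0 I]) conv x (onef R) n * pw (1 / 2) n <= _);
  last first.
  apply: sum_uniq_sub; rewrite ?iota_uniq //.
  - rewrite map_inj_in_uniq ?iota_uniq // => a b _ _ /eqP; rewrite !mulnn eqn_exp2r // => /eqP.
    by rewrite /k => /addnI /eqP; rewrite eqn_pmul2l // => /eqP.
  - move=> w /mapP[j hj ->]; move: hj; rewrite mem_iota add0n => /andP[_ jI]; rewrite mem_index_iota muln_gt0 k0 /=.
    by rewrite ltnS leq_mul // /k leq_add2l leq_mul2l ltnW ?orbT.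
  move=> n; rewrite mem_index_iota => /andP[n0 _].
  by rewrite mulr_ge0 ?pw_ge0 // (conv_one_ge0 hx).
rewrite big_map.
apply: le_trans (_ : \sum_(i <- iota 0 I) q%:R^-1 * (i.+1%:R)^-1 <= _); last first.
  apply: ler_sum => i _; rewrite pwM -pwD // (_ : 1 / 2 + 1 / 2 = 1); last by field.
  rewrite pw_oneE // -invfM; apply: le_trans (_ : 1 * (k i)%:R^-1 <= _); last first.
    apply: ler_wpM2r; first by rewrite invr_ge0.
    by apply: conv_one_square hx _ (k0 i); rewrite /k addnC mulnC coprime_sym /coprime gcdnMDl gcdn1.
  rewrite mul1r lef_pV2 ?posrE ?mulr_gt0 ?ltr0n // -natrM ler_nat /k mulnS.
  by rewrite leq_add2r.
rewrite -mulr_sumr ler_pdivlMl //.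
have -> : \sum_(i <- iota 0 I) (i.+1%:R)^-1 = \sum_(1 <= i < I.+1) (i%:R^-1 : R).
  by rewrite [RHS]big_add1 /= /index_iota subn0.
apply: le_trans (ln_le_harmonic I).
have e0 : 0 < expR (q%:R * (B + 1)) := expR_gt0 _.
by rewrite -[X in X <= _]expRK ler_ln ?posrE ?ltr0n // ltW // truncnS_gt.
Qed.

End NonVanishing.

(** * The product zeta(s) L(s, x1) L(s, x) L(s, x1 x) *)

Section FourFold.
Variable R : realType.
Implicit Types (x u v g h : nat -> R) (b : R) (q m n N M K : nat).

Lemma pwX s n k : pw s (n ^ k)%N = pw (k%:R * s) n :> R.
Proof.
rewrite /pw natrX -powR_mulrn // -powRrM; congr (_ `^ _); ring.
Qed.

Lemma pw_div b N d : 0 <= b -> b <= 1 -> (0 < d)%N -> (d <= N)%N ->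
  pw b d * pw b (N %/ d)%N <= 2 * pw b N :> R.
Proof.
move=> b0 b1 d0 dN; rewrite -pwM.
have k1 : (N <= 2 * (d * (N %/ d)))%N.
  have dN1 : (0 < N %/ d)%N by rewrite divn_gt0.
  have := ltn_ceil N d0; rewrite mulSn [(N %/ d * d)%N]mulnC.
  by move=> /ltnW/leq_trans; apply; rewrite mul2n -addnn leq_add2r leq_pmulr.
have := pwMn k1 (leq_trans d0 dN) b0; rewrite pwM.
have k3 : 1 / 2 <= pw b 2 :> R by rewrite div1r -pw_oneE // pw_le.
by have := pw_ge0 b (d * (N %/ d))%N; nra.
Qed.

Lemma isL_le q x b l : rchar q x -> isL q x b l -> `|l| <= 3 * q%:R.
Proof.
move=> [q0 x1 _ _ _] /(_ 1%N isT); rewrite big_nat1 x1 pw1 !mulr1.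
have q1 : (1 : R) <= q%:R by rewrite ler1n.
by rewrite !ler_norml => /andP[h1 h2]; apply/andP; split; lra.
Qed.

Lemma sum_conv_pw (u v : nat -> R) b N : \sum_(1 <= n < N.+1) conv u v n * pw b n =
   \sum_(1 <= d < N.+1) \sum_(1 <= e < (N %/ d).+1) (u d * pw b d) * (v e * pw b e).
Proof.
rewrite -(@sum_conv R (fun d e => u d * pw b d * (v e * pw b e))).
apply: eq_big_nat => n /andP[n0 _].
rewrite /conv mulr_suml; apply: eq_big_seq => d; rewrite -dvdn_divisors // => dn.
by rewrite mulrACA -pwM [(d * _)%N]mulnC divnK.
Qed.

(** Hyperbola method at the square root of [K]. With [b >= 9 / 10] all three errors are at most
    [m ^ (- 2 / 5)], with constants 6, 4 and 16; returning from [m] to [K] doubles their sum to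
    52. *)
Lemma rchar_conv_sum b qu u lu qv v lv K : 9 / 10 <= b -> b <= 1 ->
  rchar qu u -> rchar qv v -> isL qu u b lu -> isL qv v b lv -> (0 < K)%N ->
  `|\sum_(1 <= k < K.+1) conv u v k * pw b k - lu * lv| <= 52 * (qu%:R * qv%:R) * pw (1 / 5) K.
Proof.
move=> b9 b1 hu hv hlu hlv K0; have b0 : 0 < b by lra.
have [qu0 _ _ _ _] := hu; have qu1 : (1 : R) <= qu%:R by rewrite ler1n.
have [qv0 _ _ _ _] := hv; have qv1 : (1 : R) <= qv%:R by rewrite ler1n.
have [m [m0 mN Nm]] := nat_sqrt K0.
have m0' : (0 : R) < m%:R by rewrite ltr0n.
have mleK : (m <= K)%N by apply: leq_trans mN; rewrite leq_pmulr.
pose w : R := pw (2 / 5) m.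
have w0 : 0 < w by exact: pw_gt0.
have wK : w <= 2 * pw (1 / 5) K.
  have k0 : (0 : R) <= 1 / 5 by lra.
  have := pwMn Nm K0 k0; rewrite (_ : 4 * (m * m) = (2 * m) * (2 * m))%N; last by rewrite mulnACA.
  rewrite pwM -pwD ?muln_gt0 ?m0 // (_ : 1 / 5 + 1 / 5 = 2 / 5); last by field.
  rewrite pwM -/w.
  have k3 : 1 / 2 <= pw (2 / 5) 2 :> R by rewrite div1r -pw_oneE // pw_le //; lra.
  by have := pw_ge0 (1 / 5) K : 0 <= _ :> R; clear -k3; nra.
have bw : pw b m <= w by apply: pw_le => //; lra.
rewrite sum_conv_pw (sum_divisor_pairs _ m0 mleK).
pose U := \sum_(1 <= d < m.+1) u d * pw b d.
pose V d := \sum_(1 <= e < (K %/ d).+1) v e * pw b e.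
have T1 : \sum_(1 <= d < m.+1) \sum_(1 <= e < (K %/ d).+1) (u d * pw b d) * (v e * pw b e) =
   lv * U + \sum_(1 <= d < m.+1) u d * pw b d * (V d - lv).
  rewrite /U mulr_sumr -big_split /=; apply: eq_bigr => d _.
  by rewrite -mulr_sumr -/(V d); ring.
rewrite T1.
have eU := hlu m m0; rewrite -/U in eU.
have hB : `|\sum_(1 <= d < m.+1) u d * pw b d * (V d - lv)| <= 4 * qv%:R * w.
  apply: le_trans (ler_norm_sum _ _ _) _.
  apply: le_trans (_ : \sum_(1 <= d < m.+1) 4 * qv%:R * pw b K <= _).
    rewrite big_nat [X in _ <= X]big_nat; apply: ler_sum => d /andP[d0 dm].
    have dK : (d <= K)%N by exact: leq_trans mleK.
    have dN : (0 < K %/ d)%N by rewrite divn_gt0.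
    have hE := hlv _ dN; rewrite -/(V d) in hE.
    rewrite !normrM (ger0_norm (pw_ge0 _ _)).
    have xd := rchar_le1 d hu.
    apply: le_trans (_ : pw b d * (2 * qv%:R * pw b (K %/ d)%N) <= _).
      apply: ler_pM; rewrite ?mulr_ge0 ?pw_ge0 //.
      by rewrite ler_piMl ?pw_ge0.
    have := pw_div (ltW b0) b1 d0 dK; clear -qv0 qv1 m0 mN Nm m0'; nra.
  rewrite sumr_const_nat subn1 /= -[_ *+ m]mulr_natl.
  have k1 : pw b K <= pw b (m * m)%N by apply: pwMn => //; [rewrite muln_gt0 m0|exact: ltW].
  have k2 : m%:R * pw b (m * m)%N <= w.
    rewrite pwM -pwD // /pw -[X in X * _]powRr1 // -powRD; last by rewrite (lt0r_neq0 m0') implybT.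
    by apply: ler_powR; [rewrite ler1n|(clear -b9 b1 K0 b0 qu0 qu1 qv0 qv1 m0; lra)].
  have k3 : m%:R * pw b K <= w by apply: le_trans (ler_wpM2l (ltW m0') k1) k2.
  by rewrite mulrCA ler_wpM2l // mulr_ge0.
have hC : `|\sum_(1 <= e < (K %/ m).+1) \sum_(m.+1 <= d < (K %/ e).+1) u d * pw b d * (v e * pw b e)|
   <= 16 * qu%:R * w.
  apply: le_trans (ler_norm_sum _ _ _) _.
  apply: le_trans (_ : \sum_(1 <= e < (K %/ m).+1) 2 * qu%:R * pw b m * pw (1 - 1 / 2) e <= _).
    rewrite big_nat [X in _ <= X]big_nat; apply: ler_sum => e /andP[e0 _].
    rewrite -mulr_suml !normrM (ger0_norm (pw_ge0 _ _)).
    apply: ler_pM; rewrite ?mulr_ge0 ?pw_ge0 ?normr_ge0 ?(isL_diff _ hu hlu) //.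
    apply: le_trans (_ : 1 * pw b e <= _); first by rewrite ler_wpM2r ?pw_ge0 // (rchar_le1 _ hv).
    by rewrite mul1r pw_le //; clear -b9 b1 K0 b0 qu0 qu1 qv0 qv1 m0 mN; lra.
  rewrite -mulr_sumr; apply: le_trans (ler_wpM2l _ (sum_pw_head _ _ _)) _; rewrite ?mulr_ge0 ?pw_ge0 //; try (clear; lra).
  have k1 : (K %/ m)%:R `^ (1 / 2) <= 2 * m%:R `^ (1 / 2) :> R.
    have k0 : (K %/ m)%:R <= 4 * m%:R :> R.
      rewrite -natrM ler_nat; apply: leq_trans (leq_div2r m Nm) _.
      by rewrite mulnA mulnK.
    apply: le_trans (_ : (4 * m%:R) `^ (1 / 2) <= _).
      by rewrite ge0_ler_powR ?nnegrE ?mulr_ge0 //; lra.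
    rewrite powRM // ler_wpM2r ?powR_ge0 // (_ : 4 = 2 `^ 2); last first.
      by rewrite powR_mulrn //; ring.
    by rewrite -powRrM (_ : 2 * (1 / 2) = 1) ?powRr1 //; field.
  have k2 : m%:R `^ (1 / 2) * pw b m <= w.
    rewrite /w /pw -powRD; last by rewrite (lt0r_neq0 m0') implybT.
    by apply: ler_powR; [rewrite ler1n|(clear -b9 b1 K0 b0 qu0; lra)].
  have k4 : 2 / (1 / 2) * (K %/ m)%:R `^ (1 / 2) <= 8 * m%:R `^ (1 / 2) :> R by clear -k1; lra.
  apply: le_trans (ler_wpM2l _ k4) _; rewrite ?mulr_ge0 ?pw_ge0 //.
  rewrite [X in X <= _](_ : _ = 16 * qu%:R * (m%:R `^ (1 / 2) * pw b m)); last by ring.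
  by rewrite ler_wpM2l // mulr_ge0.
have hA : `|lv * (U - lu)| <= 6 * (qu%:R * qv%:R) * w.
  rewrite normrM; apply: le_trans (ler_pM _ _ (isL_le hv hlv) eU) _ => //.
  rewrite [X in X <= _](_ : _ = 6 * (qu%:R * qv%:R) * pw b m); last by ring.
  by rewrite ler_wpM2l // !mulr_ge0.
rewrite (_ : _ - _ = lv * (U - lu) + \sum_(1 <= d < m.+1) u d * pw b d * (V d - lv) +
  \sum_(1 <= e < (K %/ m).+1) \sum_(m.+1 <= d < (K %/ e).+1) u d * pw b d * (v e * pw b e)); last by ring.
apply: le_trans (ler_normD _ _) _; apply: le_trans (lerD (ler_normD _ _) (lexx _)) _.
have p1 : qv%:R * w <= qu%:R * qv%:R * w by rewrite -mulrA ler_peMl // mulr_ge0 // ltW.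
have p2 : qu%:R * w <= qu%:R * qv%:R * w by rewrite mulrAC ler_peMr // mulr_ge0 // ltW.
have p3 : qu%:R * qv%:R * w <= qu%:R * qv%:R * (2 * pw (1 / 5) K) by rewrite ler_wpM2l // mulr_ge0.
clear -hB hC hA p1 p2 p3; lra.
Qed.

(** Meant for [g = 1 * x1], whose sums have no constant term when L(b, x1) = 0, and
    [h = x * (x1 x)], whose sums converge to [lam] at [b] and to [mu] at 1. The hyperbola is cut at
    [y], far below [N = y ^ 8]: for [d <= y] the sums of [g] have length at least [y ^ 7], so their
    error beats the trivial [|h d| <= d]; for [d > y] only the convergence of the sums of [h] is
    used. *)
Lemma four_fold g h (a E D b mu lam : R) y : 99 / 100 <= b -> b < 1 -> (0 < y)%N ->
  (forall n, (0 < n)%N -> 0 <= g n) -> (forall n, (0 < n)%N -> `|h n| <= n%:R) ->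
  0 <= a -> 0 <= E -> 0 <= D ->
  (forall N, (0 < N)%N -> `|\sum_(1 <= n < N.+1) g n * pw b n - a * N%:R `^ (1 - b)| <= E * pw (b - 1 / 2) N) ->
  (forall N, (0 < N)%N -> `|\sum_(1 <= n < N.+1) h n * pw b n - lam| <= D * pw (1 / 5) N) ->
  (forall N, (0 < N)%N -> `|\sum_(1 <= n < N.+1) h n * pw 1 n - mu| <= D * pw (1 / 5) N) ->
  \sum_(1 <= n < (y ^ 8).+1) conv h g n * pw b n <=
    a * mu * pw (b - 1) (y ^ 8)%N + (3 * D + 1) * (a + E) * pw (1 / 10) y.
Proof.
move=> b9 b1 y0 g0 hh a0 E0 D0 hG hH hM.
pose N := (y ^ 8)%N; pose c := 1 - b; rewrite -/N.
have c0 : 0 < c by rewrite /c; lra.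
have c1 : c <= 1 by rewrite /c; clear -b9 b1 y0; lra.
have N0 : (0 < N)%N by rewrite expn_gt0 y0.
have y1 : (1 : R) <= y%:R by rewrite ler1n.
have yN : (y <= N)%N by rewrite /N -[X in (X <= _)%N]expn1 leq_pexp2l.
rewrite sum_conv_pw (sum_divisor_pairs _ y0 yN).
have Ny : pw (b - 1) N * pw (1 / 5) y <= pw (1 / 10) y :> R.
  by rewrite /N pwX -pwD // pw_le //; clear -b9 b1; lra.
have Nc : N%:R `^ c = pw (b - 1) N by rewrite /pw opprB.
pose G M := \sum_(1 <= n < M.+1) g n * pw b n.
pose H M := \sum_(1 <= n < M.+1) h n * pw b n.
have hG2 d : (0 < d)%N -> (d <= y)%N ->
    `|G (N %/ d)%N - a * (pw (b - 1) N * pw c d)| <= (a + E) * pw (14 / 5) y.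
  move=> d0 dy; have dN := leq_trans dy yN.
  set u := (N %/ d)%N; have u0 : (0 < u)%N by rewrite divn_gt0.
  have u0' : (0 : R) < u%:R by rewrite ltr0n.
  have [f1 f2] := divn_real R N d0; rewrite -/u in f1 f2.
  have [k1 k2] := powR_MVT c0 c1 u0' f1.
  have k3 : (N%:R / d%:R) `^ c = pw (b - 1) N * pw c d by rewrite powR_quot // Nc.
  have k4 : u%:R `^ c <= (N%:R / d%:R) `^ c by rewrite ge0_ler_powR ?nnegrE ?(ltW c0) // (le_trans _ f1) // ltW.
  have k5 : (N%:R / d%:R) `^ c - u%:R `^ c <= pw (b - 1 / 2) u.
    apply: le_trans k2 _; rewrite (_ : u%:R `^ (c - 1) = pw b u); last by rewrite /pw /c addrAC subrr sub0r.
    have k6 : N%:R / d%:R - u%:R <= 1 :> R by rewrite lerBlDl natr1.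
    have k7 : pw b u <= pw (b - 1 / 2) u by apply: pw_le => //; clear -b9 b1 y0; lra.
    have k8 : c * pw b u <= 1 * pw b u by rewrite ler_wpM2r ?pw_ge0.
    have : c * pw b u * (N%:R / d%:R - u%:R) <= c * pw b u * 1.
      by rewrite ler_wpM2l // mulr_ge0 ?pw_ge0 // ltW.
    clear -k6 k7 k8; lra.
  have k6 : pw (b - 1 / 2) u <= pw (14 / 5) y.
    apply: le_trans (_ : pw (2 / 5) u <= _); first by apply: pw_le => //; clear -b9 b1 y0; lra.
    rewrite (_ : 14 / 5 = 7%:R * (2 / 5)); last by field.
    have h25 : (0 : R) <= 2 / 5 by clear -b9 b1 y0; lra.
    rewrite -(pwX _ y 7); apply: (pwMn _ _ h25); rewrite ?expn_gt0 ?y0 //.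
    by rewrite leq_divRL // /N (expnS y 7) mulnC leq_mul2r dy orbT.
  rewrite -k3.
  have := hG u u0; rewrite -/(G u) -/c => k7.
  rewrite (_ : _ - _ = (G u - a * u%:R `^ c) - a * ((N%:R / d%:R) `^ c - u%:R `^ c)); last by ring.
  have k10 : 0 <= (N%:R / d%:R) `^ c - u%:R `^ c by rewrite subr_ge0.
  apply: le_trans (ler_normB _ _) _; rewrite normrM (ger0_norm a0) (ger0_norm k10).
  have k8 : a * ((N%:R / d%:R) `^ c - u%:R `^ c) <= a * pw (14 / 5) y.
    by rewrite ler_wpM2l // (le_trans k5).
  have k9 : E * pw (b - 1 / 2) u <= E * pw (14 / 5) y by rewrite ler_wpM2l.
  clear -k7 k8 k9; lra.
have T1 : \sum_(1 <= d < y.+1) \sum_(1 <= e < (N %/ d).+1) (h d * pw b d) * (g e * pw b e) =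
    a * pw (b - 1) N * (\sum_(1 <= d < y.+1) h d * pw 1 d) +
    \sum_(1 <= d < y.+1) h d * pw b d * (G (N %/ d)%N - a * (pw (b - 1) N * pw c d)).
  rewrite mulr_sumr -big_split /=; apply: eq_big_nat => d /andP[d0 _].
  rewrite -mulr_sumr -/(G _) (_ : pw 1 d = pw b d * pw c d); first by ring.
  by rewrite -pwD //; congr pw; rewrite /c; ring.
have yy : y%:R * y%:R * pw (14 / 5) y <= pw (1 / 10) y :> R.
  have yR : y%:R = y%:R `^ 1 :> R by rewrite powRr1.
  rewrite {1 2}yR.
  have yn : y%:R != 0 :> R by rewrite pnatr_eq0 -lt0n.
  rewrite /pw -!powRD ?yn ?implybT //.
  by apply: ler_powR; [|(clear -b9 b1 y0 a0; lra)].
have e1 : \sum_(1 <= d < y.+1) h d * pw b d * (G (N %/ d)%N - a * (pw (b - 1) N * pw c d)) <=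
    (a + E) * pw (1 / 10) y.
  apply: le_trans (ler_norm _) _; apply: le_trans (ler_norm_sum _ _ _) _.
  apply: le_trans (_ : \sum_(1 <= d < y.+1) y%:R * ((a + E) * pw (14 / 5) y) <= _).
    rewrite big_nat [X in _ <= X]big_nat; apply: ler_sum => d /andP[d0 dy].
    rewrite normrM; apply: ler_pM; rewrite ?normr_ge0 // ?hG2 //.
    rewrite normrM; apply: le_trans (_ : d%:R * 1 <= _).
      by apply: ler_pM; rewrite ?hh // ger0_norm ?pw_ge0 // pw_le1 //; clear -b9; lra.
    by rewrite mulr1 ler_nat.
  rewrite sumr_const_nat subn1 /= -[_ *+ y]mulr_natl.
  rewrite [X in X <= _](_ : _ = (a + E) * (y%:R * y%:R * pw (14 / 5) y)); last by ring.
  by rewrite ler_wpM2l // addr_ge0.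
have e2 : a * pw (b - 1) N * (\sum_(1 <= d < y.+1) h d * pw 1 d) <=
    a * mu * pw (b - 1) N + a * D * pw (1 / 10) y.
  have := le_trans (ler_norm _) (hM y y0); rewrite lerBlDl => k1.
  apply: le_trans (ler_wpM2l _ k1) _; first by rewrite mulr_ge0 ?pw_ge0.
  rewrite mulrDr (_ : a * mu * pw (b - 1) N = a * pw (b - 1) N * mu); last by ring.
  rewrite lerD2l (_ : _ * (D * _) = a * D * (pw (b - 1) N * pw (1 / 5) y)); last by ring.
  by rewrite ler_wpM2l // mulr_ge0.
have GN : \sum_(1 <= e < (N %/ y).+1) g e * pw b e <= (a + E) * pw (b - 1) N.
  apply: le_trans (_ : G N <= _).
    rewrite /G [X in _ <= X](big_cat_nat (n := (N %/ y).+1)) //= ?ltnS ?leq_div //.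
    rewrite lerDl big_nat_cond; apply: sumr_ge0 => i /andP[/andP[i0 _] _].
    by rewrite mulr_ge0 ?pw_ge0 // g0 // (leq_ltn_trans _ i0).
  have := le_trans (ler_norm _) (hG N N0); rewrite -/(G N) -/c Nc lerBlDl => k1.
  have k2 : pw (b - 1 / 2) N <= pw (b - 1) N by apply: pw_le => //; clear -b9 b1 y0 a0; lra.
  have := ler_wpM2l E0 k2; clear -k1 k2; lra.
have e3 : \sum_(1 <= e < (N %/ y).+1) \sum_(y.+1 <= d < (N %/ e).+1) h d * pw b d * (g e * pw b e) <=
    2 * D * (a + E) * pw (1 / 10) y.
  apply: le_trans (_ : \sum_(1 <= e < (N %/ y).+1) 2 * D * pw (1 / 5) y * (g e * pw b e) <= _).
    rewrite big_nat [X in _ <= X]big_nat; apply: ler_sum => e /andP[e0 eN].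
    rewrite -mulr_suml ler_wpM2r ?mulr_ge0 ?pw_ge0 ?g0 //.
    have yNe : (y <= N %/ e)%N by move: eN; rewrite ltnS !leq_divRL // mulnC.
    have -> : \sum_(y.+1 <= d < (N %/ e).+1) h d * pw b d = (H (N %/ e)%N - lam) - (H y - lam).
      rewrite /H [X in X - lam - _](big_cat_nat (n := y.+1)) //=; ring.
    have k1 := hH (N %/ e)%N (leq_trans y0 yNe); have k2 := hH y y0.
    have k3 : pw (1 / 5) (N %/ e)%N <= pw (1 / 5) y :> R by apply: pwMn => //; lra.
    have := ler_wpM2l D0 k3; rewrite -/(H _) in k1; rewrite -/(H _) in k2.
    clear -k1 k2; move: k1 k2; rewrite !ler_norml => /andP[? ?] /andP[? ?]; lra.
  rewrite -mulr_sumr; apply: le_trans (ler_wpM2l _ GN) _; first by rewrite !mulr_ge0 ?pw_ge0.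
  rewrite [X in X <= _](_ : _ = 2 * D * (a + E) * (pw (b - 1) N * pw (1 / 5) y)); last by ring.
  by rewrite ler_wpM2l // !mulr_ge0 // addr_ge0.
rewrite T1.
have : 0 <= D * E * pw (1 / 10) y by rewrite !mulr_ge0 ?pw_ge0.
clear -e1 e2 e3; lra.
Qed.

Lemma isL_unique q x b l q' x' l' : 0 < b -> isL q x b l -> isL q' x' b l' ->
  (forall n, (0 < n)%N -> x n = x' n) -> l = l'.
Proof.
move=> b0 h h' e; apply/eqP; rewrite -subr_eq0 -normr_eq0 eq_le normr_ge0 andbT.
apply: le_eps => d d0.
pose A : R := 2 * q%:R + 2 * q'%:R + 1.
have A0 : 0 < A by rewrite /A; have : 0 <= q%:R :> R by []; have : 0 <= q'%:R :> R by []; lra.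
have [N0 hN] := pw_to0 b0 (divr_gt0 d0 A0).
have N1 : (0 < maxn N0 1)%N by exact: leq_maxr.
have := hN _ (leq_maxl N0 1); have := h _ N1; have := h' _ N1.
rewrite (@eq_big_nat _ _ _ _ _ (fun n => x' n * _) (fun n => x n * pw b n)); last first.
  by move=> n /andP[n0 _]; rewrite e.
rewrite ler_pdivlMr // /A; have := pw_ge0 b (maxn N0 1).
rewrite add0r !ler_norml => p0 /andP[? ?] /andP[? ?] ?; apply/andP; split; nra.
Qed.

Lemma pw_lip (b b' : R) n : (0 < n)%N -> 0 <= b -> b <= b' ->
  `|pw b n - pw b' n| <= n%:R * (b' - b).
Proof.
move=> n0 b0 bb; have n0' : (0 : R) < n%:R by rewrite ltr0n.
have p1 : pw b n <= 1 by exact: pw_le1.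
rewrite ger0_norm; last by rewrite subr_ge0 pw_le.
have -> : pw b' n = pw b n * pw (b' - b) n by rewrite -pwD //; congr pw; ring.
set d := b' - b; have d0 : 0 <= d by rewrite subr_ge0.
have e1 : 1 - d * ln n%:R <= pw d n.
  by rewrite pwE // mulNr; apply: le_trans (expR_ge1Dx _).
have l1 : ln n%:R <= n%:R - 1 :> R := ln_le_sub1 n0'.
have l0 : 0 <= ln n%:R :> R := ln_nat_ge0 R n.
have q0 := pw_ge0 b n.
have k1 := ler_wpM2l q0 e1; have k2 := ler_wpM2l d0 l1.
have k3 : pw b n * (d * ln n%:R) <= d * ln n%:R by rewrite ler_piMl // mulr_ge0.
lra.
Qed.

(** Intermediate value theorem in [b]. Continuity comes from the partial sums, which converge
    uniformly for [b >= 1 / 2] by the rate built into [isL]. *)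
Lemma isL_zero q x (b0 l0 l1 : R) : rchar q x -> 1 / 2 <= b0 -> b0 < 1 ->
  isL q x b0 l0 -> l0 <= 0 -> isL q x 1 l1 -> 0 < l1 ->
  exists b, [/\ b0 <= b, b < 1 & isL q x b 0].
Proof.
move=> hx b0h b01 h0 l00 h1 l10.
have [f hf] : exists f : R -> R, forall b, b0 <= b -> isL q x b (f b).
  suff /boolp.choice[f hf] : forall b : R, exists l : R, b0 <= b -> isL q x b l by exists f.
  move=> b.
  case: (leP b0 b) => bb; last by exists 0.
  have [|l hl] := @isL_exists R q x b hx _; first by lra.
  by exists l.
(* Freezing the function to the left of [b0] makes it continuous on the whole line. *)
pose g (b : R) := f (Num.max b0 b).
have mx (b : R) : b0 <= Num.max b0 b by rewrite le_max lexx.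
have cg : continuous g.
  move=> b; apply/cvgrPdist_le => e e0.
  pose A : R := 4 * q%:R + 1; have A0 : 0 < A by rewrite /A ltr_wpDl // mulr_ge0.
  have h2 : (0 : R) < 1 / 2 by lra.
  have [N0 hN] := pw_to0 h2 (divr_gt0 (divr_gt0 e0 (ltr0n R 2)) A0).
  pose N := maxn N0 1; have N1 : (0 < N)%N by exact: leq_maxr.
  have hN1 := hN N (leq_maxl N0 1).
  have NN : (0 : R) < N%:R * N%:R + 1 by rewrite ltr_wpDl // mulr_ge0.
  apply/nbhs_ballP; exists (e / 2 / (N%:R * N%:R + 1)) => /=; first by rewrite !divr_gt0.
  move=> b'; rewrite /ball /= => hb; rewrite /g.
  have m1 := mx b; have m2 := mx b'.
  have md : `|Num.max b0 b - Num.max b0 b'| <= `|b - b'|.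
    rewrite /Num.max; case: (ltP b0 b) => p1; case: (ltP b0 b') => p2; rewrite ?subrr ?normr0 //.
      by rewrite !ger0_norm; clear -m2 p1 p2; lra.
    by rewrite !ler0_norm; clear -m2 p1 p2; lra.
  set c := Num.max b0 b in m1 md *; set c' := Num.max b0 b' in m2 md *.
  have k1 := hf c m1 N N1; have k2 := hf c' m2 N N1.
  have k3 : pw c N <= pw (1 / 2) N by apply: pw_le => //; clear -b0h b01 l00 l10 hb m1; lra.
  have k4 : pw c' N <= pw (1 / 2) N by apply: pw_le => //; clear -b0h b01 l00 l10 h2 m2; lra.
  have k5 : `|\sum_(1 <= n < N.+1) x n * pw c n - \sum_(1 <= n < N.+1) x n * pw c' n| <= e / 2.
    rewrite -sumrB; apply: le_trans (ler_norm_sum _ _ _) _.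
    apply: le_trans (_ : \sum_(1 <= n < N.+1) N%:R * `|c - c'| <= _).
      rewrite big_nat [X in _ <= X]big_nat; apply: ler_sum => n /andP[n0 nN].
      rewrite -mulrBr normrM; apply: le_trans (_ : 1 * (n%:R * `|c - c'|) <= _); last first.
        by rewrite mul1r ler_wpM2r // ler_nat.
      apply: ler_pM => //; first exact: rchar_le1 hx.
      case: (leP c c') => cc.
        by rewrite [`|c - c'|]ler0_norm ?subr_le0 // opprB; apply: pw_lip => //; clear -b0h e0 m1; lra.
      rewrite distrC [`|c - c'|]ger0_norm ?subr_ge0 ?(ltW cc) //.
      by apply: pw_lip => //; clear -b0h m2 cc; lra.
    rewrite sumr_const_nat subn1 /= -[_ *+ N]mulr_natl mulrA.
    have k6 : `|c - c'| <= e / 2 / (N%:R * N%:R + 1) by apply: le_trans md (ltW hb).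
    apply: le_trans (ler_wpM2l _ k6) _; first by rewrite mulr_ge0.
    rewrite mulrCA -[X in _ <= X]mulr1 ler_wpM2l //; first by rewrite divr_ge0 // ltW.
    by rewrite ler_pdivrMr // mul1r lerDl.
  have k6 : 4 * q%:R * pw (1 / 2) N <= e / 2.
    have p0 := pw_ge0 (1 / 2) N : 0 <= _ :> R.
    clear -A0 h2 hN1 p0; by move: hN1; rewrite ler_pdivlMr // /A; lra.
  have q0 : 0 <= q%:R :> R by [].
  have k7 := ler_wpM2l q0 k3; have k8 := ler_wpM2l q0 k4.
  clear -k1 k2 k5 k6 k7 k8; move: k1 k2 k5; rewrite !ler_norml => /andP[? ?] /andP[? ?] /andP[? ?]; apply/andP; split; lra.
have g1 : g 1 = l1.
  by rewrite /g max_r ?(ltW b01) //; apply: isL_unique (hf 1 (ltW b01)) h1 _.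
have g0 : g b0 = l0.
  by rewrite /g max_l //; apply: isL_unique (hf b0 (lexx _)) h0 _ => //; lra.
have [|c] := @IVT R g b0 1 0 (ltW b01) (continuous_subspaceT cg).
  by rewrite g1 g0 ge_min le_max l00 (ltW l10) orbT.
rewrite in_itv /= => /andP[c0 c1] gc.
have hc : isL q x c 0 by rewrite -gc /g max_r //; exact: hf.
exists c; split => //; rewrite lt_neqAle c1 andbT; apply/eqP => c1'.
by move: gc; rewrite c1' g1 => l10'; rewrite l10' ltxx in l10.
Qed.

End FourFold.

(** * Number of prime factors and the product of 1 - 1/p *)

Section PrimeFactors.
Variable R : realType.

(** The i-th entry of an increasing list above [m] is at least [m + i], so the product is bounded
    below by a telescoping one. *)
Lemma prod_one_sub_inv_ge (s : seq nat) m : (0 < m)%N -> path ltn m s ->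
  m%:R / (m + size s)%:R <= \prod_(p <- s) (1 - p%:R^-1) :> R.
Proof.
elim: s m => [|p s IH] m m0 /=.
  by rewrite big_nil addn0 divff // pnatr_eq0 -lt0n.
move=> /andP[mp hp]; have p0 : (0 < p)%N by exact: leq_trans mp.
rewrite big_cons.
have p0' : (0 : R) < p%:R by rewrite ltr0n.
have i0 : 0 <= 1 - p%:R^-1 :> R by rewrite subr_ge0 invf_le1 // ler1n.
apply: le_trans (ler_wpM2l i0 (IH p p0 hp)).
rewrite (_ : (1 - p%:R^-1) * (p%:R / (p + size s)%:R) = (p - 1)%:R / (p + size s)%:R); last first.
  by rewrite natrB // mulrA mulrBl mulVf ?gt_eqF // mul1r.
rewrite ler_pdivrMr ?ltr0n ?addn_gt0 ?m0 // mulrAC ler_pdivlMr ?ltr0n ?addn_gt0 ?p0 //.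
rewrite -!natrM ler_nat; move: (size s) => k.
rewrite -(subnK mp); move: (p - m.+1)%N => r; nia.
Qed.

Lemma prod_primes_ge q : (0 < q)%N ->
  (size (primes q)).+1%:R^-1 <= \prod_(p <- primes q) (1 - p%:R^-1) :> R.
Proof.
move=> q0; have := @prod_one_sub_inv_ge (primes q) 1 isT; rewrite mul1r add1n; apply.
have := sorted_primes q; case E: (primes q) => [|p s] //= ->; rewrite andbT.
have : p \in primes q by rewrite E mem_head.
by rewrite mem_primes => /andP[/prime_gt1].
Qed.

Lemma exp2_size_primes q : (0 < q)%N -> (2 ^ size (primes q) <= q)%N.
Proof.
move=> q0; rewrite {2}(prod_prime_decomp q0) /primes size_map.
have := @mem_prime_decomp q; elim: (prime_decomp q) => [|[p e] s IH] h; first by rewrite big_nil.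
rewrite big_cons /= expnS leq_mul //; last by apply: IH => p' e' hp; apply: h; rewrite inE hp orbT.
have [pp e0 _] := h p e (mem_head _ _).
by apply: leq_trans (prime_gt1 pp) _; rewrite -[X in (X <= _)%N]expn1 leq_pexp2l // prime_gt0.
Qed.

Lemma half_le_ln2 : 1 / 2 <= ln 2 :> R.
Proof. by have := @ln_succ_ge R 1 isT; rewrite ln1 subr0 div1r. Qed.

Lemma size_primes_le q : (0 < q)%N -> (size (primes q))%:R <= 2 * ln q%:R :> R.
Proof.
move=> q0; have := exp2_size_primes q0; rewrite -(ler_nat R) => h.
have : ln (2 ^ size (primes q))%:R <= ln q%:R :> R.
  by rewrite ler_ln ?posrE ?ltr0n ?expn_gt0.
rewrite natrX lnXn // -[_ *+ _]mulr_natl; have := half_le_ln2.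
have : 0 <= (size (primes q))%:R :> R by [].
nra.
Qed.

End PrimeFactors.

(** * Siegel's lower bound for L(1, chi) *)

Section Siegel.
Variable R : realType.
Implicit Types (x u v : nat -> R) (q m n N M K p : nat).

Lemma sum_dvd_interval (F : nat -> R) p m k : (0 < p)%N ->
  \sum_(m <= n < m + k | (p %| n)%N) F n =
  \sum_((m + p.-1) %/ p <= e < (m + k + p.-1) %/ p) F (p * e)%N.
Proof.
move=> p0; elim: k => [|k IH]; first by rewrite !addn0 !big_geq.
rewrite addnS big_mkcond big_nat_recr ?leq_addr //= -big_mkcond IH.
have E : (((m + k).+1 + p.-1) %/ p = (m + k + p.-1) %/ p + (p %| m + k))%N.
  move: (m + k)%N => n; rewrite {1 2}(divn_eq n p) addSn -addnS prednK //.
  have := ltn_pmod n p0; set a := (n %/ p)%N; set r := (n %% p)%N => rp.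
  have -> : (p %| n)%N = (r == 0)%N by [].
  rewrite -!addnA !divnMDl //; case: (posnP r) => [->|r0].
    by rewrite !add0n divnn p0 (divn_small (_ : p.-1 < p)%N) ?prednK // addn0.
  have -> : ((r + p) %/ p = 1)%N by rewrite divnDr // divnn p0 divn_small.
  have -> : (r + p.-1 = 1 * p + r.-1)%N by lia.
  by rewrite divnMDl // (divn_small (_ : r.-1 < p)%N) ?addn0 //; lia.
rewrite E; case: (boolP (p %| m + k)%N) => h; last by rewrite addn0 addr0.
rewrite addn1 big_nat_recr /=; last first.
  by rewrite leq_div2r // leq_add2r leq_addr.
congr (_ + F _); have /dvdnP[t ht] := h.
by rewrite ht divnMDl // (divn_small (_ : p.-1 < p)%N) ?addn0 ?prednK // mulnC.
Qed.

(** Removing the Euler factor at [p]. The deleted terms are [x p] times a sum of [x] over another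
    interval, so partial sums at most double, which [p q] majorises. *)
Lemma rchar_remove q x p l : rchar q x -> prime p -> isL q x 1 l ->
  let x' n := if (p %| n)%N then 0 else x n in
  rchar (p * q) x' /\ isL (p * q) x' 1 (l * (1 - x p / p%:R)).
Proof.
move=> hx pp hl x'; have [q0 x1 xM xv xs] := hx.
have p0 := prime_gt0 pp; have p1 := prime_gt1 pp.
have p0' : (0 : R) < p%:R by rewrite ltr0n.
have xp := rchar_le1 p hx.
have hx' : rchar (p * q) x'.
  split; rewrite ?muln_gt0 ?p0 //.
  - by rewrite /x' dvdn1; case: eqP => // E; rewrite E in p1.
  - move=> d e; rewrite /x' Euclid_dvdM // xM.
    by case: (p %| d)%N; case: (p %| e)%N => /=; rewrite ?mul0r ?mulr0.
  - move=> n; rewrite /x' coprimeMr (coprime_sym n p) prime_coprime //.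
    by case: (p %| n)%N => //=; exact: xv.
  move=> m k.
  have -> : \sum_(m <= n < m + k) x' n = \sum_(m <= n < m + k) x n - \sum_(m <= n < m + k | (p %| n)%N) x n.
    rewrite [X in _ - X]big_mkcond -sumrB /=; apply: eq_bigr => n _; rewrite /x'.
    by case: ifP => _; rewrite ?subrr ?subr0.
  apply: le_trans (ler_normB _ _) _.
  rewrite sum_dvd_interval //; set A := (_ %/ p)%N; set B := (_ %/ p)%N.
  have AB : (A <= B)%N by rewrite leq_div2r // leq_add2r leq_addr.
  have h2 : `|\sum_(A <= e < B) x (p * e)%N| <= q%:R.
    under eq_bigr do rewrite xM.
    rewrite -mulr_sumr normrM -(subnKC AB).
    by apply: le_trans (xs A (B - A)%N); rewrite ler_piMl.
  apply: le_trans (lerD (xs m k) h2) _; rewrite natrM.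
  have : (2 : R) <= p%:R by rewrite ler_nat.
  have : 0 <= q%:R :> R by [].
  nra.
split=> //; have [|l' hl'] := isL_exists hx' (_ : 0 < 1); first exact: ltr01.
suff -> : l * (1 - x p / p%:R) = l' by [].
apply/eqP; rewrite -subr_eq0 -normr_eq0 eq_le normr_ge0 andbT.
apply: le_eps => d d0; rewrite add0r.
pose A : R := 4 * q%:R + 2 * (p * q)%:R + 1.
have A0 : 0 < A by rewrite ltr_wpDl // addr_ge0 // mulr_ge0.
have [N0 hN] := pw_to0 (@ltr01 R) (divr_gt0 d0 A0).
pose M := maxn N0 1; have M0 : (0 < M)%N by exact: leq_maxr.
have hM := hN M (leq_maxl _ _).
(* With this length the multiples of [p] up to [N] are exactly the [p e] with [e <= M]. *)
pose N := (p * M)%N; have NM : (M <= N)%N by rewrite leq_pmull.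
have N1 : (0 < N)%N by exact: leq_trans NM.
have pN : pw 1 N <= pw 1 M :> R by apply: pwMn => //; exact: ler01.
have E : \sum_(1 <= n < N.+1) x' n * pw 1 n =
    \sum_(1 <= n < N.+1) x n * pw 1 n - x p / p%:R * \sum_(1 <= n < M.+1) x n * pw 1 n.
  have -> : x p / p%:R * \sum_(1 <= n < M.+1) x n * pw 1 n =
      \sum_(1 <= n < N.+1 | (p %| n)%N) x n * pw 1 n.
    rewrite sum_multiples // /N mulKn // mulr_sumr; apply: eq_bigr => e _.
    by rewrite xM pwM (pw_oneE R p0); ring.
  rewrite [X in _ - X]big_mkcond -sumrB /=; apply: eq_bigr => n _; rewrite /x'.
  by case: ifP => _; rewrite ?mul0r ?subrr ?subr0.
have := hl' N N1; have := hl N N1; have := hl M M0; rewrite E.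
set S := \sum_(_ <= n < _) _; set T := \sum_(_ <= n < _) _ => h1 h2 h3.
have k0 : `|x p / p%:R| <= 1.
  rewrite normrM normfV (gtr0_norm p0') ler_pdivrMr // mul1r; apply: le_trans xp _.
  by rewrite ler1n.
rewrite (_ : _ - l' = - (T - l) + x p / p%:R * (S - l) + (T - x p / p%:R * S - l')); last by ring.
apply: le_trans (ler_normD _ _) _; apply: le_trans (lerD (ler_normD _ _) h3) _.
rewrite normrN normrM.
have k1 : `|x p / p%:R| * `|S - l| <= 1 * `|S - l| by rewrite ler_wpM2r.
move: hM; rewrite ler_pdivlMr // /A => hM.
have k2 : 2 * q%:R * pw 1 N <= 2 * q%:R * pw 1 M :> R by rewrite ler_wpM2l // mulr_ge0.
have k3 : 2 * (p * q)%:R * pw 1 N <= 2 * (p * q)%:R * pw 1 M :> R by rewrite ler_wpM2l // mulr_ge0.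
have := pw_ge0 1 M : 0 <= _ :> R.
clear -h1 h2 k1 hM k2 k3; lra.
Qed.

Lemma rchar_remove_seq (s : seq nat) q x l : all prime s -> uniq s ->
  rchar q x -> isL q x 1 l -> exists q',
  isL q' (fun n => if has (fun p => p %| n)%N s then 0 else x n) 1
    (l * \prod_(p <- s) (1 - x p / p%:R)).
Proof.
move=> hs us hx hl.
suff [q' [_ h]] : exists q',
  rchar q' (fun n => if has (fun p => p %| n)%N s then 0 else x n) /\
  isL q' (fun n => if has (fun p => p %| n)%N s then 0 else x n) 1
    (l * \prod_(p <- s) (1 - x p / p%:R)) by exists q'.
elim: s hs us => [|p s IH] /=; first by exists q; rewrite big_nil mulr1.
move=> /andP[pp hs] /andP[ps us]; have [q' [h1 h2]] := IH hs us.
have := rchar_remove h1 pp h2.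
have -> : has (fun p' => p' %| p)%N s = false.
  apply/negbTE/hasPn => r rs; apply/negP; rewrite dvdn_prime2 //; last by exact: (allP hs).
  by move=> /eqP E; move: ps; rewrite -E rs.
have E : (fun n => if (p %| n)%N then 0 else if has (fun p => p %| n)%N s then 0 else x n) =
  (fun n => if (p %| n)%N || has (fun p => p %| n)%N s then 0 else x n).
  by apply/funext => n; case: (p %| n)%N.
rewrite /= E => -[h3 h4]; exists (p * q')%N; split=> //.
by rewrite big_cons mulrCA mulrC mulrA mulrAC mulrC mulrA in h4 *.
Qed.

Definition realchar q x := (0 < q)%N /\ dchar q (fun n => (x n)%:C).

Definition npr q x := realchar q x /\ ~ principal q (fun n => (x n)%:C).

Lemma realchar_vals q x : realchar q x -> [/\ x 1%N = 1,
  forall d e, x (d * e)%N = x d * x e, forall n, coprime n q -> x n ^+ 2 = 1 &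
  forall n, ~~ coprime n q -> x n = 0].
Proof.
move=> [q0 [[c1 cM _] _ h1 h0]]; split.
- by have := congr1 Re c1.
- by move=> d e; have := congr1 Re (cM d e); rewrite cReM_real.
- by move=> n /h1; rewrite cn_real => h; rewrite -(real_normK (num_real _)) h expr1n.
by move=> n /h0 h; have := congr1 Re h.
Qed.

Lemma npr_rchar q x : npr q x -> rchar q x.
Proof.
move=> [hx np]; have [v1 vM v2 v3] := realchar_vals hx; have [q0 hd] := hx.
split=> //.
- by move=> n; case: ifP => [/v2|/negbT/v3].
by move=> m k; have := dchar_partial m k q0 hd np; rewrite -rmorph_sum cn_real.
Qed.

Lemma realchar_mul q r x y : realchar q x -> realchar r y ->
  realchar (q * r) (fun n => x n * y n).
Proof.
move=> [q0 hx] [r0 hy]; split; first by rewrite muln_gt0 q0.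
by have := dchar_mul hx hy; under eq_fun do rewrite -rmorphM.
Qed.

Lemma conv_bound u v n : (forall m, `|u m| <= 1) -> (forall m, `|v m| <= 1) -> (0 < n)%N ->
  `|conv u v n| <= n%:R.
Proof.
move=> hu hv n0; rewrite /conv (sum_divisors _ n0 (leqnn n)).
apply: le_trans (ler_norm_sum _ _ _) _.
apply: le_trans (_ : \sum_(1 <= d < n.+1 | (d %| n)%N) 1 <= _).
  by apply: ler_sum => d _; rewrite normrM -[X in _ <= X]mulr1 ler_pM.
rewrite big_mkcond; apply: le_trans (_ : \sum_(1 <= d < n.+1) 1 <= _).
  by apply: ler_sum => d _; case: ifP.
by rewrite sumr_const_nat subn1.
Qed.

(** The logarithmic derivative of the fourfold product has coefficients
    [(1 + x1)(1 + x2) Lambda >= 0]. *)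
Lemma four_fold_ge0 x1 x2 n : (forall m, -1 <= x1 m) -> (forall m, -1 <= x2 m) ->
  (forall d e, x1 (d * e)%N = x1 d * x1 e) -> (forall d e, x2 (d * e)%N = x2 d * x2 e) ->
  x1 1%N = 1 -> x2 1%N = 1 -> (0 < n)%N ->
  0 <= conv (conv x2 (fun m => x1 m * x2 m)) (conv x1 (onef R)) n.
Proof.
move=> l1 l2 m1 m2 e1 e2; set h := conv x2 _; set g := conv x1 _.
pose k m := (1 + x1 m) * (1 + x2 m) * vM R m.
have m12 d e : x1 (d * e)%N * x2 (d * e)%N = x1 d * x2 d * (x1 e * x2 e).
  by rewrite m1 m2 mulrACA.
apply: (@nonneg_rec R _ k).
- by rewrite /h /g !conv1 e1 e2 /onef !mulr1.
- move=> m m0; rewrite (conv_deriv _ _ (@lgadd_ln R) m0).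
  have h1 : conv (fun m => ln m%:R * h m) g m = conv (fun m => (x2 m + x1 m * x2 m) * vM R m) (conv h g) m.
    rewrite convA //; apply: eq_conv => // d dn; rewrite /h ln_conv_mul //.
    exact: dvdn_gt0 dn.
  have h2 : conv h (fun m => ln m%:R * g m) m = conv (fun m => (1 + x1 m) * vM R m) (conv h g) m.
    rewrite [RHS]convC // -convA //; apply: eq_conv => // d dn.
    by rewrite /g ln_conv_one ?(dvdn_gt0 m0 dn) // convC ?(dvdn_gt0 m0 dn).
  by rewrite h1 h2 -convDl; apply: eq_conv => // d _; rewrite /k; ring.
- by move=> m; rewrite /k !mulr_ge0 ?vM_ge0 //; have := l1 m; have := l2 m; lra.
by rewrite /k vM1 mulr0.
Qed.

Lemma isL_one_le_ln q x l : rchar q x -> isL q x 1 l -> l <= 3 + ln q%:R.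
Proof.
move=> hx hl; have [q0 _ _ _ _] := hx; have := hl q q0; rewrite pw_oneE // -mulrA divff; last first.
  by rewrite pnatr_eq0 -lt0n.
rewrite mulr1 ler_norml => /andP[h _].
have : \sum_(1 <= n < q.+1) x n * pw 1 n <= \sum_(1 <= n < q.+1) (n%:R^-1 : R).
  rewrite big_nat [X in _ <= X]big_nat; apply: ler_sum => n /andP[n0 _].
  rewrite pw_oneE // -[X in _ <= X]mul1r ler_wpM2r ?invr_ge0 //.
  by apply: le_trans (ler_norm _) _; exact: rchar_le1 hx.
have := harmonic_le R q0; lra.
Qed.

Lemma sum_ge_first (f : nat -> R) N : (0 < N)%N -> (forall n, (0 < n)%N -> 0 <= f n) ->
  f 1%N <= \sum_(1 <= n < N.+1) f n.
Proof.
move=> N0 f0; rewrite big_ltn ?ltnS // lerDl big_nat_cond; apply: sumr_ge0 => i /andP[/andP[i0 _] _].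
by apply: f0; exact: ltn_trans i0.
Qed.

Lemma nat_ge (a : R) : exists k, (0 < k)%N /\ a <= k%:R.
Proof. by exists (Num.truncn a).+1; split=> //; rewrite ltW // truncnS_gt. Qed.

Lemma siegel_nonneg (e : R) : 0 < e -> e <= 1 / 100 -> exists2 c : R, 0 < c &
  forall q x l lb, rchar q x -> isL q x 1 l -> isL q x (1 - e) lb -> 0 <= lb -> c * pw (4 * e) q <= l.
Proof.
move=> e0 e1; have [||z [C [z0 C0 hC]]] := @two_factor R (1 - e); try lra.
have [k [k0 kC]] := nat_ge (2 * C).
have k0' : (0 : R) < k%:R by rewrite ltr0n.
exists (e / 2 * pw (4 * e) k); first by rewrite mulr_gt0 ?pw_gt0 //; lra.
move=> q x l lb hx hl hlb lb0; have [q0 x1 _ _ _] := hx.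
have q0' : (0 : R) < q%:R by rewrite ltr0n.
(* The error is at most [C q N ^ (- 1 / 4) = C / k <= 1 / 2]. *)
pose N := ((k * q) ^ 4)%N.
have kq0 : (0 < k * q)%N by rewrite muln_gt0 k0.
have N0 : (0 < N)%N by rewrite expn_gt0 kq0.
have := hC q x l lb N hx hl hlb N0.
have := @sum_ge_first (fun n => conv x (onef R) n * pw (1 - e) n) N N0.
rewrite conv1 x1 {1}/onef pw1 !mulr1 => h0.
have {h0} h1 : 1 <= \sum_(1 <= n < N.+1) conv x (onef R) n * pw (1 - e) n.
  by apply: h0 => n n0; rewrite mulr_ge0 ?pw_ge0 // (conv_one_ge0 hx).
move=> /(le_trans (ler_norm _)); rewrite lerBlDr => h2.
have zl : z * lb <= 0 by rewrite mulr_le0_ge0.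
have h3 : C * q%:R * pw (1 - e - 1 / 2) N <= 1 / 2.
  apply: le_trans (_ : C * q%:R * pw (1 / 4) N <= _).
    by rewrite ler_wpM2l ?mulr_ge0 // pw_le //; clear -e0 e1 z0 C0; lra.
  rewrite pwX (_ : 4%:R * (1 / 4) = 1); last by field.
  rewrite pw_oneE // natrM ler_pdivrMr ?mulr_gt0 //; clear -k0 kC k0' lb0 q0 x1 q0' kq0; nra.
have h4 : 1 / 2 <= l * N%:R `^ e / e.
  clear -h1 h2 zl h3; by move: h2; rewrite (_ : 1 - (1 - e) = e); [lra|ring].
have h5 : pw e N = pw (4 * e) k * pw (4 * e) q by rewrite pwX pwM.
rewrite -mulrA -h5.
have h6 : N%:R `^ e * pw e N = 1.
  by rewrite /pw -powRD ?subrr ?powRr0 // pnatr_eq0 -lt0n N0 implybT.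
have h7 : 0 < pw e N by exact: pw_gt0.
clear -e e0 h4 h6 h7; move: h4; rewrite ler_pdivlMr // => /(ler_wpM2r (ltW h7)); rewrite -[X in _ <= X]mulrA h6 mulr1; lra.
Qed.

(** If [x1 x] is principal, the two characters agree on integers prime to [q q1], so their values at
    1 differ by finitely many Euler factors. Those at primes of [q] lose at most a logarithm of [q];
    those at primes of [q1] are bounded by [q1]. *)
Lemma siegel_related q1 x1 l1 : npr q1 x1 -> isL q1 x1 1 l1 -> exists2 c : R, 0 < c &
  forall q x l, npr q x -> isL q x 1 l ->
  principal (q1 * q) (fun n => (x1 n * x n)%:C) -> c <= l * (1 + 2 * ln q%:R).
Proof.
move=> hx1 hl1; have r1 := npr_rchar hx1; have l10 := L1_gt0 r1 hl1.
have [rc1 _] := hx1; have [q10 _] := rc1; have [a1 aM a2 a3] := realchar_vals rc1.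
have q10' : (0 : R) < q1%:R by rewrite ltr0n.
exists (l1 / q1%:R); first by rewrite divr_gt0.
move=> q x l hx hl hp; have r := npr_rchar hx; have l0 := L1_gt0 r hl.
have [rc _] := hx; have [q0 _] := rc; have [b1 bM b2 b3] := realchar_vals rc.
have pr n : all prime (primes n) by apply/allP => p; rewrite mem_primes => /andP[].
have [r1' h1] := rchar_remove_seq (pr q) (primes_uniq q) r1 hl1.
have [r2' h2] := rchar_remove_seq (pr q1) (primes_uniq q1) r hl.
have hasP n m : (0 < m)%N -> (0 < n)%N -> has (fun p => p %| n)%N (primes m) = ~~ coprime n m.
  move=> m0 n0; rewrite coprime_has_primes // negbK; apply: eq_in_has => p.
  by rewrite !mem_primes => /and3P[-> _ _]; rewrite n0.
set P1 := \prod_(p <- primes q) _ in h1; set P2 := \prod_(p <- primes q1) _ in h2.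
have E : l1 * P1 = l * P2.
  apply: isL_unique ltr01 h1 h2 _ => n n0; rewrite !hasP //.
  case: (boolP (coprime n q)) => cq; case: (boolP (coprime n q1)) => cq1 //=.
  - have := hp n; rewrite coprimeMr cq cq1 => /(_ isT) h.
    have {}h := congr1 Re h; rewrite /= in h.
    have := b2 n cq; rewrite expr2 => hb; rewrite -[LHS]mulr1 -hb mulrA h mul1r.
    by [].
  - exact: a3.
  by rewrite b3.
have ip p : 0 <= p%:R^-1 :> R /\ p%:R^-1 <= 1 :> R.
  rewrite invr_ge0; split => //; case: p => [|p]; first by rewrite invr0.
  by rewrite invf_le1 ?ler1n ?ltr0n.
have P1ge : (size (primes q)).+1%:R^-1 <= P1.
  apply: le_trans (prod_primes_ge R q0) _; apply: ler_prod => p _.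
  have [i0 i1] := ip p; rewrite subr_ge0 i1 /= lerD2l lerN2 -[X in _ <= X]mul1r ler_wpM2r //.
  by apply: le_trans (ler_norm _) (rchar_le1 p r1).
have P2le : P2 <= q1%:R.
  apply: le_trans (_ : \prod_(p <- primes q1) 2 <= _).
    apply: ler_prod => p _; have [i0 i1] := ip p.
    have : `|x p / p%:R| <= 1.
      rewrite normrM (ger0_norm i0) -[X in _ <= X]mulr1 ler_pM //; exact: rchar_le1 r.
    clear -q1 x1 l1 hx1 hl1; by rewrite ler_norml => /andP[? ?]; apply/andP; split; lra.
  by rewrite big_const_seq count_predT iter_mulr_1 -natrX ler_nat exp2_size_primes.
set S := (size (primes q)).+1 in P1ge.
have S0 : (0 : R) < S%:R by rewrite ltr0n.
have S1 : S%:R <= 1 + 2 * ln q%:R :> R.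
  by have := size_primes_le R q0; rewrite /S -natr1 addrC; lra.
rewrite ler_pdivrMr //.
have k1 : l1 <= l * P2 * S%:R.
  rewrite -E -ler_pdivrMr // ler_wpM2l // ltW //.
apply: le_trans k1 _.
have k2 : l * P2 * S%:R <= l * q1%:R * S%:R by rewrite ler_wpM2r // ler_wpM2l // ltW.
apply: le_trans k2 _; rewrite mulrAC ler_wpM2r //.
by rewrite ler_wpM2l // ltW.
Qed.

(** The fourfold sum at a zero [b] of L(s, x1): its first term is 1, and with L(b, x1) = 0 the only
    main term is a multiple of L(1, x) L(1, x1 x), which is therefore not too small. *)
Lemma siegel_unrelated q1 x1 (l1 b e : R) : npr q1 x1 -> isL q1 x1 1 l1 -> isL q1 x1 b 0 ->
  99 / 100 <= b -> b < 1 -> 1 - b <= e -> exists2 c : R, 0 < c &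
  forall q x l l12, npr q x -> isL q x 1 l -> rchar (q1 * q) (fun n => x1 n * x n) ->
  isL (q1 * q) (fun n => x1 n * x n) 1 l12 -> c * pw (160 * e) q <= l * l12.
Proof.
move=> hx1 hl1 hb1 b9 b1 be; have r1 := npr_rchar hx1; have l10 := L1_gt0 r1 hl1.
have [rc1 _] := hx1; have [q10 _] := rc1; have [a1 aM a2 a3] := realchar_vals rc1.
have q10' : (0 : R) < q1%:R by rewrite ltr0n.
have b12 : 1 / 2 <= b by lra.
have [z [C [z0 C0 hC]]] := two_factor b12 b1.
pose a := l1 / (1 - b); have a0 : 0 < a by rewrite divr_gt0 // subr_gt0.
pose E := C * q1%:R; have E0 : 0 <= E by rewrite mulr_ge0.
(* 314 is twice 157, and 157 bounds 3 * 52 + 1 from the error term of [four_fold]. *)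
have [k [k0 kE]] := nat_ge (314 * (a + E) * q1%:R).
have k0' : (0 : R) < k%:R by rewrite ltr0n.
exists (pw (160 * e) k / (2 * a)); first by rewrite divr_gt0 ?pw_gt0 // mulr_gt0.
move=> q x l l12 hx hl r12 hl12; have r := npr_rchar hx; have l0 := L1_gt0 r hl.
have [rc _] := hx; have [q0 _] := rc; have [c1 cM c2 c3] := realchar_vals rc.
have q0' : (1 : R) <= q%:R by rewrite ler1n.
have kq0 : (0 < k * q)%N by rewrite muln_gt0 k0.
have b0 : 0 < b by clear -b9 b1 be l10 q10; lra.
have [lb hlb] := isL_exists r b0; have [lb12 hlb12] := isL_exists r12 b0.
(* The error factor [y ^ (- 1 / 10)] becomes [(k q) ^ (- 2)], which compensates the [q ^ 2] in [D];
   and [N = y ^ 8 = (k q) ^ 160] explains the exponent [160 e]. *)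
pose y := ((k * q) ^ 20)%N; have y0 : (0 < y)%N by rewrite expn_gt0 kq0.
set x12 := fun n => x1 n * x n in r12 hl12 hlb12.
pose D : R := 52 * (q%:R * (q1 * q)%:R).
have D0 : 0 <= D by rewrite !mulr_ge0.
have hG N : (0 < N)%N -> `|\sum_(1 <= n < N.+1) conv x1 (onef R) n * pw b n - a * N%:R `^ (1 - b)| <=
    E * pw (b - 1 / 2) N.
  move=> N0; have := hC q1 x1 l1 0 N r1 hl1 hb1 N0; rewrite mulr0 addr0.
  by rewrite /a (mulrAC l1 _ (_ `^ _)).
have hH N : (0 < N)%N -> `|\sum_(1 <= n < N.+1) conv x x12 n * pw b n - lb * lb12| <= D * pw (1 / 5) N.
  by move=> N0; apply: rchar_conv_sum => //; [(clear -b9 b1; lra)|exact: ltW].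
have hM N : (0 < N)%N -> `|\sum_(1 <= n < N.+1) conv x x12 n * pw 1 n - l * l12| <= D * pw (1 / 5) N.
  by move=> N0; apply: rchar_conv_sum => //; clear -b9; lra.
have g0 n : (0 < n)%N -> 0 <= conv x1 (onef R) n by move=> n0; exact: conv_one_ge0 r1 n0.
have hh n : (0 < n)%N -> `|conv x x12 n| <= n%:R.
  by move=> n0; apply: conv_bound n0 => m; [exact: rchar_le1 r|exact: rchar_le1 r12].
have := four_fold b9 b1 y0 g0 hh (ltW a0) E0 D0 hG hH hM.
pose N := (y ^ 8)%N; have N0 : (0 < N)%N by rewrite expn_gt0 y0.
rewrite -/N => h1.
have h2 : 1 <= \sum_(1 <= n < N.+1) conv (conv x x12) (conv x1 (onef R)) n * pw b n.
  have := @sum_ge_first (fun n => conv (conv x x12) (conv x1 (onef R)) n * pw b n) N N0.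
  have x121 : x12 1%N = 1 by rewrite /x12 a1 c1 mulr1.
  have o1 : onef R 1 = 1 by [].
  rewrite /= (conv1 (conv x x12)) (conv1 x) (conv1 x1) a1 c1 x121 o1 pw1 !mulr1; apply => n n0.
  rewrite mulr_ge0 ?pw_ge0 //; apply: four_fold_ge0 => //.
  - by move=> m; apply: rchar_ge r1.
  - by move=> m; apply: rchar_ge r.
have h3 : (3 * D + 1) * (a + E) * pw (1 / 10) y <= 1 / 2.
  rewrite /y pwX (_ : 20%:R * (1 / 10) = 2%:R); last by field.
  rewrite pw_nat natrM exprMn /D natrM.
  rewrite ler_pdivrMr; last by rewrite mulr_gt0 // exprn_gt0 // ltr0n.
  have k1 : 1 <= k%:R :> R by rewrite ler1n.
  have q11 : 1 <= q1%:R :> R by rewrite ler1n.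
  have aE : 0 <= a + E by rewrite addr_ge0 // ltW.
  have k2 : k%:R <= k%:R ^+ 2 :> R by rewrite ler_eXnr.
  have k3 : 1 <= q1%:R * q%:R ^+ 2 :> R by rewrite mulr_ege1 // exprn_ege1.
  apply: le_trans (_ : 157 * (q1%:R * q%:R ^+ 2) * (a + E) <= _).
    by rewrite ler_wpM2r //; clear -aE k2 k3; lra.
  have k4 : 314 * (a + E) * q1%:R * q%:R ^+ 2 <= k%:R ^+ 2 * q%:R ^+ 2.
    by rewrite ler_wpM2r ?exprn_ge0 // (le_trans kE).
  clear -aE k2 k3 k4; lra.
have h4 : 1 / 2 <= a * (l * l12) * pw (b - 1) N by clear -h1 h2 h3; lra.
have h5 : pw (b - 1) N * pw (1 - b) N = 1.
  by rewrite -pwD // (_ : b - 1 + (1 - b) = 0); [rewrite /pw oppr0 powRr0|ring].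
have h6 : pw (160 * e) k * pw (160 * e) q <= pw (1 - b) N.
  rewrite /N /y -expnM pwX -pwM; apply: pw_le => //.
  by rewrite (_ : (20 * 8)%N%:R = 160) //; clear -b9 b1 be; lra.
have h7 : 0 < pw (1 - b) N by exact: pw_gt0.
have h8 : 1 / 2 * pw (1 - b) N <= a * (l * l12).
  by have := ler_wpM2r (ltW h7) h4; rewrite -[X in _ <= X]mulrA h5 mulr1.
have a20 : 0 < 2 * a by rewrite mulr_gt0.
rewrite [X in X <= _]mulrAC ler_pdivrMr //; apply: le_trans h6 _.
rewrite (_ : l * l12 * (2 * a) = 2 * (a * (l * l12))); last by ring.
by move: h8; clear; lra.
Qed.

(* Ineffective: if some real L-function vanishes close to 1, all other characters are compared with it. *)
Theorem siegel (d : R) : 0 < d -> exists2 c : R, 0 < c &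
  forall q x l, npr q x -> isL q x 1 l -> c * pw d q <= l.
Proof.
(* With [160 e <= d / 2], a factor [q ^ (- d / 2)] is left over to pay for the logarithm in the
   upper bound of L(1, x1 x). *)
move=> d0; pose e : R := Num.min (1 / 100) (d / 400).
have e0 : 0 < e by rewrite lt_min; apply/andP; split; lra.
have e1 : e <= 1 / 100 by rewrite ge_min lexx.
have ed : e <= d / 400 by rewrite ge_min lexx orbT.
have [c1 c10 hc1] := siegel_nonneg e0 e1.
have b0 : 0 < 1 - e by lra.
have [hall|] := pselect (forall q x lb, npr q x -> isL q x (1 - e) lb -> 0 <= lb).
  exists c1 => // q x l hx hl; have r := npr_rchar hx.
  have [lb hlb] := isL_exists r b0; have [q0 _ _ _ _] := r.
  apply: le_trans (hc1 q x l lb r hl hlb (hall q x lb hx hlb)).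
  by rewrite ler_pM2l // pw_le //; lra.
move=> /existsNP[q1 /existsNP[x1 /existsNP[lb1 /not_implyP[hx1 /not_implyP[hlb1 /negP]]]]].
rewrite -ltNge => lb1n; have r1 := npr_rchar hx1; have [q10 _ _ _ _] := r1.
have [l1 hl1] := isL_exists r1 ltr01; have l10 := L1_gt0 r1 hl1.
have [b [eb b1 hb]] : exists b, [/\ 1 - e <= b, b < 1 & isL q1 x1 b 0].
  clear -e0 e1 hlb1 lb1n r1 hl1 l10; by apply: isL_zero r1 _ _ hlb1 (ltW lb1n) hl1 l10; lra.
have [c2 c20 hc2] := siegel_related hx1 hl1.
have [||c3 c30 hc3] := siegel_unrelated hx1 hl1 hb _ b1 (_ : 1 - b <= e); try (clear -e1 eb; lra).
have d20 : 0 < d / 2 by clear -d0; lra.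
pose A : R := 3 + ln q1%:R + 2 / d; pose B : R := 1 + 4 / d.
have lq1 : 0 <= ln q1%:R :> R by exact: ln_nat_ge0.
have A0 : 0 < A.
  rewrite /A; have : 0 < 2 / d by rewrite divr_gt0.
  by clear -c30 d20 lq1; lra.
have B0 : 0 < B.
  rewrite /B; have : 0 < 4 / d by rewrite divr_gt0.
  by clear -d0 e0; lra.
exists (Num.min (c3 / A) (c2 / B)); first by rewrite lt_min !divr_gt0.
move=> q x l hx hl; have r := npr_rchar hx; have [q0 _ _ _ _] := r; have l0 := L1_gt0 r hl.
have q1' : 1 <= q%:R :> R by rewrite ler1n.
have lnq : ln q%:R <= q%:R `^ (d / 2) / (d / 2) by apply: ln_le_powR.
have pq1 : 1 <= q%:R `^ (d / 2) by rewrite -[X in X <= _](powRr0 (q%:R : R)) ler_powR // ltW.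
have pp : q%:R `^ (d / 2) * pw (d / 2) q = 1.
  by rewrite /pw -powRD ?subrr ?powRr0 // pnatr_eq0 -lt0n q0 implybT.
have pd : pw d q = pw (d / 2) q * pw (d / 2) q by rewrite -pwD //; congr pw; field.
have pdl : pw d q <= pw (d / 2) q by apply: pw_le => //; clear -d0; lra.
have p0 : 0 < pw (d / 2) q by exact: pw_gt0.
have i2 : (d / 2)^-1 = 2 / d by rewrite invf_div.
have [hp|hp] := pselect (principal (q1 * q) (fun n => (x1 n * x n)%:C)).
  apply: le_trans (_ : c2 / B * pw d q <= _).
    by rewrite ler_wpM2r ?pw_ge0 // ge_min lexx orbT.
  rewrite mulrAC ler_pdivrMr //.
  have h1 := hc2 q x l hx hl hp.
  have h2 : 1 + 2 * ln q%:R <= B * q%:R `^ (d / 2).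
    clear -lnq pq1 pp i2 hp h1; by rewrite /B; move: lnq pq1; rewrite i2; lra.
  have h3 : c2 <= l * (B * q%:R `^ (d / 2)) by apply: le_trans h1 _; rewrite ler_pM2l.
  have := ler_wpM2r (ltW p0) h3; rewrite -!mulrA pp mulr1.
  by apply: le_trans; rewrite ler_pM2l.
have r12 : rchar (q1 * q) (fun n => x1 n * x n).
  by apply: npr_rchar; split=> //; apply: realchar_mul; [case: hx1|case: hx].
have [l12 hl12] := isL_exists r12 ltr01.
apply: le_trans (_ : c3 / A * pw d q <= _).
  by rewrite ler_wpM2r ?pw_ge0 // ge_min lexx.
have h1 := hc3 q x l l12 hx hl r12 hl12.
have h2 : l12 <= A * q%:R `^ (d / 2).
  apply: le_trans (isL_one_le_ln r12 hl12) _.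
  rewrite natrM lnM ?posrE ?ltr0n // /A.
  have k1 : 3 + ln q1%:R <= (3 + ln q1%:R) * q%:R `^ (d / 2) :> R by rewrite ler_peMr //; clear -lq1; lra.
  clear -q1' lnq p0 i2 k1; by move: lnq; rewrite i2; lra.
have h3 : l * l12 <= l * (A * q%:R `^ (d / 2)) by rewrite ler_pM2l.
have h4 : c3 * pw (d / 2) q <= c3 * pw (160 * e) q by rewrite ler_pM2l // pw_le //; clear -d0 ed; lra.
have h5 := ler_wpM2r (ltW p0) (le_trans h4 (le_trans h1 h3)).
rewrite mulrAC ler_pdivrMr //; move: h5; rewrite -!mulrA -pd pp mulr1.
by [].
Qed.

End Siegel.

(** * From upper bounds to lower bounds for L-functions *)

Section LowerBounds.
Variable R : realType.
Local Notation C := R[i].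
Implicit Types (psi chi : nat -> C) (s t W : R).

Lemma cn_LL_lip psi s s' B : cmult psi -> 1 < s -> s <= s' ->
  (forall x, s <= x -> x <= s' -> cn (LL psi 1 x) <= B) ->
  cn (LL psi 0 s' - LL psi 0 s) <= 2 * B * (s' - s).
Proof.
move=> hp s1 ss hB; rewrite !LL0E //; last exact: lt_le_trans ss.
apply: (@DS_lip R psi 1 0) => // n n0.
by rewrite expr0 mulr1; case: hp.
Qed.

(* Moving s to the right by eta = (kappa / W ^ 2) ^ 4 costs K W eta, which is half of what the
   eighth-power bound gives at 1 + eta. *)
Lemma lower_transfer (c1 K : R) : 0 < c1 -> c1 <= 1 -> 1 <= K -> exists2 c : R, 0 < c &
  forall psi W s0, cmult psi -> 1 <= W -> 1 < s0 -> s0 <= 2 ->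
  (forall s, s0 <= s -> s <= 2 -> c1 * (s - 1) ^+ 6 <= cn (LL psi 0 s) ^+ 8 * W ^+ 2) ->
  (forall s, s0 <= s -> s <= 2 -> cn (LL psi 1 s) <= K * W) ->
  c * W^-1 ^+ 7 <= cn (LL psi 0 s0).
Proof.
move=> c10 c11 K1; have K0 : 0 < K by lra.
have [k [k0 kK k1]] : exists k : R, [/\ 0 < k, k * (4 * K) = c1 & k <= 1].
  exists (c1 / (4 * K)); split; first by rewrite divr_gt0 // mulr_gt0.
    by rewrite divfK // gt_eqF // mulr_gt0.
  by rewrite ler_pdivrMr ?mulr_gt0 // mul1r; lra.
exists (c1 * k ^+ 3 / 2); first by rewrite divr_gt0 // mulr_gt0 // exprn_gt0.
move=> psi W s0 hp W1 s01 s02 ha hb.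
have W0 : 0 < W by lra.
set u := W^-1; have u0 : 0 < u by rewrite invr_gt0.
have u1 : u <= 1 by rewrite invf_le1.
have uW : u * W = 1 by rewrite mulVf ?gt_eqF.
pose e : R := k ^+ 4 * u ^+ 8.
have e0 : 0 < e by rewrite mulr_gt0 // exprn_gt0.
have e1 : e <= 1 by rewrite mulr_ile1 ?exprn_ile1 ?exprn_ge0 // ltW.
have far s : s0 <= s -> s <= 2 -> e <= s - 1 -> c1 * k ^+ 3 * u ^+ 7 <= cn (LL psi 0 s).
  move=> ss s2 es; rewrite -(@ler_pXn2r _ 8) ?nnegrE ?cn_ge0 ?mulr_ge0 ?exprn_ge0 ?(ltW c10) ?(ltW k0) ?(ltW u0) //.
  have h1 := ha s ss s2.
  have h2 : e ^+ 6 <= (s - 1) ^+ 6 by rewrite ler_pXn2r ?nnegrE // ltW // (lt_le_trans e0).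
  have h3 : c1 * e ^+ 6 * u ^+ 2 <= cn (LL psi 0 s) ^+ 8.
    have := le_trans (ler_wpM2l (ltW c10) h2) h1 => /(ler_wpM2r (exprn_ge0 2 (ltW u0))).
    by rewrite -[X in _ <= X]mulrA -exprMn [W * u]mulrC uW expr1n mulr1.
  apply: le_trans _ h3.
  have -> : (c1 * k ^+ 3 * u ^+ 7) ^+ 8 = c1 ^+ 8 * (k ^+ 24 * u ^+ 56) by ring.
  have -> : c1 * e ^+ 6 * u ^+ 2 = c1 * (k ^+ 24 * u ^+ 50).
    by rewrite /e; ring.
  apply: ler_pM; rewrite ?mulr_ge0 ?exprn_ge0 ?(ltW c10) ?(ltW k0) ?(ltW u0) //.
    by rewrite -[X in _ <= X]mulr1 exprS ler_pM2l // exprn_ile1 // ltW.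
  by rewrite ler_pM2l ?exprn_gt0 // ler_wiXn2l // ltW.
have c3 : 0 <= c1 * k ^+ 3 * u ^+ 7 by rewrite !mulr_ge0 ?exprn_ge0 ?ltW.
case: (leP e (s0 - 1)) => hs.
  by have := far s0 (lexx _) s02 hs; clear -e0 e1 c3 hs; lra.
have h1 : 1 + e - s0 <= e by clear -c10 c11 K1 K0 k0 kK k1 W1 s01; lra.
have s0e : s0 <= 1 + e by clear -e1 c3 hs h1; lra.
have e2 : 1 + e <= 2 by clear -e1 c3 hs h1 s0e; lra.
have h2 := far (1 + e) s0e e2 (ltac:((clear -c10 c11 K1 K0 k0; lra))).
have h3 : cn (LL psi 0 (1 + e) - LL psi 0 s0) <= 2 * (K * W) * (1 + e - s0).
  clear -s0 hp W1 s01 hb W0 h1 s0e e2; by apply: cn_LL_lip => // x x1 x2; apply: hb => //; lra.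
have h4 : 2 * (K * W) * (1 + e - s0) <= 2 * (K * W) * e by rewrite ler_wpM2l // !mulr_ge0 // ltW.
have h5 : 2 * (K * W) * e = c1 * k ^+ 3 * u ^+ 7 / 2.
  rewrite -kK /e (_ : 2 * (K * W) * (k ^+ 4 * u ^+ 8) = 2 * K * k ^+ 4 * u ^+ 7 * (u * W)); last by ring.
  by rewrite uW; field.
have := cnBge (LL psi 0 (1 + e)) (LL psi 0 (1 + e) - LL psi 0 s0).
rewrite subKr (_ : c1 * k ^+ 3 / 2 * u ^+ 7 = c1 * k ^+ 3 * u ^+ 7 / 2); last by ring.
move: h2 (le_trans h3 h4); rewrite h5; move: (c1 * k ^+ 3 * u ^+ 7) => X.
by move: (cn (LL psi 0 (1 + e) - LL psi 0 s0)) (cn (LL psi 0 (1 + e))) (cn (LL psi 0 s0)) => a b y; clear; lra.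
Qed.

(** The Leibniz relations form a triangular system for [F]. Each new order costs two factors [W]:
    one for dividing by [L 0], one for bounding a derivative of L. *)
Lemma leibniz_bound k (K : R) : 1 <= K -> exists2 M : R, 1 <= M & forall (F L : nat -> C) W, 1 <= W ->
  (forall j, (j <= k)%N -> L j.+1 = \sum_(i < j.+1) F (j - i)%N * L i *+ 'C(j, i)) ->
  (forall i, (i <= k.+1)%N -> cn (L i) <= K * W) -> 1 <= K * W * cn (L 0%N) ->
  forall j, (j <= k)%N -> cn (F j) <= M * W ^+ (2 * j + 2).
Proof.
move=> K1; have K0 : 0 < K by lra.
elim: k => [|k [M M1 IH]].
  exists (K * K); first by rewrite mulr_ege1.
  move=> F L W W1 hF hL h0 j; rewrite leqn0 => /eqP ->.
  have := hF 0%N (leqnn _); rewrite big_ord1 subn0 bin0 => h1.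
  have h2 : cn (F 0%N) * cn (L 0%N) <= K * W by rewrite -cnM (_ : _ * _ = L 1%N) ?hL // h1.
  have W0 : 0 <= K * W by rewrite mulr_ge0; lra.
  have := ler_wpM2l (cn_ge0 (F 0%N)) h0; rewrite mulr1 => h3.
  apply: le_trans h3 _; rewrite mulrCA; apply: le_trans (ler_wpM2l W0 h2) _.
  by rewrite le_eqVlt; apply/orP; left; apply/eqP; ring.
pose S : R := \sum_(i < k.+1) ('C(k.+1, i.+1))%:R.
have S0 : 0 <= S by apply: sumr_ge0.
pose M' := Num.max M (K * K * (1 + M * S)).
exists M'; first by rewrite le_max M1.
move=> F L W W1 hF hL h0 j; have W0 : 0 < W by lra.
rewrite leq_eqVlt => /predU1P[->|]; last first.
  rewrite ltnS => jk; apply: le_trans (_ : M * W ^+ (2 * j + 2) <= _).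
    apply: (IH F L W) => // [i ik|i ik]; [exact/hF/leqW|exact/hL/leqW].
  by rewrite ler_wpM2r ?exprn_ge0 ?(ltW W0) // le_max lexx.
have hj i : (i <= k)%N -> cn (F i) <= M * W ^+ (2 * i + 2).
  by move=> ik; apply: (IH F L W) => // [i' ik'|i' ik']; [exact/hF/leqW|exact/hL/leqW].
have := hF k.+1 (leqnn _); rewrite big_ord_recl subn0 bin0 mulr1n => h1.
have h2 : F k.+1 * L 0%N = L k.+2 - \sum_(i < k.+1) F (k - i)%N * L i.+1 *+ 'C(k.+1, i.+1).
  rewrite h1 /=; apply/eqP; rewrite eq_sym subr_eq; apply/eqP; congr (_ + _).
have h3 : cn (F k.+1) * cn (L 0%N) <= K * W + M * S * K * W ^+ (2 * k + 3).
  rewrite -cnM h2; apply: le_trans (cnB _ _) _; rewrite lerD ?hL //.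
  apply: le_trans (cn_sum _ _ _) _; rewrite (_ : M * S * K * _ = S * (M * K * W ^+ (2 * k + 3))); last by ring.
  rewrite mulr_suml; apply: ler_sum => i _.
  rewrite -mulr_natr !cnM cn_nat mulrC ler_wpM2l //.
  have ik : (i <= k)%N by rewrite -ltnS.
  apply: le_trans (ler_pM (cn_ge0 _) (cn_ge0 _) (hj _ (leq_subr i k)) (hL i.+1 _)) _; first by rewrite ltnS leqW.
  have -> : M * W ^+ (2 * (k - i) + 2) * (K * W) = M * K * W ^+ (2 * (k - i) + 3).
    rewrite (_ : (2 * (k - i) + 3 = (2 * (k - i) + 2).+1)%N); last by rewrite addnS.
    by rewrite exprS; ring.
  rewrite ler_wpM2l ?mulr_ge0 //; try (clear -K1 M1; lra).
  by rewrite ler_weXn2l // leq_add2r leq_mul2l leq_subr.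
have KW : 0 <= K * W by rewrite mulr_ge0; clear -K1 S0 W1; lra.
have := ler_wpM2l (cn_ge0 (F k.+1)) h0; rewrite mulr1 => h4.
apply: le_trans h4 _; rewrite mulrCA; apply: le_trans (ler_wpM2l KW h3) _.
apply: le_trans (_ : K * K * (1 + M * S) * W ^+ (2 * k.+1 + 2) <= _); last first.
  by rewrite ler_wpM2r ?exprn_ge0 ?(ltW W0) // le_max lexx orbT.
have -> : (2 * k.+1 + 2 = (2 * k + 3).+1)%N by lia.
rewrite mulrDr mulrDr mulrDl exprS mulr1; apply: lerD; last first.
  by rewrite le_eqVlt; apply/orP; left; apply/eqP; ring.
rewrite mulrACA ler_wpM2l //; first by rewrite mulr_ge0; clear -K1 K0; lra.
by rewrite ler_wpM2l ?(ltW W0) // -[X in X <= _]expr1 ler_weXn2l // addnS.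
Qed.

Lemma zeta_one_bound : exists2 K : R, 1 <= K & forall s, 1 < s -> s <= 2 ->
  cn (LL (@one_c R) 0 s) * (s - 1) <= K.
Proof.
have [K K1 h] := @zeta_small R 0; exists (2 * K + 1); first by lra.
move=> s s1 s2; have := h s 0 s1 s2; rewrite normr0 add0r fact0 expr1.
have -> : zz 0 s 0 = LL (@one_c R) 0 s.
  apply: DS_ext; last by apply: absD_LL => //; exact: cmult_one.
  by move=> n n0; rewrite tw0.
have -> : ww s 0 = (s - 1)%:C by [].
rewrite div1r => h1.
have s10 : 0 < s - 1 by lra.
have h2 : cn (LL (@one_c R) 0 s) <= K * 2 + (s - 1)^-1.
  have := cnBge (LL (@one_c R) 0 s) (s - 1)%:C^-1; rewrite cnV cn_real (gtr0_norm s10); lra.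
apply: le_trans (ler_wpM2r (ltW s10) h2) _; rewrite mulrDl mulVf ?gt_eqF //; nra.
Qed.

(** The 3-4-1 inequality in usable form: upper bounds for L(psi2) and L'(psi1) to the right of [s0]
    give a lower bound for L(psi1) at [s0]. The pole of zeta produces the factor [(s - 1) ^ 6] that
    [lower_transfer] accepts. *)
Lemma lower_341 (K : R) : 1 <= K -> exists2 c : R, 0 < c &
  forall psi1 psi2 W s0, cmult psi1 -> cmult psi2 ->
  (forall n, psi1 n = 0 \/ cn (psi1 n) = 1 /\ psi2 n = psi1 n ^+ 2) ->
  1 <= W -> 1 < s0 -> s0 <= 2 ->
  (forall s, s0 <= s -> s <= 2 -> cn (LL psi2 0 s) <= K * W) ->
  (forall s, s0 <= s -> s <= 2 -> cn (LL psi1 1 s) <= K * W) ->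
  c * W^-1 ^+ 7 <= cn (LL psi1 0 s0).
Proof.
move=> K1; have [Z Z1 hZ] := zeta_one_bound.
pose c1 : R := (1 / 4) ^+ 16 / (Z ^+ 6 * K ^+ 2).
have ZK : 1 <= Z ^+ 6 * K ^+ 2 by rewrite mulr_ege1 // exprn_ege1.
have ZK0 : 0 < Z ^+ 6 * K ^+ 2 by lra.
have c10 : 0 < c1 by rewrite divr_gt0 // exprn_gt0.
have c11 : c1 <= 1.
  rewrite /c1 ler_pdivrMr // [1 * (Z ^+ 6 * _)]mul1r; apply: le_trans _ ZK.
  by rewrite exprn_ile1 //; lra.
have [c c0 hc] := lower_transfer c10 c11 K1; exists c => //.
move=> psi1 psi2 W s0 h1 h2 h12 W1 s01 s02 hb2 hb1; apply: hc => // s ss s2.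
have s1 : 1 < s by exact: lt_le_trans ss.
have s10 : 0 <= s - 1 by lra.
rewrite /c1 mulrAC ler_pdivrMr //.
have := three_four_one h1 h2 h12 s1 s2.
move=> /(ler_wpM2r (exprn_ge0 6 s10))/le_trans; apply.
set z := cn (LL _ _ _); set l1 := cn (LL psi1 _ _); set l2 := cn (LL psi2 _ _).
rewrite (_ : z ^+ 6 * l1 ^+ 8 * l2 ^+ 2 * (s - 1) ^+ 6 = l1 ^+ 8 * ((z * (s - 1)) ^+ 6 * l2 ^+ 2)); last first.
  by rewrite exprMn; ring.
rewrite -[X in _ <= X]mulrA ler_wpM2l ?exprn_ge0 ?cn_ge0 //.
rewrite [W ^+ 2 * _]mulrCA; apply: ler_pM; rewrite ?exprn_ge0 ?mulr_ge0 ?cn_ge0 //.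
  by rewrite ler_pXn2r ?nnegrE ?mulr_ge0 ?cn_ge0 ?hZ //; lra.
rewrite -exprMn ler_pXn2r ?nnegrE ?cn_ge0 ?mulr_ge0 //; try (clear -K1 W1; lra).
by rewrite [W * K]mulrC hb2.
Qed.

Lemma cmult_dchar q chi t : dchar q chi -> cmult (fun n => chi n * tw t n).
Proof. by move=> [h _ _ _]; apply: cmultM h (cmult_tw t). Qed.

Lemma dchar_upper j (d : R) : 0 < d -> d <= 1 / 2 -> exists2 K : R, 1 <= K &
  forall q chi t s, (0 < q)%N -> dchar q chi -> ~ principal q chi -> 1 < s -> s <= 2 ->
  cn (LL (fun n => chi n * tw t n) j s) <= K * (q%:R * (`|t| + 2)) `^ d.
Proof.
move=> d0 d1; have [K K1 hK]   := @chi_upper R j d d0 d1; exists K => // q chi t s q0 hc np s1 s2.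
apply: (@csum_bound R _ _ 0); first by apply: absD_LL s1; exact: cmult_dchar hc.
by move=> N _; apply: hK => //; exact: ltW.
Qed.

Lemma cn_ww_ge s t : `|s - 1| <= cn (ww s t) /\ `|t| <= cn (ww s t).
Proof. by split; [exact: (Re_le_cn (ww s t))|exact: (Im_le_cn (ww s t))]. Qed.

Lemma zeta_upper j (r : R) s t (K : R) : 0 < r -> 1 < s -> s <= 2 -> `|t| <= 2 ->
  (r <= s - 1 \/ r <= `|t|) -> 1 <= K ->
  cn (zz j s t - (j`!)%:R / ww s t ^+ j.+1) <= K * (`|t| + 2) ->
  cn (zz j s t) <= (4 * K + (j`!)%:R) * (1 + r^-1 ^+ j.+1).
Proof.
move=> r0 s1 s2 t1 hr K1 h; have [w1 w2] := cn_ww_ge s t.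
have rw : r <= cn (ww s t) by case: hr => hr; [move: w1; rewrite ger0_norm; lra|lra].
have w0 : 0 < cn (ww s t) by lra.
have h1 : cn ((j`!)%:R / ww s t ^+ j.+1) <= (j`!)%:R * r^-1 ^+ j.+1.
  rewrite cnM cnV cnX cn_nat -exprVn ler_wpM2l //.
  by rewrite ler_pXn2r ?nnegrE ?invr_ge0 ?cn_ge0 ?(ltW r0) // lef_pV2.
have h2 := cnBge (zz j s t) ((j`!)%:R / ww s t ^+ j.+1).
have h3 : 0 <= r^-1 ^+ j.+1 by rewrite exprn_ge0 // invr_ge0 ltW.
have h4 : (0 : R) <= (j`!)%:R by [].
clear -t1 K1 h h1 h2 h3 h4; nra.
Qed.

Lemma uniform_const (P : nat -> R -> Prop) : (forall i (K K' : R), P i K -> K <= K' -> P i K') ->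
  (forall i, exists2 K : R, 1 <= K & P i K) ->
  forall k, exists2 K : R, 1 <= K & forall i, (i <= k)%N -> P i K.
Proof.
move=> hm hP; elim=> [|k [K K1 IH]].
  by have [K K1 h] := hP 0%N; exists K => // i; rewrite leqn0 => /eqP ->.
have [K' K'1 h] := hP k.+1; exists (Num.max K K'); first by rewrite le_max K1.
move=> i; rewrite leq_eqVlt => /predU1P[->|]; first by apply: hm h _; rewrite le_max lexx orbT.
by rewrite ltnS => /IH/hm; apply; rewrite le_max lexx.
Qed.

Lemma powR_monoD (V a b : R) : 1 <= V -> a <= b -> V `^ a <= V `^ b.
Proof. by move=> V1 ab; apply: ler_powR. Qed.

Lemma powR_ge1 (V a : R) : 1 <= V -> 0 <= a -> 1 <= V `^ a.
Proof. by move=> V1 a0; rewrite -[X in X <= _](powRr0 V) ler_powR. Qed.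

(** The exponent [d'] is at most [d / (2 k + 2)], so that the loss [W ^ (2 k + 2)] of
    [leibniz_bound] with [W = V ^ d'] is at most [V ^ d]. *)
Lemma FF_powR k (d : R) : 0 < d -> exists d' : R, [/\ 0 < d', d' <= 1 / 2 &
  forall K c : R, 1 <= K -> 0 < c -> exists2 M : R, 1 <= M & forall psi s V,
  cmult psi -> 1 < s -> 1 <= V ->
  (forall i, (i <= k.+1)%N -> cn (LL psi i s) <= K * V `^ d') ->
  c * V `^ (- d') <= cn (LL psi 0 s) -> cn (FF psi k s) <= M * V `^ d].
Proof.
move=> d0; pose d' : R := Num.min (1 / 2) (d / (2 * k + 2)%:R).
have k0 : (0 : R) < (2 * k + 2)%:R by rewrite ltr0n addn2.
have d'0 : 0 < d' by rewrite lt_min; apply/andP; split; [lra|exact: divr_gt0].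
have d'1 : d' <= 1 / 2 by rewrite ge_min lexx.
have d'2 : d' * (2 * k + 2)%:R <= d by rewrite -ler_pdivlMr // ge_min lexx orbT.
exists d'; split=> // K c K1 c0.
pose K' := Num.max K c^-1; have K'1 : 1 <= K' by rewrite le_max K1.
have [M M1 hM] := leibniz_bound k K'1; exists M => // psi s V hp s1 V1 hL h0.
have V0 : 0 < V by lra.
have W1 := powR_ge1 V1 (ltW d'0).
have := hM (fun j => FF psi j s) (fun j => LL psi j s) (V `^ d') W1.
move=> /(_ _ _ _ k (leqnn k)) h.
apply: le_trans (h _ _ _) _.
- by move=> j _; exact: LL_leibniz.
- move=> i ik; apply: le_trans (hL i ik) _; rewrite ler_wpM2r ?powR_ge0 // le_max lexx //.
- have p0 : 0 < V `^ d' by exact: powR_gt0.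
  have h1 : c^-1 * V `^ d' * (c * V `^ (- d')) <= K' * V `^ d' * cn (LL psi 0 s).
    apply: ler_pM => //; rewrite ?mulr_ge0 ?invr_ge0 ?powR_ge0 ?(ltW c0) //.
    by rewrite ler_wpM2r ?powR_ge0 // le_max lexx orbT.
  apply: le_trans h1; rewrite mulrACA mulVf ?gt_eqF // mul1r powRN mulfV ?gt_eqF //.
rewrite ler_wpM2l //; first by clear -M1 s1 V1; lra.
by rewrite -powR_mulrn ?powR_ge0 // -powRrM powR_monoD.
Qed.

Lemma tw_sqr t n : tw t n = 0 \/ cn (tw t n) = 1 /\ tw (2 * t) n = tw t n ^+ 2.
Proof.
case: n => [|n]; first by left.
right; split; first by rewrite /tw /= cn_cis.
by rewrite expr2 twD; congr (tw _ _); ring.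
Qed.

(** At distance [r] from the pole and for bounded [t] all the upper bounds are constants, so
    [lower_341] applies with [W = 1]. *)
Lemma zeta_lower_mid (r : R) : 0 < r -> exists2 c : R, 0 < c &
  forall s t, 1 < s -> s <= 2 -> `|t| <= 1 -> (r <= s - 1 \/ r <= `|t|) -> c <= cn (zz 0 s t).
Proof.
move=> r0; have [K0 K01 h0] := @zeta_small R 0; have [K1 K11 h1] := @zeta_small R 1.
pose B0 : R := (4 * K0 + 0`!%:R) * (1 + r^-1 ^+ 1).
pose B1 : R := (4 * K1 + 1`!%:R) * (1 + r^-1 ^+ 2).
pose K := Num.max 1 (Num.max B0 B1).
have K1' : 1 <= K by rewrite le_max lexx.
have [c c0 hc] := lower_341 K1'; exists c => // s t s1 s2 t1 hr.
have := hc (tw t) (tw (2 * t)) 1 s (cmult_tw _) (cmult_tw _) (tw_sqr t) (lexx _) s1 s2.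
rewrite invr1 expr1n !mulr1; apply => x sx x2.
  apply: le_trans (_ : B0 <= _); last by rewrite !le_max lexx !orbT.
  have x1 : 1 < x by exact: lt_le_trans sx.
  apply: (@zeta_upper 0 r x (2 * t) K0) => //; last exact: h0.
    by rewrite normrM ger0_norm //; clear -s2 t1 hr sx x2 x1; lra.
  by case: hr => hr; [left; (clear -r0 hr sx; lra)|right; rewrite normrM ger0_norm //; (clear -r0 hr sx; lra)].
apply: le_trans (_ : B1 <= _); last by rewrite !le_max lexx !orbT.
have x1 : 1 < x by exact: lt_le_trans sx.
apply: (@zeta_upper 1 r x t K1) => //; [(clear -s2 t1; lra)| |exact: h1].
by case: hr => hr; [left; (clear -hr sx; lra)|right; (clear -hr sx; lra)].
Qed.

Lemma zeta_lower_far (d : R) : 0 < d -> exists2 c : R, 0 < c &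
  forall s t, 1 < s -> s <= 2 -> 1 <= `|t| -> c * (`|t| + 2) `^ (- d) <= cn (zz 0 s t).
Proof.
(* [lower_341] loses the seventh power of [W = V ^ e]. *)
move=> d0; pose e : R := Num.min (1 / 2) (d / 7).
have e0 : 0 < e by rewrite lt_min; apply/andP; split; [lra|exact: divr_gt0].
have e1 : e <= 1 / 2 by rewrite ge_min lexx.
have e7 : e * 7%:R <= d by rewrite -ler_pdivlMr // ge_min lexx orbT.
have [K0 K01 h0] := @zeta_large R 0 e 1 e0 e1 ltr01 (lexx _).
have [K1 K11 h1] := @zeta_large R 1 e 1 e0 e1 ltr01 (lexx _).
pose K := Num.max (2 * K0) K1; have K1' : 1 <= K by rewrite le_max K11 orbT.
have [c c0 hc] := lower_341 K1'; exists c => // s t s1 s2 t1.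
pose V : R := `|t| + 2; have V1 : 1 <= V by rewrite /V; clear -K1' c0 s1 s2 t1; lra.
have W1 := powR_ge1 V1 (ltW e0).
have := hc (tw t) (tw (2 * t)) (V `^ e) s (cmult_tw _) (cmult_tw _) (tw_sqr t) W1 s1 s2.
move=> h; apply: le_trans (h _ _).
- rewrite ler_pM2l // -powRN -powR_mulrn ?powR_ge0 // -powRrM powR_monoD //; clear -e7; lra.
- move=> x sx x2; have x1 : 1 < x by exact: lt_le_trans sx.
  have t2 : 1 <= `|2 * t| by rewrite normrM ger0_norm //; clear -s2 t1 V1 W1; lra.
  apply: le_trans (h0 x (2 * t) x1 x2 t2) _.
  apply: le_trans (_ : K0 * (2 * V `^ e) <= _).
    rewrite ler_wpM2l //; first by clear -d0 e0 e1 e7 K01 K11; lra.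
    apply: le_trans (_ : (2 * V) `^ e <= _); last by apply: powR2_le; clear -e0 e1 V1; lra.
    have a1 : 0 <= `|2 * t| + 2 by rewrite addr_ge0.
    have a2 : 0 <= 2 * V by clear -t1 V1; lra.
    rewrite ge0_ler_powR ?nnegrE ?(ltW e0) //.
    by rewrite normrM ger0_norm // /V; clear -d0 e0; lra.
  by rewrite mulrCA mulrA ler_wpM2r ?powR_ge0 // le_max lexx.
move=> x sx x2; have x1 : 1 < x by exact: lt_le_trans sx.
apply: le_trans (h1 x t x1 x2 t1) _; rewrite ler_wpM2r ?powR_ge0 // le_max lexx orbT //.
Qed.

Lemma zeta_FF_far k (d : R) : 0 < d -> exists2 M : R, 1 <= M &
  forall s t, 1 < s -> s <= 2 -> 1 <= `|t| -> cn (FF (tw t) k s) <= M * (`|t| + 2) `^ d.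
Proof.
move=> d0; have [e [e0 e1 hF]] := FF_powR k d0.
have [c c0 hc] := zeta_lower_far e0.
have [K K1 hK] : exists2 K : R, 1 <= K & forall i, (i <= k.+1)%N -> forall s t,
    1 < s -> s <= 2 -> 1 <= `|t| -> cn (zz i s t) <= K * (`|t| + 2) `^ e.
  apply: (@uniform_const (fun i K => forall s t,
    1 < s -> s <= 2 -> 1 <= `|t| -> cn (zz i s t) <= K * (`|t| + 2) `^ e)) => [i K K' h KK s t s1 s2 t1|i].
    by apply: le_trans (h s t s1 s2 t1) _; rewrite ler_wpM2r ?powR_ge0.
  exact: zeta_large.
have [M M1 hM] := hF K c K1 c0; exists M => // s t s1 s2 t1.
apply: hM => //; [exact: cmult_tw|(clear -s2 t1; lra)| |exact: hc].
by move=> i ik; exact: hK.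
Qed.

Lemma cder_sum (I : Type) (r : seq I) (f : I -> R -> C) (df : I -> C) (x : R) :
  (forall i, cder (f i) (df i) x) -> cder (fun y => \sum_(i <- r) f i y) (\sum_(i <- r) df i) x.
Proof.
move=> h; elim: r => [|i r IH].
  rewrite big_nil (_ : (fun y => _) = fun=> 0); first exact: cder_const.
  by apply/funext => y; rewrite big_nil.
rewrite big_cons (_ : (fun y => _) = fun y => f i y + \sum_(j <- r) f j y); first exact: cderD.
by apply/funext => y; rewrite big_cons.
Qed.

(** Mean value estimate along the segment from 1 to [s + i t], carried out on partial sums because
    the series converges only conditionally at the end 1. *)
Lemma dchar_near_one (d : R) : 0 < d -> d <= 1 / 2 -> exists2 K : R, 1 <= K &
  forall q (x : nat -> R) (l : R) t s, npr q x -> isL q x 1 l -> 1 < s -> s <= 2 ->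
  cn (LL (fun n => (x n)%:C * tw t n) 0 s - l%:C) <= K * cn (ww s t) * (q%:R * (`|t| + 2)) `^ d.
Proof.
move=> d0 d1; have [K K1 hK] := @chi_upper R 1 d d0 d1; exists (2 * K); first by lra.
move=> q x l t s hx hl s1 s2; have [[q0 hd] np] := hx.
have hp := cmult_dchar t hd.
pose P N := psum (tm (fun n => lnc R n ^+ 0 * ((x n)%:C * tw t n)) s) N.
have lim1 : clim P (LL (fun n => (x n)%:C * tw t n) 0 s) by apply: absumP; exact: absD_LL.
have lim2 : clim (fun N => (\sum_(1 <= n < N.+1) x n * pw 1 n)%:C) l%:C.
  move=> e e0; have A0 : 0 < 2 * q%:R + 1 :> R by rewrite ltr_wpDl // mulr_ge0.
  have [N0 hN] := pw_to0 (@ltr01 R) (divr_gt0 e0 A0).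
  exists (maxn N0 1) => N; rewrite geq_max => /andP[h1 h2].
  have := hN N h1; rewrite ler_pdivlMr // => h3.
  rewrite -rmorphB cn_real; apply: le_trans (hl N h2) _.
  by have := pw_ge0 1 N : 0 <= _ :> R; clear -e0 A0 h1 h2 h3; lra.
have lim3 := climD lim1 (climZ (-1) lim2); rewrite mulN1r in lim3.
apply: (clim_le (N1 := 0) lim3) => N _; rewrite mulN1r.
(* The parameter [u] in [0, 1] follows the segment: [f n u] is the n-th term at the point
   [1 + u (s - 1 + i t)]. *)
pose f n (u : R) : C := ((x n)%:C * (pw 1 n)%:C) *
   (cis (- (t * ln n%:R) * u) * (expR (- ((s - 1) * ln n%:R) * u))%:C).
have fE n u : (0 < n)%N -> f n u = tm (fun n => (x n)%:C * tw (u * t) n) (1 + u * (s - 1)) n.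
  move=> n0; rewrite /f /tm /tw; case: eqP => [E|_]; first by rewrite E in n0.
  rewrite pwD // [pw (u * _) n]pwE // rmorphM /=.
  have -> : - (t * ln n%:R) * u = - (u * t) * ln n%:R by ring.
  have -> : - ((s - 1) * ln n%:R) * u = - (u * (s - 1)) * ln n%:R by ring.
  by ring.
have hder n (u : R) : cder (f n) (- ww s t * (lnc R n * f n u)) u.
  have h1 := cderM (cder_cis (- (t * ln n%:R)) u) (cder_exp (- ((s - 1) * ln n%:R)) u).
  have h2 := cderM (cder_const ((x n)%:C * (pw 1 n)%:C) u) h1.
  apply: cder_eq h2 _; rewrite mul0r add0r /f /lnc /ww.
  set E := cis _; set F := expR _; set A := (x n)%:C * _.
  have -> : (s - 1) +i* t = (s - 1)%:C + (0 +i* t) :> C by apply: complexP; rewrite /= ?addr0 ?add0r.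
  have -> : 0 +i* - (t * ln n%:R) = - ((0 +i* t) * (ln n%:R)%:C) :> C.
    by apply: complexP; rewrite /=; ring.
  rewrite !rmorphM rmorphN rmorphM; ring.
pose S u := \sum_(1 <= n < N.+1) f n u.
have hS (u : R) : cder S (- ww s t * \sum_(1 <= n < N.+1) lnc R n * f n u) u.
  rewrite mulr_sumr; exact: cder_sum.
have -> : P N - (\sum_(1 <= n < N.+1) x n * pw 1 n)%:C = S 1 - S 0.
  congr (_ - _).
    rewrite /P /S /psum; apply: eq_big_nat => n /andP[n0 _].
    by rewrite fE // !mul1r /tm expr0 mul1r addrC subrK.
  rewrite /S rmorph_sum; apply: eq_bigr => n _.
  by rewrite /f !mulr0 cis0 expR0 mul1r mulr1 rmorphM.
have := @cder_lip R S (fun u => - ww s t * \sum_(1 <= n < N.+1) lnc R n * f n u) 0 1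
  (cn (ww s t) * (K * (q%:R * (`|t| + 2)) `^ d)) ler01 (fun u _ _ => hS u).
move=> h; apply: le_trans (h _) _; last by rewrite subr0 mulr1 le_eqVlt; apply/orP; left; apply/eqP; ring.
move=> u u0 u1; rewrite cnM cnN ler_wpM2l ?cn_ge0 //.
have us : 1 <= 1 + u * (s - 1) /\ 1 + u * (s - 1) <= 2.
  have : 0 <= u * (s - 1) by rewrite mulr_ge0 //; clear -d0 d1 K1 s1 s2; lra.
  have : u * (s - 1) <= 1 * (s - 1) by rewrite ler_wpM2r //; clear -d0 d1 K1 s1 s2; lra.
  clear -l t s hx hl s1 s2; by split; lra.
have := hK q (fun n => (x n)%:C) (u * t) _ N q0 hd np us.1 us.2.
have -> : psum (tm (fun n => lnc R n ^+ 1 * ((x n)%:C * tw (u * t) n)) (1 + u * (s - 1))) N =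
    \sum_(1 <= n < N.+1) lnc R n * f n u.
  by apply: eq_big_nat => n /andP[n0 _]; rewrite fE // /tm expr1 !mulrA.
move=> /le_trans; apply; rewrite ler_wpM2l //; first by clear -d0 d1 K1; lra.
rewrite ge0_ler_powR ?nnegrE ?mulr_ge0 ?addr_ge0 //; first exact: ltW.
rewrite ler_wpM2l // lerD2r normrM ger0_norm // ler_piMl //.
Qed.

End LowerBounds.

(** * Lower bounds for all characters, and bounds for derivatives of L'/L *)

Section CharacterBounds.
Variable R : realType.
Local Notation C := R[i].
Implicit Types (psi chi : nat -> C) (s t W : R).

Lemma dchar_sqr q chi : dchar q chi -> dchar q (fun n => chi n * chi n).
Proof.
move=> [hm hp h1 h0]; split; first exact: cmultM.
- by move=> n; rewrite hp.
- by move=> n cq; rewrite cnM h1 // mulr1.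
by move=> n cq; rewrite h0 // mul0r.
Qed.

Lemma dchar_tw_sqr q chi t n : dchar q chi -> chi n * tw t n = 0 \/
  [/\ coprime n q, cn (chi n * tw t n) = 1 & (chi n * chi n) * tw (2 * t) n = (chi n * tw t n) ^+ 2].
Proof.
move=> [hm hp h1 h0]; case: (boolP (coprime n q)) => cq; last by left; rewrite h0 // mul0r.
have [-> |[tw1 tw2]] := tw_sqr t n; first by left; rewrite mulr0.
by right; split=> //; rewrite ?cnM ?h1 ?tw1 ?mulr1 // tw2 exprMn expr2.
Qed.

Lemma powR_twice (V y e : R) : 0 <= y -> y <= 2 * V -> 0 < e -> e <= 1 -> y `^ e <= 2 * V `^ e.
Proof.
move=> y0 yV e0 e1; have V0 : 0 <= V by lra.
apply: le_trans (powR2_le V0 (ltW e0) e1).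
by rewrite ge0_ler_powR ?nnegrE ?(ltW e0) //; lra.
Qed.

(** When [chi ^ 2] is nonprincipal, the companion function at [2 t] has no pole either, so
    [lower_341] works uniformly in [t], including [t = 0]. *)
Lemma dchar_lower_complex (d : R) : 0 < d -> exists2 c : R, 0 < c &
  forall q chi t s, (0 < q)%N -> dchar q chi -> ~ principal q chi ->
  ~ principal q (fun n => chi n * chi n) -> 1 < s -> s <= 2 ->
  c * (q%:R * (`|t| + 2)) `^ (- d) <= cn (LL (fun n => chi n * tw t n) 0 s).
Proof.
move=> d0; pose e : R := Num.min (1 / 2) (d / 7).
have e0 : 0 < e by rewrite lt_min; apply/andP; split; [lra|exact: divr_gt0].
have e1 : e <= 1 / 2 by rewrite ge_min lexx.
have e7 : e * 7%:R <= d by rewrite -ler_pdivlMr // ge_min lexx orbT.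
have [K0 K01 h0] := @dchar_upper R 0 e e0 e1.
have [K1 K11 h1] := @dchar_upper R 1 e e0 e1.
pose K := Num.max (2 * K0) K1; have K1' : 1 <= K by rewrite le_max K11 orbT.
have [c c0 hc] := lower_341 K1'; exists c => // q chi t s q0 hd np np2 s1 s2.
have q1 : 1 <= q%:R :> R by rewrite ler1n.
pose V : R := q%:R * (`|t| + 2).
have V1 : 1 <= V by rewrite /V; have := normr_ge0 t; clear -K1' c0 q0 s1 s2 q1; nra.
have W1 := powR_ge1 V1 (ltW e0).
have hp := cmult_dchar t hd; have hp2 := cmult_dchar (2 * t) (dchar_sqr hd).
have hrel n : chi n * tw t n = 0 \/ cn (chi n * tw t n) = 1 /\
    chi n * chi n * tw (2 * t) n = (chi n * tw t n) ^+ 2.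
  by have [->|[_ h2 h3]] := dchar_tw_sqr t n hd; [left|right].
have := hc _ _ (V `^ e) s hp hp2 hrel W1 s1 s2.
move=> h; apply: le_trans (h _ _).
- rewrite ler_pM2l // -powRN -powR_mulrn ?powR_ge0 // -powRrM powR_monoD //; clear -e7; lra.
- move=> x sx x2; have x1 : 1 < x by exact: lt_le_trans sx.
  apply: le_trans (h0 q _ (2 * t) x q0 (dchar_sqr hd) np2 x1 x2) _.
  apply: le_trans (_ : K0 * (2 * V `^ e) <= _).
    rewrite ler_wpM2l //; first by clear -d0 e0 e1 e7 K01 K11; lra.
    apply: powR_twice => //; last by clear -d0 e0 e1 e7; lra.
    by rewrite normrM ger0_norm // /V; have := normr_ge0 t; clear -s1 s2 q1 V1; nra.
  by rewrite mulrCA mulrA ler_wpM2r ?powR_ge0 // le_max lexx.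
move=> x sx x2; have x1 : 1 < x by exact: lt_le_trans sx.
apply: le_trans (h1 q chi t x q0 hd np x1 x2) _; rewrite ler_wpM2r ?powR_ge0 // le_max lexx orbT //.
Qed.

Lemma powR_le3 (y e : R) : 0 <= y -> y <= 1 -> 0 < e -> e <= 1 / 2 -> (y + 2) `^ e <= 3.
Proof.
move=> y0 y1 e0 e1; apply: le_trans (_ : (y + 2) `^ 1 <= _); first by apply: powR_monoD; lra.
by rewrite powRr1; lra.
Qed.

Lemma powRN_anti (V q e : R) : 0 < q -> q <= V -> 0 <= e -> V `^ (- e) <= q `^ (- e).
Proof.
move=> q0 qV e0; have V0 : 0 < V by lra.
by rewrite !powRN lef_pV2 ?posrE ?powR_gt0 // ge0_ler_powR ?nnegrE // ltW.
Qed.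

(** For real [x] the companion has a pole at [t = 0]. Since the relation between [psi1] and [psi2]
    is needed only where [x n <> 0], zeta itself, twisted by [2 t], serves as companion. Within a
    radius [r] of the point 1 Siegel's bound takes over. *)
Lemma dchar_lower_real (d : R) : 0 < d -> exists2 c : R, 0 < c &
  forall q (x : nat -> R) t s, npr q x -> 1 < s -> s <= 2 ->
  c * (q%:R * (`|t| + 2)) `^ (- d) <= cn (LL (fun n => (x n)%:C * tw t n) 0 s).
Proof.
(* Here [W = V ^ (2 e)], and its seventh power is lost. *)
move=> d0; pose e : R := Num.min (1 / 2) (d / 14).
have e0 : 0 < e by rewrite lt_min; apply/andP; split; [lra|exact: divr_gt0].
have e1 : e <= 1 / 2 by rewrite ge_min lexx.
have e7 : e * 14%:R <= d by rewrite -ler_pdivlMr // ge_min lexx orbT.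
have [K1 K11 h1] := @dchar_upper R 1 e e0 e1.
have [KS KS1 hKS] := @zeta_small R 0.
have [KL KL1 hKL] := @zeta_large R 0 e 1 e0 e1 ltr01 (lexx _).
have [KN KN1 hKN] := @dchar_near_one R e e0 e1.
have [cs cs0 hcs] := @siegel R e e0.
pose a : R := cs / (12 * KN); have KN0 : 0 < 12 * KN by clear -KS1 KL1 KN1 cs0; lra.
have KN00 : 0 <= KN by clear -KS1 KL1 KN1 cs0 KN0; lra.
have ed : - d <= - e by clear -d0 e0 e1 e7 K11; lra.
have a0 : 0 < a by rewrite divr_gt0.
pose B : R := (4 * KS + 1) * (1 + a^-1).
have ia : 0 < a^-1 by rewrite invr_gt0.
have B0 : 0 <= B by rewrite mulr_ge0 //; clear -KS1 ia; lra.
pose K := K1 + 2 * KL + B; have K1' : 1 <= K by rewrite /K; clear -K11 KS1 KL1 ed a0 ia B0; lra.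
have [c c0 hc] := lower_341 K1'.
exists (Num.min c (cs / 2)); first by rewrite lt_min c0 divr_gt0.
move=> q x t s hx s1 s2; have [[q0 hd] np] := hx.
have q1 : 1 <= q%:R :> R by rewrite ler1n.
have t0 := normr_ge0 t.
pose V : R := q%:R * (`|t| + 2); rewrite -/V.
have qV : q%:R <= V by rewrite /V; clear -s1 s2 q0 q1 t0; nra.
have V1 : 1 <= V by clear -s2 q0 q1 t0 qV; lra.
have tV : `|t| + 2 <= V by rewrite /V; clear -s2 q0 q1 t0; nra.
(* With this radius the variation of L given by [dchar_near_one] is at most half of Siegel's bound
   [cs q ^ (- e)]. *)
pose r := a * pw (2 * e) q; have r0 : 0 < r by rewrite mulr_gt0 ?pw_gt0.
have pVd : 0 <= V `^ (- d) by exact: powR_ge0.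
have We : V `^ e <= V `^ (2 * e) by apply: powR_monoD => //; clear -d0 e0 e1; lra.
have [/andP[sr tr]|] := boolP ((s - 1 < r) && (`|t| < r) && (`|t| <= 1)).
  move: sr => /andP[sr tr'].
  have [l hl] := isL_exists (npr_rchar hx) ltr01.
  have hs := hcs q x l hx hl.
  have hn := hKN q x l t s hx hl s1 s2; rewrite -/V in hn.
  have ww2 : cn (ww s t) <= 2 * r.
    apply: le_trans (cn_le_ReIm _) _; rewrite /= ger0_norm; clear -s1 sr tr'; lra.
  have Vq : V `^ e <= 3 * q%:R `^ e.
    rewrite /V powRM //.
    by rewrite mulrC ler_wpM2r ?powR_ge0 // powR_le3.
  have h5 : KN * cn (ww s t) * V `^ e <= KN * (2 * r) * (3 * q%:R `^ e).
    by apply: ler_pM; rewrite ?powR_ge0 ?mulr_ge0 ?cn_ge0 // ler_wpM2l.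
  have h6 : KN * (2 * r) * (3 * q%:R `^ e) = cs / 2 * pw e q.
    have pp : q%:R `^ e * pw e q = 1.
      by rewrite /pw -powRD ?subrr ?powRr0 // pnatr_eq0 -lt0n q0 implybT.
    rewrite /r (_ : 2 * e = e + e); last by ring.
    rewrite pwD // (_ : _ * _ = KN * 6 * a * pw e q * (q%:R `^ e * pw e q)); last by ring.
    by rewrite pp /a; field; clear -KN1; lra.
  have cl : cn l%:C = l.
    rewrite cn_real ger0_norm //; apply: le_trans hs; rewrite mulr_ge0 ?pw_ge0 // ltW //.
  have h7 := cnBge l%:C (l%:C - LL (fun n => (x n)%:C * tw t n) 0 s).
  rewrite subKr cl cnBC in h7.
  have h8 : Num.min c (cs / 2) * V `^ (- d) <= cs / 2 * pw e q.
    apply: ler_pM => //; rewrite ?le_min ?ge_min ?lexx ?orbT ?(ltW c0) ?divr_ge0 ?(ltW cs0) //.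
    apply: le_trans (powR_monoD V1 ed) _.
    by apply: powRN_anti => //; [rewrite ltr0n|exact: ltW].
  apply: le_trans h8 _.
  set u := cn (LL _ 0 s - l%:C) in hn h7; set v := cn (LL _ 0 s) in h7 *.
  have h9 := le_trans hn h5; rewrite h6 in h9.
  by clear hn; move: u v h7 h9 hs => u v; clear; lra.
move=> hnot.
(* Away from the point 1: the polar term of the companion is at most [1 / r], which is of order
   [V ^ (2 e)]. *)
have hp := cmult_dchar t hd.
have W1 : 1 <= V `^ (2 * e) by apply: powR_ge1 => //; clear -d0 e0; lra.
have hrel n : (x n)%:C * tw t n = 0 \/ cn ((x n)%:C * tw t n) = 1 /\
    tw (2 * t) n = ((x n)%:C * tw t n) ^+ 2.
  have [->|[cq h2 h3]] := dchar_tw_sqr t n hd; [by left|right; split=> //].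
  rewrite -h3 -rmorphM -expr2.
  have [_ _ v2 _] := realchar_vals (proj1 hx).
  by rewrite v2 // mul1r.
have := hc _ _ (V `^ (2 * e)) s hp (cmult_tw (2 * t)) hrel W1 s1 s2.
move=> h; apply: le_trans (h _ _).
- apply: ler_pM => //; first by rewrite le_min (ltW c0) divr_ge0 // ltW.
    by rewrite ge_min lexx.
  clear -e1 e7 KL1 V1; rewrite -powRN -powR_mulrn ?powR_ge0 // -powRrM powR_monoD //; clear -e7; lra.
- move=> y sy y2; have y1 : 1 < y by exact: lt_le_trans sy.
  case: (leP `|t| 1) => t1.
    apply: le_trans (_ : B * V `^ (2 * e) <= _); last first.
      by rewrite ler_wpM2r ?powR_ge0 // /K; clear -K11 KS1 KL1 KN1; lra.
    apply: le_trans (@zeta_upper R 0 r y (2 * t) KS r0 y1 y2 _ _ KS1 (hKS y (2 * t) y1 y2)) _.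
    + by rewrite normrM ger0_norm //; clear -y1 t1; lra.
    + move: hnot; rewrite t1 andbT negb_and -!leNgt => /orP[h2|h2]; [left; lra|right].
      by rewrite normrM ger0_norm //; clear -t0 h2; lra.
    rewrite /B -mulrA fact0 ler_wpM2l //; first by clear -KS1; lra.
    rewrite expr1 mulrDl mul1r lerD // /r invfM ler_wpM2l ?(ltW ia) //.
    by rewrite /pw powRN invrK ge0_ler_powR ?nnegrE ?(le_trans ler01 q1) ?(le_trans ler01 V1) // mulr_ge0 // ltW.
  apply: le_trans (_ : 2 * KL * V `^ (2 * e) <= _); last first.
    by rewrite ler_wpM2r ?powR_ge0 // /K; clear -K11 B0; lra.
  have t2 : 1 <= `|2 * t| by rewrite normrM ger0_norm //; clear -t1; lra.
  apply: le_trans (hKL y (2 * t) y1 y2 t2) _.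
  rewrite [2 * KL]mulrC -mulrA ler_wpM2l //; first by clear -KL1; lra.
  apply: le_trans (_ : 2 * V `^ e <= _); last by clear -We hnot; lra.
  apply: powR_twice => //; last by clear -e1; lra.
  by rewrite normrM ger0_norm //; clear -tV; lra.
move=> y sy y2; have y1 : 1 < y by exact: lt_le_trans sy.
apply: le_trans (h1 q _ t y q0 hd np y1 y2) _; rewrite -/V.
apply: ler_pM => //; rewrite ?powR_ge0 //; first by clear -K11; lra.
by rewrite /K; clear -K11 KS1 KL1 a0 ia B0 K1' c0; lra.
Qed.

Lemma real_of_sqr_principal q chi : dchar q chi -> principal q (fun n => chi n * chi n) ->
  forall n, chi n = (Re (chi n))%:C.
Proof.
move=> [_ _ _ h0] hp n; case: (boolP (coprime n q)) => cq; last by rewrite h0.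
have /eqP := hp n cq; rewrite -expr2 sqrf_eq1 => /orP[] /eqP -> //.
by apply: complexP; rewrite /= ?oppr0.
Qed.

Lemma dchar_lower (d : R) : 0 < d -> exists2 c : R, 0 < c &
  forall q chi t s, (0 < q)%N -> dchar q chi -> ~ principal q chi -> 1 < s -> s <= 2 ->
  c * (q%:R * (`|t| + 2)) `^ (- d) <= cn (LL (fun n => chi n * tw t n) 0 s).
Proof.
move=> d0; have [c1 c10 h1] := dchar_lower_complex d0; have [c2 c20 h2] := dchar_lower_real d0.
exists (Num.min c1 c2); first by rewrite lt_min c10.
move=> q chi t s q0 hd np s1 s2.
have [hr|hr] := pselect (principal q (fun n => chi n * chi n)); last first.
  apply: le_trans (h1 q chi t s q0 hd np hr s1 s2).
  by rewrite ler_wpM2r ?powR_ge0 // ge_min lexx.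
have E := real_of_sqr_principal hd hr.
have Ef : chi = (fun n => (Re (chi n))%:C) by apply/funext.
have hx : npr q (fun n => Re (chi n)).
  by split; [split=> //|]; rewrite -Ef.
have := h2 q _ t s hx s1 s2.
have -> : (fun n => (Re (chi n))%:C * tw t n) = (fun n => chi n * tw t n).
  by apply/funext => n; rewrite -E.
by apply: le_trans; rewrite ler_wpM2r ?powR_ge0 // ge_min lexx orbT.
Qed.

Lemma dchar_FF k (d : R) : 0 < d -> exists2 M : R, 1 <= M &
  forall q chi t s, (0 < q)%N -> dchar q chi -> ~ principal q chi -> 1 < s -> s <= 2 ->
  cn (FF (fun n => chi n * tw t n) k s) <= M * (q%:R * (`|t| + 2)) `^ d.
Proof.
move=> d0; have [e [e0 e1 hF]] := FF_powR k d0.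
have [c c0 hc] := dchar_lower e0.
have [K K1 hK] : exists2 K : R, 1 <= K & forall i, (i <= k.+1)%N -> forall q chi t s,
    (0 < q)%N -> dchar q chi -> ~ principal q chi -> 1 < s -> s <= 2 ->
    cn (LL (fun n => chi n * tw t n) i s) <= K * (q%:R * (`|t| + 2)) `^ e.
  apply: (@uniform_const R (fun i K => forall q chi t s,
    (0 < q)%N -> dchar q chi -> ~ principal q chi -> 1 < s -> s <= 2 ->
    cn (LL (fun n => chi n * tw t n) i s) <= K * (q%:R * (`|t| + 2)) `^ e)).
    move=> i K K' h KK q chi t s q0 hd np s1 s2.
    by apply: le_trans (h q chi t s q0 hd np s1 s2) _; rewrite ler_wpM2r ?powR_ge0.
  by move=> i; exact: dchar_upper.
have [M M1 hM] := hF K c K1 c0; exists M => // q chi t s q0 hd np s1 s2.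
apply: hM => //; first exact: cmult_dchar hd.
- have q1 : 1 <= q%:R :> R by rewrite ler1n.
  by have := normr_ge0 t; nra.
- by move=> i ik; exact: hK.
exact: hc.
Qed.

(** Multiplication by [w] removes a simple pole. Up to signs the [Z j] are the derivatives of [w L],
    the [P j] those of [- L'/L - 1 / w], the negative logarithmic derivative of [w L]; the pair
    satisfies the same Leibniz relations. *)
Lemma leibniz_pole (F L : nat -> C) (w : C) k : w != 0 ->
  (forall j, L j.+1 = \sum_(i < j.+1) F (j - i)%N * L i *+ 'C(j, i)) ->
  let P j := F j - j`!%:R / w ^+ j.+1 in
  let Z j := w * L j - j%:R * L j.-1 in
  Z k.+1 = \sum_(i < k.+1) P (k - i)%N * Z i *+ 'C(k, i).
Proof.
move=> w0 hL P Z.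
have key i : (i <= k)%N -> P (k - i)%N * Z i *+ 'C(k, i) =
   w * (F (k - i)%N * L i *+ 'C(k, i)) - F (k - i)%N * L i.-1 *+ (i * 'C(k, i))
   - (k`!%:R / i`!%:R * w ^- (k - i) * L i - (if i is i'.+1 then k`!%:R / i'`!%:R * w ^- (k - i') * L i' else 0)).
  move=> ik; have fi : (i`!)%:R != 0 :> C by rewrite pnatr_eq0 -lt0n fact_gt0.
  have hb : ('C(k, i))%:R * (k - i)`!%:R = k`!%:R / i`!%:R :> C.
    by rewrite -(bin_fact ik) !natrM -mulrA mulrC -!mulrA [i`!%:R * _]mulrC; field.
  rewrite -(mulr_natr (P _ * _)) -(mulr_natr (F _ * L i)) -(mulr_natr (F _ * L i.-1)) /P /Z natrM.
  have h3 : ('C(k, i))%:R * ((k - i)`!%:R / w ^+ (k - i).+1) * (w * L i) =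
      k`!%:R / i`!%:R * w ^- (k - i) * L i.
    by rewrite -hb exprS invfM; field; rewrite expf_neq0 ?w0.
  have h4 : ('C(k, i))%:R * ((k - i)`!%:R / w ^+ (k - i).+1) * (i%:R * L i.-1) =
      (if i is i'.+1 then k`!%:R / i'`!%:R * w ^- (k - i') * L i' else 0).
    case: i ik fi hb h3 => [|i] ik fi hb _; first by rewrite mul0r mulr0.
    rewrite [X in X * _]mulrA hb subnSK // factS natrM.
    have i0 : i.+1%:R != 0 :> C by rewrite pnatr_eq0.
    have fi' : (i`!)%:R != 0 :> C by rewrite pnatr_eq0 -lt0n fact_gt0.
    have wn := expf_neq0 (k - i) w0; rewrite /=.
    move: (i.+1%:R : C) i0 (w ^+ (k - i)) wn => a a0 b b0.
    by field; rewrite b0 a0 fi'.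
  rewrite -h4 -h3; ring.
under eq_bigr => i _ do rewrite (key i (leq_ord i)).
rewrite !sumrB -mulr_sumr -hL.
have S2 : \sum_(i < k.+1) F (k - i)%N * L i.-1 *+ (i * 'C(k, i)) = k%:R * L k.
  case: k {key} => [|k]; first by rewrite big_ord1 mul0n mulr0n mul0r.
  rewrite big_ord_recl mul0n mulr0n add0r hL mulr_sumr; apply: eq_bigr => i _.
  by rewrite lift0 subSS /= -mul_bin_diag mulr_natl -mulrnA mulnC.
rewrite S2.
have S3 : \sum_(i < k.+1) (k`!%:R / i`!%:R * w ^- (k - i) * L i) -
   \sum_(i < k.+1) (if i : nat is i'.+1 then k`!%:R / i'`!%:R * w ^- (k - i') * L i' else 0) = L k.
  rewrite big_ord_recr /= [X in _ - X]big_ord_recl /= add0r addrAC.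
  have -> : \sum_(i < k) (k`!%:R / i`!%:R * w ^- (k - i) * L i) -
     \sum_(i < k) (k`!%:R / (i`!)%:R * w ^- (k - i) * L i) = 0 by rewrite subrr.
  by rewrite add0r subnn expr0 invr1 mulr1 divff ?mul1r // pnatr_eq0 -lt0n fact_gt0.
rewrite S3 /Z /= -natr1; ring.
Qed.

(** The function [w] zeta is regular near 1 and bounded below, so [leibniz_bound] applies to the
    pair of [leibniz_pole]. In [FF - zz] the polar parts [k! / w ^ (k + 1)] cancel. *)
Lemma zeta_FF_near k : exists2 M : R, 1 <= M &
  forall s t, 1 < s -> s <= 2 -> `|t| <= 1 -> cn (FF (tw t) k s - zz k s t) <= M.
Proof.
pose Q j s t : C := zz j s t - (j`!)%:R / ww s t ^+ j.+1.
have [K K1 hK] : exists2 K : R, 1 <= K & forall i, (i <= k.+1)%N -> forall s t,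
    1 < s -> s <= 2 -> `|t| <= 1 -> cn (Q i s t) <= K.
  apply: (@uniform_const R (fun i K => forall s t, 1 < s -> s <= 2 -> `|t| <= 1 -> cn (Q i s t) <= K)).
    by move=> i K K' h KK s t s1 s2 t1; exact: le_trans (h s t s1 s2 t1) KK.
  move=> i; have [K K1 h] := @zeta_small R i; exists (3 * K); first by lra.
  move=> s t s1 s2 t1; apply: le_trans (h s t s1 s2) _; nra.
have K0 : 0 < K by lra.
pose r := (2 * K)^-1; have r0 : 0 < r by rewrite invr_gt0; lra.
have rK : r * (2 * K) = 1 by rewrite mulVf // gt_eqF //; lra.
have r20 : 0 < r / 2 by lra.
have [c c0 hc] := zeta_lower_mid r20.
pose Km : R := Num.max (2 * K + k.+1%:R * K + 1) (Num.max 2 (r * c)^-1).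
have rc0 : 0 < r * c by rewrite mulr_gt0.
have Km1 : 1 <= Km by rewrite le_max; apply/orP; right; rewrite le_max; apply/orP; left; lra.
have [M M1 hM] := leibniz_bound k Km1; exists (M + K); first by lra.
move=> s t s1 s2 t1; set w := ww s t.
have w0 : w != 0 by exact: ww_neq0.
have wle : cn w <= `|s - 1| + `|t| by exact: cn_le_ReIm.
have s10 : `|s - 1| = s - 1 by rewrite ger0_norm; clear -s1; lra.
have w2 : cn w <= 2 by rewrite s10 in wle; clear -s2 t1 w0 wle s10; lra.
pose P j := FF (tw t) j s - j`!%:R / w ^+ j.+1.
pose Z j := w * zz j s t - j%:R * zz j.-1 s t.
have Z0E : Z 0%N = 1 + w * Q 0%N s t.
  rewrite /Z /Q mul0r subr0 fact0 expr1 -/w mulrBr mulrCA divff // mulr1; ring.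
have ZE j : Z j.+1 = w * Q j.+1 s t - j.+1%:R * Q j s t.
  rewrite /Z /Q /= -/w factS natrM !mulrBr.
  have -> : w * (j.+1%:R * j`!%:R / w ^+ j.+2) = j.+1%:R * (j`!%:R / w ^+ j.+1).
    have wn := expf_neq0 j.+1 w0; rewrite (exprS w j.+1) invfM.
    rewrite [LHS](_ : _ = w / w * (j.+1%:R * (j`!%:R / w ^+ j.+1))); last first.
      by move: (w ^+ j.+1)^-1 (j.+1%:R : C) (j`!%:R : C) w^-1 => *; ring.
    by rewrite divff // mul1r.
  by move: (j.+1%:R * _) => z; ring.
have bZ i : (i <= k.+1)%N -> cn (Z i) <= Km * 1.
  move=> ik; rewrite mulr1; apply: le_trans (_ : 2 * K + k.+1%:R * K + 1 <= _); last by rewrite le_max lexx.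
  have hw j : (j <= k.+1)%N -> cn (w * Q j s t) <= 2 * K.
    by move=> jk; rewrite cnM ler_pM ?cn_ge0 // hK.
  case: i ik => [|i] ik.
    rewrite Z0E; apply: le_trans (cnD _ _) _; rewrite cn1.
    have := hw 0%N ik; have : 0 <= k.+1%:R * K by rewrite mulr_ge0 // ltW.
    by move: (cn _) => u; clear -K1 K0 r0 rK; lra.
  rewrite ZE; apply: le_trans (cnB _ _) _.
  have h1 : cn (i.+1%:R * Q i s t) <= k.+1%:R * K.
    by rewrite cnM cn_nat ler_pM ?cn_ge0 // ?ler_nat // hK // ltnW.
  clear -w2 Z0E ZE hw i ik h1; have := hw i.+1 ik; move: h1; move: (cn _) (cn _) => u v; lra.
have bZ0 : 1 <= Km * 1 * cn (Z 0%N).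
  (* Within distance [r = 1 / (2 K)] of the pole, [w] zeta is within 1/2 of 1; beyond it
     [zeta_lower_mid] applies, as [s - 1] or [|t|] is at least [r / 2]. *)
  rewrite mulr1; case: (leP (cn w) r) => hw.
    have h1 : cn (w * Q 0%N s t) <= 1 / 2.
      rewrite cnM; apply: le_trans (ler_pM (cn_ge0 _) (cn_ge0 _) hw (hK 0%N _ s t s1 s2 t1)) _ => //.
      clear -K1 K0 r0 rK; lra.
    have h2 : 1 / 2 <= cn (Z 0%N).
      have := cnBge 1 (- (w * Q 0%N s t)); rewrite opprK -Z0E cn1 cnN.
      clear -bZ hw h1; by move: h1; move: (cn _) (cn _) => u v; lra.
    have h3 : 2 <= Km by rewrite le_max le_max lexx orbT.
    by apply: le_trans (ler_pM _ _ h3 h2) => //; clear -K1 K0; lra.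
  have h1 : c <= cn (zz 0 s t).
    apply: hc => //; rewrite s10 in wle.
    clear -hw wle; by case: (leP (r / 2) (s - 1)) => h; [left|right; lra].
  have h2 : r * c <= cn (Z 0%N).
    by rewrite /Z mul0r subr0 cnM ler_pM // ltW.
  have h3 : (r * c)^-1 <= Km by rewrite !le_max lexx !orbT.
  apply: le_trans (ler_pM _ _ h3 h2); rewrite ?mulVf ?gt_eqF //; first by rewrite invr_ge0 ltW.
  exact: ltW.
have hZ j : (j <= k)%N -> Z j.+1 = \sum_(i < j.+1) P (j - i)%N * Z i *+ 'C(j, i).
  move=> _; apply: (@leibniz_pole (fun j => FF (tw t) j s) (fun j => zz j s t) w j w0) => j'.
  exact: LL_leibniz (cmult_tw t) s1.
have := hM P Z 1 (lexx _) hZ bZ bZ0 k (leqnn k); rewrite expr1n mulr1 => hP.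
have -> : FF (tw t) k s - zz k s t = P k - Q k s t by rewrite /P /Q -/w; ring.
apply: le_trans (cnB _ _) _; rewrite lerD // hK //.
Qed.

Lemma zeta_FF k (d : R) : 0 < d -> exists2 M : R, 1 <= M &
  forall s t, 1 < s -> s <= 2 -> cn (FF (tw t) k s - zz k s t) <= M * (`|t| + 2) `^ d.
Proof.
move=> d0; have [M1 M11 h1] := zeta_FF_near k.
pose e : R := Num.min (1 / 2) d.
have e0 : 0 < e by rewrite lt_min d0 andbT; lra.
have e1 : e <= 1 / 2 by rewrite ge_min lexx.
have ed : e <= d by rewrite ge_min lexx orbT.
have [M2 M21 h2] := @zeta_FF_far R k d d0.
have [M3 M31 h3] := @zeta_large R k e 1 e0 e1 ltr01 (lexx _).
exists (M1 + M2 + M3); first by lra.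
move=> s t s1 s2; have t0 := normr_ge0 t.
have V1 : 1 <= `|t| + 2 by lra.
have W1 := powR_ge1 V1 (ltW d0).
case: (leP `|t| 1) => t1.
  apply: le_trans (h1 s t s1 s2 t1) _; clear -d0 M11 e0 M21 M31 W1; nra.
apply: le_trans (cnB _ _) _.
have h4 := h2 s t s1 s2 (ltW t1); have h5 := h3 s t s1 s2 (ltW t1).
have h6 : M3 * (`|t| + 2) `^ e <= M3 * (`|t| + 2) `^ d.
  by rewrite ler_wpM2l ?powR_monoD //; clear -ed M21 M31; lra.
have h7 : 0 <= M1 * (`|t| + 2) `^ d by rewrite mulr_ge0 ?powR_ge0 //; clear -d0 M11 e0 e1; lra.
clear -h4 h5 h6 h7; lra.
Qed.

End CharacterBounds.

(** * Discretised Fejer kernel and sharp truncation *)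

Section Fejer.
Variable R : realType.
Local Notation C := R[i].
Implicit Types (t y a P Y : R) (j m n J N : nat).
Local Notation pi2 := ((pi : R) *+ 2).

Lemma cos_anti (a b : R) : 0 <= a -> a <= b -> b <= pi -> cos b <= cos a.
Proof.
move=> a0 ab bp; move: ab; rewrite le_eqVlt => /predU1P[-> //|ab].
have ha : a \in `[0, pi] by rewrite in_itv /= a0 (le_trans (ltW ab)).
have hb : b \in `[0, pi] by rewrite in_itv /= bp (le_trans a0 (ltW ab)).
by rewrite ltW // ltr_cos.
Qed.

Lemma pi2_gt1 : 1 <= (pi : R).
Proof. by have := pi_ge2 R; lra. Qed.

Lemma sin_lower a : 0 <= a -> a <= 1 -> a * cos 1 <= sin a.
Proof.
move=> a0 a1; have [c [c0 ca]] := @MVT_closed R sin cos 0 a a0 (fun x _ _ => is_derive_sin x).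
rewrite sin0 !subr0 mulrC => ->; rewrite ler_wpM2l //; apply: cos_anti => //; first by lra.
exact: pi2_gt1.
Qed.

Lemma cn_one_sub_cis t : cn (1 - cis t) ^+ 2 = 2 - 2 * cos t.
Proof.
rewrite cn_sqr cReD cImD cReN cImN /= (_ : _ + _ = 1 - 2 * cos t + (cos t ^+ 2 + sin t ^+ 2)); last by ring.
by rewrite cos2Dsin2; ring.
Qed.

(** Reflection in [pi] reduces to [t <= pi], where the cosine decreases. *)
Lemma cis_far a t : 0 < a -> a <= 1 -> a <= t -> t <= pi2 - a ->
  a * cos 1 <= cn (1 - cis t).
Proof.
move=> a0 a1 at1 at2; have k0 := cos1_gt0 R.
apply: le_trans (sin_lower (ltW a0) a1) _.
have pg := pi2_gt1.
have s0 : 0 <= sin a by apply: sin_ge0_pi; rewrite ltW //=; lra.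
rewrite -(@ler_pXn2r _ 2) ?nnegrE ?cn_ge0 // cn_one_sub_cis.
have ct : cos t <= cos a.
  case: (leP t pi) => tp; first by apply: cos_anti => //; lra.
  have -> : cos t = cos (pi2 - t).
    by rewrite -[in LHS](cosN t) -(cosD2pi (- t)) addrC.
  by apply: cos_anti; [exact: ltW|lra|rewrite mulr2n; lra].
rewrite sin2cos2; have := sqr_ge0 (1 - cos a); rewrite !expr2; nra.
Qed.

Definition Dk J t : C := \sum_(j < J) cis (j%:R * t).

Lemma cis_natM n t : cis (n%:R * t) = cis t ^+ n.
Proof. by rewrite mulr_natl cisMn. Qed.

Lemma Dk_bound J t : cn (Dk J t) * cn (1 - cis t) <= 2.
Proof.
have -> : Dk J t = \sum_(j < J) cis t ^+ j by apply: eq_bigr => j _; rewrite cis_natM.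
rewrite -cnM mulrC -cnN -mulNr opprB -subrX1.
by apply: le_trans (cnB _ _) _; rewrite cnX cn_cis expr1n cn1.
Qed.

Lemma cis_Re t : Re (cis t) = cos t. Proof. by []. Qed.
Lemma cis_Im t : Im (cis t) = sin t. Proof. by []. Qed.

Lemma Dk_sqr J t : (cn (Dk J t) ^+ 2)%:C =
  \sum_(j < J) \sum_(j' < J) cis ((j%:R - j'%:R) * t).
Proof.
have -> : \sum_(j < J) \sum_(j' < J) cis ((j%:R - j'%:R) * t) =
   Dk J t * \sum_(j < J) cis (- (j%:R * t)).
  rewrite /Dk big_distrlr /=; apply: eq_bigr => j _; apply: eq_bigr => j' _.
  by rewrite -cisD; congr cis; ring.
set z := Dk J t; set z' := \sum_(j < J) _.
have hr : Re z' = Re z by rewrite !cRe_sum; apply: eq_bigr => j _; rewrite !cis_Re cosN.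
have hi : Im z' = - Im z.
  by rewrite !cIm_sum -sumrN; apply: eq_bigr => j _; rewrite !cis_Im sinN.
rewrite cn_sqr; apply: complexP; rewrite ?cReM ?cImM hr hi /=; ring.
Qed.

Lemma cis_pi2 : cis pi2 = 1 :> C.
Proof. by apply: complexP; rewrite /= ?cos2pi ?sin2pi. Qed.

Lemma cis_neq1 t : 0 < t -> t < pi2 -> cis t != 1 :> C.
Proof.
move=> t0 t2; apply/eqP => h.
pose a := Num.min 1 (Num.min t (pi2 - t)).
have a0 : 0 < a by rewrite !lt_min ltr01 t0 subr_gt0.
have := @cis_far a t a0; rewrite h subrr cn0.
have a1 : a <= 1 by rewrite ge_min lexx.
have a2 : a <= t by rewrite !ge_min lexx orbT.
have a3 : a <= pi2 - t by rewrite !ge_min lexx !orbT.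
move=> /(_ a1 a2 (ltac:(lra))); have := mulr_gt0 a0 (cos1_gt0 R); lra.
Qed.

Lemma root_sum J j j' : (0 < J)%N -> (j < J)%N -> (j' < J)%N ->
  \sum_(m < J) cis ((j%:R - j'%:R) * (m%:R * (pi2 / J%:R))) = (if j == j' then J%:R else 0) :> C.
Proof.
move=> J0 jJ jJ'; have J0' : (0 : R) < J%:R by rewrite ltr0n.
case: eqP => [->|/eqP jj].
  rewrite subrr (eq_bigr (fun=> 1)); last by move=> m _; rewrite mul0r cis0.
  by rewrite sumr_const card_ord.
have pp := pi_gt0 R; have p20 : 0 < pi2 by rewrite mulr2n; lra.
set z := cis ((j%:R - j'%:R) * (pi2 / J%:R)).
rewrite (eq_bigr (fun m : 'I_J => z ^+ m)); last first.
  by move=> m _; rewrite /z -cis_natM; congr cis; ring.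
have zJ : z ^+ J = 1.
  rewrite /z -cis_natM (_ : _ * _ = j%:R * pi2 + j'%:R * (- pi2)); last by field; rewrite gt_eqF.
  rewrite cisD !cis_natM cis_pi2 expr1n mul1r.
  have -> : cis (- pi2) = 1 :> C by rewrite -[LHS]mul1r -{1}cis_pi2 -cisD subrr cis0.
  by rewrite expr1n.
have z1 : z - 1 != 0.
  rewrite subr_eq0; move: jj; rewrite neq_ltn => /orP[jj|jj].
    have : cis ((j'%:R - j%:R) * (pi2 / J%:R)) != 1 :> C.
      apply: cis_neq1; first by rewrite mulr_gt0 ?subr_gt0 ?ltr_nat // divr_gt0.
      rewrite mulrCA -[X in _ < X]mulr1 ltr_pM2l // ltr_pdivrMr // mul1r.
      by apply: le_lt_trans (_ : j'%:R < _); rewrite ?ltr_nat // gerBl.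
    apply: contra_neq => zz1; rewrite -[LHS]mul1r -{1}zz1 /z -cisD -mulrDl.
    by rewrite addrA subrK subrr mul0r cis0.
  apply: cis_neq1; first by rewrite mulr_gt0 ?subr_gt0 ?ltr_nat // divr_gt0.
  rewrite mulrCA -[X in _ < X]mulr1 ltr_pM2l // ltr_pdivrMr // mul1r.
  by apply: le_lt_trans (_ : j%:R < _); rewrite ?ltr_nat // gerBl.
by apply: (mulfI z1); rewrite -subrX1 zJ subrr mulr0.
Qed.

(** Orthogonality over the J-th roots of unity. The normalised Fejer kernels centred at the grid
    points form an exact partition of unity, so both [wF] and [1 - wF] are sums of kernels. *)
Lemma Dk_avg J t : (0 < J)%N -> \sum_(m < J) cn (Dk J (m%:R * (pi2 / J%:R) - t)) ^+ 2 = J%:R ^+ 2.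
Proof.
move=> J0; apply: (@complexI R); rewrite rmorph_sum /=.
under eq_bigr do rewrite Dk_sqr.
rewrite exchange_big /=; under eq_bigr do rewrite exchange_big /=.
rewrite (eq_bigr (fun j : 'I_J => J%:R)); last first.
  move=> j _; rewrite (eq_bigr (fun j' : 'I_J => if j' == j then J%:R else 0)); last first.
    move=> j' _; rewrite (eq_bigr (fun m : 'I_J => cis (- ((j%:R - j'%:R) * t)) *
        cis ((j%:R - j'%:R) * (m%:R * (pi2 / J%:R))))); last first.
      by move=> m _; rewrite -cisD; congr cis; ring.
    rewrite -mulr_sumr root_sum // eq_sym -val_eqE /=; case: eqP => [->|_]; last by rewrite mulr0.
    by rewrite subrr mul0r oppr0 cis0 mul1r.
  by rewrite -big_mkcond big_pred1_eq.
rewrite sumr_const card_ord -[_ *+ J]mulr_natr -expr2 rmorphXn /= rmorph_nat //.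
Qed.

(* wF approximates the cutoff y <= Y (periodised modulo P) by a sum of Fejer kernels at the points
   P m / J, so that only finitely many twists n ^ (- i t) occur. *)
Definition ww_I (J : nat) (P Y : R) (m : nat) : bool := P * m%:R / J%:R <= Y.
Definition wF J P Y y : R :=
  (\sum_(m < J | ww_I J P Y m) cn (Dk J (m%:R * (pi2 / J%:R) - pi2 / P * y)) ^+ 2) / J%:R ^+ 2.

Lemma wF_compl J P Y y : (0 < J)%N -> 1 - wF J P Y y =
  (\sum_(m < J | ~~ ww_I J P Y m) cn (Dk J (m%:R * (pi2 / J%:R) - pi2 / P * y)) ^+ 2) / J%:R ^+ 2.
Proof.
move=> J0; have J2 : J%:R ^+ 2 != 0 :> R by rewrite expf_neq0 // pnatr_eq0 -lt0n.
rewrite /wF -[X in X - _](divff J2) -{1}(Dk_avg (pi2 / P * y) J0) (bigID (fun m : 'I_J => ww_I J P Y m)) /=.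
by rewrite -mulrBl addrAC subrr add0r.
Qed.

Lemma wF_ge0 J P Y y : 0 <= wF J P Y y.
Proof. by rewrite divr_ge0 ?exprn_ge0 //; apply: sumr_ge0 => m _; rewrite exprn_ge0 ?cn_ge0. Qed.

Lemma wF_le1 J P Y y : (0 < J)%N -> wF J P Y y <= 1.
Proof.
move=> J0; rewrite -subr_ge0 wF_compl // divr_ge0 ?exprn_ge0 //.
by apply: sumr_ge0 => m _; rewrite exprn_ge0 ?cn_ge0.
Qed.

Lemma cn_Dk_N J t : cn (Dk J (- t)) = cn (Dk J t).
Proof.
apply: (@pexpIrn _ 2) => //; rewrite ?nnegrE ?cn_ge0 //; apply: (@complexI R).
rewrite !Dk_sqr exchange_big /=; apply: eq_bigr => j _; apply: eq_bigr => j' _; congr cis; ring.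
Qed.

Lemma Dk_far J P (r u : R) : 0 < P -> 0 < r -> pi2 / P * r <= 1 -> r <= `|u| -> `|u| <= P - r ->
  cn (Dk J (pi2 / P * u)) ^+ 2 <= 4 / (pi2 / P * r * cos 1) ^+ 2.
Proof.
move=> P0 r0 hr ur uP; have k0 := cos1_gt0 R.
have pp := pi_gt0 R; have p20 : 0 < pi2 by rewrite mulr2n; lra.
have h0 : 0 < pi2 / P by rewrite divr_gt0.
set h := pi2 / P in h0 hr *.
have hP : h * P = pi2 by rewrite /h divfK // gt_eqF.
have -> : cn (Dk J (h * u)) = cn (Dk J (h * `|u|)).
  by case: (leP 0 u) => u0; [rewrite ger0_norm|rewrite ltr0_norm // mulrN cn_Dk_N].
move: ur uP; set v := `|u| => ur uP.
have hrk : 0 < h * r * cos 1 := mulr_gt0 (mulr_gt0 h0 r0) k0.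
have h1 : h * r * cos 1 <= cn (1 - cis (h * v)).
  apply: cis_far => //; first by rewrite mulr_gt0.
    by rewrite ler_pM2l.
  by rewrite -hP -mulrBr ler_pM2l.
have h2 := Dk_bound J (h * v).
rewrite ler_pdivlMr ?exprn_gt0 // -exprMn (_ : 4 = 2 ^+ 2); last by ring.
have n1 : 0 <= cn (Dk J (h * v)) * (h * r * cos 1) := mulr_ge0 (cn_ge0 _) (ltW hrk).
rewrite ler_pXn2r ?nnegrE //.
by apply: le_trans _ h2; rewrite ler_wpM2l ?cn_ge0.
Qed.

(** If [y] keeps distance [r] from the cutoff and from the ends of the period, every grid point on
    the wrong side of [Y] is at distance at least [r] from [y] modulo [P]. There the squared kernel
    is bounded independently of [J], against the normalisation [J ^ 2]. *)
Lemma wF_err J P Y (r : R) y : (0 < J)%N -> 0 < P -> 0 < r -> pi2 / P * r <= 1 ->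
  r <= y -> y <= P - r -> r <= `|y - Y| ->
  `|(if y <= Y then 1 else 0) - wF J P Y y| <= 4 / (pi2 / P * r * cos 1) ^+ 2 / J%:R.
Proof.
move=> J0 P0 r0 hr ry yP yY; have J0' : (0 : R) < J%:R by rewrite ltr0n.
have E m : m%:R * (pi2 / J%:R) - pi2 / P * y = pi2 / P * (P * m%:R / J%:R - y).
  by field; rewrite !gt_eqF.
have mP (m : 'I_J) : 0 <= P * m%:R / J%:R /\ P * m%:R / J%:R <= P.
  split; first by rewrite divr_ge0 ?mulr_ge0 // ltW.
  by rewrite ler_pdivrMr // ler_pM2l // ler_nat ltnW.
have bnd (Q : pred nat) : (forall m : 'I_J, Q m -> r <= `|P * m%:R / J%:R - y| /\ `|P * m%:R / J%:R - y| <= P - r) ->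
   (\sum_(m < J | Q m) cn (Dk J (m%:R * (pi2 / J%:R) - pi2 / P * y)) ^+ 2) / J%:R ^+ 2 <=
   4 / (pi2 / P * r * cos 1) ^+ 2 / J%:R.
  move=> hQ; rewrite expr2 invfM mulrA ler_pM2r ?invr_gt0 // ler_pdivrMr //.
  apply: le_trans (_ : \sum_(m < J | Q m) 4 / (pi2 / P * r * cos 1) ^+ 2 <= _).
    by apply: ler_sum => m /hQ[h1 h2]; rewrite E Dk_far.
  have b0 : 0 <= 4 / (pi2 / P * r * cos 1) ^+ 2 by rewrite divr_ge0 // sqr_ge0.
  rewrite big_mkcond; apply: le_trans (_ : \sum_(m < J) 4 / (pi2 / P * r * cos 1) ^+ 2 <= _).
    by apply: ler_sum => m _; case: ifP.
  by rewrite sumr_const card_ord mulr_natr.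
case: (leP y Y) => yY'.
  rewrite ler0_norm ?subr_le0 // in yY.
  rewrite ger0_norm ?subr_ge0 ?wF_le1 // wF_compl //; apply: (bnd (fun m => ~~ ww_I J P Y m)) => m; rewrite /ww_I -ltNge => hm.
  clear -ry mP yY' yY hm; have [h1 h2] := mP m; rewrite ger0_norm; lra.
rewrite gtr0_norm ?subr_gt0 // in yY.
rewrite sub0r normrN ger0_norm ?wF_ge0 // /wF; apply: (bnd (ww_I J P Y)) => m; rewrite /ww_I => hm.
clear -yP mP yY' yY hm; have [h1 h2] := mP m; rewrite ler0_norm; lra.
Qed.

(** Expanding the squared kernels turns the weight into twists by the frequencies
    [(j - j') 2 pi / P]. There are at most [J ^ 3] terms with coefficients at most [J ^ (- 2)],
    whence [J B]. *)
Lemma wF_DS J P Y (a : nat -> C) s (B : R) : (0 < J)%N -> absD a s ->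
  (forall j j', (j < J)%N -> (j' < J)%N ->
     cn (DS (fun n => a n * tw ((j%:R - j'%:R) * (pi2 / P)) n) s) <= B) ->
  absum (fun n => tm a s n * (wF J P Y (ln n%:R))%:C) /\
  cn (csum (fun n => tm a s n * (wF J P Y (ln n%:R))%:C)) <= J%:R * B.
Proof.
move=> J0 ha hB; have J0' : (0 : R) < J%:R by rewrite ltr0n.
pose T := ('I_J * 'I_J * 'I_J)%type.
pose tt (p : T) : R := (p.1.2%:R - p.2%:R) * (pi2 / P).
pose co (p : T) : C := if ww_I J P Y p.1.1 then
  cis ((p.1.2%:R - p.2%:R) * (p.1.1%:R * (pi2 / J%:R))) / J%:R ^+ 2 else 0.
pose u (p : T) n := co p * tm (fun n => a n * tw (tt p) n) s n.
have absa t : absum (tm (fun n => a n * tw t n) s).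
  apply: absum_le ha => n n0; rewrite !cn_tm cnM ler_wpM2r ?pw_ge0 //.
  by have [_ _ h] := cmult_tw t; rewrite ler_piMr ?cn_ge0.
have absu p : absum (u p) by apply: absumZ.
have Eu n : (0 < n)%N -> tm a s n * (wF J P Y (ln n%:R))%:C = \sum_(p : T) u p n.
  move=> n0; rewrite -(pair_bigA _ (fun (x : 'I_J * 'I_J) (j' : 'I_J) => u (x, j') n)) /=.
  rewrite -(pair_bigA _ (fun (m j : 'I_J) => \sum_(j' : 'I_J) u (m, j, j') n)) /=.
  rewrite /wF rmorphM /= fmorphV rmorphXn /= rmorph_nat rmorph_sum /= mulr_suml mulr_sumr big_mkcond.
  apply: eq_bigr => m _; case: ifP => hm; last first.
    by rewrite big1 // => j _; rewrite big1 // => j' _; rewrite /u /co hm mul0r.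
  rewrite Dk_sqr mulr_suml mulr_sumr; apply: eq_bigr => j _.
  rewrite mulr_suml mulr_sumr; apply: eq_bigr => j' _; rewrite /u /co hm /tm /tw gtn_eqF //=.
  rewrite mulrBr [cis (_ - _)]cisD (_ : - ((j%:R - j'%:R) * (pi2 / P * ln n%:R)) = - tt (m, j, j') * ln n%:R); first by ring.
  by rewrite /tt; ring.
have [S1 A1] := csum_bigD (index_enum T) absu.
split; first by apply: absum_ext A1.
rewrite (csum_ext Eu A1) S1; apply: le_trans (cn_sum _ _ _) _.
have B0 : 0 <= B by apply: le_trans (hB 0%N 0%N J0 J0); exact: cn_ge0.
apply: le_trans (_ : \sum_(p : T) B / J%:R ^+ 2 <= _).
  apply: ler_sum => p _; rewrite /u csumZ // cnM mulrC; apply: ler_pM; rewrite ?cn_ge0 //.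
    exact: hB.
  rewrite /co; case: ifP => _; last by rewrite cn0 invr_ge0 exprn_ge0.
  by rewrite cnM cn_cis mul1r cnV cnX cn_nat.
rewrite sumr_const !card_prod card_ord -[_ *+ _]mulr_natr !natrM.
by rewrite le_eqVlt; apply/orP; left; apply/eqP; field; rewrite gt_eqF.
Qed.

Lemma log_weight_sum k : exists2 c : R, 1 <= c & forall X N, 1 <= X ->
  \sum_(1 <= n < N.+1) (1 + ln n%:R) ^+ k * pw (1 + X^-1) n <= c * X ^+ k.+1.
Proof.
have [c c0 hc] := @logsum R k.
exists (2 ^+ k * (2 + c)); first by rewrite mulr_ege1 ?exprn_ege1 //; lra.
move=> X N X1; have X0 : 0 < X by lra.
have iX : 0 < X^-1 by rewrite invr_gt0.
have iX1 : X^-1 <= 1 by rewrite invf_le1.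
have h1 := hc X^-1 N iX iX1; rewrite invrK in h1.
have h2 := @sum_pw_bound R X^-1 N.+1 iX; rewrite invrK in h2.
apply: le_trans (_ : 2 ^+ k * (\sum_(1 <= n < N.+1) pw (1 + X^-1) n +
    \sum_(1 <= n < N.+1) ln n%:R ^+ k * pw (1 + X^-1) n) <= _).
  rewrite -big_split mulr_sumr /=; apply: ler_sum => n _.
  rewrite -{2}[pw _ n]mul1r -mulrDl mulrA ler_wpM2r ?pw_ge0 //.
  have l0 := ln_nat_ge0 R n.
  case: (leP (ln (n%:R : R)) 1) => l1.
    apply: le_trans (_ : 2 ^+ k <= _); first by apply: lerXn2r; rewrite ?nnegrE //; lra.
    by rewrite ler_peMr ?exprn_ge0 // lerDl exprn_ge0.
  apply: le_trans (_ : (2 * ln n%:R) ^+ k <= _).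
    by apply: lerXn2r; rewrite ?nnegrE ?mulr_ge0 //; lra.
  by rewrite exprMn ler_wpM2l ?exprn_ge0 // lerDr.
rewrite -mulrA ler_wpM2l ?exprn_ge0 //; apply: le_trans (lerD h2 h1) _.
rewrite mulrDl lerD //; have : X <= X ^+ k.+1 by rewrite -[X in X <= _]expr1 ler_weXn2l.
lra.
Qed.

(** Telescoping [ln n] clamped to [Y - r, Y + 2 r]: the window has length [3 r], and
    [1 / n <= 2 / (n + 1)] costs a factor 2. The upper end leaves room for [ln (n + 1)]. *)
Lemma near_sum Y (r : R) M : 0 < r -> (forall n, (0 < n)%N -> `|ln n%:R - Y| < r -> n%:R^-1 <= r) ->
  \sum_(1 <= n < M.+1 | `|ln n%:R - Y| < r) (n%:R^-1 : R) <= 6 * r.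
Proof.
move=> r0 hn; pose f n : R := Num.max (Y - r) (Num.min (ln n%:R) (Y + 2 * r)).
have fm m n : (0 < m)%N -> (m <= n)%N -> f m <= f n.
  move=> m0 mn; have l : ln m%:R <= ln n%:R :> R.
    by rewrite ler_ln ?posrE ?ltr0n ?ler_nat // (leq_trans m0).
  rewrite /f ge_max; apply/andP; split; rewrite le_max; apply/orP; [by left|right].
  by rewrite le_min !ge_min l lexx orbT.
have h1 : \sum_(1 <= n < M.+1 | `|ln n%:R - Y| < r) (n%:R^-1 : R) <=
    \sum_(1 <= n < M.+1) 2 * (f n.+1 - f n).
  rewrite big_mkcond big_nat [X in _ <= X]big_nat; apply: ler_sum => n /andP[n0 _].
  case: ifP => [h|_]; last by rewrite mulr_ge0 // subr_ge0 fm.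
  have n0' : (0 : R) < n%:R by rewrite ltr0n.
  have hr := hn n n0 h; move: h; rewrite ltr_norml => /andP[ha hb].
  have s1 := @ln_succ_ge R n n0; have s2 := @ln_succ_le R n n0.
  have i1 : n%:R^-1 <= 2 * n.+1%:R^-1 :> R.
    rewrite -[X in X <= _]mul1r ler_pdivrMr // mulrAC ler_pdivlMr ?ltr0n // mul1r -natrM ler_nat.
    by rewrite mul2n -addnn -addn1 leq_add2l.
  have -> : f n = ln n%:R.
    rewrite /f min_l; last by lra.
    by rewrite max_r //; lra.
  have i0 : 0 <= n.+1%:R^-1 :> R by rewrite invr_ge0.
  have -> : f n.+1 = ln n.+1%:R.
    rewrite /f min_l; last by move: (ln n.+1%:R) s1 s2 => *; lra.
    by rewrite max_r //; move: (ln n.+1%:R) (n.+1%:R^-1) s1 s2 i0 => *; lra.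
  by move: (ln n.+1%:R) (n.+1%:R^-1) s1 s2 i1 => *; lra.
apply: le_trans h1 _; rewrite -mulr_sumr telescope_sumr ?ltnS //.
have f1 : Y - r <= f 1%N by rewrite le_max lexx.
have f2 : f M.+1 <= Y + 2 * r by rewrite ge_max ge_min lexx orbT andbT; lra.
lra.
Qed.

(** The sharp cutoff [n <= N] is compared with the weight [wF]. The four terms are the weighted
    series, the error far from the cutoff, the terms near it, and those close to or beyond the end
    of the period. *)
Lemma truncated_bound (b : nat -> C) k (s r Bd S Tl : R) P J N :
  (forall n, (0 < n)%N -> cn (b n) <= 1 + ln n%:R) -> (0 < k)%N -> 1 < s ->
  (0 < J)%N -> 0 < P -> 0 < r -> r <= 1 / 2 -> pi2 / P * r <= 1 -> (0 < N)%N -> 2 / N%:R <= r ->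
  (forall j j', (j < J)%N -> (j' < J)%N ->
     cn (DS (fun n => lnc R n ^+ k * (b n * tw ((j%:R - j'%:R) * (pi2 / P)) n)) s) <= Bd) ->
  (forall M, \sum_(1 <= n < M.+1) (1 + ln n%:R) ^+ k.+1 * pw s n <= S) ->
  (forall M, \sum_(1 <= n < M.+1 | P - r < ln n%:R) (1 + ln n%:R) ^+ k.+1 * pw s n <= Tl) ->
  cn (psum (tm (fun n => lnc R n ^+ k * b n) s) N) <=
    J%:R * Bd + 4 / (pi2 / P * r * cos 1) ^+ 2 / J%:R * S + (2 + ln N%:R) ^+ k.+1 * (6 * r) + Tl.
Proof.
move=> hb k0 s1 J0 P0 r0 r1 hr N0 Nr hBd hS hT.
pose a n := lnc R n ^+ k * b n; pose Y : R := ln N%:R.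
have ha n : (0 < n)%N -> cn (a n) <= (1 + ln n%:R) ^+ k.+1.
  move=> n0; rewrite cnM cnX cn_lnc exprSr; have l0 := ln_nat_ge0 R n.
  apply: ler_pM; rewrite ?exprn_ge0 ?cn_ge0 ?hb //.
  by rewrite ler_pXn2r ?nnegrE //; clear -n0 l0; lra.
have absa : absD a s.
  by apply: (@absD_log R a 1 k.+1) => // n n0; rewrite mul1r ha.
have [|hab hcs] := @wF_DS J P Y a s Bd J0 absa.
  move=> j j' jJ jJ'; apply: le_trans (hBd j j' jJ jJ'); rewrite le_eqVlt; apply/orP; left; apply/eqP.
  by congr (cn (DS _ s)); apply/funext => n; rewrite /a mulrA.
set S0 := csum _ in hcs; set E0 := 4 / _ / _.
have E00 : 0 <= E0 by rewrite !divr_ge0 // sqr_ge0.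
have lim := absumP hab; rewrite -/S0 in lim.
have Tl0 : 0 <= Tl by apply: le_trans (hT 0%N); rewrite big_geq.
have N0' : (0 : R) < N%:R by rewrite ltr0n.
have near n : (0 < n)%N -> `|ln n%:R - Y| < r -> n%:R^-1 <= r.
  move=> n0; rewrite ltr_norml => /andP[h _]; have n0' : (0 : R) < n%:R by rewrite ltr0n.
  have h1 : N%:R / 2 <= n%:R :> R.
    case: (leP (N%:R / 2) (n%:R : R)) => // hlt.
    have : ln n%:R <= ln (N%:R / 2) :> R by rewrite ler_ln ?posrE // ?divr_gt0 //; exact: ltW.
    rewrite ln_div ?posrE // -/Y; have := half_le_ln2 R; clear -r0 r1 hr N0' n0 h; lra.
  by apply: le_trans _ Nr; rewrite -(invf_div N%:R 2) lef_pV2 ?posrE ?divr_gt0.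
have key M : (N <= M)%N -> cn (psum (fun n => tm a s n * (wF J P Y (ln n%:R))%:C) M - psum (tm a s) N) <=
    E0 * S + (2 + Y) ^+ k.+1 * (6 * r) + Tl.
  move=> NM.
  have -> : psum (tm a s) N = \sum_(1 <= n < M.+1) tm a s n * (if ln n%:R <= Y then 1 else 0).
    rewrite /psum [RHS](big_cat_nat (n := N.+1)) //= ?ltnS //=.
    rewrite [X in _ = _ + X]big_nat [X in _ = _ + X]big1 ?addr0.
      apply: eq_big_nat => n /andP[n0 nN].
      by rewrite ler_ln ?posrE ?ltr0n // ler_nat -ltnS nN mulr1.
    move=> n /andP[nN _]; rewrite ler_ln ?posrE ?ltr0n //; last exact: leq_trans nN.
    by rewrite ler_nat leqNgt nN mulr0.
  rewrite /psum -sumrB; apply: le_trans (cn_sum _ _ _) _.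
  pose G n : R := (1 + ln n%:R) ^+ k.+1 * pw s n.
  have G0 n : 0 <= G n by rewrite mulr_ge0 ?pw_ge0 // exprn_ge0 // addr_ge0 // ln_nat_ge0.
  apply: le_trans (_ : \sum_(1 <= n < M.+1) (E0 * G n + (if `|ln n%:R - Y| < r then G n else 0) +
      (if P - r < ln n%:R then G n else 0)) <= _); last first.
    rewrite !big_split /= -mulr_sumr -!big_mkcond /=; apply: lerD => //; apply: lerD; first by rewrite ler_wpM2l.
    apply: le_trans (_ : \sum_(1 <= n < M.+1 | `|ln n%:R - Y| < r) (2 + Y) ^+ k.+1 * n%:R^-1 <= _).
      rewrite big_nat_cond [X in _ <= X]big_nat_cond; apply: ler_sum => n /andP[/andP[n0 _] h].
      move: h; rewrite ltr_norml => /andP[_ h].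
      apply: ler_pM; rewrite ?pw_ge0 ?exprn_ge0 //; first by rewrite addr_ge0 // ln_nat_ge0.
        have := ln_nat_ge0 R n; have := ln_nat_ge0 R N; rewrite -/Y => ? ?.
        by rewrite ler_pXn2r ?nnegrE //; lra.
      by rewrite -pw_oneE // pw_le // ltW.
    rewrite -mulr_sumr ler_wpM2l ?near_sum // exprn_ge0 // addr_ge0 //; exact: ln_nat_ge0.
  rewrite big_nat [X in _ <= X]big_nat; apply: ler_sum => n /andP[n0 _].
  rewrite -mulrBr cnM cn_tm.
  have -> : (wF J P Y (ln n%:R))%:C - (if ln n%:R <= Y then 1 else 0) =
     (wF J P Y (ln n%:R) - (if ln n%:R <= Y then 1 else 0))%:C :> C.
    by rewrite rmorphB; case: ifP => _; rewrite ?rmorph1 ?rmorph0.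
  rewrite cn_real distrC.
  have w0 := wF_ge0 J P Y (ln n%:R); have w1 := wF_le1 P Y (ln n%:R) J0.
  have e1 : `|(if ln n%:R <= Y then 1 else 0) - wF J P Y (ln n%:R)| <= 1.
    by case: ifP => _; rewrite ler_norml; apply/andP; split; clear -w0 w1; lra.
  have aG : cn (a n) * pw s n <= G n by rewrite ler_wpM2r ?pw_ge0 ?ha.
  have a0 : 0 <= cn (a n) * pw s n by rewrite mulr_ge0 ?cn_ge0 ?pw_ge0.
  have EG : 0 <= E0 * G n by rewrite mulr_ge0.
  have big : cn (a n) * pw s n * `|(if ln n%:R <= Y then 1 else 0) - wF J P Y (ln n%:R)| <= G n.
    by apply: le_trans _ aG; rewrite ler_piMr.
  have Gn := G0 n.
  case: (ltP `|ln n%:R - Y| r) => h1.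
    by apply: le_trans big _; rewrite -addrA addrCA lerDl; case: ifP => _; rewrite addr_ge0.
  case: (ltP (P - r) (ln n%:R)) => h2; first by apply: le_trans big _; rewrite addr0 lerDr.
  rewrite !addr0.
  (* [n = 1] lies at the left end of the period, where [wF_err] does not apply; its coefficient
     contains [ln 1 ^ k = 0], as [k > 0]. *)
  have [n1|n1] := leqP n 1.
    have -> : n = 1%N by apply/eqP; rewrite eqn_leq n1 n0.
    rewrite /a cnM cnX cn_lnc ln1 expr0n eqn0Ngt k0 /= !mul0r.
    by rewrite mulr_ge0.
  rewrite mulrC ler_pM ?normr_ge0 //; apply: wF_err => //.
  - apply: le_trans r1 (le_trans (half_le_ln2 R) _); rewrite ler_ln ?posrE ?ltr0n ?ler_nat //.
have lim2 := climD lim (climZ (-1) (clim_const (psum (tm a s) N))).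
rewrite mulN1r in lim2.
have h : cn (S0 - psum (tm a s) N) <= E0 * S + (2 + Y) ^+ k.+1 * (6 * r) + Tl.
  by apply: (clim_le (N1 := N) lim2) => M NM; have := key M NM; rewrite ?mulN1r.
have := cnBge (psum (tm a s) N) S0; rewrite cnBC -/Y; move: h hcs.
rewrite -/a.
move: (cn (S0 - psum (tm a s) N)) (cn S0) (cn (psum (tm a s) N)) => u1 u2 u3; clear; lra.
Qed.

End Fejer.

(** * Choice of parameters and removal of the weights *)

Section LongSums.
Variable R : realType.
Local Notation C := R[i].
Implicit Types (b : nat -> C) (X x q t : R) (K N n : nat).
Local Notation pi2 := ((pi : R) *+ 2).

Lemma exp_decay m (d : R) : 0 < d -> exists2 c : R, 1 <= c &
  forall X, 0 <= X -> X ^+ m * expR (- (d * X)) <= c.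
Proof.
move=> d0; have [c c1 h] := @lnX_le_powR R m d d0; exists c => // X X0.
have e1 : 1 <= expR X by apply: le_trans _ (expR_ge1Dx X); lra.
have := h (expR X) e1; rewrite expRK.
rewrite powRE ?expR_gt0 // expRK expRN => h1.
by rewrite ler_pdivrMr ?expR_gt0.
Qed.

Lemma pi2_bounds : 4 <= pi2 /\ pi2 <= 8.
Proof. by rewrite mulr2n; have := pi_ge2 R; have := pihalf_lt2 R; split; lra. Qed.

Lemma truncn_bounds (y : R) : 1 <= y -> y <= (Num.truncn y).+1%:R /\ (Num.truncn y).+1%:R <= 2 * y.
Proof.
move=> y1; split; first by rewrite ltW // truncnS_gt.
have : (Num.truncn y)%:R <= y by rewrite truncn_le; lra.
by rewrite -natr1; lra.
Qed.

(** The decay [n ^ (- 1 / X)] is split in two. Beyond [ln n = X ^ 2 - 1 / 2] one half is at most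
    [e ^ (- X / 4)], which beats any power of [X]; the other half keeps the sum convergent. *)
Lemma tail_sum K k : exists2 c : R, 1 <= c & forall X (r : R) M, 2 <= X -> r <= 1 / 2 ->
  \sum_(1 <= n < M.+1 | X ^+ 2 - r < ln n%:R) (1 + ln n%:R) ^+ k * pw (1 + X^-1) n <=
  c * (X ^+ k.+1 / X ^+ K).
Proof.
have [c1 c11 h1] := @log_weight_sum R k.
have d0 : (0 : R) < 1 / 4 by lra.
have [c2 c21 h2] := exp_decay K d0.
exists (c1 * 2 ^+ k.+1 * c2); first by rewrite !mulr_ege1 ?exprn_ege1 //; lra.
move=> X r M X2 r2; have X0 : 0 < X by lra.
have X2' : 1 <= 2 * X by lra.
have h3 := h1 (2 * X) M X2'.
have h4 := h2 X (ltW X0).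
have XK : 0 < X ^+ K by rewrite exprn_gt0.
apply: le_trans (_ : \sum_(1 <= n < M.+1) ((1 + ln n%:R) ^+ k * pw (1 + (2 * X)^-1) n) * expR (- (1 / 4 * X)) <= _).
  rewrite big_mkcond big_nat [X in _ <= X]big_nat; apply: ler_sum => n /andP[n0 _].
  have l0 := ln_nat_ge0 R n.
  have g0 : 0 <= (1 + ln n%:R) ^+ k :> R by rewrite exprn_ge0 //; clear -XK n0 l0; lra.
  case: ifP => hn; last by rewrite !mulr_ge0 ?pw_ge0 ?expR_ge0.
  rewrite -mulrA ler_wpM2l // (_ : 1 + X^-1 = 1 + (2 * X)^-1 + (2 * X)^-1); last by field; clear -r2 X0 X2'; lra.
  rewrite pwD // ler_wpM2l ?pw_ge0 // pwE // ler_expR mulNr lerN2 [_^-1 * _]mulrC ler_pdivlMr; last by clear -X2'; lra.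
  clear -X2 r2 X0 l0 g0 hn; by move: hn; rewrite expr2; nra.
rewrite -mulr_suml; apply: le_trans (ler_wpM2r (expR_ge0 _) h3) _.
rewrite exprMn [X in _ <= X](_ : _ = c1 * 2 ^+ k.+1 * (X ^+ k.+1 * (c2 / X ^+ K))); last by ring.
rewrite [X in X <= _](_ : _ = c1 * 2 ^+ k.+1 * (X ^+ k.+1 * expR (- (1 / 4 * X)))); last by ring.
rewrite ler_wpM2l ?mulr_ge0 ?exprn_ge0 //; first by clear -c11 d0; lra.
by rewrite ler_wpM2l ?exprn_ge0 ?(ltW X0) // ler_pdivlMr // mulrC.
Qed.

(** Period [X ^ 2], resolution [r = X ^ (- K - 1)] and [J] about [X ^ (3 K + 8)] make all four terms
    of [truncated_bound] at most of order [X ^ (3 K + 9)]. Frequencies are at most [2 J], so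
    [q (|t| + 2)] is at most [8 X ^ (4 K + 8)] and the hypothesis on the series yields a bound
    linear in [X]. *)
Lemma fejer_sup K (M0 : R) : 1 <= M0 -> exists2 c : R, 1 <= c & forall b q X N,
  (forall n, (0 < n)%N -> cn (b n) <= 1 + ln n%:R) -> 1 <= q -> q <= X ^+ K -> 2 <= X ->
  (forall t, cn (DS (fun n => lnc R n ^+ (4 * K + 9) * (b n * tw t n)) (1 + X^-1)) <=
     M0 * (q * (`|t| + 2)) `^ ((4 * K + 8)%:R^-1)) ->
  (0 < N)%N -> 2 / N%:R <= X ^- K.+1 -> ln N%:R <= X ->
  cn (psum (tm (fun n => lnc R n ^+ (4 * K + 9) * b n) (1 + X^-1)) N) <= c * X ^+ (3 * K + 9).
Proof.
move=> M01; set k := (4 * K + 9)%N; set a := (3 * K + 9)%N; set d := (4 * K + 8)%:R^-1.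
have n1 : (K + (3 * K + 8) = 4 * K + 8)%N by lia.
have n2 : k.+2 = (a + K.+2)%N by rewrite /k /a; lia.
have n3 : k.+1 = (a + K.+1)%N by rewrite /k /a; lia.
have n4 : a = (3 * K + 8).+1 by rewrite /a; lia.
have n5 : (2 * K + 6 = K.+3 + K.+3)%N by lia.
have n6 : (2 * K + 6 + k.+2 = a + (3 * K + 8))%N by rewrite /k /a; lia.
have [cS cS1 hS] := @log_weight_sum R k.+1.
have [cT cT1 hT] := tail_sum K.+2 k.+1.
have k0 := cos1_gt0 R; set kp := cos 1 in k0.
have kp2 : 0 < kp ^+ 2 by rewrite exprn_gt0.
exists (16 * M0 + cS / (4 * kp ^+ 2) + 6 * 2 ^+ k.+1 + cT).
  have : 0 <= cS / (4 * kp ^+ 2) by rewrite divr_ge0 ?mulr_ge0 ?(ltW kp2) //; clear -cS1 k0; lra.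
  have : 0 <= 6 * 2 ^+ k.+1 :> R by rewrite mulr_ge0 // exprn_ge0.
  lra.
move=> b q X N hb q1 qX X2 hD N0 NX lN.
have X0 : 0 < X by clear -k0 kp2 q1 qX X2 N0 NX lN; lra.
have X1 : 1 <= X by clear -k0 kp2 q1 qX X2 N0 NX lN X0; lra.
have Xp m : 0 < X ^+ m by rewrite exprn_gt0.
have iX : 0 < X^-1 by rewrite invr_gt0.
have iX1 : X^-1 <= 1 / 2 by rewrite div1r lef_pV2 ?posrE.
pose r : R := X ^- K.+1; have r0 : 0 < r by rewrite invr_gt0.
have r2 : r <= 1 / 2.
  rewrite div1r lef_pV2 ?posrE //; apply: le_trans X2 _.
  by rewrite -[X in X <= _]expr1 ler_weXn2l.
have [J1 J2] := truncn_bounds (exprn_ege1 (3 * K + 8) X1).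
set J := (Num.truncn _).+1 in J1 J2.
have J0' : (0 : R) < J%:R by rewrite ltr0n.
have [p4 p8] := pi2_bounds.
have P0 := Xp 2%N.
have hr : pi2 / X ^+ 2 * r <= 1.
  apply: le_trans (_ : 8 / X ^+ 2 * (1 / 2) <= _).
    by apply: ler_pM; rewrite ?divr_ge0 ?(ltW r0) // ?ler_pM2r ?invr_gt0 // ?ltW //; clear -p4; lra.
  rewrite mulrAC ler_pdivrMr //; have : 2 * 2 <= X ^+ 2 by rewrite expr2 ler_pM.
  clear -M01 n1 n2 n3 n4 n5 n6; lra.
have hBd j j' : (j < J)%N -> (j' < J)%N ->
   cn (DS (fun n => lnc R n ^+ k * (b n * tw ((j%:R - j'%:R) * (pi2 / X ^+ 2)) n)) (1 + X^-1)) <= M0 * (8 * X).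
  move=> jJ jJ'; apply: le_trans (hD _) _; rewrite ler_wpM2l //; first by clear -M01 n1 n2 n3 n4 n5 n6; lra.
  have h1 : `|(j%:R - j'%:R) * (pi2 / X ^+ 2)| <= 2 * J%:R.
    rewrite normrM mulrC; apply: ler_pM => //.
      rewrite ger0_norm; last by rewrite divr_ge0 ?(ltW P0) //; clear -p4 p8; lra.
      rewrite ler_pdivrMr //; have : 2 * 2 <= X ^+ 2 by rewrite expr2 ler_pM.
      clear -J2 J0' p4 p8; lra.
    have : j%:R < J%:R :> R by rewrite ltr_nat.
    have : j'%:R < J%:R :> R by rewrite ltr_nat.
    have : 0 <= j%:R :> R by []. have : 0 <= j'%:R :> R by [].
    clear -K M0; by rewrite ler_norml => *; apply/andP; split; lra.
  have h2 : q * (`|(j%:R - j'%:R) * (pi2 / X ^+ 2)| + 2) <= 8 * X ^+ (4 * K + 8).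
    apply: le_trans (_ : X ^+ K * (8 * X ^+ (3 * K + 8)) <= _); last first.
      by rewrite mulrCA -exprD n1.
    apply: ler_pM => //; first by clear -kp2 q1; lra.
    have : 1 <= J%:R :> R by rewrite ler1n.
    clear -J1 J2 jJ' h1; lra.
  have d0 : 0 < d by rewrite invr_gt0 ltr0n addn_gt0 orbT.
  have d1 : d <= 1 by rewrite invf_le1 ?ler1n ?ltr0n ?addn_gt0 ?orbT.
  apply: le_trans (_ : (8 * X ^+ (4 * K + 8)) `^ d <= _).
    rewrite ge0_ler_powR ?nnegrE ?(ltW d0) // ?mulr_ge0 ?addr_ge0 ?exprn_ge0 //; clear -q1 X2; lra.
  rewrite powRM ?exprn_ge0 ?(ltW X0) // -powR_mulrn ?(ltW X0) // -powRrM mulfV ?powRr1 ?(ltW X0) //.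
  rewrite ler_wpM2r ?(ltW X0) //; apply: ler1_powR => //; clear -M01 n1 n2 n3; lra.
have s1 : 1 < 1 + X^-1 by clear -NX lN X0 X1 iX iX1 r0; lra.
have hS' M : \sum_(1 <= n < M.+1) (1 + ln n%:R) ^+ k.+1 * pw (1 + X^-1) n <= cS * X ^+ k.+2 by exact: hS.
have hT' M : \sum_(1 <= n < M.+1 | X ^+ 2 - r < ln n%:R) (1 + ln n%:R) ^+ k.+1 * pw (1 + X^-1) n <=
   cT * (X ^+ k.+2 / X ^+ K.+2) by exact: hT.
have kk : (0 < k)%N by rewrite addn_gt0 orbT.
have := truncated_bound hb kk s1 (ltn0Sn _) P0 r0 r2 hr N0 NX hBd hS' hT'.
rewrite -/J -/kp => /le_trans; apply.
rewrite [X in _ <= X](_ : _ = 16 * M0 * X ^+ a + cS / (4 * kp ^+ 2) * X ^+ a + 6 * 2 ^+ k.+1 * X ^+ a +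
  cT * X ^+ a); last by ring.
apply: lerD; last first.
  rewrite n2.
  by rewrite exprD mulfK ?gt_eqF.
apply: lerD; last first.
  have l0 := ln_nat_ge0 R N.
  apply: le_trans (_ : (2 * X) ^+ k.+1 * (6 * r) <= _).
    by rewrite ler_wpM2r ?mulr_ge0 ?(ltW r0) // lerXn2r ?nnegrE ?mulr_ge0 ?addr_ge0 ?(ltW X0) //; clear -X2 lN; lra.
  rewrite exprMn n3.
  rewrite [X ^+ (a + K.+1)]exprD /r le_eqVlt; apply/orP; left; apply/eqP.
  have := lt0r_neq0 (Xp K.+1); move: (X ^+ K.+1) (X ^+ a) (2 ^+ (a + K.+1) : R) => u v w u0.
  by field.
apply: lerD.
  apply: le_trans (_ : 2 * X ^+ (3 * K + 8) * (M0 * (8 * X)) <= _).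
    by rewrite ler_wpM2r // !mulr_ge0 ?(ltW X0) //; clear -M01; lra.
  rewrite n4.
  by rewrite exprSr le_eqVlt; apply/orP; left; apply/eqP; ring.
set Z := pi2 / X ^+ 2 * r * kp.
have Zge : 4 * kp / X ^+ K.+3 <= Z.
  rewrite /Z /r (_ : 4 * kp / X ^+ K.+3 = 4 / X ^+ 2 * X ^- K.+1 * kp).
    by rewrite ler_wpM2r ?(ltW k0) // ler_wpM2r ?(ltW r0) // ler_wpM2r // invr_ge0 ltW.
  rewrite (_ : K.+3 = (2 + K.+1)%N) // exprD invfM; ring.
have z0 : 0 < 4 * kp / X ^+ K.+3 by rewrite divr_gt0 // mulr_gt0.
have Z2 : 4 / Z ^+ 2 <= X ^+ (2 * K + 6) / (4 * kp ^+ 2).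
  apply: le_trans (_ : 4 / (4 * kp / X ^+ K.+3) ^+ 2 <= _).
    rewrite ler_pM2l // lef_pV2 ?posrE ?exprn_gt0 ?(lt_le_trans z0) // lerXn2r ?nnegrE ?(ltW z0) //.
    exact: ltW (lt_le_trans z0 Zge).
  rewrite n5 exprD.
  rewrite le_eqVlt; apply/orP; left; apply/eqP.
  have kn := lt0r_neq0 k0; have := lt0r_neq0 (Xp K.+3); move: (X ^+ K.+3) => u u0.
  by field; rewrite u0 kn.
apply: le_trans (_ : X ^+ (2 * K + 6) / (4 * kp ^+ 2) / X ^+ (3 * K + 8) * (cS * X ^+ k.+2) <= _).
  have S0 : 0 <= cS * X ^+ k.+2 by rewrite mulr_ge0 ?(ltW (Xp _)) //; clear -n6 cS1; lra.
  have Q0 : 0 <= 4 / Z ^+ 2 by rewrite divr_ge0 // sqr_ge0.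
  have iJ : 0 <= J%:R^-1 :> R by rewrite invr_ge0.
  have JJ : J%:R^-1 <= (X ^+ (3 * K + 8))^-1 by rewrite lef_pV2 ?posrE.
  exact: ler_wpM2r S0 _ _ (ler_pM Q0 iJ Z2 JJ).
rewrite le_eqVlt; apply/orP; left; apply/eqP.
have -> : X ^+ (2 * K + 6) / (4 * kp ^+ 2) / X ^+ (3 * K + 8) * (cS * X ^+ k.+2) =
   cS / (4 * kp ^+ 2) * (X ^+ (2 * K + 6) * X ^+ k.+2 / X ^+ (3 * K + 8)) by ring.
rewrite -exprD n6.
by rewrite exprD mulfK ?gt_eqF.
Qed.

Lemma trivial_sum b N : (forall n, (0 < n)%N -> cn (b n) <= 1 + ln n%:R) ->
  cn (\sum_(1 <= n < N.+1) b n) <= N%:R * (1 + ln N%:R).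
Proof.
move=> hb; apply: le_trans (cn_sum _ _ _) _.
apply: le_trans (_ : \sum_(1 <= n < N.+1) (1 + ln N%:R) <= _).
  rewrite big_nat [X in _ <= X]big_nat; apply: ler_sum => n /andP[n0 nN].
  apply: le_trans (hb n n0) _; rewrite lerD2l ler_ln ?posrE ?ltr0n ?ler_nat //.
  exact: leq_trans n0 nN.
by rewrite sumr_const_nat subn1 /= mulr_natl.
Qed.

Lemma variation_bound (u v : nat -> R) m l : (forall n, (m <= n)%N -> 0 <= u n) ->
  (forall n, (m <= n)%N -> 0 <= v n) ->
  (forall n, (m <= n)%N -> u n <= u n.+1) -> (forall n, (m <= n)%N -> v n.+1 <= v n) ->
  \sum_(m <= n < m + l) `|u n.+1 * v n.+1 - u n * v n| <= 2 * (u (m + l)%N * v m).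
Proof.
move=> u0 v0 hu hv.
have ui i j : (m <= i)%N -> (i <= j)%N -> u i <= u j.
  by move=> mi; elim: j => [|j IH]; rewrite leq_eqVlt => /predU1P[->//|//]; rewrite ltnS => ij;
     apply: le_trans (IH ij) (hu j (leq_trans mi ij)).
have vd j : (m <= j)%N -> v j <= v m.
  by elim: j => [|j IH]; rewrite leq_eqVlt => /predU1P[->//|//]; rewrite ltnS => ij;
     apply: le_trans (hv j ij) (IH ij).
apply: le_trans (_ : \sum_(m <= n < m + l) ((u n.+1 - u n) * v m + u (m + l)%N * (v n - v n.+1)) <= _).
  rewrite big_nat [X in _ <= X]big_nat; apply: ler_sum => n /andP[mn nl].
  have -> : u n.+1 * v n.+1 - u n * v n = (u n.+1 - u n) * v n - u n.+1 * (v n - v n.+1) by ring.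
  apply: le_trans (ler_normB _ _) _.
  have un := hu n mn; have vn := hv n mn.
  have un1 := u0 n.+1 (leqW mn).
  rewrite !ger0_norm ?mulr_ge0 ?subr_ge0 ?v0 //; apply: lerD.
    by rewrite ler_wpM2l ?subr_ge0 ?vd.
  by rewrite ler_wpM2r ?subr_ge0 // ui // leqW.
rewrite big_split /= -mulr_suml -mulr_sumr !telescope_sumr ?leq_addr //.
have -> : \sum_(m <= n < m + l) (v n - v n.+1) = v m - v (m + l)%N.
  rewrite -[RHS]opprB -telescope_sumr ?leq_addr // -sumrN; apply: eq_bigr => n _; by rewrite opprB.
have mm := leqnn m; have ml := leq_addr l m.
have := mulr_ge0 (u0 m mm) (v0 m mm); have := mulr_ge0 (u0 _ ml) (v0 _ ml).
lra.
Qed.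

(** Partial summation removes the weight [ln ^ k n * n ^ (- s)] at [s = 1 + 1 / X]. Above the square
    root of [x] one has [ln n >= X / 2], and [n ^ s] exceeds [n] by a bounded factor, so
    [X ^ (3 K + 9)] becomes [x X ^ (3 K + 9 - k) = x X ^ (- K)]. Terms up to the square root are
    trivial. *)
Lemma fejer_main K (M0 : R) : 1 <= M0 -> exists2 c : R, 1 <= c & forall b q x N,
  (forall n, (0 < n)%N -> cn (b n) <= 1 + ln n%:R) -> 1 <= q -> q <= (ln x) ^+ K -> 1 < x -> 1 <= ln x ->
  (forall s t, 1 < s -> s <= 2 -> cn (DS (fun n => lnc R n ^+ (4 * K + 9) * (b n * tw t n)) s) <=
     M0 * (q * (`|t| + 2)) `^ ((4 * K + 8)%:R^-1)) ->
  N%:R <= x -> cn (\sum_(1 <= n < N.+1) b n) <= c * (x / (ln x) ^+ K).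
Proof.
move=> M01; have [c1 c11 h1] := fejer_sup K M01.
set k := (4 * K + 9)%N in h1 *; set a := (3 * K + 9)%N in h1.
have nk : k = (a + K)%N by rewrite /k /a; lia.
have d0 : (0 : R) < 1 / 2 by lra.
have [c2 c21 h2] := @lnX_le_powR R K.+2 (1 / 2) d0.
pose X0 : R := Num.max 2 (4 * c2).
have X02 : 2 <= X0 by rewrite le_max lexx.
have X0c : 4 * c2 <= X0 by rewrite le_max lexx orbT.
pose cA : R := 2 * X0 ^+ K.+1; pose cB : R := 24 * expR 1 * c1 * 2 ^+ k.
have cA0 : 0 <= cA by rewrite mulr_ge0 // exprn_ge0 //; lra.
have cB0 : 0 <= cB by rewrite !mulr_ge0 ?expR_ge0 ?exprn_ge0 //; lra.
exists (cA + 2 * c2 + cB); first by lra.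
move=> b q x N hb q1 qX x1 X1 hD Nx.
have x0 : 0 < x by clear -cA0 cB0 q1 qX x1 X1 Nx; lra.
set X := ln x in qX X1 *.
have X0' : 0 < X by clear -cB0 q1 x1 Nx x0 qX X1; lra.
have XK : 0 < X ^+ K by rewrite exprn_gt0.
have xK : 0 < x / X ^+ K by rewrite divr_gt0.
have lnle M : (0 < M)%N -> M%:R <= x -> ln M%:R <= X by move=> Mp Mx; rewrite ler_ln ?posrE ?ltr0n.
have triv (M : nat) (y : R) : M%:R <= y -> y <= x -> cn (\sum_(1 <= n < M.+1) b n) <= 2 * y * X.
  move=> My yx; apply: le_trans (trivial_sum M hb) _.
  case: M My => [|M] My; first by rewrite mul0r mulr_ge0 ?(ltW X0') // mulr_ge0.
  have := lnle M.+1 (ltn0Sn _) (le_trans My yx) => l.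
  have l0 := ln_nat_ge0 R M.+1.
  apply: le_trans (_ : y * (2 * X) <= _); last by rewrite le_eqVlt; apply/orP; left; apply/eqP; ring.
  by apply: ler_pM => //; rewrite ?addr_ge0 //; clear -X1 l; lra.
case: (ltP X X0) => XX.
  apply: le_trans (triv N x Nx (lexx _)) _.
  apply: le_trans (_ : cA * (x / X ^+ K) <= _); last by rewrite ler_wpM2r ?(ltW xK) //; clear -d0 c21 cA0 cB0; lra.
  rewrite mulrA ler_pdivlMr // /cA.
  have h3 : X ^+ K.+1 <= X0 ^+ K.+1 by rewrite lerXn2r ?nnegrE //; clear -X0' XX; lra.
  rewrite [X in X <= _](_ : _ = 2 * X ^+ K.+1 * x); last by rewrite exprS; ring.
  by rewrite ler_wpM2r ?(ltW x0) // ler_wpM2l.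
have X2 : 2 <= X by clear -X02 X0c cA0 XK xK XX; lra.
pose y : R := x `^ (1 / 2).
have yy : y * y = x.
  rewrite /y -powRD; last by rewrite (gt_eqF x0) implybT.
  by rewrite (_ : 1 / 2 + 1 / 2 = 1) ?powRr1 ?(ltW x0) //; field.
have y0 : 0 < y by rewrite powR_gt0.
have Xc : X ^+ K.+2 <= c2 * y by apply: h2; clear -q1 x1; lra.
have X1K : X ^+ K.+1 <= c2 * y.
  by apply: le_trans Xc; rewrite ler_weXn2l.
have y4 : 4 * X ^+ K.+1 <= y.
  have c20 : 0 < c2 by clear -M01 c11 nk d0 c21 X02; lra.
  rewrite -(ler_pM2l c20); apply: le_trans _ Xc; rewrite (exprS X K.+1) mulrCA mulrA ler_wpM2r ?exprn_ge0 ?(ltW X0') //.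
  by clear -X0c cA0 cB0 q1 x1 Nx XX X2 yy; lra.
have XK1 : 1 <= X ^+ K.+1 by rewrite exprn_ege1.
pose N1 := Num.truncn y.
have N1y : N1%:R <= y by rewrite truncn_le; clear -yy y0 Xc X1K y4 XK1; lra.
have yN1 : y <= N1.+1%:R by rewrite ltW // truncnS_gt.
have yx : y <= x by rewrite -yy ler_peMr ?(ltW y0) //; clear -y0 y4 XK1; lra.
clear -M01 c11 h1 nk d0 c21 h2 X02 X0c cA0 cB0 hb q1 x1 hD Nx x0 qX X1 X0' XK xK lnle triv XX X2 yy y0 Xc X1K y4 XK1 N1y yN1 yx; have N1X : 2 * X ^+ K.+1 <= N1%:R by move: yN1; rewrite -natr1; lra.
have N10 : (0 < N1)%N by rewrite -(ltr0n R); clear -X1K y4 XK1 N1y yN1; lra.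
have N1r : 2 / N1%:R <= X ^- K.+1.
  by rewrite ler_pdivrMr ?ltr0n // mulrC ler_pdivlMr // ?exprn_gt0 //; lra.
have small M : (M <= N1)%N -> cn (\sum_(1 <= n < M.+1) b n) <= 2 * c2 * (x / X ^+ K).
  move=> MN; apply: le_trans (triv M y _ yx) _; first by rewrite (le_trans _ N1y) // ler_nat.
  rewrite mulrA ler_pdivlMr // -yy.
  rewrite [X in X <= _](_ : _ = 2 * y * X ^+ K.+1); last by rewrite exprS; ring.
  rewrite [X in _ <= X](_ : _ = 2 * y * (c2 * y)); last by ring.
  by rewrite ler_wpM2l // mulr_ge0 // ltW.
case: (leqP N N1) => NN.
  by apply: le_trans (small N NN) _; rewrite ler_wpM2r ?(ltW xK) //; clear -cA0 cB0; lra.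
rewrite (big_cat_nat (n := N1.+1)) //= ?ltnS 1?ltnW //; apply: le_trans (cnD _ _) _.
rewrite [X in _ <= X](_ : _ = 2 * c2 * (x / X ^+ K) + (cA + cB) * (x / X ^+ K)); last by ring.
apply: lerD; first exact: small.
apply: le_trans (_ : cB * (x / X ^+ K) <= _); last by rewrite ler_wpM2r ?(ltW xK) //; clear -cA0; lra.
pose s : R := 1 + X^-1.
have iX : 0 < X^-1 by rewrite invr_gt0.
have iX1 : X^-1 <= 1 by rewrite invf_le1.
have hsup M : (N1 <= M)%N -> (M <= N)%N -> cn (psum (tm (fun n => lnc R n ^+ k * b n) s) M) <= c1 * X ^+ a.
  move=> M1 M2; apply: (h1 b q X M) => //.
  - by move=> t; apply: hD; clear -iX iX1 M1 M2; lra.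
  - exact: leq_trans M1.
  - apply: le_trans _ N1r; rewrite ler_pM2l // lef_pV2 ?posrE ?ltr0n ?ler_nat //.
    exact: leq_trans M1.
  apply: lnle; first exact: leq_trans M1.
  by apply: le_trans Nx; rewrite ler_nat.
(* Cut off at [N], because Abel summation needs the partial sums bounded for every length and [hsup]
   stops at [N]. *)
pose aa n := if (n <= N)%N then tm (fun n => lnc R n ^+ k * b n) s n else 0.
pose u n : R := n%:R `^ s; pose v n : R := (ln n%:R)^-1 ^+ k.
pose g n : C := (u n * v n)%:C.
have partial l : cn (\sum_(N1.+1 <= n < N1.+1 + l) aa n) <= 2 * (c1 * X ^+ a).
  pose L := minn l (N - N1).
  have E : \sum_(N1.+1 <= n < N1.+1 + l) aa n = psum (tm (fun n => lnc R n ^+ k * b n) s) (N1 + L) -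
     psum (tm (fun n => lnc R n ^+ k * b n) s) N1.
    have LN : (N1 + L <= N)%N by rewrite -(subnKC (ltnW NN)) leq_add2l geq_minr.
    rewrite (big_cat_nat (n := N1.+1 + L)) ?leq_addr ?leq_add2l ?geq_minl //=.
    rewrite [X in _ + X]big_nat [X in _ + X]big1 ?addr0; last first.
      move=> n /andP[n1 n2]; rewrite /aa; case: ifP => // nN.
      move: n1; rewrite addSn => n1.
      have : (N1 + L < N)%N by exact: leq_trans n1 nN.
      rewrite /L; case: (leqP l (N - N1)) => hl.
        by move: n2; rewrite addSn ltnS leqNgt => /negP; case; move: n1; rewrite /L (minn_idPl hl).
      by rewrite subnKC ?ltnn // ltnW.
    rewrite /psum [X in _ = X - _](big_cat_nat (n := N1.+1)) //=; last by rewrite ltnS leq_addr.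
    rewrite addrAC subrr add0r -addSn; apply: eq_big_nat => n /andP[n1 n2].
    by rewrite /aa (leq_trans _ LN) // -ltnS -addSn.
  rewrite E; apply: le_trans (cnB _ _) _.
  have := hsup (N1 + L)%N (leq_addr _ _); have := hsup N1 (leqnn _) (ltnW NN).
  have LN : (N1 + L <= N)%N by rewrite -(subnKC (ltnW NN)) leq_add2l geq_minr.
  clear -iX iX1 hsup l E LN; move=> h3 /(_ LN) h4; lra.
have lnN n : (N1 < n)%N -> X / 2 <= ln n%:R.
  move=> nN; have : ln y <= ln n%:R.
    rewrite ler_ln ?posrE ?ltr0n //; last exact: leq_trans nN.
    by apply: le_trans yN1 _; rewrite ler_nat.
  by rewrite /y ln_powR mulrC mulrA mulr1.
have bg n : (N1 < n)%N -> (n <= N)%N -> b n = aa n * g n.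
  move=> n1 n2; have n0 : (0 < n)%N by exact: leq_trans n1.
  rewrite /aa n2 /tm /g /lnc; have l1 := lnN n n1.
  have l0 : ln n%:R != 0 :> R by rewrite gt_eqF //; clear -X0' XK l1; lra.
  have uv : pw s n * u n = 1.
    by rewrite /u /pw -powRD ?subrr ?(addrC (- s)) ?subrr ?powRr0 // pnatr_eq0 -lt0n n0 implybT.
  have E1 : ln n%:R ^+ k * pw s n * (u n * v n) = 1.
    by rewrite /v [X in X * _]mulrC mulrACA uv mul1r -exprMn mulfV // expr1n.
  rewrite -rmorphXn /= [RHS](_ : _ = b n * ((ln n%:R ^+ k)%:C * (pw s n)%:C * (u n * v n)%:C)); last first.
    by move: (ln n%:R ^+ k)%:C (u n * v n)%:C => *; ring.
  by rewrite -!rmorphM /= E1 rmorph1 mulr1.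
have u0 n : 0 <= u n by exact: powR_ge0.
have v0 n : 0 <= v n by rewrite exprn_ge0 // invr_ge0 ln_nat_ge0.
have uN n : (N1.+1 <= n)%N -> u n <= u n.+1.
  by move=> _; rewrite ge0_ler_powR ?nnegrE ?ler_nat //; rewrite /s; clear -iX; lra.
have vN n : (N1.+1 <= n)%N -> v n.+1 <= v n.
  move=> n1; rewrite lerXn2r ?nnegrE ?invr_ge0 ?ln_nat_ge0 // lef_pV2 ?posrE.
  - by rewrite ler_ln ?posrE ?ltr0n ?ler_nat //; exact: leq_trans n1.
  - by have := lnN n.+1 (leqW n1); clear -X1 X0' XK xK; lra.
  by have := lnN n n1; clear -X1 X0' XK xK; lra.
have := @abel_bound R aa g _ _ (N - N1) partial.
rewrite addSn subnKC 1?ltnW // => hab.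
rewrite (_ : \sum_(N1.+1 <= i < N.+1) b i = \sum_(N1.+1 <= n < N.+1) aa n * g n); last first.
  by apply: eq_big_nat => n /andP[n1 n2]; rewrite bg.
apply: le_trans hab _.
have gv : \sum_(N1.+1 <= n < N.+1) cn (g n.+1 - g n) <= 2 * (u N.+1 * v N1.+1).
  have := @variation_bound u v N1.+1 (N - N1) (fun n _ => u0 n) (fun n _ => v0 n) uN vN.
  rewrite addSn subnKC 1?ltnW //; apply: le_trans; apply: ler_sum => n _.
  by rewrite /g -rmorphB cn_real.
have gN : cn (g N.+1) <= u N.+1 * v N1.+1.
  rewrite cn_real ger0_norm ?mulr_ge0 // ler_wpM2l //.
  rewrite lerXn2r ?nnegrE ?invr_ge0 ?ln_nat_ge0 // lef_pV2 ?posrE.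
  - by rewrite ler_ln ?posrE ?ltr0n ?ler_nat // ltnW // ltnS.
  - by have := lnN N.+1 (leqW NN); clear -X1 X0' XK xK; lra.
  by have := lnN N1.+1 (leqnn _); clear -q1 x1 Nx x0 qX X1 X0' XK xK; lra.
have uB : u N.+1 <= 4 * expR 1 * x.
  apply: le_trans (_ : (2 * x) `^ s <= _).
    rewrite ge0_ler_powR ?nnegrE ?mulr_ge0 ?(ltW x0) //; first by rewrite /s; clear -iX; lra.
    by rewrite -natr1; clear -q1 x1 Nx x0; lra.
  rewrite powRM ?(ltW x0) // -mulrA; apply: ler_pM; rewrite ?powR_ge0 //.
    apply: le_trans (_ : 2 `^ 2%:R <= _); first by rewrite ler_powR //; rewrite /s; clear -iX1; lra.
    by rewrite powR_mulrn // expr2; clear; lra.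
  rewrite /s powRD; last by rewrite (gt_eqF x0) implybT.
  rewrite powRr1 ?(ltW x0) // mulrC [x `^ _]powRE // mulVf ?gt_eqF //.
have vB : v N1.+1 <= (2 / X) ^+ k.
  rewrite lerXn2r ?nnegrE ?invr_ge0 ?ln_nat_ge0 ?divr_ge0 ?(ltW X0') //.
  rewrite -(invf_div X 2) lef_pV2 ?posrE ?divr_gt0 ?lnN //.
  by have := lnN N1.+1 (leqnn _); clear -X0' XK xK XX; lra.
have uvB : u N.+1 * v N1.+1 <= 4 * expR 1 * x * (2 / X) ^+ k by apply: ler_pM.
apply: le_trans (_ : 2 * (c1 * X ^+ a) * (3 * (4 * expR 1 * x * (2 / X) ^+ k)) <= _).
  rewrite ler_wpM2l ?mulr_ge0 ?exprn_ge0 ?(ltW X0') //; first by clear -c11; lra.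
  clear -gv gN uB vB uvB; lra.
rewrite /cB expr_div_n nk [X ^+ (a + K)]exprD le_eqVlt; apply/orP; left; apply/eqP.
have Xa : X ^+ a != 0 by rewrite gt_eqF // exprn_gt0.
move: (lt0r_neq0 XK) Xa; move: (X ^+ K) (X ^+ a) (expR 1) (2 ^+ (a + K) : R) => p r e z1 p0 r0.
by field; rewrite p0 r0.
Qed.

End LongSums.

(** * The Siegel-Walfisz theorem *)

Section SiegelWalfisz.
Variable R : realType.
Local Notation C := R[i].
Implicit Types (chi : nat -> C) (x : R) (K N n q a : nat).

Lemma char_sum K : exists2 c : R, 1 <= c & forall q chi x N, (0 < q)%N -> dchar q chi ->
  ~ principal q chi -> q%:R <= (ln x) ^+ K -> 1 < x -> 1 <= ln x -> N%:R <= x ->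
  cn (\sum_(1 <= n < N.+1) chi n * (vM R n)%:C) <= c * (x / (ln x) ^+ K).
Proof.
have d0 : (0 : R) < (4 * K + 8)%:R^-1 by rewrite invr_gt0 ltr0n addn_gt0 orbT.
have [M M1 hM] := @dchar_FF R (4 * K + 9) _ d0.
have [c c1 hc] := fejer_main K M1; exists c => // q chi x N q0 hd np qX x1 X1 Nx.
apply: (hc _ q%:R) => //; last first.
- move=> s t s1 s2; have := hM q chi t s q0 hd np s1 s2.
  rewrite (_ : FF _ _ _ = DS (fun n => lnc R n ^+ (4 * K + 9) * (chi n * (vM R n)%:C * tw t n)) s) //.
  by congr (DS _ s); apply/funext => n; rewrite mulrAC.
- by rewrite ler1n.
move=> n n0; rewrite cnM cn_real (ger0_norm (vM_ge0 R n)).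
have [[_ _ h] _ _ _] := hd.
have l0 := ln_nat_ge0 R n; have v1 := vM_le R n0; have v0 := vM_ge0 R n.
apply: le_trans (_ : 1 * vM R n <= _); first by rewrite ler_wpM2r.
by lra.
Qed.

(** The argument is run on [Lambda - 1]: its series is [FF - zz], from which the pole has
    disappeared by [zeta_FF]. *)
Lemma prime_number_theorem K : exists2 c : R, 1 <= c & forall x N, 1 < x -> 1 <= ln x -> N%:R <= x ->
  `|\sum_(1 <= n < N.+1) vM R n - N%:R| <= c * (x / (ln x) ^+ K).
Proof.
have d0 : (0 : R) < (4 * K + 8)%:R^-1 by rewrite invr_gt0 ltr0n addn_gt0 orbT.
have [M M1 hM] := @zeta_FF R (4 * K + 9) _ d0.
have [c c1 hc] := fejer_main K M1; exists c => // x N x1 X1 Nx.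
have := hc (fun n => (vM R n - 1)%:C) 1 x N.
rewrite -rmorph_sum cn_real sumrB sumr_const_nat subn1 /=; apply => //.
- move=> n n0; rewrite cn_real; have l0 := ln_nat_ge0 R n; have v1 := vM_le R n0; have v0 := vM_ge0 R n.
  by rewrite ler_norml; apply/andP; split; clear -Nx n0 l0 v1 v0; lra.
- by rewrite exprn_ege1.
move=> s t s1 s2; have := hM s t s1 s2; rewrite mul1r.
rewrite (_ : FF _ _ _ - zz _ _ _ = DS (fun n => lnc R n ^+ (4 * K + 9) * ((vM R n - 1)%:C * tw t n)) s) //.
have ct := cmult_tw t.
have A1 : absD (fun n => lnc R n ^+ (4 * K + 9) * (tw t n * (vM R n)%:C)) s by exact: absD_FF.
have A2 : absD (fun n => lnc R n ^+ (4 * K + 9) * tw t n) s by exact: absD_LL.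
have A3 := absumZ (-1) A2.
rewrite /FF /zz /DS -[X in _ + X]mulN1r -csumZ // -csumD //; apply/esym; apply: csum_ext; last exact: absumD.
move=> n n0; rewrite /tm rmorphB rmorph1; ring.
Qed.

Lemma vM_prime p : prime p -> vM R p = ln p%:R.
Proof.
move=> pp; have p0 := prime_gt0 pp; have p1 := prime_gt1 pp.
rewrite -(sum_vM R p0) (sum_divisors _ p0 (leqnn p)) big_mkcond big_nat_recr //= dvdnn.
rewrite big_ltn // dvd1n vM1 add0r big_nat_cond big1 ?add0r // => d /andP[/andP[d1 dp] _].
case: ifP => // hd; have /primeP[_ /(_ d hd)] := pp.
by rewrite (gtn_eqF d1) /= => /eqP E; rewrite E ltnn in dp.
Qed.

Lemma log2_le k N : (2 ^ k <= N)%N -> k%:R <= 2 * ln N%:R :> R.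
Proof.
move=> h; have : ln (2 ^ k)%:R <= ln N%:R :> R.
  by rewrite ler_ln ?posrE ?ltr0n ?ler_nat ?expn_gt0 // (leq_trans _ h) ?expn_gt0.
rewrite natrX lnXn // -[_ *+ _]mulr_natl; have := half_le_ln2 R.
have : 0 <= k%:R :> R by [].
nra.
Qed.

(** Prime powers are counted by their base: at most [Z] bases, each with at most [2 ln N] exponents,
    since [2 ^ k <= N]. *)
Lemma vM_small_base (S : pred nat) N Z :
  (forall p k, prime p -> (0 < k)%N -> (p ^ k <= N)%N -> S (p ^ k)%N -> (p <= Z)%N) ->
  \sum_(1 <= n < N.+1 | S n) vM R n <= Z%:R * (2 * ln N%:R * ln N%:R).
Proof.
move=> hS; have l0 := ln_nat_ge0 R N.
rewrite big_nat_cond (eq_bigr (fun n => \sum_(1 <= p < N.+1 | prime p)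
   \sum_(1 <= k < N.+1 | n == (p ^ k)%N) ln p%:R)); last first.
  by move=> n /andP[/andP[n0 nN] _]; rewrite (vME R n0 (M := N)).
rewrite exchange_big /=.
apply: le_trans (_ : \sum_(1 <= p < N.+1 | prime p) (if (p <= Z)%N then 2 * ln N%:R * ln N%:R else 0) <= _); last first.
  rewrite -big_mkcondr /=.
  apply: le_trans (_ : \sum_(1 <= p < Z.+1) 2 * ln N%:R * ln N%:R <= _); last first.
    by rewrite sumr_const_nat subn1 /= -[_ *+ Z]mulr_natl.
  have g0 : 0 <= 2 * ln N%:R * ln N%:R :> R by rewrite !mulr_ge0.
  rewrite -[X in X <= _]big_filter; apply: sum_uniq_sub => //.
  - by rewrite filter_uniq // iota_uniq.
  - exact: iota_uniq.
  by move=> p; rewrite mem_filter !mem_index_iota => /andP[/andP[_ pZ] /andP[p0 _]]; rewrite p0 ltnS.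
rewrite big_nat_cond [X in _ <= X]big_nat_cond; apply: ler_sum => p /andP[/andP[p0 pN] pp].
rewrite (exchange_big_dep xpredT) //=; have p1 := prime_gt1 pp.
have lp : ln p%:R <= ln N%:R :> R by rewrite ler_ln ?posrE ?ltr0n ?ler_nat // (leq_trans p0).
have lp0 := ln_nat_ge0 R p.
pose L := Num.truncn (2 * ln N%:R : R).
have hL k : (0 < k)%N -> (p ^ k <= N)%N -> (k <= L)%N.
  move=> k0 pk; rewrite /L truncn_ge_nat ?mulr_ge0 //.
  by apply: log2_le; apply: leq_trans pk; rewrite leq_exp2r.
case: ifP => pZ; last first.
  rewrite big_nat_cond big1 // => k /andP[/andP[k0 _] _]; rewrite big_seq_cond big1 // => n.
  rewrite mem_index_iota => /andP[_ /andP[/andP[/andP[n0 nN] Sn] /eqP E]].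
  by move: pZ; rewrite (hS p k) // -?E.
apply: le_trans (_ : \sum_(1 <= k < L.+1) ln N%:R <= _); last first.
  rewrite sumr_const_nat subn1 /= -[_ *+ L]mulr_natl ler_wpM2r //.
  by rewrite /L truncn_le mulr_ge0.
apply: le_trans (_ : \sum_(1 <= k < N.+1) (if (k <= L)%N then ln N%:R else 0) <= _); last first.
  rewrite -big_mkcond /= -[X in X <= _]big_filter; apply: sum_uniq_sub => //.
  - by rewrite filter_uniq // iota_uniq.
  - exact: iota_uniq.
  by move=> k; rewrite mem_filter !mem_index_iota => /andP[kL /andP[k0 _]]; rewrite k0 ltnS.
rewrite big_nat [X in _ <= X]big_nat; apply: ler_sum => k /andP[k0 kN].
rewrite -big_filter; set s := [seq _ <- _ | _].
have us : uniq s by rewrite filter_uniq // iota_uniq.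
have hs n : n \in s -> n = (p ^ k)%N /\ (n <= N)%N.
  by rewrite mem_filter => /andP[/andP[/andP[/andP[_ nN] _] /eqP E] _].
case E: s => [|n s']; first by rewrite big_nil; case: ifP.
have [En nN] : n = (p ^ k)%N /\ (n <= N)%N by apply: hs; rewrite E mem_head.
rewrite hL // -?En //; case: s' E => [|m s'] E; first by rewrite big_seq1.
have [Em _] : m = (p ^ k)%N /\ (m <= N)%N by apply: hs; rewrite E !inE eqxx orbT.
by move: us; rewrite E /= inE En Em eqxx.
Qed.

(** With [a'] an inverse of [a], the value [chi a'] stands in for the conjugate of [chi a]. *)
Lemma residue_chars q a (chi : 'I_(totient q) -> nat -> C) : (0 < q)%N -> coprime a q ->
  (forall i, dchar q (chi i)) ->
  (forall n, coprime n q -> \sum_i chi i n = if (n == 1 %[mod q])%N then (totient q)%:R else 0) ->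
  exists2 a', coprime a' q & forall n, \sum_i chi i a' * chi i n =
    if (n == a %[mod q])%N then (totient q)%:R else 0.
Proof.
move=> q0 ca hd hs.
have [a' ca' ha'] : exists2 a', coprime a' q & (a' * a = 1 %[mod q])%N.
  have a0 : (0 < a)%N \/ q = 1%N.
    case: a ca => [|a] ca; last by left.
    by right; apply/eqP; rewrite -[X in X == _]gcd0n.
  case: a0 => [a0|->]; last by exists 1%N; rewrite ?coprimen1 // !modn1.
  case: (egcdnP q a0) => km kn E _.
  have g1 : gcdn a q = 1%N by apply/eqP.
  rewrite g1 in E.
  exists km; last by rewrite E modnMDl.
  have : coprime (km * a) q by rewrite E coprime_sym /coprime gcdnMDl gcdn1.
  by rewrite coprimeMl => /andP[].
exists a' => // n.
have -> : \sum_i chi i a' * chi i n = \sum_i chi i (a' * n)%N.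
  by apply: eq_bigr => i _; have [[_ h _] _ _ _] := hd i; rewrite h.
case: (boolP (coprime n q)) => cn'.
  rewrite hs ?coprimeMl ?ca' //.
  have -> // : (a' * n == 1 %[mod q])%N = (n == a %[mod q])%N.
  apply/eqP/eqP => h; last by rewrite -modnMmr h modnMmr.
  have : (a * (a' * n) = a %[mod q])%N by rewrite -modnMmr h modnMmr muln1.
  by rewrite mulnA [(a * a')%N]mulnC -modnMml ha' modnMml mul1n.
rewrite big1; last first.
  by move=> i _; have [_ _ _ h] := hd i; rewrite h // coprimeMl negb_and cn' orbT.
case: eqP => // h; move: cn'; rewrite -coprime_modl h coprime_modl ca //.
Qed.

Definition thetaAP (N q a : nat) : R := \sum_(1 <= p < N.+1 | prime p && (p == a %[mod q])%N) ln p%:R.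

Lemma sqrt_powR (x : R) : 0 < x -> x `^ (1 / 2) * x `^ (1 / 2) = x.
Proof.
move=> x0; rewrite -powRD; last by rewrite (gt_eqF x0) implybT.
by rewrite (_ : 1 / 2 + 1 / 2 = 1) ?powRr1 ?(ltW x0) //; field.
Qed.

(** The difference consists of proper prime powers, whose bases are at most the square root of
    [x]. *)
Lemma thetaAP_psi K : exists2 c : R, 1 <= c & forall x N q a, 1 < x -> 1 <= ln x -> N%:R <= x ->
  `|thetaAP N q a - \sum_(1 <= n < N.+1 | (n == a %[mod q])%N) vM R n| <= c * (x / (ln x) ^+ K).
Proof.
have d0 : (0 : R) < 1 / 2 by lra.
have [c2 c21 h2] := @lnX_le_powR R K.+2 (1 / 2) d0.
exists (2 * c2); first by lra.
move=> x N q a x1 X1 Nx; have x0 : 0 < x by lra.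
set X := ln x in X1 *; have X0 : 0 < X by lra.
pose y : R := x `^ (1 / 2); have yy : y * y = x := sqrt_powR x0.
have y0 : 0 < y by rewrite powR_gt0.
have E : thetaAP N q a - \sum_(1 <= n < N.+1 | (n == a %[mod q])%N) vM R n =
   - \sum_(1 <= n < N.+1 | ~~ prime n && (n == a %[mod q])%N) vM R n.
  rewrite /thetaAP (eq_bigr (fun n => vM R n)); last by move=> n /andP[pn _]; rewrite vM_prime.
  rewrite [X in _ - X](bigID prime) /= (eq_bigl (fun n => prime n && (n == a %[mod q])%N)) //.
  rewrite [X in _ - (X + _)](eq_bigl (fun n => prime n && (n == a %[mod q])%N)); last by move=> n; rewrite andbC.
  rewrite opprD addrA subrr add0r; congr (- _); apply: eq_bigl => n; by rewrite andbC.
rewrite E normrN ger0_norm; last by apply: sumr_ge0 => n _; exact: vM_ge0.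
case: (posnP N) => [->|N0]; first by rewrite big_geq // mulr_ge0 ?divr_ge0 ?exprn_ge0 ?(ltW x0) ?(ltW X0) //; lra.
have lN : ln N%:R <= X by rewrite ler_ln ?posrE ?ltr0n.
have l0 := ln_nat_ge0 R N.
pose Z := Num.truncn y.
have Zy : Z%:R <= y by rewrite truncn_le ltW.
apply: le_trans (@vM_small_base (fun n => ~~ prime n && (n == a %[mod q])%N) N Z _) _.
  move=> p k pp k0 pkN /andP[npk _].
  have k2 : (1 < k)%N.
    by case: k k0 pkN npk => [|[|k]] // _ _; rewrite expn1 pp.
  have pN : (p * p <= N)%N.
    by apply: leq_trans pkN; rewrite mulnn leq_exp2l // prime_gt1.
  rewrite /Z truncn_ge_nat ?(ltW y0) //.
  rewrite leNgt; apply/negP => yp.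
  have : y * y < p%:R * p%:R by rewrite ltr_pM // ltW.
  rewrite yy -natrM ltNge => /negP; apply; apply: le_trans Nx; by rewrite ler_nat.
apply: le_trans (_ : y * (2 * X * X) <= _).
  apply: ler_pM; rewrite ?mulr_ge0 //.
  apply: ler_pM; rewrite ?mulr_ge0 //; lra.
rewrite [X in _ <= X]mulrA ler_pdivlMr ?exprn_gt0 //.
rewrite [X in X <= _](_ : _ = 2 * y * X ^+ K.+2); last by rewrite !exprS; ring.
rewrite -yy [X in _ <= X](_ : _ = 2 * y * (c2 * y)); last by ring.
by rewrite ler_wpM2l ?mulr_ge0 ?(ltW y0) // h2 // ltW.
Qed.

(** The error is measured by [x], not by [N], so that the estimate can be subtracted at any two
    points below [x], however small. *)
Theorem siegel_walfisz K : exists2 c : R, 1 <= c & forall x N q a, 1 < x -> 1 <= ln x -> N%:R <= x ->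
  (0 < q)%N -> q%:R <= (ln x) ^+ K -> coprime a q ->
  `|thetaAP N q a - N%:R / (totient q)%:R| <= c * (x / (ln x) ^+ K).
Proof.
have [c1 c11 h1] := char_sum K; have [c2 c21 h2] := prime_number_theorem K.
have [c3 c31 h3] := thetaAP_psi K.
have [c4 c41 h4] := @lnX_le_powR R (K + K + 2) 1 ltr01.
exists (c1 + c2 + c3 + 2 * c4); first by lra.
move=> x N q a x1 X1 Nx q0 qX ca; have x0 : 0 < x by lra.
set X := ln x in X1 qX *; have X0 : 0 < X by lra.
set W := x / X ^+ K; have W0 : 0 < W by rewrite divr_gt0 // exprn_gt0.
have [chi [hd hs]] := dirichlet_characters R q0.
have [i0 [pi0 npi]] := principal_count q0 hd hs.
have [a' ca' ha] := residue_chars q0 ca hd hs.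
have t0 : (0 < totient q)%N by rewrite totient_gt0.
have t0' : (0 : R) < (totient q)%:R by rewrite ltr0n.
have t1' : (1 : R) <= (totient q)%:R by rewrite ler1n.
pose P := \sum_(1 <= n < N.+1 | (n == a %[mod q])%N) vM R n.
have E1 : ((totient q)%:R * P)%:C = \sum_i chi i a' * \sum_(1 <= n < N.+1) chi i n * (vM R n)%:C.
  rewrite rmorphM /= rmorph_nat rmorph_sum /= mulr_sumr.
  rewrite [RHS](eq_bigr (fun i => \sum_(1 <= n < N.+1) chi i a' * chi i n * (vM R n)%:C)); last first.
    by move=> i _; rewrite mulr_sumr; apply: eq_bigr => n _; rewrite mulrA.
  rewrite exchange_big /= big_mkcond /=; apply: eq_bigr => n _.
  by rewrite -mulr_suml ha; case: ifP => _; rewrite ?mul0r.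
have nonpr i : i != i0 -> cn (chi i a' * \sum_(1 <= n < N.+1) chi i n * (vM R n)%:C) <= c1 * W.
  move=> ii; rewrite cnM; have [[_ _ hle] _ _ _] := hd i.
  apply: le_trans (_ : 1 * cn (\sum_(1 <= n < N.+1) chi i n * (vM R n)%:C) <= _); first by rewrite ler_wpM2r ?cn_ge0.
  by rewrite mul1r; apply: (h1 q (chi i) x N) => //; exact: npi.
have prin : \sum_(1 <= n < N.+1) chi i0 n * (vM R n)%:C =
   (\sum_(1 <= n < N.+1) vM R n - \sum_(1 <= n < N.+1 | ~~ coprime n q) vM R n)%:C.
  rewrite [X in _ - X]big_mkcond -sumrB rmorph_sum /=; apply: eq_bigr => n _.
  have [_ _ _ h0] := hd i0; case: (boolP (coprime n q)) => cq; first by rewrite pi0 // mul1r subr0.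
  by rewrite h0 // mul0r subrr.
(* The principal character misses the powers of primes dividing [q]; their bases are at most
   [q <= X ^ K]. *)
have nc : \sum_(1 <= n < N.+1 | ~~ coprime n q) vM R n <= 2 * c4 * W.
  case: (posnP N) => [->|N0]; first by rewrite big_geq // mulr_ge0 ?(ltW W0) //; clear -c41; lra.
  have lN : ln N%:R <= X by rewrite ler_ln ?posrE ?ltr0n.
  have l0 := ln_nat_ge0 R N.
  apply: le_trans (@vM_small_base (fun n => ~~ coprime n q) N q _) _.
    move=> p k pp k0 _; rewrite coprime_pexpl // prime_coprime // negbK => /dvdn_leq; exact.
  apply: le_trans (_ : X ^+ K * (2 * X * X) <= _).
    apply: ler_pM; rewrite ?mulr_ge0 //.
    by apply: ler_pM; rewrite ?mulr_ge0 //; clear -E1 prin N0 lN l0; lra.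
  rewrite /W [X in _ <= X]mulrA ler_pdivlMr ?exprn_gt0 //.
  rewrite [X in X <= _](_ : _ = 2 * X ^+ (K + K + 2)); last by rewrite !exprD !exprS expr0; ring.
  by rewrite -mulrA ler_wpM2l //; have := h4 x (ltW x1); rewrite powRr1 ?(ltW x0).
have nc0 : 0 <= \sum_(1 <= n < N.+1 | ~~ coprime n q) vM R n by apply: sumr_ge0 => n _; exact: vM_ge0.
have key : `|(totient q)%:R * P - N%:R| <= (totient q)%:R * ((c1 + c2 + 2 * c4) * W).
  rewrite -cn_real rmorphB /= E1 (bigD1 i0) //= prin pi0 // mul1r.
  set A := \sum_(1 <= n < N.+1) vM R n; set B := \sum_(_ <= _ < _ | _) _; set S := \sum_(i | _) _.
  have -> : (A - B)%:C + S - (N%:R)%:C = (A - N%:R - B)%:C + S.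
    by rewrite !rmorphB; ring.
  apply: le_trans (cnD _ _) _; rewrite cn_real.
  have hA : `|A - N%:R - B| <= (c2 + 2 * c4) * W.
    have := h2 x N x1 X1 Nx; rewrite -/A -/X -/W => hA.
    apply: le_trans (ler_normB _ _) _; rewrite (ger0_norm nc0) -/B mulrDl lerD //.
  have hSS : cn S <= (totient q)%:R * (c1 * W).
    apply: le_trans (cn_sum _ _ _) _.
    apply: le_trans (_ : \sum_(i < totient q) c1 * W <= _); last first.
      by rewrite sumr_const card_ord mulr_natl.
    rewrite big_mkcond; apply: ler_sum => i _; case: ifP => [ii|_]; first exact: nonpr.
    by rewrite mulr_ge0 ?(ltW W0) //; clear -c11 c21 c31 c41 x1; lra.
  have hA' : (c2 + 2 * c4) * W <= (totient q)%:R * ((c2 + 2 * c4) * W).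
    by rewrite ler_peMl // mulr_ge0 ?(ltW W0) //; clear -c21 c41; lra.
  clear -hA hSS hA'; lra.
have key2 : `|P - N%:R / (totient q)%:R| <= (c1 + c2 + 2 * c4) * W.
  rewrite -(ler_pM2l t0') -{1}(gtr0_norm t0') -normrM mulrBr mulrCA divff ?gt_eqF // mulr1.
  exact: key.
have := h3 x N q a x1 X1 Nx; rewrite -/P -/X -/W => h5.
rewrite (_ : _ - _ = (thetaAP N q a - P) + (P - N%:R / (totient q)%:R)); last by ring.
apply: le_trans (ler_normD _ _) _; clear -key2 h5; lra.
Qed.

End SiegelWalfisz.

(** * Averages of 1 / phi and the cancellation of main terms *)

Section Totient.
Variable R : realType.
Implicit Types (n m d p h V W D L : nat).

Lemma totient_prod n : (0 < n)%N ->
  (totient n)%:R = n%:R * \prod_(p <- primes n) (1 - p%:R^-1) :> R.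
Proof.
move=> n0; have nR : n%:R = \prod_(p <- primes n) (p ^ logn p n)%:R :> R.
  by rewrite {1}(prod_prime_decomp n0) prime_decompE big_map natr_prod.
rewrite totientE // natr_prod [X in _ = X * _]nR -big_split /=; apply: eq_big_seq => p.
rewrite mem_primes => /and3P[pp _ pn]; have p0 := prime_gt0 pp.
have e0 : (0 < logn p n)%N by rewrite logn_gt0 mem_primes pp n0.
rewrite -{2}(prednK e0) natrM natrX expnS natrM natrX -subn1 natrB //.
by field; rewrite pnatr_eq0 -lt0n.
Qed.

Lemma totient_inv_le n : (0 < n)%N -> (totient n)%:R^-1 <= (1 + 2 * ln n%:R) / n%:R :> R.
Proof.
move=> n0; have n0' : (0 : R) < n%:R by rewrite ltr0n.
have h := prod_primes_ge R n0; have s0 : (0 : R) < (size (primes n)).+1%:R by rewrite ltr0n.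
have P0 : 0 < \prod_(p <- primes n) (1 - p%:R^-1) :> R by apply: lt_le_trans h; rewrite invr_gt0.
rewrite totient_prod // invfM mulrC ler_pM2r ?invr_gt0 //.
apply: le_trans (_ : (size (primes n)).+1%:R <= _).
  by rewrite -[X in _ <= X]invrK lef_pV2 ?posrE ?invr_gt0.
by have := size_primes_le R n0; rewrite -natr1; lra.
Qed.

Definition sqf n : bool := `[< forall r, prime r -> ~~ (r * r %| n)%N >].
(* mu(n)^2 / phi(n), the Dirichlet quotient of n / phi(n) by 1 *)
Definition ee n : R := if sqf n then (totient n)%:R^-1 else 0.

Lemma ee_ge0 n : 0 <= ee n.
Proof. by rewrite /ee; case: ifP => _ //; rewrite invr_ge0. Qed.

Lemma ee_le n : ee n <= (totient n)%:R^-1.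
Proof. by rewrite /ee; case: ifP => _ //; rewrite invr_ge0. Qed.

Lemma sqf_mul p d : prime p -> sqf (p * d) = ~~ (p %| d)%N && sqf d.
Proof.
move=> pp; have p0 := prime_gt0 pp; apply/asboolP/andP => [h|[pd /asboolP h] r pr].
  split; first by have := h p pp; rewrite dvdn_pmul2l.
  by apply/asboolP => r pr; apply: contra (h r pr) => h'; rewrite dvdn_mull.
have [->|rp] := eqVneq r p; first by rewrite dvdn_pmul2l.
apply: contra (h r pr); rewrite Gauss_dvdr //.
by rewrite coprimeMl prime_coprime // dvdn_prime2 // rp.
Qed.

(** Induction on [n = m p ^ a] with [p] prime to [m]. The divisors not divisible by [p] are those of
    [m]; of the others only [p e] with [e] dividing [m] can be squarefree, and they contribute
    [1 / (p - 1)] times the sum for [m]. *)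
Lemma sum_ee n : (0 < n)%N -> \sum_(d <- divisors n) ee d = n%:R / (totient n)%:R.
Proof.
elim/ltn_ind: n => n IH n0.
have [n1|n1] := leqP n 1.
  have -> : n = 1%N by apply/eqP; rewrite eqn_leq n1 n0.
  rewrite big_seq1 /ee (_ : sqf 1 = true) ?div1r //.
  apply/asboolP => r pr; rewrite dvdn1 muln_eq1 negb_and.
  by case: eqP pr => // ->.
set p := pdiv n; have pp : prime p by exact: pdiv_prime.
have p0 := prime_gt0 pp; have p1 := prime_gt1 pp.
have [m cpm nE] := pfactor_coprime pp n0; set a := logn p n in nE.
have a0 : (0 < a)%N by rewrite logn_gt0 mem_primes pp n0 pdiv_dvd.
have m0 : (0 < m)%N by move: n0; rewrite nE muln_gt0 => /andP[].
have pm : ~~ (p %| m)%N by rewrite -prime_coprime.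
have mpn : (m * p <= n)%N by rewrite nE leq_mul2l -[X in (X <= _)%N]expn1 leq_pexp2l // orbT.
have mn : (m < n)%N by apply: leq_trans mpn; rewrite -[X in (X < _)%N]muln1 ltn_pmul2l.
have dm d : ~~ (p %| d)%N -> (d %| n)%N = (d %| m)%N.
  by move=> pd; rewrite nE Gauss_dvdl // coprime_pexpr // coprime_sym prime_coprime.
rewrite (sum_divisors _ n0 (leqnn n)) (bigID (fun d => p %| d)%N) /= addrC.
have -> : \sum_(1 <= d < n.+1 | (d %| n)%N && ~~ (p %| d)%N) ee d = m%:R / (totient m)%:R.
  rewrite -(IH m mn m0) (sum_divisors _ m0 (ltnW mn)); apply: eq_bigl => d.
  case: (boolP (p %| d)%N) => pd; last by rewrite andbT dm.
  by rewrite andbF; apply/esym/negP => /(dvdn_trans pd); apply/negP.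
have -> : \sum_(1 <= d < n.+1 | (d %| n)%N && (p %| d)%N) ee d =
    (p%:R - 1)^-1 * (m%:R / (totient m)%:R).
  rewrite -(IH m mn m0) (@sum_divisors R _ m (n %/ p)%N m0); last by rewrite leq_divRL.
  rewrite (eq_bigl (fun d => (p %| d)%N && (d %| n)%N)); last by move=> d; rewrite andbC.
  rewrite big_mkcondr /= (sum_multiples (fun d => if (d %| n)%N then ee d else 0) n p0).
  rewrite [in RHS]big_mkcond mulr_sumr /=; apply: eq_bigr => e _.
  case: (boolP (p %| e)%N) => pe.
    have -> : (e %| m)%N = false by apply/negP => /(dvdn_trans pe); apply/negP.
    by rewrite mulr0 /ee sqf_mul // pe; case: ifP.
  have -> : (p * e %| n)%N = (e %| m)%N.
    rewrite nE -(prednK a0) expnS mulnCA dvdn_pmul2l //.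
    by rewrite Gauss_dvdl // coprime_sym coprimeXl // prime_coprime.
  case: ifP => _; last by rewrite mulr0.
  rewrite /ee sqf_mul // pe /=; case: ifP => _; last by rewrite mulr0.
  rewrite totient_coprime ?prime_coprime // totient_prime // natrM invfM -subn1 natrB //.
rewrite nE totient_coprime; last by rewrite coprime_sym coprimeXl // coprime_sym.
have pE : (p ^ a)%:R = p%:R * (p ^ a.-1)%:R :> R by rewrite -natrM -expnS prednK.
have pS : p.-1%:R = p%:R - 1 :> R by rewrite -subn1 natrB.
rewrite totient_pfactor // !natrM pE pS.
have q0 : p%:R - 1 != 0 :> R by rewrite subr_eq0 (eqr_nat R p 1) gtn_eqF.
have t0 : (totient m)%:R != 0 :> R by rewrite pnatr_eq0 -lt0n totient_gt0.
have pa : (p ^ a.-1)%:R != 0 :> R by rewrite pnatr_eq0 -lt0n expn_gt0 p0.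
by field; rewrite pa t0 q0.
Qed.

Lemma inv_totient n M : (0 < n)%N -> (n <= M)%N ->
  (totient n)%:R^-1 = n%:R^-1 * \sum_(1 <= d < M.+1 | (d %| n)%N) ee d :> R.
Proof.
move=> n0 nM; rewrite -(sum_divisors _ n0 nM) sum_ee // mulrA mulVf ?mul1r //.
by rewrite pnatr_eq0 -lt0n.
Qed.

Lemma harmonic_upper h c M : (0 < h)%N -> (0 < c)%N -> (h <= c * M)%N ->
  \sum_(1 <= m < M.+1 | (h <= c * m)%N) (m%:R^-1 : R) <= c%:R / h%:R + ln (c%:R * M%:R / h%:R).
Proof.
move=> h0 c0; have h0' : (0 : R) < h%:R by rewrite ltr0n.
have c0' : (0 : R) < c%:R by rewrite ltr0n.
elim: M => [|M IH]; first by rewrite muln0 leqNgt h0.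
move=> hM; rewrite big_mkcond big_nat_recr //= -big_mkcond hM.
have M0' : (0 : R) < M.+1%:R by rewrite ltr0n.
case: (leqP h (c * M)) => hcM.
  have M0 : (0 < M)%N by move: hcM; case: (M) => // ; rewrite muln0 leqNgt h0.
  have Mp : (0 : R) < M%:R by rewrite ltr0n.
  apply: le_trans (lerD (IH hcM) (ln_succ_ge R M0)) _.
  rewrite !lnM ?lnV ?posrE ?invr_gt0 ?mulr_gt0 //.
  by move: (ln M.+1%:R) (ln M%:R) (ln c%:R) => *; lra.
rewrite big_nat_cond big1 ?add0r; last first.
  move=> m /andP[/andP[_ mM] hm]; have := leq_trans hm (leq_mul (leqnn c) (mM : (m <= M)%N)).
  by rewrite leqNgt hcM.
have hM' : h%:R <= c%:R * M.+1%:R :> R by rewrite -natrM ler_nat.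
have l0 : 0 <= ln (c%:R * M.+1%:R / h%:R) :> R by rewrite ln_ge0 // ler_pdivlMr // mul1r.
have : M.+1%:R^-1 <= c%:R / h%:R :> R.
  by rewrite ler_pdivlMr // mulrC ler_pdivrMr.
move: (M.+1%:R^-1) (ln _) l0 => *; lra.
Qed.

Lemma harmonic_lower a b : (a <= b)%N ->
  ln (b.+1%:R / a.+1%:R) <= \sum_(a.+1 <= r < b.+1) (r%:R^-1 : R).
Proof.
move=> ab; rewrite -(subnKC ab); elim: (b - a)%N => [|k IH].
  by rewrite addn0 big_geq // divff ?ln1 // pnatr_eq0.
rewrite addnS big_nat_recr ?ltnS ?leq_addr //=.
apply: le_trans (lerD IH (lexx _)).
have s := @ln_succ_le R (a + k).+1 isT.
rewrite !ln_div ?posrE ?ltr0n //.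
by move: (ln _) (ln (a + k).+1%:R) (ln a.+1%:R) ((a + k).+1%:R^-1) s => *; lra.
Qed.

(** The admissible [m] run from [h / (d W)] to [h / (d V)], a range of logarithmic length
    [ln (W / V)] whatever [h] and [d]. The second term is the first reciprocal. *)
Lemma window_upper V W d h M : (0 < V)%N -> (V <= W)%N -> (0 < d)%N -> (0 < h)%N ->
  \sum_(1 <= m < M.+1 | (d * m * V < h)%N && (h <= d * m * W)%N) (m%:R^-1 : R) <=
  ln (W%:R / V%:R) + W%:R * d%:R / h%:R.
Proof.
move=> V0 VW d0 h0; have W0 : (0 < W)%N by exact: leq_trans VW.
have V0' : (0 : R) < V%:R by rewrite ltr0n.
have W0' : (0 : R) < W%:R by rewrite ltr0n.
have d0' : (0 : R) < d%:R by rewrite ltr0n.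
have h0' : (0 : R) < h%:R by rewrite ltr0n.
have l0 : 0 <= ln (W%:R / V%:R) :> R by rewrite ln_ge0 // ler_pdivlMr // mul1r ler_nat.
pose c := (d * W)%N; have c0 : (0 < c)%N by rewrite muln_gt0 d0.
pose M' := (h.-1 %/ (d * V))%N.
have dV : (0 < d * V)%N by rewrite muln_gt0 d0.
apply: le_trans (_ : \sum_(1 <= m < M'.+1 | (h <= c * m)%N) (m%:R^-1 : R) <= _).
  rewrite -[X in X <= _]big_filter -[X in _ <= X]big_filter; apply: sum_uniq_sub.
  - by rewrite filter_uniq // iota_uniq.
  - by rewrite filter_uniq // iota_uniq.
  - move=> m; rewrite !mem_filter !mem_index_iota => /andP[/andP[h1 h2] /andP[m0 _]].
    rewrite m0 ltnS /c mulnAC h2 /= leq_divRL //.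
    by rewrite mulnA [(m * d)%N]mulnC -ltnS prednK.
  by move=> m _; rewrite invr_ge0.
case: (leqP h (c * M')) => hc; last first.
  rewrite big_nat_cond big1; first by rewrite addr_ge0 // divr_ge0 ?mulr_ge0.
  move=> m /andP[/andP[_ mM] hm]; have := leq_trans hm (leq_mul (leqnn c) (mM : (m <= M')%N)).
  by rewrite leqNgt hc.
apply: le_trans (harmonic_upper h0 c0 hc) _.
have M0 : (0 < M')%N by move: hc; case: (M') => //; rewrite muln0 leqNgt h0.
rewrite addrC /c natrM [d%:R * _]mulrC lerD2r ler_ln ?posrE ?divr_gt0 ?mulr_gt0 ?ltr0n //.
rewrite ler_pdivrMr // [X in _ <= X]mulrAC ler_pdivlMr // -!mulrA ler_pM2l //.
rewrite -!natrM ler_nat; apply: leq_trans (_ : h.-1 <= _)%N; last exact: leq_pred.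
by rewrite mulnCA leq_trunc_div.
Qed.

Lemma window_lower V W d : (0 < V)%N -> (V <= W)%N -> (0 < d)%N ->
  ln (W%:R / V%:R) - d%:R / V%:R <= \sum_((V %/ d).+1 <= r < (W %/ d).+1) (r%:R^-1 : R).
Proof.
move=> V0 VW d0; have W0 : (0 < W)%N by exact: leq_trans VW.
have V0' : (0 : R) < V%:R by rewrite ltr0n.
have W0' : (0 : R) < W%:R by rewrite ltr0n.
have d0' : (0 : R) < d%:R by rewrite ltr0n.
apply: le_trans (harmonic_lower (leq_div2r d VW)).
have [a1 _] := divn_real R V d0; have [_ b2] := divn_real R W d0.
have p1 : 0 < W%:R / d%:R :> R by rewrite divr_gt0.
have p2 : 0 < V%:R / d%:R + 1 :> R by rewrite addr_gt0 // divr_gt0.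
have h1 : ln (W%:R / d%:R / (V%:R / d%:R + 1)) <= ln ((W %/ d).+1%:R / (V %/ d).+1%:R) :> R.
  rewrite ler_ln ?posrE ?divr_gt0 ?ltr0n //; apply: ler_pM; rewrite ?invr_ge0 ?(ltW p1) ?(ltW p2) //.
  by rewrite lef_pV2 ?posrE ?ltr0n // -natr1 lerD2r.
apply: le_trans h1.
have -> : W%:R / d%:R / (V%:R / d%:R + 1) = W%:R / V%:R / (1 + d%:R / V%:R) :> R.
  by field; rewrite !gt_eqF // addr_gt0.
have p3 : 0 < 1 + d%:R / V%:R :> R by rewrite addr_gt0 // divr_gt0.
rewrite [X in _ <= X]ln_div ?posrE ?divr_gt0 //.
by rewrite lerD2l lerN2; apply: le_trans (ln_le_sub1 p3) _; rewrite addrAC subrr add0r.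
Qed.

Lemma sum_triangle L : 2 * \sum_(1 <= h < L) (L%:R - h%:R) <= L%:R * L%:R :> R.
Proof.
elim: L => [|L IH]; first by rewrite big_geq // mulr0 mulr_ge0.
case: L IH => [|L] IH; first by rewrite big_geq // mulr0 mulr_ge0.
rewrite big_nat_recr //=.
have -> : \sum_(1 <= h < L.+1) (L.+2%:R - h%:R) = \sum_(1 <= h < L.+1) (L.+1%:R - h%:R) + L%:R :> R.
  rewrite [X in _ = _ + X](_ : _ = \sum_(1 <= h < L.+1) 1); last by rewrite sumr_const_nat subn1.
  rewrite -big_split /=.
  by apply: eq_bigr => h _; rewrite -[L.+2%:R]natr1; ring.
move: IH; rewrite -[L.+2%:R]natr1 -[L.+1%:R]natr1; have : 0 <= L%:R :> R by [].
move: (\sum_(_ <= _ < _) _) => S; nra.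
Qed.

Lemma sum_window_le V W D L d : (0 < V)%N -> (V <= W)%N -> (0 < L)%N -> (0 < d)%N ->
  2 * \sum_(1 <= e < (D %/ d).+1) ((d * e)%:R^-1 *
    \sum_(1 <= h < L | (d * e * V < h)%N && (h <= d * e * W)%N) (L%:R - h%:R)) <=
  d%:R^-1 * (L%:R * L%:R * ln (W%:R / V%:R)) + 2 * L%:R * W%:R * (1 + ln L%:R) :> R.
Proof.
move=> V0 VW L0 d0; have W0 : (0 < W)%N by exact: leq_trans VW.
have V0' : (0 : R) < V%:R by rewrite ltr0n.
have W0' : (0 : R) < W%:R by rewrite ltr0n.
have d0' : (0 : R) < d%:R by rewrite ltr0n.
have L0' : (0 : R) < L%:R by rewrite ltr0n.
set lam := ln _; have l0 : 0 <= lam by rewrite ln_ge0 // ler_pdivlMr // mul1r ler_nat.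
apply: le_trans (_ : 2 * \sum_(1 <= h < L) d%:R^-1 * ((L%:R - h%:R) * (lam + W%:R * d%:R / h%:R)) <= _).
  rewrite ler_pM2l //.
  rewrite (eq_bigr (fun e => \sum_(1 <= h < L | (d * e * V < h)%N && (h <= d * e * W)%N)
     d%:R^-1 * ((L%:R - h%:R) * e%:R^-1))); last first.
    by move=> e _; rewrite mulr_sumr; apply: eq_bigr => h _; rewrite natrM invfM; ring.
  rewrite (exchange_big_dep xpredT) //= big_nat [X in _ <= X]big_nat; apply: ler_sum => h /andP[h0 hL].
  rewrite -!mulr_sumr ler_pM2l ?invr_gt0 // ler_wpM2l ?window_upper // subr_ge0 ler_nat ltnW //.
rewrite -mulr_sumr.
have -> : \sum_(1 <= h < L) ((L%:R - h%:R) * (lam + W%:R * d%:R / h%:R)) =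
   lam * \sum_(1 <= h < L) (L%:R - h%:R) + W%:R * d%:R * \sum_(1 <= h < L) (L%:R - h%:R) / h%:R :> R.
  by rewrite !mulr_sumr -big_split /=; apply: eq_bigr => h _; ring.
have t1 := sum_triangle L.
have t2 : \sum_(1 <= h < L) (L%:R - h%:R) / h%:R <= L%:R * (1 + ln L%:R) :> R.
  apply: le_trans (_ : L%:R * \sum_(1 <= h < L.+1) (h%:R^-1 : R) <= _); last first.
    by rewrite ler_wpM2l ?(ltW L0') // harmonic_le.
  rewrite big_nat_recr //= mulrDr mulr_sumr; apply: le_trans (_ : \sum_(1 <= h < L) L%:R / h%:R <= _).
    apply: ler_sum => h _; rewrite ler_wpM2r ?invr_ge0 // gerBl //.
  by rewrite lerDl mulr_ge0 ?invr_ge0 // ltW.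
move: t1 t2; set S1 := \sum_(_ <= _ < _) _; set S2 := \sum_(_ <= _ < _) _ => t1 t2.
have -> : 2 * (d%:R^-1 * (lam * S1 + W%:R * d%:R * S2)) = d%:R^-1 * (lam * (2 * S1)) + 2 * (W%:R * S2).
  by field; rewrite gt_eqF.
apply: lerD.
  by rewrite ler_pM2l ?invr_gt0 // mulrC ler_wpM2r.
have := ler_wpM2l (ltW W0') t2; lra.
Qed.

(** Only divisors up to [D] are kept in the expansion of [1 / phi r], harmless for a lower bound
    since [ee >= 0]; the truncation then matches the one in the upper bound for the other side. *)
Lemma sum_inv_totient_ge V W D : (0 < V)%N -> (V <= W)%N ->
  \sum_(1 <= d < D.+1) ee d * (d%:R^-1 * ln (W%:R / V%:R) - V%:R^-1) <=
  \sum_(V.+1 <= r < W.+1) ((totient r)%:R^-1 : R).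
Proof.
move=> V0 VW; have V0' : (0 : R) < V%:R by rewrite ltr0n.
apply: le_trans (_ : \sum_(1 <= d < D.+1) ee d * \sum_(V.+1 <= r < W.+1 | (d %| r)%N) (r%:R^-1 : R) <= _).
  rewrite big_nat [X in _ <= X]big_nat; apply: ler_sum => d /andP[d0 _].
  have d0' : (0 : R) < d%:R by rewrite ltr0n.
  rewrite ler_wpM2l ?ee_ge0 //.
  have -> : W.+1 = (V.+1 + (W - V))%N by rewrite addSn subnKC.
  rewrite sum_dvd_interval //.
  have e1 n : ((n.+1 + d.-1) %/ d = (n %/ d).+1)%N.
    by rewrite addSn -addnS prednK // divnDr // divnn d0 addn1.
  rewrite [(V.+1 + (W - V))%N]addSn subnKC // !e1.
  under eq_bigr do rewrite natrM invfM.
  rewrite -mulr_sumr; apply: le_trans (ler_wpM2l _ (window_lower V0 VW d0)); last by rewrite invr_ge0 ltW.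
  by rewrite mulrBr lerD2l lerN2 mulrA mulVf ?mul1r // gt_eqF.
under eq_bigr do rewrite mulr_sumr.
rewrite (exchange_big_dep xpredT) //= big_nat [X in _ <= X]big_nat; apply: ler_sum => r /andP[r0 rW].
have rp : (0 < r)%N by exact: leq_ltn_trans r0.
rewrite (inv_totient rp (leq_maxl r D)) -mulr_suml [X in _ <= X]mulrC ler_wpM2r ?invr_ge0 //.
rewrite [X in _ <= X]big_mkcond (big_cat_nat (n := D.+1)) //= ?ltnS ?leq_maxr //= -big_mkcond.
by rewrite lerDl; apply: sumr_ge0 => d _; case: ifP => _; rewrite ?ee_ge0.
Qed.

(** The cancellation of main terms as an inequality. The left side is the prediction for pairs with
    difference [r m], averaged over [m]; the right side comes from the squares of the means,
    averaged over [r]. Expanding [1 / phi] through [ee] gives on both sides [L ^ 2 ln (W / V)] times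
    the sum of [ee d / d]. *)
Lemma phi_main V W D L : (0 < V)%N -> (V <= W)%N -> (0 < L)%N ->
  2 * \sum_(1 <= m < D.+1) ((totient m)%:R^-1 *
    \sum_(1 <= h < L | (m * V < h)%N && (h <= m * W)%N) (L%:R - h%:R)) <=
  L%:R * L%:R * \sum_(V.+1 <= r < W.+1) ((totient r)%:R^-1 : R) +
  (\sum_(1 <= d < D.+1) ee d) * (2 * L%:R * W%:R * (1 + ln L%:R) + L%:R * L%:R / V%:R) :> R.
Proof.
move=> V0 VW L0; have L0' : (0 : R) < L%:R by rewrite ltr0n.
pose B m : R := \sum_(1 <= h < L | (m * V < h)%N && (h <= m * W)%N) (L%:R - h%:R).
have E : \sum_(1 <= m < D.+1) ((totient m)%:R^-1 * B m) =
   \sum_(1 <= d < D.+1) ee d * \sum_(1 <= e < (D %/ d).+1) ((d * e)%:R^-1 * B (d * e)%N).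
  transitivity (\sum_(1 <= m < D.+1) \sum_(1 <= d < D.+1 | (d %| m)%N) ee d * (m%:R^-1 * B m)).
    apply: eq_big_nat => m /andP[m0 mD]; rewrite (inv_totient m0 (mD : (m <= D)%N)).
    by rewrite -mulr_suml; ring.
  rewrite (exchange_big_dep xpredT) //=; apply: eq_big_nat => d /andP[d0 _].
  by rewrite -mulr_sumr (sum_multiples (fun m => m%:R^-1 * B m) D d0).
rewrite E mulr_sumr.
have G := sum_inv_totient_ge D V0 VW.
apply: le_trans (_ : \sum_(1 <= d < D.+1) ee d * (d%:R^-1 * (L%:R * L%:R * ln (W%:R / V%:R)) +
    2 * L%:R * W%:R * (1 + ln L%:R)) <= _).
  rewrite big_nat [X in _ <= X]big_nat; apply: ler_sum => d /andP[d0 _].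
  by rewrite mulrCA ler_wpM2l ?ee_ge0 // sum_window_le.
have := ler_wpM2l (ltW (mulr_gt0 L0' L0')) G.
move=> H; rewrite -lerBlDr; apply: le_trans H.
rewrite lerBlDr mulr_sumr mulr_suml -big_split /= le_eqVlt; apply/orP; left; apply/eqP.
apply: eq_bigr => d _; ring.
Qed.

End Totient.

(** * Dispersion over large moduli on one block *)

Section Dispersion.
Variable R : realType.
Implicit Types (n m r u L V W a q : nat).

Definition lp n : R := if prime n then ln n%:R else 0.
Definition blk u L := index_iota u.+1 (u + L).+1.

Lemma lp_ge0 n : 0 <= lp n.
Proof. by rewrite /lp; case: ifP => _ //; exact: ln_nat_ge0. Qed.

Lemma mem_blk u L n : (n \in blk u L) = (u < n <= u + L)%N.
Proof. by rewrite mem_index_iota ltnS. Qed.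

Lemma blk_uniq u L : uniq (blk u L). Proof. exact: iota_uniq. Qed.

Lemma thetaAP_lp N q a : thetaAP R N q a = \sum_(1 <= n < N.+1 | n == a %[mod q]) lp n.
Proof.
rewrite /thetaAP [RHS]big_mkcond [LHS]big_mkcond; apply: eq_bigr => n _.
by rewrite /lp; case: (prime n); case: (_ == _ %[mod _]).
Qed.

Definition theta_blk u L q a : R := \sum_(n <- blk u L | n == a %[mod q]) lp n.

Lemma theta_blk_thetaAP u L q a : theta_blk u L q a = thetaAP R (u + L) q a - thetaAP R u q a.
Proof.
rewrite !thetaAP_lp [X in _ = X - _](big_cat_nat (n := u.+1)) //= ?ltnS ?leq_addr //.
by rewrite addrAC subrr add0r.
Qed.

Definition chebyshev_blk u L : R := \sum_(n <- blk u L) lp n.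

Lemma chebyshev_blk_thetaAP u L : chebyshev_blk u L = thetaAP R (u + L) 1 0 - thetaAP R u 1 0.
Proof. by rewrite -theta_blk_thetaAP /theta_blk /chebyshev_blk; apply: eq_bigl => n; rewrite !modn1. Qed.

Definition blockvar u L q : R :=
  \sum_(0 <= a < q | coprime a q) (theta_blk u L q a - L%:R / (totient q)%:R) ^+ 2.

Definition pairsum u L r : R :=
  \sum_(n <- blk u L) \sum_(n' <- blk u L | (n < n')%N && (r %| n' - n)%N) lp n * lp n'.

(** Classes not prime to [r] are added back, which can only increase a sum of squares. *)
Lemma sum_residue_sq u L r : (0 < r)%N ->
  \sum_(0 <= a < r | coprime a r) theta_blk u L r a ^+ 2 <=
  \sum_(n <- blk u L) \sum_(n' <- blk u L | n == n' %[mod r]) lp n * lp n'.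
Proof.
move=> r0; apply: le_trans (_ : \sum_(0 <= a < r) theta_blk u L r a ^+ 2 <= _).
  rewrite big_mkcond; apply: ler_sum => a _; case: ifP => _ //; exact: sqr_ge0.
apply: le_trans (_ : \sum_(0 <= a < r) \sum_(n <- blk u L | n == a %[mod r])
    \sum_(n' <- blk u L | n' == a %[mod r]) lp n * lp n' <= _).
  by apply: ler_sum => a _; rewrite expr2 /theta_blk big_distrlr.
rewrite (exchange_big_dep xpredT) //=; apply: ler_sum => n _.
rewrite (exchange_big_dep xpredT) //= [X in _ <= X]big_mkcond; apply: ler_sum => n' _.
case: ifPn => [/eqP nn'|nn'].
  apply: le_trans (_ : \sum_(0 <= a < r | a == (n %% r)%N) lp n * lp n' <= _).
    rewrite big_mkcond [X in _ <= X]big_mkcond !big_nat; apply: ler_sum => a /andP[_ ar].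
    rewrite -nn' andbb (modn_small ar) eq_sym; by case: ifP.
  by rewrite big_nat1_eq ltn_pmod.
rewrite big1 // => a /andP[/eqP h1 /eqP h2]; by move: nn'; rewrite h1 h2 eqxx.
Qed.

Lemma sum_pairs_split u L r :
  \sum_(n <- blk u L) \sum_(n' <- blk u L | n == n' %[mod r]) lp n * lp n' =
  \sum_(n <- blk u L) lp n ^+ 2 + 2 * pairsum u L r.
Proof.
have -> : 2 * pairsum u L r = pairsum u L r +
    \sum_(n <- blk u L) \sum_(n' <- blk u L | (n' < n)%N && (r %| n - n')%N) lp n * lp n'.
  rewrite mulr_natl mulr2n; congr (_ + _); rewrite /pairsum (exchange_big_dep xpredT) //=.
  by apply: eq_bigr => n _; apply: eq_bigr => n' _; rewrite mulrC.
rewrite /pairsum -!big_split /= !big_seq; apply: eq_bigr => n nb.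
have -> : lp n ^+ 2 = \sum_(n' <- blk u L | n' == n) lp n * lp n'.
  by rewrite -big_filter filter_pred1_uniq ?blk_uniq // big_seq1 expr2.
rewrite big_mkcond [X in X + _]big_mkcond [X in _ + (X + _)]big_mkcond [X in _ + (_ + X)]big_mkcond.
rewrite -!big_split /=; apply: eq_bigr => n' _.
case: (ltngtP n n') => [h|h|->] /=; rewrite ?eqxx ?add0r ?addr0 //.
  by rewrite eq_sym eqn_mod_dvd // ltnW.
by rewrite eqn_mod_dvd // ltnW.
Qed.

(** A prime of the block not coprime to [r] divides [r], and the values of Lambda at the divisors of
    [r] sum to [ln r]. *)
Lemma sum_coprime_ge u L r : (0 < r)%N ->
  chebyshev_blk u L - ln r%:R <= \sum_(0 <= a < r | coprime a r) theta_blk u L r a.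
Proof.
move=> r0; have -> : \sum_(0 <= a < r | coprime a r) theta_blk u L r a =
    \sum_(n <- blk u L | coprime n r) lp n.
  rewrite /theta_blk (exchange_big_dep xpredT) //= [RHS]big_mkcond; apply: eq_bigr => n _.
  have -> : \sum_(0 <= a < r | coprime a r && (n == a %[mod r])) lp n =
      \sum_(0 <= a < r | a == (n %% r)%N) (if coprime n r then lp n else 0).
    rewrite big_mkcond [RHS]big_mkcond !big_nat; apply: eq_bigr => a /andP[_ ar].
    rewrite (modn_small ar) [(_ %% _ == a)%N]eq_sym andbC; case: eqP => //= ->.
    by rewrite coprime_modl.
  by rewrite big_nat1_eq ltn_pmod.
rewrite lerBlDl /chebyshev_blk (bigID (fun n => coprime n r)) /= addrC lerD2r -(sum_vM R r0).
rewrite -big_filter; set s := seq.filter _ _.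
apply: le_trans (_ : \sum_(n <- [seq n <- s | prime n]) vM R n <= _).
  rewrite [X in _ <= X]big_filter [X in _ <= X]big_mkcond; apply: ler_sum => n _.
  by rewrite /lp; case: ifP => // pn; rewrite vM_prime.
apply: sum_uniq_sub; rewrite ?divisors_uniq ?filter_uniq ?blk_uniq //.
  move=> n; rewrite !mem_filter -dvdn_divisors // => /and3P[pn + _].
  by rewrite prime_coprime // negbK.
by move=> *; exact: vM_ge0.
Qed.

Lemma blockvar_le u L r : (0 < r)%N ->
  blockvar u L r <= \sum_(n <- blk u L) lp n ^+ 2 + 2 * pairsum u L r
    - (totient r)%:R^-1 * (2 * L%:R * (chebyshev_blk u L - ln r%:R) - L%:R * L%:R).
Proof.
move=> r0; rewrite -(sum_pairs_split u L r).
have f0 : 0 < (totient r)%:R :> R by rewrite ltr0n totient_gt0.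
have -> : blockvar u L r = \sum_(0 <= a < r | coprime a r) theta_blk u L r a ^+ 2
    - 2 * (L%:R / (totient r)%:R) * (\sum_(0 <= a < r | coprime a r) theta_blk u L r a)
    + L%:R * L%:R / (totient r)%:R.
  have -> : L%:R * L%:R / (totient r)%:R =
     \sum_(0 <= a < r | coprime a r) (L%:R / (totient r)%:R) ^+ 2 :> R.
    rewrite big_const_seq iter_addr_0 -[LHS]mulr1 -mulr_natr.
    have -> : count (fun a => coprime a r) (index_iota 0 r) = totient r.
      rewrite totient_count_coprime -sum1_count big_mkcond; apply: eq_bigr => a _.
      by rewrite coprime_sym; case: coprime.
    by field; rewrite gt_eqF.
  rewrite mulr_sumr -sumrB -big_split /=; apply: eq_bigr => a _; ring.
have h1 := @sum_residue_sq u L r r0; have h2 := @sum_coprime_ge u L r r0.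
have := ler_wpM2l (_ : 0 <= 2 * (L%:R / (totient r)%:R)) h2.
have i0 : 0 <= (totient r)%:R^-1 :> R by rewrite invr_ge0 ltW.
have l0 : 0 <= L%:R :> R by [].
rewrite mulr_ge0 ?mulr_ge0 // => /(_ isT).
move: h1; set a := \sum_(_ <= _ < _ | _) _; set b := \sum_(_ <- _) _; set c := \sum_(_ <= _ < _ | _) _.
move: (chebyshev_blk u L) (ln r%:R) (L%:R) ((totient r)%:R^-1) => t lr l f h1' h3; lra.
Qed.

(** Divisor switching: the large divisor [r] of a difference [k] is replaced by the small one
    [m = k / r], and the condition [V < r <= W] becomes [m V < k <= m W]. *)
Lemma divisor_window_le V W M k : (0 < V)%N -> (0 < k)%N -> (k %/ V <= M)%N ->
  \sum_(V.+1 <= r < W.+1 | (r %| k)%N) (1 : R) <=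
  \sum_(1 <= m < M.+1 | [&& (m %| k)%N, (m * V < k)%N & (k <= m * W)%N]) 1.
Proof.
move=> V0 k0 kM; rewrite -big_filter -[X in _ <= X]big_filter.
set s1 := seq.filter _ _; set s2 := seq.filter _ _.
rewrite [X in X <= _](_ : _ = \sum_(i <- map (fun r => k %/ r)%N s1) 1); last by rewrite big_map.
apply: sum_uniq_sub => //; [|by rewrite filter_uniq ?iota_uniq|].
  rewrite map_inj_in_uniq ?filter_uniq ?iota_uniq // => r r'.
  rewrite !mem_filter => /andP[d1 _] /andP[d2 _] e.
  have /eqP := etrans (divnK d1) (esym (divnK d2)); rewrite e eqn_pmul2l ?divn_gt0 //.
    by move/eqP.
    exact: dvdn_leq.
  exact: dvdn_gt0 d2.
move=> m /mapP [r]; rewrite mem_filter mem_index_iota => /and3P[d1 r1 r2] ->.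
have r0 : (0 < r)%N by apply: leq_trans r1.
have e := divnK d1; have m0 : (0 < k %/ r)%N by rewrite divn_gt0 // dvdn_leq.
have vk : ((k %/ r) * V < k)%N by rewrite -{2}e ltn_pmul2l.
rewrite mem_filter mem_index_iota m0 vk dvdn_div //= ltnS; apply/andP; split.
  by rewrite -{1}e leq_pmul2l.
by apply: leq_trans kM; rewrite leq_divRL // ltnW.
Qed.


Section Fixed.
Variables (u L V W M : nat) (E X : R).
Hypotheses (V0 : (0 < V)%N) (VW : (V <= W)%N) (L0 : (0 < L)%N) (M0 : (0 < M)%N) (LM : (L %/ V <= M)%N).
Hypothesis hSW : forall m a N, (0 < m <= M)%N -> coprime a m -> (N <= u + L)%N ->
  `|thetaAP R N m a - N%:R / (totient m)%:R| <= E.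
Hypothesis hX : ln (u + L)%:R <= X.
Hypothesis hW : ln W%:R <= X.

(** Number of gaps [h] from [n] to an integer of the block that are allowed by the window of [m]. *)
Let ell m n : R := \sum_(1 <= h < L | [&& (m * V < h)%N, (h <= m * W)%N & (n + h <= u + L)%N]) 1.

Lemma SW_one N : (N <= u + L)%N -> `|thetaAP R N 1 0 - N%:R| <= E.
Proof. by move=> NL; have := @hSW 1%N 0%N N; rewrite (_ : totient 1 = 1)%N // divr1; apply. Qed.

Lemma chebyshev_blk_near l : (l <= L)%N -> `|chebyshev_blk u l - l%:R| <= 2 * E.
Proof.
move=> lL; rewrite chebyshev_blk_thetaAP.
have h1 := @SW_one (u + l) (leq_add (leqnn u) lL); have h2 := @SW_one u (leq_addr L u).
move: h1 h2; rewrite natrD !ler_norml => /andP[a1 a2] /andP[b1 b2]; apply/andP.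
by move: a1 a2 b1 b2; move: (thetaAP _ _ _ _) (thetaAP _ _ _ _) (u%:R) (l%:R) => t1 t2 u' l' *; split; lra.
Qed.

Lemma E_ge0 : 0 <= E.
Proof. exact: le_trans (normr_ge0 _) (@SW_one 0%N (leq0n _)). Qed.

(* If n divides m the sum is empty, since n' would be a proper multiple of the prime n. *)
Lemma inner_count m n : (0 < m <= M)%N -> prime n -> n \in blk u L ->
  \sum_(n' <- blk u L | [&& (n < n')%N, (m %| n' - n)%N, (m * V < n' - n)%N & (n' - n <= m * W)%N])
    lp n' <= ell m n / (totient m)%:R + 2 * E.
Proof.
move=> mM pn; rewrite mem_blk => /andP[un nuL]; have /andP[m0 _] := mM.
have E0 := E_ge0; have ell0 : 0 <= ell m n by apply: sumr_ge0.
have [cn|] := boolP (coprime n m); last first.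
  rewrite prime_coprime // negbK => nm; rewrite big1 ?addr_ge0 ?mulr_ge0 ?invr_ge0 //.
  move=> n' /and4P[nn' mn _ _]; rewrite /lp; case: ifP => // pn'.
  have : (n %| n')%N by rewrite -(subnK (ltnW nn')) dvdn_addl // (dvdn_trans nm).
  by rewrite dvdn_prime2 // => /eqP e; move: nn'; rewrite e ltnn.
set t1 := minn (u + L) (n + m * V); set t2 := minn (u + L) (n + m * W).
have mVW : (m * V <= m * W)%N by rewrite leq_mul2l VW orbT.
have [t12 t1L t2L] : [/\ t1 <= t2, t1 <= u + L & t2 <= u + L]%N.
  by rewrite /t1 /t2; split; clear -mVW; lia.
have t2E : t2 = (t1 + (t2 - t1))%N by rewrite subnKC.
apply: le_trans (_ : theta_blk t1 (t2 - t1) m n <= _).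
  rewrite /theta_blk -big_filter -[X in _ <= X]big_filter.
  apply: sum_uniq_sub; rewrite ?filter_uniq ?blk_uniq //; last by move=> *; exact: lp_ge0.
  move=> n'; rewrite !mem_filter !mem_blk -t2E => /andP[/and4P[a1 a2 a3 a4] /andP[a5 a6]].
  rewrite eqn_mod_dvd ?(ltnW a1) // a2 /= /t1 /t2; clear -a1 a3 a4 a5 a6; lia.
have h1 := @hSW m n t1 mM cn t1L; have h2 := @hSW m n t2 mM cn t2L.
rewrite theta_blk_thetaAP -t2E; have h3 : (t2 - t1)%:R <= ell m n.
  rewrite /ell -big_filter; set s := seq.filter _ _.
  have -> : (t2 - t1)%:R = \sum_(h <- map (fun i => i - n)%N (index_iota t1.+1 t2.+1)) (1 : R).
    by rewrite big_map sumr_const_nat subSS.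
  have hi i : i \in index_iota t1.+1 t2.+1 -> [&& n < i, i <= u + L, m * V < i - n & i - n <= m * W]%N.
    rewrite mem_index_iota /t1 /t2; clear -mVW nuL un L0; lia.
  apply: sum_uniq_sub => //; [|by rewrite filter_uniq ?iota_uniq|].
    rewrite map_inj_in_uniq ?iota_uniq // => i j /hi/and4P[i1 _ _ _] /hi/and4P[j1 _ _ _].
    clear -i1 j1; lia.
  move=> h /mapP [i ib ->]; have /and4P[i1 i2 i3 i4] := hi i ib; rewrite mem_filter mem_index_iota.
  rewrite i3 i4; clear -i1 i2 un; lia.
have f0 : 0 <= (totient m)%:R^-1 :> R by rewrite invr_ge0.
have h4 := ler_wpM2r f0 h3; move: h4; rewrite natrB // mulrBl.
move: h1 h2; rewrite !ler_norml => /andP[a1 a2] /andP[b1 b2].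
move: a1 a2 b1 b2; clear; move: (thetaAP _ _ _ _) (thetaAP _ _ _ _) (_ / _) (_ / _) (_ / _) => *; lra.
Qed.

(** For a fixed gap [h] the admissible [n] fill the initial sub-block of length [L - h], where the
    prime number theorem applies. *)
Lemma sum_ell m : \sum_(n <- blk u L) lp n * ell m n <=
  \sum_(1 <= h < L | (m * V < h)%N && (h <= m * W)%N) (L%:R - h%:R + 2 * E).
Proof.
rewrite /ell; under eq_bigr do rewrite mulr_sumr.
rewrite (exchange_big_dep (fun h => (m * V < h)%N && (h <= m * W)%N)) /=; last first.
  by move=> n h _ /and3P[-> ->].
rewrite big_nat_cond [X in _ <= X]big_nat_cond; apply: ler_sum => h /and3P[/andP[h1 hL] hV hW'].
apply: le_trans (_ : chebyshev_blk u (L - h) <= _).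
  rewrite /chebyshev_blk -big_filter; under eq_bigr do rewrite mulr1.
  apply: sum_uniq_sub; rewrite ?filter_uniq ?blk_uniq //; last by move=> *; exact: lp_ge0.
  move=> n; rewrite mem_filter !mem_blk hV hW' /=; clear -hL; lia.
have := @chebyshev_blk_near (L - h) (leq_subr _ _); rewrite natrB ?(ltnW hL) // ler_norml => /andP[_].
by move=> k; rewrite -lerBlDl.
Qed.

Lemma sum_pairsum : \sum_(V.+1 <= r < W.+1) pairsum u L r <=
  \sum_(1 <= m < M.+1) (totient m)%:R^-1 *
     (\sum_(1 <= h < L | (m * V < h)%N && (h <= m * W)%N) (L%:R - h%:R))
  + 2 * E * L%:R * (\sum_(1 <= m < M.+1) (totient m)%:R^-1) + 2 * E * M%:R * chebyshev_blk u L.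
Proof.
have E0 := E_ge0.
apply: le_trans (_ : \sum_(1 <= m < M.+1) \sum_(n <- blk u L) lp n *
  \sum_(n' <- blk u L | [&& (n < n')%N, (m %| n' - n)%N, (m * V < n' - n)%N & (n' - n <= m * W)%N])
    lp n' <= _).
  rewrite /pairsum exchange_big [X in _ <= X]exchange_big /= !big_seq; apply: ler_sum => n nb.
  under [X in _ <= X]eq_bigr do rewrite mulr_sumr.
  rewrite (exchange_big_dep (fun n' => (n < n')%N)) /=; last by move=> ? ? _ /andP[].
  rewrite [X in _ <= X](exchange_big_dep (fun n' => (n < n')%N)) /=; last by move=> ? ? _ /and4P[].
  rewrite big_seq_cond [X in _ <= X]big_seq_cond; apply: ler_sum => n' /andP[n'b nn'].
  move: nb n'b; rewrite !mem_blk => nb n'b.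
  have k0 : (0 < n' - n)%N by rewrite subn_gt0.
  have kM : ((n' - n) %/ V <= M)%N.
    by apply: leq_trans LM; apply: leq_div2r; clear -nb n'b; lia.
  have := @divisor_window_le V W M (n' - n) V0 k0 kM.
  have e (P : pred nat) s : lp n * lp n' * (\sum_(i <- s | P i) 1) = \sum_(i <- s | P i) lp n * lp n'.
    by rewrite mulr_sumr; apply: eq_bigr => *; rewrite mulr1.
  by move/(ler_wpM2l (mulr_ge0 (lp_ge0 n) (lp_ge0 n'))); rewrite !e nn'.
have -> : 2 * E * M%:R * chebyshev_blk u L = \sum_(1 <= m < M.+1) 2 * E * chebyshev_blk u L.
  by rewrite sumr_const_nat subn1 /= -[RHS]mulr_natr; ring.
rewrite mulr_sumr -!big_split /=.
rewrite big_nat [X in _ <= X]big_nat; apply: ler_sum => m mM; rewrite ltnS in mM.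
apply: le_trans (_ : \sum_(n <- blk u L) lp n * (ell m n / (totient m)%:R + 2 * E) <= _).
  rewrite !big_seq; apply: ler_sum => n nb; rewrite /lp; case: ifP => [pn|]; last by rewrite !mul0r.
  apply: ler_wpM2l; first exact: ln_nat_ge0.
  exact: inner_count.
rewrite (eq_bigr (fun n => lp n * ell m n / (totient m)%:R + lp n * (2 * E))); last first.
  by move=> n _; rewrite mulrDr mulrA.
rewrite big_split /= -!mulr_suml -/(chebyshev_blk u L) [chebyshev_blk u L * _]mulrC lerD2r [X in _ <= X + _]mulrC -mulrDl.
apply: ler_wpM2r; first by rewrite invr_ge0.
apply: le_trans (sum_ell m) _; rewrite big_split /=; apply: lerD => //.
apply: le_trans (_ : \sum_(1 <= h < L) 2 * E <= _).
  by rewrite big_mkcond; apply: ler_sum => h _; case: ifP => // _; rewrite mulr_ge0.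
rewrite sumr_const_nat -[X in X <= _]mulr_natr; apply: ler_wpM2l; first by rewrite mulr_ge0.
by rewrite ler_nat leq_subr.
Qed.

(** [phi_main] absorbs the term [L ^ 2] times the sum of [1 / phi r]. What is left is the diagonal,
    the errors of [phi_main], and the Siegel-Walfisz errors [E] of the outer and inner prime
    sums. *)
Lemma dispersion : \sum_(V.+1 <= r < W.+1) blockvar u L r <=
  W%:R * X * chebyshev_blk u L + (\sum_(1 <= d < M.+1) ee R d) *
     (2 * L%:R * W%:R * (1 + ln L%:R) + L%:R * L%:R / V%:R)
  + (4 * E * L%:R + 2 * L%:R * X) * (\sum_(V.+1 <= r < W.+1) (totient r)%:R^-1)
  + 4 * E * L%:R * (\sum_(1 <= m < M.+1) (totient m)%:R^-1) + 4 * E * M%:R * chebyshev_blk u L.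
Proof.
have h1 : \sum_(V.+1 <= r < W.+1) blockvar u L r <= \sum_(V.+1 <= r < W.+1)
   (X * chebyshev_blk u L + 2 * pairsum u L r - (totient r)%:R^-1 * (L%:R * L%:R - 4 * E * L%:R - 2 * L%:R * X)).
  rewrite big_nat [X in _ <= X]big_nat; apply: ler_sum => r /andP[rV rW].
  have r0 : (0 < r)%N by apply: leq_trans rV.
  apply: le_trans (blockvar_le u L r0) _; apply: lerB; first apply: lerD => //.
    rewrite /chebyshev_blk mulr_sumr !big_seq; apply: ler_sum => n; rewrite mem_blk => /andP[nu nL].
    rewrite expr2; apply: ler_wpM2r; first exact: lp_ge0.
    apply: le_trans hX; rewrite /lp; case: ifP => _; last exact: ln_nat_ge0.
    by rewrite ler_ln ?posrE ?ltr0n ?ler_nat // ?(leq_trans _ nL) // (leq_trans _ nu).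
  apply: ler_wpM2l; first by rewrite invr_ge0.
  have := chebyshev_blk_near (leqnn L); rewrite ler_norml => /andP[t1 _].
  have rX : ln r%:R <= X.
    by apply: le_trans hW; rewrite ler_ln ?posrE ?ltr0n ?ler_nat // (leq_trans r0).
  have l0 : 0 <= L%:R :> R by [].
  move: t1 rX l0; move: (chebyshev_blk _ _) (ln r%:R) (L%:R) => t lr l t1 rX l0; nra.
apply: le_trans h1 _; rewrite !(big_split, sumrN) /= sumr_const_nat subSS -mulr_sumr -mulr_suml.
have h2 := sum_pairsum; have h3 := @phi_main R V W M L V0 VW L0.
have WV : (X * chebyshev_blk u L) *+ (W - V) <= W%:R * X * chebyshev_blk u L.
  rewrite -mulr_natl -mulrA; apply: ler_wpM2r; last by rewrite ler_nat leq_subr.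
  rewrite mulr_ge0 ?sumr_ge0 // ?(le_trans _ hX) ?ln_nat_ge0 // => n _; exact: lp_ge0.
move: h2 h3 WV; clear; move: (chebyshev_blk _ _) ((_ * _) *+ _) => t k.
move: (\sum_(_ <= _ < _) pairsum _ _ _) => a.
move: (\sum_(_ <= _ < _) ee _ _) => b.
move: (\sum_(V.+1 <= _ < _) _) => c.
move: (\sum_(1 <= _ < _) (totient _)%:R^-1) => d.
move: (\sum_(1 <= _ < _) _) => e.
move: (_ / V%:R) (ln L%:R) => lv lL *; lra.
Qed.

End Fixed.
End Dispersion.

(** * From small moduli to large ones *)

Section SmallModuli.
Variable R : realType.
Implicit Types (n m r u L V W a b q : nat).

Lemma sqr_sum_le (I : Type) (s : seq I) (P : pred I) (F : I -> R) (c : R) :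
  \sum_(i <- s | P i) 1 <= c ->
  (\sum_(i <- s | P i) F i) ^+ 2 <= c * \sum_(i <- s | P i) F i ^+ 2.
Proof.
move=> hc; set T := \sum_(i <- s | P i) F i ^+ 2.
have T0 : 0 <= T by apply: sumr_ge0 => i _; exact: sqr_ge0.
apply: le_trans (ler_wpM2r T0 hc); set n := \sum_(i <- s | P i) 1.
suff : 2 * (\sum_(i <- s | P i) F i) ^+ 2 <= n * T + n * T by lra.
have -> : n * T + n * T = \sum_(i <- s | P i) \sum_(j <- s | P j) (F i ^+ 2 + F j ^+ 2).
  rewrite [X in X + _]mulrC !big_distrlr /= -big_split /=; apply: eq_bigr => i _.
  by rewrite -big_split /=; apply: eq_bigr => j _; rewrite mulr1 mul1r.
rewrite expr2 big_distrlr /= mulr_sumr; apply: ler_sum => i _.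
rewrite mulr_sumr; apply: ler_sum => j _; have := sqr_ge0 (F i - F j); nra.
Qed.

Lemma sum_residue (F : nat -> R) q n : (0 < q)%N ->
  \sum_(0 <= a < q | n == a %[mod q]) F a = F (n %% q)%N.
Proof.
move=> q0; rewrite big_mkcond (eq_big_nat _ _ (F2 := fun a => if a == (n %% q)%N then F a else 0)).
  by rewrite -big_mkcond big_nat1_eq ltn_pmod.
by move=> a /andP[_ aq]; rewrite (modn_small aq) eq_sym.
Qed.

Lemma count_class q m a : (0 < q)%N ->
  \sum_(0 <= b < q * m | b == a %[mod q]) 1 = m%:R :> R.
Proof.
move=> q0; rewrite mulnC big_mkcond big_nat_mul.
rewrite (eq_bigr (fun=> 1)) ?sumr_const_nat ?subn0 // => i _.
rewrite mulSn -{1}[(i * q)%N]add0n big_addn addnK -big_mkcond /=.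
rewrite -[RHS](@sum_residue (fun=> 1) q a q0); apply: eq_bigl => j.
by rewrite addnC modnMDl eq_sym.
Qed.

Definition lift_class q m a b := (b == a %[mod q]) && coprime b (q * m).

(** The number of lifts is [m] if [m] divides [q]; otherwise it is [m - 1], since the Chinese
    remainder theorem gives exactly one lift divisible by [m]. In both cases it is the same for all
    [a]. *)
Lemma count_lift q m a a' : (0 < q)%N -> prime m -> coprime a q -> coprime a' q ->
  \sum_(0 <= b < q * m | lift_class q m a b) 1 =
  \sum_(0 <= b < q * m | lift_class q m a' b) 1 :> R.
Proof.
move=> q0 pm ca ca'; have m0 := prime_gt0 pm; have qm0 : (0 < q * m)%N by rewrite muln_gt0 q0.
have cl c b : coprime c q -> (b == c %[mod q]) -> coprime b q.
  by move=> cc /eqP e; rewrite -coprime_modl e coprime_modl.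
suff H c : coprime c q -> \sum_(0 <= b < q * m | lift_class q m c b) 1 =
    m%:R - (if (m %| q)%N then 0 else 1) :> R by rewrite !H.
move=> {a a' ca ca'} cc; rewrite -(@count_class q m c q0).
rewrite [X in _ = X - _](bigID (fun b => coprime b m)) /=.
have -> : \sum_(0 <= b < q * m | lift_class q m c b) 1 =
    \sum_(0 <= b < q * m | (b == c %[mod q]) && coprime b m) 1 :> R.
  apply: eq_bigl => b; rewrite /lift_class coprimeMr andbA; case e: (b == _ %[mod _]) => //=.
  by rewrite (cl c).
suff -> : \sum_(0 <= b < q * m | (b == c %[mod q]) && ~~ coprime b m) 1 =
    (if (m %| q)%N then 0 else 1) :> R by rewrite addrK.
case: ifPn => [mq|nmq].
  rewrite big1 // => b /andP[e]; have := cl c b cc e => cb.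
  by rewrite (coprime_dvdr mq cb).
have cqm : coprime q m by rewrite coprime_sym prime_coprime.
rewrite -[RHS](@sum_residue (fun=> 1) (q * m) (chinese q m c 0) qm0); apply: eq_bigl => b.
rewrite chinese_remainder // chinese_modl // chinese_modr // mod0n eq_sym; congr (_ && _).
by rewrite coprime_sym prime_coprime // negbK /dvdn eq_sym.
Qed.

Lemma totient_lift q m a : (0 < q)%N -> prime m -> coprime a q ->
  (totient (q * m))%:R = (totient q)%:R * \sum_(0 <= b < q * m | lift_class q m a b) 1 :> R.
Proof.
move=> q0 pm ca; have qm0 : (0 < q * m)%N by rewrite muln_gt0 q0 prime_gt0.
have tot n : (totient n)%:R = \sum_(0 <= b < n | coprime b n) 1 :> R.
  rewrite totient_count_coprime natr_sum [RHS]big_mkcond; apply: eq_bigr => b _.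
  by rewrite coprime_sym; case: coprime.
rewrite !tot mulr_suml.
rewrite [RHS](eq_bigr (fun c => \sum_(0 <= b < q * m | lift_class q m c b) 1)); last first.
  by move=> c cc; rewrite mul1r; apply: count_lift.
rewrite (exchange_big_dep (fun b => coprime b (q * m))) /=; last by move=> c b _ /andP[].
apply: eq_bigr => b cb; rewrite -[LHS](@sum_residue (fun=> 1) q b q0); apply: eq_bigl => c.
rewrite /lift_class cb andbT; case e: (b == _ %[mod _]); rewrite ?andbF ?andbT //.
move: cb; rewrite coprimeMr => /andP[cb _].
by rewrite -coprime_modl -(eqP e) coprime_modl cb.
Qed.

(** The correction [e] can only come from the prime [m] itself, and only in the class of [m]. *)
Lemma theta_blk_lift u L q m a : (0 < q)%N -> prime m -> coprime a q ->
  exists2 e : R, e ^+ 2 <= (if m == a %[mod q] then (ln m%:R) ^+ 2 else 0) &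
  theta_blk R u L q a = \sum_(0 <= b < q * m | lift_class q m a b) theta_blk R u L (q * m) b + e.
Proof.
move=> q0 pm ca; have qm0 : (0 < q * m)%N by rewrite muln_gt0 q0 prime_gt0.
exists (\sum_(n <- blk u L | (n == a %[mod q]) && ~~ coprime n (q * m)) lp R n); last first.
  rewrite {1}/theta_blk (bigID (fun n => coprime n (q * m))) /=; congr (_ + _).
  rewrite /theta_blk (exchange_big_dep xpredT) //= big_mkcond; apply: eq_bigr => n _.
  rewrite [RHS](eq_bigl (fun b => (n == b %[mod q * m]) && lift_class q m a b)); last first.
    by move=> b; rewrite andbC.
  rewrite big_mkcondr sum_residue // /lift_class coprime_modl modn_dvdm //.
  exact: dvdn_mulr.
have l0 := ln_nat_ge0 R m.
set e := \sum_(_ <- _ | _) _; have e0 : 0 <= e by apply: sumr_ge0 => *; exact: lp_ge0.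
have : e <= if m == a %[mod q] then ln m%:R else 0.
  apply: le_trans (_ : \sum_(n <- blk u L | n == m) (if m == a %[mod q] then lp R m else 0) <= _).
    rewrite /e big_mkcond [X in _ <= X]big_mkcond; apply: ler_sum => n _.
    have nn : 0 <= (if n == m then if m == a %[mod q] then lp R m else 0 else 0).
      by do 2 case: ifP => //; rewrite ?lp_ge0.
    case: ifPn => // /andP[na]; have cn : coprime n q by rewrite -coprime_modl (eqP na) coprime_modl.
    rewrite coprimeMr cn /= coprime_sym prime_coprime // negbK => mn.
    have [pn|/negbTE pn] := boolP (prime n); last by rewrite /lp pn.
    by move: mn; rewrite dvdn_prime2 // => /eqP mn; rewrite mn eqxx na.
  rewrite -big_filter; have := filter_uniq (pred1 m) (blk_uniq u L).
  have : all (pred1 m) [seq i <- blk u L | i == m] by exact: filter_all.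
  case: seq.filter => [|n [|n' s]] /=.
  - by rewrite big_nil; case: ifP.
  - by rewrite big_seq1 /lp pm.
  - by move=> /and3P[/eqP-> /eqP-> _]; rewrite inE eqxx.
case: ifP => _ h; first by rewrite ler_sqr ?nnegrE.
have -> : e = 0 by apply/eqP; rewrite eq_le h e0.
by rewrite expr0n.
Qed.

(* A class modulo q splits into classes modulo q m, up to the class of multiples of m, which
   contains no prime but m. *)
Lemma blockvar_mul u L q m : (0 < q)%N -> prime m ->
  blockvar R u L q <= 2 * m%:R * blockvar R u L (q * m) + 2 * (ln m%:R) ^+ 2.
Proof.
move=> q0 pm; have qm0 : (0 < q * m)%N by rewrite muln_gt0 q0 prime_gt0.
pose D b := theta_blk R u L (q * m) b - L%:R / (totient (q * m))%:R.
have step a : coprime a q -> (theta_blk R u L q a - L%:R / (totient q)%:R) ^+ 2 <=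
    2 * m%:R * (\sum_(0 <= b < q * m | lift_class q m a b) D b ^+ 2) +
    2 * (if m == a %[mod q] then (ln m%:R) ^+ 2 else 0).
  move=> ca; have [e he ->] := @theta_blk_lift u L q m a q0 pm ca.
  have f1 : (totient q)%:R != 0 :> R by rewrite pnatr_eq0 -lt0n totient_gt0.
  have f2 : (totient (q * m))%:R != 0 :> R by rewrite pnatr_eq0 -lt0n totient_gt0.
  have hD : \sum_(0 <= b < q * m | lift_class q m a b) D b =
      \sum_(0 <= b < q * m | lift_class q m a b) theta_blk R u L (q * m) b - L%:R / (totient q)%:R.
    rewrite /D big_split /=; congr (_ + _).
    transitivity (- (L%:R / (totient (q * m))%:R) * \sum_(0 <= b < q * m | lift_class q m a b) 1 : R).
      by rewrite mulr_sumr; apply: eq_bigr => b _; rewrite mulr1.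
    have := totient_lift q0 pm ca; move: f2; set t := \sum_(_ <= _ < _ | _) _ => + h.
    rewrite h mulf_eq0 negb_or => /andP[_ t0]; field; by rewrite f1 t0.
  have cs := @sqr_sum_le _ (index_iota 0 (q * m)) (lift_class q m a) D m%:R.
  have /cs : \sum_(0 <= b < q * m | lift_class q m a b) 1 <= m%:R :> R.
    rewrite -(@count_class q m a q0) big_mkcond [X in _ <= X]big_mkcond; apply: ler_sum => b _.
    by rewrite /lift_class; case: eqP => //= _; case: ifP.
  rewrite hD => {}cs; set T := \sum_(_ <= _ < _ | _) theta_blk _ _ _ _ _ in cs *.
  set c := _ / _ in cs *; have := sqr_ge0 (T - c - e); move: he cs.
  by rewrite /c; set y := if _ then _ else _; set z := \sum_(_ <= _ < _ | _) _; clearbody y z T; nra.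
apply: le_trans (_ : \sum_(0 <= a < q | coprime a q) (2 * m%:R *
    (\sum_(0 <= b < q * m | lift_class q m a b) D b ^+ 2) +
    2 * (if m == a %[mod q] then (ln m%:R) ^+ 2 else 0)) <= _); first exact: ler_sum.
rewrite big_split /= -!mulr_sumr; apply: lerD; apply: ler_wpM2l => //.
  rewrite (exchange_big_dep (fun b => coprime b (q * m))) /=; last by move=> c b _ /andP[].
  apply: ler_sum => b cb; rewrite -[X in _ <= X](@sum_residue (fun=> D b ^+ 2) q b q0).
  rewrite big_mkcond [X in _ <= X]big_mkcond; apply: ler_sum => a _.
  rewrite /lift_class; case: (b == a %[mod q]); rewrite ?andbF //=.
  by case: ifP => _ //; rewrite sqr_ge0.
rewrite -big_mkcondr -[X in _ <= X](@sum_residue (fun=> (ln m%:R) ^+ 2) q m q0).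
rewrite big_mkcond [X in _ <= X]big_mkcond; apply: ler_sum => a _.
by case: (m == a %[mod q]); rewrite ?andbF //= andbT; case: ifP => _ //; rewrite sqr_ge0.
Qed.


Lemma theta_upper : exists2 c : R, 1 <= c & forall N, thetaAP R N 1 0 <= c * N%:R.
Proof.
have [c c1 hc] := siegel_walfisz R 1; exists (3 + c); first by lra.
move=> N; have N0 : 0 <= N%:R :> R by []. 
have [N4|N4] := ltnP N 4.
  apply: le_trans (_ : \sum_(1 <= p < N.+1) 3 <= _); last first.
    by rewrite sumr_const_nat subn1 /= -[X in X <= _]mulr_natr; nra.
  rewrite /thetaAP big_mkcond big_nat [X in _ <= X]big_nat; apply: ler_sum => p /andP[p1 pN].
  case: ifP => // _; apply: le_trans (ln_le_sub1 _) _; first by rewrite ltr0n.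
  rewrite lerBlDl; have p4 : (p < 4)%N by apply: leq_trans pN _.
  by rewrite -[1 + 3]/(4%:R) ler_nat ltnW.
have x1 : 1 < N%:R :> R by rewrite ltr1n (leq_trans _ N4).
have l1 : 1 <= ln N%:R :> R.
  apply: le_trans (_ : ln (2 * 2) <= _); first by rewrite lnM ?posrE //; have := half_le_ln2 R; lra.
  by rewrite -natrM ler_ln ?posrE ?ltr0n ?ler_nat // (leq_trans _ N4).
have := hc N%:R N 1%N 0%N x1 l1 (lexx _) isT; rewrite !expr1 => /(_ l1 isT).
rewrite (_ : totient 1 = 1)%N // divr1 ler_norml => /andP[_ h].
have : c * (N%:R / ln N%:R) <= c * N%:R.
  apply: ler_wpM2l; first by lra.
  by rewrite ler_pdivrMr ?(lt_le_trans _ l1) // ler_peMr.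
by move: h; move: (thetaAP _ _ _ _) (c * _) => *; nra.
Qed.

Lemma theta_lower : exists N0, forall N, (N0 <= N)%N -> N%:R / 2 <= thetaAP R N 1 0.
Proof.
have [c c1 hc] := siegel_walfisz R 1; exists (Num.truncn (expR (2 * c))).+1 => N hN.
have eN : expR (2 * c) <= N%:R.
  by apply: le_trans (ltW (truncnS_gt _)) _; rewrite ler_nat.
have N0 : 0 < N%:R :> R by apply: lt_le_trans eN; exact: expR_gt0.
have l2 : 2 * c <= ln N%:R by rewrite -[X in X <= _]expRK ler_ln ?posrE // expR_gt0.
have x1 : 1 < N%:R :> R.
  by apply: lt_le_trans eN; rewrite -expR0 ltr_expR mulr_gt0 // (lt_le_trans _ c1).
have l1 : 1 <= ln N%:R :> R by lra.
have := hc N%:R N 1%N 0%N x1 l1 (lexx _) isT; rewrite !expr1 => /(_ l1 isT).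
rewrite (_ : totient 1 = 1)%N // divr1 ler_norml => /andP[h _].
have : c * (N%:R / ln N%:R) <= N%:R / 2.
  rewrite mulrA ler_pdivrMr ?(lt_le_trans _ l1) //; nra.
by move: h; move: (thetaAP _ _ _ _) (c * _) => *; lra.
Qed.

Lemma blockvar_ge0 u L q : 0 <= blockvar R u L q.
Proof. by apply: sumr_ge0 => a _; exact: sqr_ge0. Qed.

Lemma thetaAP_one N : thetaAP R N 1 0 = \sum_(1 <= p < N.+1 | prime p) ln p%:R.
Proof. by apply: eq_bigl => p; rewrite !modn1 eqxx andbT. Qed.

Definition pweight V W q : R :=
  \sum_(1 <= m < W.+1 | prime m && (V < q * m <= W)%N) ln m%:R.

(** Chebyshev bounds at [W / q] and [V / q]. *)
Lemma pweight_bounds : exists M0 : nat, exists2 c : R, (1 < M0)%N /\ 1 <= c &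
  forall W q, (0 < q <= W %/ M0)%N ->
  W%:R <= 8 * q%:R * pweight (W %/ M0) W q /\ q%:R * pweight (W %/ M0) W q <= c * W%:R.
Proof.
(* [M0 >= 8 c] makes the primes up to [V / q] weigh at most [W / (8 q)], while those up to [W / q]
   weigh at least [W / (4 q)]. *)
have [c c1 hc] := theta_upper; have [N0 hN] := theta_lower.
pose M0 := (maxn 2 (maxn N0 (Num.truncn (8 * c)).+1))%N; exists M0; exists c.
  by split => //; rewrite /M0 leq_max.
have M2 : (1 < M0)%N by rewrite /M0 leq_max.
have MN : (N0 <= M0)%N by rewrite /M0 !leq_max leqnn orbT.
have Mc : 8 * c <= M0%:R.
  by apply: le_trans (ltW (truncnS_gt _)) _; rewrite ler_nat /M0 !leq_max leqnn !orbT.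
clearbody M0 => W q /andP[q0 qV]; set V := (W %/ M0)%N in qV *.
have VM : (V * M0 <= W)%N by exact: leq_divM.
have qM : (M0 <= W %/ q)%N by rewrite leq_divRL // mulnC; apply: leq_trans VM; rewrite leq_mul2r qV orbT.
have wq m : (q * m <= W)%N = (m <= W %/ q)%N by rewrite leq_divRL // mulnC.
have vq m : (V < q * m)%N = (V %/ q < m)%N by rewrite ltn_divLR // mulnC.
have qr : 0 < q%:R :> R by rewrite ltr0n.
split; last first.
  apply: le_trans (_ : q%:R * thetaAP R (W %/ q) 1 0 <= _).
    apply: ler_wpM2l; first exact: ltW.
    rewrite thetaAP_one /pweight -big_filter -[X in _ <= X]big_filter.
    apply: sum_uniq_sub; rewrite ?filter_uniq ?iota_uniq //; last by move=> *; exact: ln_nat_ge0.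
    move=> m; rewrite !mem_filter !mem_index_iota => /andP[/and3P[-> _]].
    by rewrite wq ltnS => h /andP[->].
  apply: le_trans (ler_wpM2l (ltW qr) (hc _)) _.
  rewrite mulrCA; apply: ler_wpM2l; first by lra.
  by rewrite -natrM ler_nat mulnC leq_divM.
have h1 : thetaAP R (W %/ q) 1 0 <= thetaAP R (V %/ q) 1 0 + pweight V W q.
  rewrite !thetaAP_one (@big_cat_nat _ _ _ (V %/ q).+1) //=; last first.
    by rewrite ltnS leq_div2r // leq_div.
  rewrite lerD2l /pweight -big_filter -[X in _ <= X]big_filter.
  apply: sum_uniq_sub; rewrite ?filter_uniq ?iota_uniq //; last by move=> *; exact: ln_nat_ge0.
  move=> m; rewrite !mem_filter !mem_index_iota => /andP[-> /andP[m1 m2]].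
  rewrite wq vq m1 -ltnS m2 (leq_ltn_trans _ m1) //= ltnS.
  by rewrite ltnS in m2; apply: leq_trans m2 (leq_div _ _).
have h2 := hN _ (leq_trans MN qM).
have h3 : W%:R <= q%:R * (2 * (W %/ q)%:R) :> R.
  rewrite -!natrM ler_nat; have := ltn_ceil W q0.
  have : (1 <= W %/ q)%N by apply: leq_trans qM; apply: ltnW.
  move: (W %/ q)%N => w; clear -q0; nia.
have h4 : 8 * (q%:R * thetaAP R (V %/ q) 1 0) <= W%:R.
  apply: le_trans (_ : 8 * (q%:R * (c * (V %/ q)%:R)) <= _).
    by rewrite ler_pM2l // ler_pM2l.
  apply: le_trans (_ : M0%:R * V%:R <= _); last by rewrite -natrM ler_nat mulnC.
  apply: le_trans (_ : 8 * c * V%:R <= _); last exact: ler_wpM2r.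
  have -> : 8 * (q%:R * (c * (V %/ q)%:R)) = 8 * c * (q%:R * (V %/ q)%:R) by ring.
  apply: ler_wpM2l; first by lra.
  by rewrite -natrM ler_nat mulnC leq_divM.
have h5 := ler_wpM2l (ltW qr) h1; have h6 := ler_wpM2l (ltW qr) h2.
move: h3 h4 h5 h6; clear; move: (thetaAP _ _ _ _) (thetaAP _ _ _ _) (pweight _ _ _) => a b w.
move: (q%:R) ((W %/ q)%:R) (W%:R) => q' t w'; nra.
Qed.

(** Each [r] is reached from its prime factors [m] with total weight at most [ln r]; this is where
    one logarithm is lost. *)
Lemma sum_prime_multiples V W (F : nat -> R) (X : R) : (forall r, 0 <= F r) -> ln W%:R <= X ->
  \sum_(1 <= q < V.+1) \sum_(1 <= m < W.+1 | prime m && (V < q * m <= W)%N) ln m%:R * F (q * m)%N <=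
  X * \sum_(V.+1 <= r < W.+1) F r.
Proof.
move=> F0 hX.
have -> : \sum_(1 <= q < V.+1) \sum_(1 <= m < W.+1 | prime m && (V < q * m <= W)%N) ln m%:R * F (q * m)%N =
  \sum_(1 <= q < V.+1) \sum_(1 <= m < W.+1 | prime m) \sum_(V.+1 <= r < W.+1 | r == (q * m)%N) ln m%:R * F r.
  apply: eq_bigr => q _; rewrite big_mkcondr; apply: eq_bigr => m _.
  by rewrite big_nat1_eq ltnS.
under eq_bigr do rewrite (exchange_big_dep xpredT) //=.
rewrite exchange_big /= mulr_sumr big_nat [X in _ <= X]big_nat; apply: ler_sum => r /andP[rV rW].
have r0 : (0 < r)%N by apply: leq_trans rV.
apply: le_trans (_ : \sum_(1 <= m < W.+1 | prime m && (m %| r)%N) ln m%:R * F r <= _).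
  rewrite (exchange_big_dep prime) /=; last by move=> ? ? _ /andP[].
  rewrite big_mkcondr; apply: ler_sum => m pm; have m0 := prime_gt0 pm.
  have lF : 0 <= ln m%:R * F r by rewrite mulr_ge0 ?ln_nat_ge0.
  case: ifPn => [mr|nmr]; last first.
    by rewrite big1 // => q /andP[_ /eqP e]; rewrite e dvdn_mull in nmr.
  apply: le_trans (_ : \sum_(1 <= q < V.+1 | q == (r %/ m)%N) ln m%:R * F r <= _).
    rewrite big_mkcond [X in _ <= X]big_mkcond; apply: ler_sum => q _.
    by rewrite pm /=; case: eqP => [->|_]; rewrite ?mulnK ?eqxx //; case: ifP.
  by rewrite big_nat1_eq; case: ifP.
rewrite -mulr_suml; apply: ler_wpM2r => //; apply: le_trans (_ : ln r%:R <= _); last first.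
  by apply: le_trans hX; rewrite ler_ln ?posrE ?ltr0n ?ler_nat // (leq_trans r0).
rewrite -(sum_vM R r0) -big_filter; set s := seq.filter _ _.
rewrite [X in X <= _](_ : _ = \sum_(m <- s) vM R m).
  apply: sum_uniq_sub; rewrite ?filter_uniq ?iota_uniq ?divisors_uniq //.
    by move=> m; rewrite mem_filter -dvdn_divisors // => /andP[/andP[]].
  by move=> *; exact: vM_ge0.
by rewrite !big_seq; apply: eq_bigr => m; rewrite mem_filter => /andP[/andP[pm _] _]; rewrite vM_prime.
Qed.

(** [blockvar_mul] is averaged over the primes [m] with [V < q m <= W], with weights [ln m] of total
    about [W / q]. The loss of a factor [m] is compensated because [q m <= W]. *)
Lemma small_moduli : exists M0 : nat, exists2 C : R, (1 < M0)%N /\ 1 <= C &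
  forall u L W (X : R), ln W%:R <= X ->
  \sum_(1 <= q < (W %/ M0).+1) blockvar R u L q <=
  C * X * (\sum_((W %/ M0).+1 <= r < W.+1) blockvar R u L r) + C * X ^+ 2 * W%:R.
Proof.
have [M0 [c [M1 c1] hc]] := pweight_bounds; exists M0; exists (16 * c); first by split => //; lra.
move=> u L W X hX; set V := (W %/ M0)%N.
have X0 : 0 <= X by apply: le_trans hX; exact: ln_nat_ge0.
have step q : (0 < q <= V)%N -> blockvar R u L q <= 16 * c * X ^+ 2 +
    16 * \sum_(1 <= m < W.+1 | prime m && (V < q * m <= W)%N) ln m%:R * blockvar R u L (q * m).
  move=> qV; have /andP[q0 _] := qV; have [b1 b2] := hc W q qV.
  have W0 : (0 < W)%N.
    by case/andP: qV => q1 q2; apply: leq_trans (leq_trans q1 q2) _; exact: leq_div.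
  have Wr : 0 < W%:R :> R by rewrite ltr0n.
  rewrite -(ler_pM2l Wr); apply: le_trans (ler_wpM2r (blockvar_ge0 u L q) b1) _.
  apply: le_trans (_ : 16 * X ^+ 2 * (q%:R * pweight V W q) + 16 * W%:R *
     \sum_(1 <= m < W.+1 | prime m && (V < q * m <= W)%N) ln m%:R * blockvar R u L (q * m) <= _); last first.
    have k0 : 0 <= 16 * X ^+ 2 by rewrite mulr_ge0 ?sqr_ge0.
    have := ler_wpM2l k0 b2; rewrite -/V.
    by move: (\sum_(_ <= _ < _ | _) _) (pweight _ _ _) => *; lra.
  rewrite /pweight -/V [8 * _ * _]mulr_sumr [X in X <= _]mulr_suml [q%:R * _]mulr_sumr.
  rewrite [X in _ <= X + _]mulr_sumr [X in _ <= _ + X]mulr_sumr -big_split /=.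
  apply: ler_sum => m /and3P[pm _ mW]; have h := @blockvar_mul u L q m q0 pm.
  have l0 := ln_nat_ge0 R m.
  have lX : ln m%:R ^+ 2 <= X ^+ 2.
    rewrite ler_sqr ?nnegrE //; apply: le_trans hX.
    rewrite ler_ln ?posrE ?ltr0n ?ler_nat // ?prime_gt0 //.
    by apply: leq_trans mW; rewrite leq_pmull.
  have qm : q%:R * m%:R <= W%:R :> R by rewrite -natrM ler_nat.
  have s0 := blockvar_ge0 u L (q * m).
  have q0r : 0 <= q%:R :> R by [].
  have h1 := ler_wpM2l (mulr_ge0 q0r l0) h.
  have h2 := ler_wpM2l (mulr_ge0 q0r l0) lX.
  have h3 := ler_wpM2l (mulr_ge0 l0 s0) qm.
  move: h1 h2 h3; clear; set a := blockvar R u L q; set b := blockvar R u L (q * m).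
  by move: (ln m%:R : R) => l h1 h2 h3; clearbody a b; lra.
apply: le_trans (_ : \sum_(1 <= q < V.+1) (16 * c * X ^+ 2 +
    16 * \sum_(1 <= m < W.+1 | prime m && (V < q * m <= W)%N) ln m%:R * blockvar R u L (q * m)) <= _).
  by rewrite big_nat [X in _ <= X]big_nat; apply: ler_sum => q; rewrite ltnS; exact: step.
rewrite big_split /= addrC -mulr_sumr sumr_const_nat subn1 /= -[_ *+ V]mulr_natr.
have h := @sum_prime_multiples V W (blockvar R u L) X (blockvar_ge0 u L) hX.
have S0 : 0 <= \sum_(V.+1 <= r < W.+1) blockvar R u L r by apply: sumr_ge0 => *; exact: blockvar_ge0.
apply: lerD.
  have := mulr_ge0 X0 S0; move: h; clear -c1; move: (\sum_(_ <= _ < _) _) (\sum_(_ <= _ < _) _) => *; nra.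
apply: ler_wpM2l; first by rewrite mulr_ge0 ?sqr_ge0 //; lra.
by rewrite ler_nat leq_div.
Qed.

End SmallModuli.

(** * Variance over all moduli on one block *)

Section BlockEstimate.
Variable R : realType.
Implicit Types (n m r u L V W M q A : nat).

Lemma sum_inv_totient_le D : (0 < D)%N ->
  \sum_(1 <= m < D.+1) (totient m)%:R^-1 <= (1 + 2 * ln D%:R) * (1 + ln D%:R) :> R.
Proof.
move=> D0; apply: le_trans (ler_wpM2l _ (@harmonic_le R D D0)); last first.
  by rewrite addr_ge0 // mulr_ge0 // ln_nat_ge0.
rewrite mulr_sumr big_nat [X in _ <= X]big_nat; apply: ler_sum => m /andP[m0 mD].
apply: le_trans (@totient_inv_le R m m0) _; apply: ler_wpM2r; first by rewrite invr_ge0.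
by rewrite lerD2l ler_pM2l // ler_ln ?posrE ?ltr0n ?ler_nat.
Qed.

(** Bookkeeping for the five terms of [dispersion]. Besides lengths and logarithms, [P] is [X ^ A],
    [Th] the Chebyshev sum of the block, [ED] and [PD] the sums of [ee] and [1 / phi] up to [M], [G]
    the sum of [1 / phi] over ]V, W], and [lv] the ratio [L / V]. *)
Lemma dispersion_terms (c c2 c4 m0 l w X Y P E Th ED PD lL lv G M : R) :
  1 <= c -> 1 <= c2 -> 1 <= c4 -> 1 <= m0 -> 1 <= l -> 1 <= w -> 1 <= X -> 1 <= Y -> 1 <= P ->
  0 <= E -> E * P * X <= 2 * c * w -> P * X ^+ 3 <= 2 * c2 * w ->
  0 <= Th -> Th <= (1 + 4 * c) * l -> 0 <= ED -> ED <= c4 * Y ^+ 2 -> PD <= c4 * Y ^+ 2 ->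
  0 <= lL -> lL <= X -> 0 <= lv -> lv <= 8 * m0 * P -> 0 <= G -> G <= 6 * X ^+ 2 ->
  0 <= M -> M <= 8 * m0 * P ->
  w * X * Th + ED * (2 * l * w * (1 + lL) + l * lv) + (4 * E * l + 2 * l * X) * G
   + 4 * E * l * PD + 4 * E * M * Th <=
  (1 + 4 * c + c4 * (4 + 16 * m0 * c2) + (48 * c + 24 * c2) + 8 * c * c4
    + 64 * m0 * c * (1 + 4 * c)) * (l * w * X * Y ^+ 2).
Proof.
move=> hc hc2 hc4 hm hl hw hX hY hP hE hEP hPX hT0 hT hED0 hED hPD hL0 hL hv0 hv hG0 hG hM0 hM.
have [c0 c20 c40 m00] : [/\ 0 <= c, 0 <= c2, 0 <= c4 & 0 <= m0].
  by split; apply: le_trans ler01 _.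
have [l0 w0 X0 P0] : [/\ 0 <= l, 0 <= w, 0 <= X & 0 <= P].
  by split; apply: le_trans ler01 _.
pose T0 := l * w * X; have T00 : 0 <= T0 by rewrite /T0 !mulr_ge0.
have Y2 : 1 <= Y ^+ 2 by rewrite exprn_ege1.
have Y0 : 0 <= Y by exact: le_trans ler01 hY.
have Y20 : 0 <= Y ^+ 2 by exact: sqr_ge0.
have TY : T0 <= T0 * Y ^+ 2 by rewrite ler_peMr.
have lw0 : 0 <= l * w by rewrite mulr_ge0.
have lwT : l * w <= T0 by rewrite /T0 ler_peMr.
have X3 : 1 <= X ^+ 3 by rewrite exprn_ege1.
have P2 : P <= 2 * c2 * w by apply: le_trans hPX; rewrite ler_peMr.
have X32 : X ^+ 3 <= 2 * c2 * w by apply: le_trans hPX; rewrite ler_peMl // (le_trans ler01 X3).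
have EP0 : 0 <= E * P by rewrite mulr_ge0.
have EP : E * P <= 2 * c * w by apply: le_trans hEP; rewrite ler_peMr.
have EX : E * X <= 2 * c * w.
  apply: le_trans hEP; rewrite -mulrA; apply: ler_wpM2l => //; by rewrite ler_peMl.
have E2 : E <= 2 * c * w by apply: le_trans EP; rewrite ler_peMr.
have t1 : w * X * Th <= (1 + 4 * c) * (T0 * Y ^+ 2).
  apply: le_trans (ler_wpM2l (mulr_ge0 w0 X0) hT) _.
  have -> : w * X * ((1 + 4 * c) * l) = (1 + 4 * c) * T0 by rewrite /T0; ring.
  by apply: ler_wpM2l => //; clear -hc hc2 hc4 hm hl; lra.
have t2 : ED * (2 * l * w * (1 + lL) + l * lv) <= c4 * (4 + 16 * m0 * c2) * (T0 * Y ^+ 2).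
  have i0 : 0 <= 2 * l * w * (1 + lL) + l * lv by rewrite addr_ge0 ?mulr_ge0 // addr_ge0.
  apply: le_trans (ler_wpM2r i0 hED) _.
  have -> : c4 * (4 + 16 * m0 * c2) * (T0 * Y ^+ 2) = c4 * Y ^+ 2 * ((4 + 16 * m0 * c2) * T0) by ring.
  apply: ler_wpM2l; first by rewrite mulr_ge0.
  rewrite [X in _ <= X]mulrDl; apply: lerD.
    have -> : 4 * T0 = 2 * l * w * (2 * X) by rewrite /T0; ring.
    apply: ler_wpM2l; last by clear -hX hY hP hE hEP hPX hL hv0 hv; lra.
    by rewrite !mulr_ge0.
  apply: le_trans (ler_wpM2l l0 hv) _; apply: le_trans (_ : l * (8 * m0 * (2 * c2 * w)) <= _).
    by apply: ler_wpM2l => //; apply: ler_wpM2l => //; rewrite mulr_ge0.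
  have -> : l * (8 * m0 * (2 * c2 * w)) = 16 * m0 * c2 * (l * w) by ring.
  by apply: ler_wpM2l => //; rewrite !mulr_ge0.
have t3 : (4 * E * l + 2 * l * X) * G <= (48 * c + 24 * c2) * (T0 * Y ^+ 2).
  have i0 : 0 <= 4 * E * l + 2 * l * X by rewrite addr_ge0 ?mulr_ge0.
  apply: le_trans (ler_wpM2l i0 hG) _.
  have -> : (4 * E * l + 2 * l * X) * (6 * X ^+ 2) = 24 * (l * X) * (E * X) + 12 * l * X ^+ 3 by ring.
  apply: le_trans (_ : 24 * (l * X) * (2 * c * w) + 12 * l * (2 * c2 * w) <= _).
    by apply: lerD; apply: ler_wpM2l; rewrite ?mulr_ge0.
  have -> : 24 * (l * X) * (2 * c * w) + 12 * l * (2 * c2 * w) = 48 * c * T0 + 24 * c2 * (l * w).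
    by rewrite /T0; ring.
  apply: le_trans (_ : 48 * c * T0 + 24 * c2 * T0 <= _).
    by apply: lerD => //; apply: ler_wpM2l; rewrite ?mulr_ge0.
  by rewrite -mulrDl; apply: ler_wpM2l => //; rewrite addr_ge0 ?mulr_ge0.
have t4 : 4 * E * l * PD <= 8 * c * c4 * (T0 * Y ^+ 2).
  apply: le_trans (ler_wpM2l _ hPD) _; first by rewrite !mulr_ge0.
  have -> : 4 * E * l * (c4 * Y ^+ 2) = 4 * c4 * l * Y ^+ 2 * E by ring.
  apply: le_trans (ler_wpM2l _ E2) _; first by rewrite !mulr_ge0.
  have -> : 4 * c4 * l * Y ^+ 2 * (2 * c * w) = 8 * c * c4 * Y ^+ 2 * (l * w) by ring.
  have -> : 8 * c * c4 * (T0 * Y ^+ 2) = 8 * c * c4 * Y ^+ 2 * T0 by ring.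
  by apply: ler_wpM2l => //; rewrite !mulr_ge0.
have t5 : 4 * E * M * Th <= 64 * m0 * c * (1 + 4 * c) * (T0 * Y ^+ 2).
  have k0 : 0 <= 1 + 4 * c by clear -hc hc2 hc4 hm hl hw; lra.
  apply: le_trans (_ : 4 * E * (8 * m0 * P) * ((1 + 4 * c) * l) <= _).
    apply: ler_pM => //; first by rewrite !mulr_ge0.
    by apply: ler_wpM2l; rewrite ?mulr_ge0.
  have -> : 4 * E * (8 * m0 * P) * ((1 + 4 * c) * l) = 32 * m0 * (1 + 4 * c) * l * (E * P) by ring.
  apply: le_trans (ler_wpM2l _ EP) _; first by rewrite !mulr_ge0.
  have -> : 32 * m0 * (1 + 4 * c) * l * (2 * c * w) = 64 * m0 * c * (1 + 4 * c) * (l * w) by ring.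
  by apply: ler_wpM2l; [rewrite !mulr_ge0 | exact: le_trans lwT TY].
rewrite -/T0; set Z := T0 * Y ^+ 2 in t1 t2 t3 t4 t5 *.
have dist (a b d e f : R) : (a + b + d + e + f) * Z = a * Z + b * Z + d * Z + e * Z + f * Z by ring.
by rewrite dist; apply: lerD t5; apply: lerD t4; apply: lerD t3; apply: lerD t2.
Qed.

Lemma block_estimate A : exists X0 : R, exists2 C : R, 1 <= X0 /\ 1 <= C & forall (x : R) W u L,
  1 < x -> X0 <= ln x -> x <= 2 * ln x ^+ A * W%:R -> (W <= L)%N -> (u + L)%:R <= x ->
  \sum_(1 <= q < W.+1) blockvar R u L q <=
  C * (L%:R * W%:R * ln x ^+ 2 * (1 + ln (ln x)) ^+ 2).
Proof.
(* One [A] because [W] may be as small as [x / (2 X ^ A)], another because [m] ranges up to a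
   multiple of [X ^ A], and 1 to spare for constants and a logarithm. *)
have [c c1 hc] := siegel_walfisz R (2 * A + 1).
have [M0 [C1 [M1 C11] hM]] := small_moduli R.
have [c2 c21 hc2] := @lnX_le_powR R (2 * A + 3) 1 ltr01.
have m1 : 1 <= M0%:R :> R by rewrite ler1n ltnW.
have m0 : 0 <= M0%:R :> R by [].
pose c3 := ln (8 * M0%:R) + A%:R : R.
have c30 : 0 <= c3.
  by rewrite /c3 addr_ge0 // ln_ge0 //; lra.
pose c4 := (1 + 2 * c3) * (1 + c3).
have c41 : 1 <= c4 by rewrite /c4 mulr_ege1 //; lra.
pose c5 := 1 + 4 * c + c4 * (4 + 16 * M0%:R * c2) + (48 * c + 24 * c2) + 8 * c * c4
    + 64 * M0%:R * c * (1 + 4 * c).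
have c51 : 1 <= c5.
  have a1 : 0 <= c4 * (4 + 16 * M0%:R * c2) by rewrite mulr_ge0 ?addr_ge0 ?mulr_ge0 //; clear -c21 c30; lra.
  have a2 : 0 <= 8 * c * c4 by rewrite !mulr_ge0 //; clear -c1 c30; lra.
  have a3 : 0 <= 64 * M0%:R * c * (1 + 4 * c) by rewrite !mulr_ge0 ?addr_ge0 ?mulr_ge0 //; clear -c1; lra.
  by rewrite /c5; clear -c1 M1 c21 a1 a2 a3; lra.
(* This size of [ln x] ensures [M0 <= W], hence [V > 0], and [8 M0 <= X], hence moduli [m] within
   the range of Siegel-Walfisz. *)
exists (8 * M0%:R * c2); exists (C1 * c5 + c5 + C1).
  by split; [rewrite mulr_ege1 //; (clear -C11 m1 c51; lra) | (clear -C11 m1 c51; nra)].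
move=> x W u L x1 hX hW WL uL; set X := ln x in hX hW *; set P := X ^+ A in hW *.
have X1 : 1 <= X by apply: le_trans hX; rewrite mulr_ege1 //; lra.
have X0 : 0 <= X by clear -hX hW X1; lra.
have P1 : 1 <= P by exact: exprn_ege1.
have P0 : 0 <= P by clear -hW X1 X0 P1; lra.
have x0 : 0 < x by clear -x1 WL uL hX; lra.
have eK : X ^+ (2 * A + 1) = P * P * X by rewrite exprD expr1 mulnC exprM expr2.
have PX : P * X ^+ 3 <= 2 * c2 * W%:R.
  have := hc2 x (ltW x1); rewrite powRr1 ?(ltW x0) // -/X exprD mulnC exprM expr2 -/P => h.
  have := ler_wpM2l (_ : 0 <= c2) hW => /(_ ltac:((clear -c1 M1 C11 c21 m1; lra))) h'.
  rewrite -(@ler_pM2l _ P) ?(lt_le_trans ltr01) //.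
  clear -x0 eK h h'; by move: h h'; move: (X ^+ 3) (W%:R) => *; lra.
have WM : M0%:R <= W%:R :> R.
  have XP : X <= P * X ^+ 3.
    by apply: le_trans (_ : X ^+ 3 <= _); rewrite ?ler_peMl ?ler_eXnr // ?exprn_ge0.
  have h : 8 * M0%:R * c2 <= 2 * c2 * W%:R by apply: le_trans hX (le_trans XP PX).
  have h4 : 4 * M0%:R <= W%:R :> R.
    rewrite -(@ler_pM2l _ (2 * c2)); last by clear -c1 M1 C11 c21 m1; lra.
    clear -eK PX XP h; by move: h; move: (W%:R) (M0%:R : R) => *; lra.
  by clear -c21 m1 m0 XP h h4; lra.
rewrite ler_nat in WM; set V := (W %/ M0)%N.
have V0 : (0 < V)%N by rewrite divn_gt0 // ltnW.
have W0 : (0 < W)%N by apply: leq_trans WM; apply: ltnW.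
have L0 : (0 < L)%N by apply: leq_trans WL.
have VW : (V <= W)%N by exact: leq_div.
have WV : (W <= 2 * M0 * V)%N.
  have := ltn_ceil W (ltnW M1); rewrite -/V; move: V0; clear; nia.
have w1 : 1 <= W%:R :> R by rewrite ler1n.
have l1 : 1 <= L%:R :> R by rewrite ler1n.
have wl : W%:R <= L%:R :> R by rewrite ler_nat.
have v0 : 0 < V%:R :> R by rewrite ltr0n.
have lx : L%:R <= x by apply: le_trans uL; rewrite ler_nat leq_addl.
pose M := (L %/ V).+1.
have lv : L%:R / V%:R + 1 <= 8 * M0%:R * P.
  have wv : W%:R <= 2 * M0%:R * V%:R :> R by rewrite -!natrM ler_nat.
  have vl : V%:R <= L%:R :> R by rewrite ler_nat (leq_trans VW).
  have a1 : L%:R <= 4 * M0%:R * P * V%:R.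
    apply: le_trans lx (le_trans hW _); have := ler_wpM2l (mulr_ge0 (ler0n R 2) P0) wv.
    clear -A; by move: (V%:R) (W%:R) (M0%:R : R) => *; lra.
  have a2 : 1 <= L%:R / V%:R :> R by rewrite ler_pdivlMr // mul1r.
  have a3 : L%:R / V%:R <= 4 * M0%:R * P by rewrite ler_pdivrMr.
  clear -lx wv vl a1 a2 a3; by move: (L%:R / V%:R) a2 a3 => *; lra.
have M8 : M%:R <= 8 * M0%:R * P.
  apply: le_trans lv; rewrite /M -natr1 lerD2r.
  by have [] := @divn_real R L V V0.
have MK : M%:R <= X ^+ (2 * A + 1).
  apply: le_trans M8 _; rewrite eK.
  have a1 : 8 * M0%:R <= X by apply: le_trans hX; rewrite ler_peMr //; lra.
  have a2 : 8 * M0%:R * P <= X * P by exact: ler_wpM2r.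
  have a3 : X * P <= P * P * X by rewrite [X * P]mulrC -mulrA ler_peMl ?mulr_ge0.
  exact: le_trans a2 a3.
pose E := c * (x / X ^+ (2 * A + 1)).
have XK0 : 0 < X ^+ (2 * A + 1) by rewrite exprn_gt0 //; clear -hW X1 X0 P1; lra.
have E0 : 0 <= E by rewrite mulr_ge0 ?divr_ge0 ?(ltW XK0) ?(ltW x0) //; clear -c1; lra.
have EPX : E * P * X <= 2 * c * W%:R.
  have -> : E * P * X = c * (x / P).
    have Pn : P != 0 by rewrite gt_eqF // (lt_le_trans ltr01).
    have Xn : X != 0 by rewrite gt_eqF // (lt_le_trans ltr01).
    by rewrite /E eK; field; rewrite Pn Xn.
  rewrite -[2 * c]mulrC -mulrA; apply: ler_wpM2l; first by clear -c1 M1 C11 c21; lra.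
  clear -hW X1 X0 P1; by rewrite ler_pdivrMr ?(lt_le_trans ltr01) //; move: hW; lra.
have lnX n : (0 < n)%N -> n%:R <= x -> ln n%:R <= X.
  by move=> n0 nx; rewrite /X ler_ln ?posrE ?ltr0n.
have uX : ln (u + L)%:R <= X by apply: lnX; rewrite ?addn_gt0 ?L0 ?orbT.
have wX : ln W%:R <= X by apply: lnX => //; exact: le_trans wl lx.
have lX : ln L%:R <= X by exact: lnX.
have hSW m a N : (0 < m <= M)%N -> coprime a m -> (N <= u + L)%N ->
    `|thetaAP R N m a - N%:R / (totient m)%:R| <= E.
  move=> /andP[mm mM] ca NL; apply: hc => //.
    by apply: le_trans uL; rewrite ler_nat.
  by apply: le_trans MK; rewrite ler_nat.
have D := @dispersion R u L V W M E X V0 VW L0 (ltn0Sn _) (leqnSn _) hSW uX wX.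
have Y1 : 1 <= 1 + ln X by rewrite lerDl ln_ge0.
have lM : ln M%:R <= c3 * (1 + ln X).
  apply: le_trans (_ : ln (8 * M0%:R * P) <= _).
    rewrite ler_ln ?posrE ?ltr0n //; apply: lt_le_trans M8; by rewrite ltr0n.
  rewrite lnM ?posrE ?(lt_le_trans ltr01) //; last by rewrite mulr_ege1 //; clear; lra.
  rewrite /P lnXn ?(lt_le_trans ltr01) // -[ln X *+ A]mulr_natl /c3.
  have a1 : 0 <= ln (8 * M0%:R) :> R by rewrite ln_ge0 //; clear -c21 m1; lra.
  have a2 : 0 <= ln X by rewrite ln_ge0.
  have a3 : 0 <= A%:R :> R by [].
  by move: (ln (8 * M0%:R)) (ln X) (A%:R : R) a1 a2 a3; clear => *; nra.
have PD : \sum_(1 <= m < M.+1) (totient m)%:R^-1 <= c4 * (1 + ln X) ^+ 2.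
  apply: le_trans (@sum_inv_totient_le M (ltn0Sn _)) _.
  have lM0 := ln_nat_ge0 R M.
  have -> : c4 * (1 + ln X) ^+ 2 = ((1 + 2 * c3) * (1 + ln X)) * ((1 + c3) * (1 + ln X)).
    by rewrite /c4; ring.
  move: lM lM0 Y1 c30; move: (ln M%:R) (1 + ln X); clear => a y a1 a2 a3 c30.
  by apply: ler_pM; rewrite ?addr_ge0 ?mulr_ge0 //; lra.
have ED0 : 0 <= \sum_(1 <= d < M.+1) ee R d by apply: sumr_ge0 => *; exact: ee_ge0.
have ED : \sum_(1 <= d < M.+1) ee R d <= c4 * (1 + ln X) ^+ 2.
  by apply: le_trans PD; apply: ler_sum => d _; exact: ee_le.
have G0 : 0 <= \sum_(V.+1 <= r < W.+1) (totient r)%:R^-1 :> R.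
  by apply: sumr_ge0 => r _; rewrite invr_ge0.
have G6 : \sum_(V.+1 <= r < W.+1) (totient r)%:R^-1 <= 6 * X ^+ 2.
  apply: le_trans (_ : \sum_(1 <= r < W.+1) (totient r)%:R^-1 <= _).
    rewrite [X in _ <= X](@big_cat_nat _ _ _ V.+1) //= lerDr.
    by apply: sumr_ge0 => r _; rewrite invr_ge0.
  apply: le_trans (@sum_inv_totient_le W W0) _; have := ln_nat_ge0 R W; move: wX X1.
  by clearbody X; clear; move: (ln W%:R) => *; nra.
have Th0 : 0 <= chebyshev_blk R u L by apply: sumr_ge0 => *; exact: lp_ge0.
have Th : chebyshev_blk R u L <= (1 + 4 * c) * L%:R.
  have := @chebyshev_blk_near R u L M E (ltn0Sn _) hSW L (leqnn L); rewrite ler_norml => /andP[_].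
  have E2 : E <= 2 * c * W%:R.
    apply: le_trans EPX; rewrite -mulrA ler_peMr //; by rewrite mulr_ege1.
  have : 2 * c * W%:R <= 2 * c * L%:R by apply: ler_wpM2l => //; clear -c1; lra.
  by move: (chebyshev_blk _ _ _) E2; clear => *; lra.
have lv0 : 0 <= L%:R / V%:R :> R by rewrite divr_ge0 // ltW.
have lv8 : L%:R / V%:R <= 8 * M0%:R * P by apply: le_trans lv; rewrite lerDl.
have T := @dispersion_terms c c2 c4 M0%:R L%:R W%:R X (1 + ln X) P E (chebyshev_blk R u L) _ _ (ln L%:R)
   (L%:R / V%:R) _ M%:R c1 c21 c41 m1 l1 w1 X1 Y1 P1 E0 EPX PX Th0 Th ED0 ED PD (ln_nat_ge0 R L) lX
   lv0 lv8 G0 G6 (ler0n _ _) M8.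
have main : \sum_(V.+1 <= r < W.+1) blockvar R u L r <= c5 * (L%:R * W%:R * X * (1 + ln X) ^+ 2).
  by apply: le_trans D _; rewrite -[_ * _ / V%:R]mulrA.
rewrite (@big_cat_nat _ _ _ V.+1) //=.
have S := hM u L W X wX; rewrite -/V in S.
have Y2 : 1 <= (1 + ln X) ^+ 2 by exact: exprn_ege1.
move: main S Y2; set S1 := \sum_(_ <= _ < _) _; set S2 := \sum_(_ <= _ < _) _.
move: ((1 + ln X) ^+ 2) => y main S Y2.
have lw0 : 0 <= L%:R * W%:R :> R by rewrite mulr_ge0.
have C10 : 0 <= C1 by exact: le_trans ler01 C11.
have y0 : 0 <= y by exact: le_trans ler01 Y2.
have c50 : 0 <= c5 by exact: le_trans ler01 c51.
have main2 : C1 * X * S1 <= C1 * X * (c5 * (L%:R * W%:R * X * y)).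
  by apply: ler_wpM2l => //; rewrite mulr_ge0.
have a1 : L%:R * W%:R * X * y <= L%:R * W%:R * X ^+ 2 * y.
  apply: ler_wpM2r => //.
  by apply: ler_wpM2l => //; rewrite expr2 ler_peMr.
have a2 : C1 * X ^+ 2 * W%:R <= C1 * (L%:R * W%:R * X ^+ 2 * y).
  rewrite -mulrA; apply: ler_wpM2l => //.
  apply: le_trans (_ : L%:R * W%:R * X ^+ 2 <= _).
    by rewrite mulrC; apply: ler_wpM2r; [exact: sqr_ge0 | rewrite ler_peMl].
  by rewrite ler_peMr // mulr_ge0 ?sqr_ge0.
have a3 : c5 * (L%:R * W%:R * X * y) <= c5 * (L%:R * W%:R * X ^+ 2 * y).
  exact: ler_wpM2l.
apply: le_trans (lerD S (le_trans main a3)) _.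
move: main2 a2; set T1 := L%:R * W%:R * X ^+ 2 * y.
have -> : C1 * X * (c5 * (L%:R * W%:R * X * y)) = C1 * c5 * T1 by rewrite /T1; ring.
by move: T1; clear => *; lra.
Qed.

End BlockEstimate.

(** * Reduction of interval partitions to dyadic grid blocks *)

Section Partitions.
Variable R : realType.
Implicit Types (n m l k s t B N i j W q a kap : nat).

(** Squared increments of [f] over all dyadic blocks of level at most [kap] inside [s, t]. The cap
    [B] on [k] gives every interval the same index range, so that sums can be exchanged. *)
Definition dyadic_sum (f : nat -> R) kap B s t : R :=
  \sum_(0 <= l < kap.+1) \sum_(0 <= k < B | (s <= k * 2 ^ l)%N && (k.+1 * 2 ^ l <= t)%N)
    (f (k.+1 * 2 ^ l)%N - f (k * 2 ^ l)%N) ^+ 2.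

Lemma dyadic_sum_ge0 (f : nat -> R) kap B s t : 0 <= dyadic_sum f kap B s t.
Proof. by do 2 (apply: sumr_ge0 => ? _); exact: sqr_ge0. Qed.

Lemma dyadic_step (e1 e2 F d0 d c : R) : 1 <= c -> e1 ^+ 2 + e2 ^+ 2 <= d0 -> F ^+ 2 <= c * d ->
  (e1 + e2 + F) ^+ 2 <= (c + 2) * (d0 + d).
Proof.
move=> c1 h1 h2; have c0 : 0 < c by exact: lt_le_trans ltr01 c1.
apply: le_trans (_ : (c + 2) * (e1 ^+ 2 + e2 ^+ 2 + F ^+ 2 / c) <= _); last first.
  apply: ler_wpM2l; first by rewrite addr_ge0 // ltW.
  by apply: lerD => //; rewrite ler_pdivrMr // mulrC.
set g := F / c; have -> : F = c * g by rewrite /g mulrC divfK // gt_eqF.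
have -> : (c * g) ^+ 2 / c = c * g ^+ 2 by field; rewrite gt_eqF.
have := sqr_ge0 (e1 - e2); have := mulr_ge0 (ltW c0) (sqr_ge0 (e1 - g)).
have := mulr_ge0 (ltW c0) (sqr_ge0 (e2 - g)); nra.
Qed.

(* The constant is linear in kap because the step uses Cauchy-Schwarz with weights 1, 1, 1 / c. *)
Lemma dyadic_ineq kap : forall (f : nat -> R) B s t, (s <= t)%N -> (t <= 2 ^ kap)%N -> (t <= B)%N ->
  (f t - f s) ^+ 2 <= (2 * kap + 1)%:R * dyadic_sum f kap B s t.
Proof.
elim: kap => [|kap IH] f B s t st tk tB.
  have := dyadic_sum_ge0 f 0 B s t; rewrite muln0 add0n mul1r.
  case: (ltngtP s t) st => // [st _ _|-> _ h]; last by rewrite subrr expr0n.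
  have [-> t1] : s = 0%N /\ t = 1%N by rewrite expn0 in tk; lia.
  rewrite t1 /dyadic_sum big_nat1 (@big_cat_nat _ _ _ 1) //=; last by rewrite -t1.
  rewrite [X in _ <= X + _]big_mkcond big_nat1 expn0 !muln1 /= lerDl.
  by apply: sumr_ge0 => *; exact: sqr_ge0.
case: (ltngtP s t) st => // [st _|-> _]; last first.
  by rewrite subrr expr0n mulr_ge0 // dyadic_sum_ge0.
(* Both ends are rounded inward to even integers: at most two blocks of level 0 are split off, and
   the rest is the same problem for [f n.*2] one level lower. *)
set s' := uphalf s; set t' := t./2.
have oh n := odd_double_half n.
have s2 : s'.*2 = (s + odd s)%N by rewrite /s' uphalf_half doubleD; have := oh s; case: odd => /=; lia.
have t2 : t'.*2 = (t - odd t)%N by rewrite /t'; have := oh t; case: odd => /=; lia.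
have st' : (s' <= t')%N by rewrite -leq_double s2 t2; have := oh s; have := oh t; case: odd; case: odd => /=; lia.
have tk' : (t' <= 2 ^ kap)%N by move: tk; rewrite expnS; have := t2; lia.
have tB' : (t' <= B)%N by apply: leq_trans tB; rewrite -[t']half_double; lia.
have H := IH (fun n => f n.*2) B s' t' st' tk' tB'.
set e1 := f s'.*2 - f s; set e2 := f t - f t'.*2.
have -> : f t - f s = e1 + e2 + (f t'.*2 - f s'.*2) by rewrite /e1 /e2; ring.
have -> : (2 * kap.+1 + 1)%:R = (2 * kap + 1)%:R + 2 :> R.
  by rewrite -natrD; congr _%:R; lia.
have -> : dyadic_sum f kap.+1 B s t =
    \sum_(0 <= k < B | (s <= k)%N && (k < t)%N) (f k.+1 - f k) ^+ 2 +
    dyadic_sum (fun n => f n.*2) kap B s' t'.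
  rewrite /dyadic_sum big_nat_recl //; congr (_ + _).
    rewrite expn0; apply: eq_big => [k|k _]; by rewrite !muln1.
  apply: eq_bigr => l _; apply: eq_big => [k|k _].
    have -> : (k * 2 ^ l.+1 = (k * 2 ^ l).*2)%N by rewrite expnS -mul2n; lia.
    have -> : (k.+1 * 2 ^ l.+1 = (k.+1 * 2 ^ l).*2)%N by rewrite expnS -mul2n; lia.
    move: (k * 2 ^ l)%N (k.+1 * 2 ^ l)%N => a b.
    congr (_ && _); apply/idP/idP => h.
    - by rewrite -leq_double s2; have := oh s; case: odd => /=; lia.
    - by rewrite -leq_double s2 in h; lia.
    - by rewrite -leq_double t2; have := oh t; case: odd => /=; lia.
    - by rewrite -leq_double t2 in h; lia.
  by rewrite expnS mulnCA mul2n mulnCA mul2n.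
apply: dyadic_step H; first by rewrite ler1n; lia.
pose G k := (f k.+1 - f k) ^+ 2; have G0 k : 0 <= G k by exact: sqr_ge0.
apply: le_trans (_ : \sum_(0 <= k < B | k == s) (if odd s then G k else 0) +
   \sum_(0 <= k < B | k == t.-1) (if odd t then G k else 0) <= _); last first.
  rewrite big_mkcond [X in _ + X]big_mkcond -big_split /= [X in _ <= X]big_mkcond.
  apply: ler_sum => k _.
  case: eqP => [->|_]; case: eqP => [e|_]; rewrite ?add0r ?addr0 -/(G _).
  - rewrite leqnn st /=; case os: (odd s); case ot: (odd t); rewrite ?addr0 ?add0r //.
    by move: os ot; rewrite e; case: (t) st => //= t0 _ ->.
  - by rewrite leqnn st /=; case: odd.
  - have -> : (s <= k)%N && (k < t)%N by lia.
    by case: odd.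
  - by case: ifP.
rewrite !big_nat1_eq /=; have -> : (s < B)%N by lia.
have -> : (t.-1 < B)%N by lia.
apply: lerD.
  rewrite /e1 s2; case: odd; rewrite ?addn1 ?addn0 ?subrr ?expr0n //.
rewrite /e2 t2; case: odd; rewrite ?subn1 ?subn0 ?subrr ?expr0n //=.
by rewrite /G prednK //; lia.
Qed.

Definition grid_sum (F : nat -> R) W kap B (P : nat -> nat -> bool) : R :=
  \sum_(0 <= l < kap.+1) \sum_(0 <= k < B | P (k * 2 ^ l * W)%N (k.+1 * 2 ^ l * W)%N)
    (F (k.+1 * 2 ^ l * W)%N - F (k * 2 ^ l * W)%N) ^+ 2.

(** The interval is trimmed to its first and last grid points [s W] and [t W]; without any grid
    point it is shorter than [W] and falls under [short]. The factor 3 comes from squaring a sum of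
    three pieces. *)
Lemma interval_ineq (F w : nat -> R) W kap B N i j : (0 < W)%N -> (forall n, 0 <= w n) ->
  (forall i j, (i <= j)%N -> (j <= N)%N -> (j <= i + W)%N ->
     (F j - F i) ^+ 2 <= \sum_(i.+1 <= n < j.+1) w n) ->
  (N %/ W <= 2 ^ kap)%N -> (N %/ W <= B)%N -> (i <= j)%N -> (j <= N)%N ->
  (F j - F i) ^+ 2 <= 3 * \sum_(i.+1 <= n < j.+1) w n +
    3 * ((2 * kap + 1)%:R * grid_sum F W kap B (fun u v => (i <= u)%N && (v <= j)%N)).
Proof.
move=> W0 w0 short Nk NB ij jN; set g := grid_sum _ _ _ _ _.
have g0 : 0 <= g by do 2 (apply: sumr_ge0 => ? _); exact: sqr_ge0.
have kg0 : 0 <= (2 * kap + 1)%:R * g by rewrite mulr_ge0.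
have wi0 a b : 0 <= \sum_(a <= n < b) w n by apply: sumr_ge0.
pose s := ((i + W.-1) %/ W)%N; pose t := (j %/ W)%N.
have tj : (t * W <= j)%N by exact: leq_divM.
have jt : (j < t.+1 * W)%N by exact: ltn_ceil.
have is_ : (i <= s * W)%N.
  by have := ltn_ceil (i + W.-1) W0; rewrite -/s; clear -W0; nia.
have si : (s * W < i + W)%N.
  by have := leq_divM (i + W.-1) W; rewrite -/s; clear -W0; nia.
have [st|ts] := leqP s t; last first.
  apply: le_trans (short _ _ ij jN _) _.
    have : (t.+1 * W <= s * W)%N by rewrite leq_mul2r ts orbT.
    by clear -jt si; lia.
  by have := wi0 i.+1 j.+1; lra.
have sW : (s * W <= t * W)%N by rewrite leq_mul2r st orbT.
have h1 := short i (s * W)%N is_ (leq_trans sW (leq_trans tj jN)) (ltnW si).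
have h2 := short (t * W)%N j tj jN (eq_ind _ (fun k => j <= k)%N (ltnW jt) _ (mulSnr t W)).
have tN : (t <= N %/ W)%N by exact: leq_div2r.
have h3 := @dyadic_ineq kap (fun n => F (n * W)%N) B s t st (leq_trans tN Nk) (leq_trans tN NB).
have h4 : dyadic_sum (fun n => F (n * W)%N) kap B s t <= g.
  apply: ler_sum => l _; rewrite big_mkcond [X in _ <= X]big_mkcond; apply: ler_sum => k _.
  case: ifP => [/andP[a1 a2]|_]; last by case: ifP => // _; exact: sqr_ge0.
  have -> : (i <= k * 2 ^ l * W)%N by apply: leq_trans is_ _; rewrite leq_mul2r a1 orbT.
  by have -> : (k.+1 * 2 ^ l * W <= j)%N by apply: leq_trans tj; rewrite leq_mul2r a2 orbT.
have h5 : \sum_(i.+1 <= n < (s * W).+1) w n + \sum_((t * W).+1 <= n < j.+1) w n <= \sum_(i.+1 <= n < j.+1) w n.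
  rewrite [X in _ <= X](@big_cat_nat _ _ _ (s * W).+1) //=; last by rewrite ltnS (leq_trans sW).
  rewrite lerD2l [X in _ <= X](@big_cat_nat _ _ _ (t * W).+1) //= lerDr; exact: wi0.
have h6 := ler_wpM2l (ler0n R (2 * kap + 1)) h4.
have -> : F j - F i = (F (s * W)%N - F i) + (F j - F (t * W)%N) + (F (t * W)%N - F (s * W)%N) by ring.
move: h1 h2 h3 h5 h6; clear; move: (F (s * W)%N - F i) (F j - F (t * W)%N) (F (t * W)%N - F (s * W)%N) => a b c.
move: (\sum_(_ <= _ < _) _) (\sum_(_ <= _ < _) _) (\sum_(_ <= _ < _) _) (_ * g) (_ * _) => x1 x2 x3 y z h1 h2 h3 h5 h6.
have := sqr_ge0 (a - b); have := sqr_ge0 (b - c); have := sqr_ge0 (a - c); nra.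
Qed.


(** The half-open form, with [i] one below the minimum, turns sums over the interval into
    differences of sums over initial segments. *)
Lemma interval_ends N (I : {set 'I_N.+1}) : I != finset.set0 -> I \subset ground N -> Defs.is_interval I ->
  exists i j, [/\ (i <= j)%N, (j <= N)%N & forall n : 'I_N.+1, (n \in I) = (i < n <= j)%N].
Proof.
case/set0Pn => n0 In0 sI /forallP iI.
have [m Im mP] := (@arg_minnP _ n0 (mem I) (fun n : 'I_N.+1 => n : nat) In0).
have [M IM MP] := (@arg_maxnP _ n0 (mem I) (fun n : 'I_N.+1 => n : nat) In0).
have m0 : (0 < m)%N by move/fintype.subsetP/(_ m Im): sI; rewrite inE.
have mM : (m <= M)%N by exact: mP.
exists m.-1, (M : nat); split.
- by apply: leq_trans mM; exact: leq_pred.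
- by rewrite -ltnS ltn_ord.
move=> n; rewrite prednK //; apply/idP/andP => [In|[mn nM]].
  by split; [exact: mP | exact: MP].
move/(_ m)/forallP/(_ n)/forallP/(_ M)/implyP: iI; apply.
by rewrite mn nM; apply/and3P.
Qed.

Lemma sum_ord_interval N (I : {set 'I_N.+1}) i j (G : nat -> R) : (j <= N)%N ->
  (forall n : 'I_N.+1, (n \in I) = (i < n <= j)%N) ->
  \sum_(n in I) G n = \sum_(i.+1 <= n < j.+1) G n.
Proof.
move=> jN hI; rewrite (eq_bigl (fun n : 'I_N.+1 => (i < n <= j)%N)) //.
rewrite -(big_mkord (fun n => (i < n <= j)%N)) [RHS](@big_nat_widenl _ _ _ _ 0%N) //.
by rewrite [RHS](@big_nat_widen _ _ _ _ _ N.+1).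
Qed.

Definition disc q a n : R := thetaAP R n q a - n%:R / (totient q)%:R.

Lemma theta_disc N (I : {set 'I_N.+1}) i j q a : (i <= j)%N -> (j <= N)%N ->
  (forall n : 'I_N.+1, (n \in I) = (i < n <= j)%N) ->
  theta R I q a - #|I|%:R / (totient q)%:R = disc q a j - disc q a i.
Proof.
move=> ij jN hI.
have -> : theta R I q a = thetaAP R j q a - thetaAP R i q a.
  have e : j = (i + (j - i))%N by rewrite subnKC.
  rewrite [in thetaAP R j q a]e -theta_blk_thetaAP /theta_blk /blk -e [RHS]big_mkcond /theta big_mkcondr /=.
  rewrite -(sum_ord_interval _ jN hI); apply: eq_bigr => n _.
  by rewrite /lp; case: prime; case: (_ == _ %[mod _]).
have -> : #|I|%:R = j%:R - i%:R :> R.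
  rewrite -sum1_card natr_sum (@sum_ord_interval _ _ i j (fun=> 1)) //.
  by rewrite sumr_const_nat subSS natrB.
rewrite /disc; ring.
Qed.

(** The right side does not depend on the partition, which is what allows the maximum to be taken
    inside the sums over [q] and [a]. *)
Lemma part_sum_le N (P : {set {set 'I_N.+1}}) q a (w : nat -> R) W kap B : interval_partition P ->
  (0 < W)%N -> (forall n, 0 <= w n) ->
  (forall i j, (i <= j)%N -> (j <= N)%N -> (j <= i + W)%N ->
     (disc q a j - disc q a i) ^+ 2 <= \sum_(i.+1 <= n < j.+1) w n) ->
  (N %/ W <= 2 ^ kap)%N -> (N %/ W <= B)%N ->
  part_sum R P q a <= 3 * \sum_(1 <= n < N.+1) w n +
    3 * ((2 * kap + 1)%:R * grid_sum (disc q a) W kap B (fun u v => (v <= N)%N)).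
Proof.
move=> /andP[pP /forallP iP] W0 w0 short Nk NB.
have hg : forall n : 'I_N.+1, (n \in ground N) = (0 < n <= N)%N.
  by move=> n; rewrite inE; have := ltn_ord n; rewrite ltnS => ->; rewrite andbT.
have P0 I : I \in P -> I != finset.set0.
  by move=> IP; apply: contraTneq IP => ->; case/and3P: pP.
have Pg I : I \in P -> I \subset ground N.
  by case/and3P: pP => /eqP <- _ _ IP; exact: (finset.bigcup_sup I).
set F := disc q a.
pose Dk l k := (F (k.+1 * 2 ^ l * W)%N - F (k * 2 ^ l * W)%N) ^+ 2.
(* Each block is charged to its right endpoint. A block inside a part has its endpoint in that part,
   so summing point charges over all parts counts no block twice. *)
pose G (n : 'I_N.+1) : R := 3 * w n + 3 * ((2 * kap + 1)%:R * \sum_(0 <= l < kap.+1)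
  \sum_(0 <= k < B) if n == (k.+1 * 2 ^ l * W)%N :> nat then Dk l k else 0).
have D0 l k : 0 <= Dk l k by exact: sqr_ge0.
apply: le_trans (_ : \sum_(I in P) \sum_(n in I) G n <= _).
  apply: ler_sum => I IP; have [i [j [ij jN hI]]] := interval_ends (P0 I IP) (Pg I IP) (implyP (iP I) IP).
  rewrite (theta_disc q a ij jN hI); apply: le_trans (interval_ineq W0 w0 short Nk NB ij jN) _.
  rewrite /G big_split /= -!mulr_sumr (sum_ord_interval w jN hI) lerD2l ler_pM2l //.
  apply: ler_wpM2l => //; rewrite exchange_big /=; apply: ler_sum => l _.
  rewrite exchange_big /= big_mkcond; apply: ler_sum => k _; case: ifP => [/andP[h1 h2]|_].
    have vN : (k.+1 * 2 ^ l * W < N.+1)%N by rewrite ltnS (leq_trans h2).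
    rewrite (bigD1 (Ordinal vN)) /= ?eqxx ?lerDl ?sumr_ge0 //.
      by move=> n _; case: ifP.
    rewrite hI /= h2 andbT; apply: leq_ltn_trans h1 _.
    by rewrite ltn_pmul2r // ltn_pmul2r ?expn_gt0.
  by apply: sumr_ge0 => n _; case: ifP.
rewrite -(set_partition_big _ pP) /G big_split /= -!mulr_sumr (sum_ord_interval w (leqnn N) hg).
rewrite lerD2l ler_pM2l //; apply: ler_wpM2l => //.
rewrite exchange_big /=; apply: ler_sum => l _.
rewrite exchange_big /= [X in _ <= X]big_mkcond; apply: ler_sum => k _.
rewrite (@sum_ord_interval _ _ 0%N N (fun n => if n == (k.+1 * 2 ^ l * W)%N then Dk l k else 0)) //.
rewrite -big_mkcond big_nat1_eq ltnS -/(Dk l k).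
by case: (k.+1 * _ * _ <= N)%N; rewrite ?andbF // andbT; case: ifP.
Qed.

Lemma part_sum_ge0 N (P : {set {set 'I_N.+1}}) q a : 0 <= part_sum R P q a.
Proof. by apply: sumr_ge0 => I _; exact: sqr_ge0. Qed.

Lemma max_part_ge0 N q a : 0 <= max_part R N q a.
Proof.
rewrite /max_part; elim/big_rec: _ => // P y _ y0.
by rewrite le_max part_sum_ge0.
Qed.

Lemma max_part_le N q a (b : R) : 0 <= b ->
  (forall P : {set {set 'I_N.+1}}, interval_partition P -> part_sum R P q a <= b) ->
  max_part R N q a <= b.
Proof. by move=> b0 h; rewrite /max_part; elim/big_ind: _ => // x y; rewrite ge_max => -> ->. Qed.

End Partitions.

(** * Summation over moduli and conclusion *)

Section Assembly.
Variable R : realType.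
Implicit Types (n m l k N i j W q a A kap B : nat).

Lemma count_short i j W q a : (0 < q)%N -> (j <= i + W)%N ->
  \sum_(n <- blk i (j - i) | n == a %[mod q]) 1 <= (W %/ q + 2)%:R :> R.
Proof.
move=> q0 jW; rewrite -big_filter; set s := seq.filter _ _.
rewrite [X in X <= _](_ : _ = \sum_(b <- map (fun n => n %/ q)%N s) 1); last by rewrite big_map.
have -> : (W %/ q + 2)%:R = \sum_(i %/ q <= b < i %/ q + (W %/ q + 2)) 1 :> R.
  by rewrite sumr_const_nat addKn.
apply: sum_uniq_sub => //; rewrite ?iota_uniq //.
  rewrite map_inj_in_uniq ?filter_uniq ?blk_uniq // => n n'.
  rewrite !mem_filter => /andP[/eqP e _] /andP[/eqP e' _] d.
  by rewrite (divn_eq n q) (divn_eq n' q) d e e'.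
move=> b /mapP [n]; rewrite mem_filter mem_blk mem_index_iota => /and3P[_ n1 n2] ->.
rewrite leq_div2r ?(ltnW n1) //= ltn_divLR //.
have := ltn_ceil i q0; have := ltn_ceil W q0; clear -n1 n2 jW.
move: (i %/ q)%N (W %/ q)%N => x y; nia.
Qed.

(** Point weights whose sum dominates the squared discrepancy of an interval of length at most [W],
    by Cauchy-Schwarz over the at most [W / q + 2] integers of the class. *)
Definition short_weight W q a n : R :=
  2 * ((W %/ q + 2)%:R * (if n == a %[mod q] then lp R n ^+ 2 else 0))
  + 2 * (W%:R / (totient q)%:R ^+ 2).

Lemma short_weight_ge0 W q a n : 0 <= short_weight W q a n.
Proof.
rewrite addr_ge0 // mulr_ge0 // ?divr_ge0 ?sqr_ge0 // mulr_ge0 //.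
by case: ifP => // _; exact: sqr_ge0.
Qed.

Lemma short_ineq W q a i j : (0 < q)%N -> (i <= j)%N -> (j <= i + W)%N ->
  (disc R q a j - disc R q a i) ^+ 2 <= \sum_(i.+1 <= n < j.+1) short_weight W q a n.
Proof.
move=> q0 ij jW; have e : (i + (j - i) = j)%N by rewrite subnKC.
have -> : disc R q a j - disc R q a i = theta_blk R i (j - i) q a - (j - i)%:R / (totient q)%:R.
  by rewrite theta_blk_thetaAP e natrB // /disc; ring.
have h := @sqr_sum_le R _ (blk i (j - i)) (fun n => n == a %[mod q]) (lp R) _ (count_short a q0 jW).
rewrite -/(theta_blk R i (j - i) q a) in h.
have -> : \sum_(i.+1 <= n < j.+1) short_weight W q a n =
    2 * ((W %/ q + 2)%:R * \sum_(n <- blk i (j - i) | n == a %[mod q]) lp R n ^+ 2) +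
    2 * ((j - i)%:R * (W%:R / (totient q)%:R ^+ 2)).
  rewrite /short_weight big_split /= -!mulr_sumr /blk e -big_mkcond sumr_const_nat subSS.
  by congr (_ + 2 * _); rewrite -[_ ^- 2 *+ _]mulr_natl mulrCA.
have h2 : ((j - i)%:R / (totient q)%:R) ^+ 2 <= (j - i)%:R * (W%:R / (totient q)%:R ^+ 2) :> R.
  rewrite exprMn exprVn expr2 -mulrA ler_wpM2l // ler_wpM2r ?invr_ge0 ?sqr_ge0 // ler_nat.
  by rewrite leq_subLR.
move: h h2; set x := theta_blk _ _ _ _ _; set y := _ / _; set z := _ * \sum_(_ <- _ | _) _; set t := _ * (_ / _).
clearbody x y z t; clear => h h2.
have := sqr_ge0 (x + y); nra.
Qed.

(** Needed to pass from residues 1, ..., q to 0, ..., q - 1; the two ranges differ only in the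
    representative of the zero class, which is coprime to [q] for [q = 1]. *)
Lemma max_part_period N q : max_part R N q q = max_part R N q 0.
Proof.
rewrite /max_part; apply: eq_bigr => P _; apply: eq_bigr => I _; congr ((_ - _) ^+ 2).
by apply: eq_bigl => p; rewrite modnn mod0n.
Qed.

Lemma sum_coprime_shift (f : nat -> R) q : (0 < q)%N -> f q = f 0%N ->
  \sum_(1 <= a < q.+1 | coprime a q) f a = \sum_(0 <= a < q | coprime a q) f a.
Proof.
move=> q0 fq; rewrite big_mkcond [RHS]big_mkcond big_nat_recr // [RHS]big_ltn //= addrC.
by rewrite /coprime gcdnn gcd0n fq.
Qed.

Lemma sum_short_weight N W q : (0 < q)%N ->
  \sum_(0 <= a < q | coprime a q) \sum_(1 <= n < N.+1) short_weight W q a n <=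
  2 * ((W %/ q + 2)%:R * \sum_(1 <= n < N.+1) lp R n ^+ 2) + 2 * (N%:R * (W%:R / (totient q)%:R)).
Proof.
move=> q0; have f0 : (totient q)%:R != 0 :> R by rewrite pnatr_eq0 -lt0n totient_gt0.
rewrite exchange_big /= /short_weight.
rewrite (eq_bigr (fun n => 2 * ((W %/ q + 2)%:R * (\sum_(0 <= a < q | coprime a q)
  if n == a %[mod q] then lp R n ^+ 2 else 0)) + 2 * (W%:R / (totient q)%:R))); last first.
  move=> n _; rewrite big_split /= -!mulr_sumr; congr (_ + 2 * _).
  rewrite big_const_seq iter_addr_0 -[_ ^- 2 *+ _]mulr_natr.
  have -> : count (fun a => coprime a q) (index_iota 0 q) = totient q.
    rewrite totient_count_coprime -sum1_count big_mkcond; apply: eq_bigr => a _.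
    by rewrite coprime_sym; case: coprime.
  by field.
rewrite big_split /=; apply: lerD; last first.
  by rewrite sumr_const_nat subn1 /= -[X in X <= _]mulr_natl mulrCA.
rewrite -!mulr_sumr ler_pM2l //; apply: ler_wpM2l => //; apply: ler_sum => n _.
rewrite -big_mkcondr -[X in _ <= X](@sum_residue R (fun=> lp R n ^+ 2) q n q0).
rewrite big_mkcond [X in _ <= X]big_mkcond; apply: ler_sum => a _.
by case: (n == a %[mod q]); rewrite ?andbF //= andbT; case: ifP => _ //; rewrite sqr_ge0.
Qed.

Lemma sum_disc_blockvar q u L : \sum_(0 <= a < q | coprime a q) (disc R q a (u + L) - disc R q a u) ^+ 2 = blockvar R u L q.
Proof.
apply: eq_bigr => a _; congr (_ ^+ 2); rewrite theta_blk_thetaAP /disc natrD; ring.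
Qed.

(** On each level the blocks are disjoint of length [2 ^ l W >= W], so a block bound proportional to
    the length adds up to at most [N T]. *)
Lemma sum_grid_blockvar N W kap B (T : R) : (0 < W)%N ->
  (forall u L, (W <= L)%N -> (u + L <= N)%N -> \sum_(1 <= q < W.+1) blockvar R u L q <= L%:R * T) -> 0 <= T ->
  \sum_(1 <= q < W.+1) \sum_(0 <= a < q | coprime a q)
    grid_sum (disc R q a) W kap B (fun u v => (v <= N)%N) <= kap.+1%:R * (N%:R * T).
Proof.
move=> W0 hT T0.
have -> : \sum_(1 <= q < W.+1) \sum_(0 <= a < q | coprime a q)
    grid_sum (disc R q a) W kap B (fun u v => (v <= N)%N) =
  \sum_(0 <= l < kap.+1) \sum_(0 <= k < B | (k.+1 * 2 ^ l * W <= N)%N)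
    \sum_(1 <= q < W.+1) blockvar R (k * 2 ^ l * W) (2 ^ l * W) q.
  rewrite /grid_sum; under eq_bigr do rewrite exchange_big /=.
  rewrite exchange_big /=; apply: eq_bigr => l _.
  under eq_bigr do rewrite exchange_big /=.
  rewrite exchange_big /=; apply: eq_bigr => k _; apply: eq_bigr => q _.
  rewrite -sum_disc_blockvar; apply: eq_bigr => a _.
  by rewrite mulSn mulnDl addnC.
rewrite -[kap.+1%:R]natr1 -[X in _ <= X]mulr1.
apply: le_trans (_ : \sum_(0 <= l < kap.+1) N%:R * T <= _); last first.
  by rewrite sumr_const_nat subn0 -[X in X <= _]mulr_natl natr1 mulr1.
apply: ler_sum => l _; have m0 : (0 < 2 ^ l * W)%N by rewrite muln_gt0 expn_gt0.
apply: le_trans (_ : \sum_(0 <= k < B | (k.+1 * 2 ^ l * W <= N)%N) (2 ^ l * W)%:R * T <= _).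
  apply: ler_sum => k kN; apply: hT; first by rewrite leq_pmull // expn_gt0.
  by rewrite -mulnA -mulSnr mulnA.
rewrite -mulr_suml; apply: ler_wpM2r => //.
apply: le_trans (_ : \sum_(0 <= k < N %/ (2 ^ l * W)) (2 ^ l * W)%:R <= _); last first.
  by rewrite sumr_const_nat subn0 -[X in X <= _]mulr_natr -natrM ler_nat mulnC leq_divM.
rewrite -big_filter; apply: sum_uniq_sub; rewrite ?filter_uniq ?iota_uniq // => k.
by rewrite mem_filter !mem_index_iota -mulnA leq_divRL // => /andP[].
Qed.

(** The short ends cost only [x W X ^ 2]. The blocks cost [x W X ^ 2 Y ^ 4] with [Y = 1 + ln X], two
    factors [Y] from [block_estimate] and two from the dyadic decomposition, and [Y ^ 4] is at most
    a multiple of [X]. *)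
Lemma large_bound A : exists X0 : R, exists2 C : R, 1 <= X0 /\ 1 <= C & forall (x : R) W,
  1 < x -> X0 <= ln x -> x <= 2 * ln x ^+ A * W%:R -> W%:R <= x ->
  \sum_(1 <= q < W.+1) \sum_(1 <= a < q.+1 | coprime a q) max_part R (Num.truncn x) q a <=
  C * (x * W%:R * ln x ^+ 3).
Proof.
have [X0 [C [X01 C1] hC]] := block_estimate R A.
have [c c1 hc] := theta_upper R.
have [c6 c61 hc6] := @lnX_le_powR R 4 1 ltr01.
pose a1 : R := 4 + 2 * A%:R.
have a10 : 0 <= a1 by rewrite /a1 addr_ge0 // mulr_ge0.
pose C2 := 24 * c + 36 + 6 * (a1 * a1 * C * (c6 * expR 1)).
have e0 := expR_gt0 (1 : R).
have T20 : 0 <= a1 * a1 * C * (c6 * expR 1).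
  by rewrite !mulr_ge0 ?(ltW e0) //; [exact: le_trans C1 | exact: le_trans c61].
exists X0; exists C2; first by split => //; rewrite /C2; lra.
move=> x W x1 hX hW Wx; have H := hC x W _ _ x1 hX hW; set X := ln x in hX hW H *.
have X1 : 1 <= X by exact: le_trans hX.
have Xp : 0 < X by exact: lt_le_trans X1.
have x0 : 0 < x by exact: lt_trans x1.
have W0 : (0 < W)%N.
  rewrite lt0n; apply: contraTneq hW => ->; by rewrite mulr0 -ltNge.
set N := Num.truncn x.
have Nx : N%:R <= x by rewrite /N truncn_le ltW.
have WN : (W <= N)%N by rewrite /N truncn_ge_nat // ltW.
have N0 : (0 < N)%N by exact: leq_trans WN.
have lN n : (0 < n)%N -> n%:R <= x -> ln n%:R <= X.
  by move=> n0 nx; rewrite /X ler_ln ?posrE ?ltr0n.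
set d := (N %/ W)%N; have d0 : (0 < d)%N by rewrite divn_gt0.
(* As [N / W <= 2 X ^ A], the number of levels is at most a multiple of [1 + ln X]. *)
pose kap := (trunc_log 2 d).+1.
have dk : (d <= 2 ^ kap)%N by apply: ltnW; exact: trunc_log_ltn.
set Y := 1 + ln X; have Y1 : 1 <= Y by rewrite /Y lerDl ln_ge0.
have kapY : kap.+1%:R <= a1 * Y.
  have k1 : (trunc_log 2 d)%:R <= 2 * ln d%:R :> R by apply: log2_le; exact: trunc_logP.
  have k2 : ln d%:R <= 1 + A%:R * ln X.
    apply: le_trans (_ : ln (2 * X ^+ A) <= _).
      rewrite ler_ln ?posrE ?ltr0n ?mulr_gt0 ?exprn_gt0 //.
      have [dle _] := @divn_real R N W W0; apply: le_trans dle _.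
      by rewrite ler_pdivrMr ?ltr0n //; apply: le_trans Nx hW.
    rewrite lnM ?posrE ?exprn_gt0 // lnXn // -[_ *+ A]mulr_natl lerD2r.
    by apply: le_trans (ln_le_sub1 _) _ => //; lra.
  have -> : kap.+1%:R = (trunc_log 2 d)%:R + 2 :> R by rewrite /kap -!natr1; ring.
  have lX0 : 0 <= ln X by rewrite ln_ge0.
  have A0 : 0 <= A%:R :> R by [].
  rewrite /a1 /Y; move: k1 k2 lX0 A0; clear.
  move: (_%:R) (ln d%:R) (ln X) (A%:R : R) => k1 ld lX A' *; nra.
pose T := C * (W%:R * X ^+ 2 * Y ^+ 2).
have T0 : 0 <= T.
  rewrite /T !mulr_ge0 ?sqr_ge0 //; [exact: le_trans C1 | exact: ltW | exact: ltW | exact: le_trans Y1..].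
have HT u L : (W <= L)%N -> (u + L <= N)%N -> \sum_(1 <= q < W.+1) blockvar R u L q <= L%:R * T.
  move=> WL uL; apply: le_trans (H u L WL _) _.
    by apply: le_trans Nx; rewrite ler_nat.
  by rewrite -/Y /T; rewrite le_eqVlt; apply/orP; left; apply/eqP; ring.
have G := @sum_grid_blockvar N W kap d T W0 HT T0.
have bound q : (0 < q)%N -> \sum_(1 <= a < q.+1 | coprime a q) max_part R N q a <=
    3 * \sum_(0 <= a < q | coprime a q) \sum_(1 <= n < N.+1) short_weight W q a n +
    3 * ((2 * kap + 1)%:R * \sum_(0 <= a < q | coprime a q)
       grid_sum (disc R q a) W kap d (fun u v => (v <= N)%N)).
  move=> q0; rewrite sum_coprime_shift ?max_part_period // !mulr_sumr -big_split /=.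
  apply: ler_sum => a ca; apply: max_part_le => [|P hP].
    rewrite addr_ge0 // !mulr_ge0 //.
      by apply: sumr_ge0 => n _; exact: short_weight_ge0.
    by do 2 (apply: sumr_ge0 => ? _); exact: sqr_ge0.
  apply: part_sum_le => // [n|i j ij jN jW]; first exact: short_weight_ge0.
  exact: short_ineq.
apply: le_trans (_ : \sum_(1 <= q < W.+1) (3 *
    \sum_(0 <= a < q | coprime a q) \sum_(1 <= n < N.+1) short_weight W q a n +
    3 * ((2 * kap + 1)%:R * \sum_(0 <= a < q | coprime a q)
       grid_sum (disc R q a) W kap d (fun u v => (v <= N)%N))) <= _).
  by rewrite big_nat [X in _ <= X]big_nat; apply: ler_sum => q /andP[q0 _]; exact: bound.
rewrite big_split /= -!mulr_sumr.
have S1 : \sum_(1 <= q < W.+1) \sum_(0 <= a < q | coprime a q) \sum_(1 <= n < N.+1) short_weight W q a n <=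
    (8 * c + 12) * (x * W%:R * X ^+ 3).
  apply: le_trans (_ : \sum_(1 <= q < W.+1) (2 * ((W %/ q + 2)%:R * \sum_(1 <= n < N.+1) lp R n ^+ 2)
     + 2 * (N%:R * (W%:R / (totient q)%:R))) <= _).
    by rewrite big_nat [X in _ <= X]big_nat; apply: ler_sum => q /andP[q0 _]; exact: sum_short_weight.
  rewrite big_split /= -!mulr_sumr -mulr_suml.
  have b1 : \sum_(1 <= n < N.+1) lp R n ^+ 2 <= X * (c * x).
    apply: le_trans (_ : X * thetaAP R N 1 0 <= _); last first.
      apply: ler_wpM2l; first exact: ltW.
      apply: le_trans (hc N) _; apply: ler_wpM2l => //; exact: le_trans c1.
    rewrite thetaAP_lp mulr_sumr.
    rewrite [X in _ <= X](eq_bigl xpredT); last by move=> n; rewrite !modn1.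
    rewrite [X in X <= _]big_nat [X in _ <= X]big_nat; apply: ler_sum => n /andP[n0 nN].
    rewrite expr2; apply: ler_wpM2r; first exact: lp_ge0.
    rewrite /lp; case: ifP => _; last exact: ltW.
    by apply: lN => //; apply: le_trans Nx; rewrite ler_nat.
  have b2 : \sum_(1 <= q < W.+1) (W %/ q + 2)%:R <= 4 * (W%:R * X) :> R.
    apply: le_trans (_ : \sum_(1 <= q < W.+1) (W%:R * q%:R^-1 + 2) <= _).
      rewrite big_nat [X in _ <= X]big_nat; apply: ler_sum => q /andP[q0 _].
      by rewrite natrD lerD2r; have [] := @divn_real R W q q0.
    rewrite big_split /= -mulr_sumr sumr_const_nat subn1 /= -[2 *+ W]mulr_natr.
    have := ler_wpM2l (ler0n R W) (@harmonic_le R W W0).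
    have := ler_wpM2l (ler0n R W) (lN W W0 Wx); have := ler_wpM2l (ler0n R W) X1.
    by clear; move: (\sum_(_ <= _ < _) _) (ln W%:R) => *; lra.
  have b3 : \sum_(1 <= q < W.+1) (totient q)%:R^-1 <= 6 * X ^+ 2.
    apply: le_trans (@sum_inv_totient_le R W W0) _; have := ln_nat_ge0 R W.
    have := lN W W0 Wx; move: X1; clear; clearbody X; move: (ln W%:R) => *; nra.
  have b1' : 0 <= \sum_(1 <= n < N.+1) lp R n ^+ 2 by apply: sumr_ge0 => *; exact: sqr_ge0.
  have b2' : 0 <= \sum_(1 <= q < W.+1) (W %/ q + 2)%:R :> R by apply: sumr_ge0.
  have b3' : 0 <= \sum_(1 <= q < W.+1) (totient q)%:R^-1 :> R.
    by apply: sumr_ge0 => *; rewrite invr_ge0.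
  have p1 := ler_pM b2' b1' b2 b1.
  have w0 : 0 <= W%:R :> R by [].
  have p2 : N%:R * (W%:R * \sum_(1 <= q < W.+1) (totient q)%:R^-1) <= x * (W%:R * (6 * X ^+ 2)).
    by apply: ler_pM => //; rewrite ?mulr_ge0 //; apply: ler_wpM2l.
  have xw0 : 0 <= x * W%:R by rewrite mulr_ge0 // ltW.
  have p3 : x * W%:R * X ^+ 2 <= x * W%:R * X ^+ 3.
    by apply: ler_wpM2l => //; rewrite exprS ler_peMl // sqr_ge0.
  have p4 := ler_wpM2l (le_trans ler01 c1) p3.
  move: p1 p2 p3 p4; clear.
  move: (\sum_(_ <= _ < _) _) (\sum_(_ <= _ < _) _) (\sum_(_ <= _ < _) _) (W%:R) (N%:R) => s1 s2 s3 w n p1 p2 p3 p4.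
  lra.
have S2 : (2 * kap + 1)%:R * \sum_(1 <= q < W.+1) \sum_(0 <= a < q | coprime a q)
       grid_sum (disc R q a) W kap d (fun u v => (v <= N)%N) <=
    2 * (a1 * a1 * C * (c6 * expR 1)) * (x * W%:R * X ^+ 3).
  apply: le_trans (ler_wpM2l _ G) _ => //.
  have Y4 : Y ^+ 4 <= c6 * expR 1 * X.
    have := hc6 (expR 1 * X); rewrite lnM ?posrE // expRK powRr1 ?mulr_ge0 ?(ltW e0) ?(ltW Xp) //.
    rewrite -/Y mulrA; apply; rewrite mulr_ege1 //.
    by rewrite -expR0 ler_expR.
  have k2 : (2 * kap + 1)%:R <= 2 * (a1 * Y).
    apply: le_trans (_ : 2 * kap.+1%:R <= _); last by rewrite ler_pM2l.
    by rewrite -natrM ler_nat mulnS addnC leq_add2r.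
  have NT : N%:R * T <= x * T by exact: ler_wpM2r.
  apply: le_trans (_ : 2 * (a1 * Y) * (a1 * Y * (x * T)) <= _).
    have NT0 := mulr_ge0 (ler0n R N) T0; have K0 := mulr_ge0 (ler0n R kap.+1) NT0.
    exact: ler_pM (ler0n _ _) K0 k2 (ler_pM (ler0n _ _) NT0 kapY NT).
  have -> : 2 * (a1 * Y) * (a1 * Y * (x * T)) = 2 * (a1 * a1 * C) * (x * W%:R * X ^+ 2) * Y ^+ 4.
    by rewrite /T; ring.
  have -> : 2 * (a1 * a1 * C * (c6 * expR 1)) * (x * W%:R * X ^+ 3) =
     2 * (a1 * a1 * C) * (x * W%:R * X ^+ 2) * (c6 * expR 1 * X) by ring.
  apply: ler_wpM2l => //; rewrite !mulr_ge0 ?(ltW x0) ?(ltW Xp) //; exact: le_trans C1.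
have -> : C2 * (x * W%:R * X ^+ 3) = 3 * ((8 * c + 12) * (x * W%:R * X ^+ 3)) +
   3 * (2 * (a1 * a1 * C * (c6 * expR 1)) * (x * W%:R * X ^+ 3)) by rewrite /C2; ring.
by apply: lerD; rewrite ler_pM2l.
Qed.

Lemma term_le_sum (f : nat -> R) n m : (n < m)%N -> (forall i, 0 <= f i) ->
  f n <= \sum_(0 <= i < m) f i.
Proof.
move=> nm f0; rewrite (@big_cat_nat _ _ _ n) //=; last exact: ltnW.
by rewrite [X in _ + X]big_ltn // addrCA lerDl addr_ge0 ?sumr_ge0.
Qed.

End Assembly.

(** For large [x] this is [large_bound] at [W = floor Q]. For bounded [x] the left side depends only
    on the integer parts of [Q] and [x], hence takes finitely many values, and the right side is
    bounded below. *)
Theorem theorem4 (R : realType) (A : R) (hA : 0 < A) :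
  exists C : R, 0 < C /\
  forall x Q : R, 1 < x -> 0 < Q ->
    x * (ln x) `^ (- A) <= Q -> Q <= x ->
    \sum_(1 <= q < (Num.truncn Q).+1)
      \sum_(1 <= a < q.+1 | coprime a q)
        max_part R (Num.truncn x) q a
    <= C * x * Q * (ln x) ^+ 3.
Proof.
(* An integer exponent at least [A]. *)
pose A' := (Num.truncn A).+1.
have AA : A <= A'%:R by exact: ltW (truncnS_gt _).
have [X1 [C1 [X11 C11] large]] := large_bound R A'.
have [c c1 hc] := @lnX_le_powR R A'.+1 1 ltr01.
pose X0 := Num.max X1 c; have X01 : 1 <= X0 by rewrite le_max X11.
pose n0 := (Num.truncn (expR X0)).+1.
pose LHS w N := \sum_(1 <= q < w.+1) \sum_(1 <= a < q.+1 | coprime a q) max_part R N q a.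
have LHS0 w N : 0 <= LHS w N by do 2 (apply: sumr_ge0 => ? _); exact: max_part_ge0.
(* A crude majorant of all values of the left side with [ln x < X0]; both integer parts are then
   below [n0]. *)
pose B := \sum_(0 <= w < n0) \sum_(0 <= N < n0) LHS w N.
have B0 : 0 <= B by do 2 (apply: sumr_ge0 => ? _); exact: LHS0.
have XA0 : 0 < X0 `^ A by rewrite powR_gt0 // (lt_le_trans ltr01).
exists (C1 + B * X0 `^ A); split.
  by rewrite ltr_pwDl ?mulr_ge0 ?(ltW XA0) // (lt_le_trans ltr01).
move=> x Q x1 Q0 hQ Qx; rewrite -/(LHS _ _).
have x0 : 0 < x by exact: lt_trans x1.
have Xp : 0 < ln x by rewrite ln_gt0.
set X := ln x in hQ Xp *.
(* Comparing [x X ^ (- A) <= Q] with [Q <= x] forces [X ^ (- A) <= 1], so the hypotheses already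
   imply that [ln x] is at least 1. *)
have XX : 1 <= X.
  have : X `^ (- A) <= 1 by rewrite -(ler_pM2l x0) mulr1; exact: le_trans Qx.
  rewrite powRE // -expR0 ler_expR mulNr oppr_le0 pmulr_rge0 // => h.
  by rewrite -[X in _ <= X]lnK ?posrE // ler_expR.
have XA : x <= X `^ A * Q.
  move: hQ; rewrite powRN -[_ <= Q](@ler_pM2r _ (X `^ A)) ?powR_gt0 // divfK ?gt_eqF ?powR_gt0 //.
  by rewrite mulrC.
have xQ0 : 0 <= x * Q * X ^+ 3 by rewrite !mulr_ge0 ?exprn_ge0 // ltW.
have -> : (C1 + B * X0 `^ A) * x * Q * X ^+ 3 = C1 * (x * Q * X ^+ 3) + B * (X0 `^ A * (x * Q * X ^+ 3)) by ring.
have [hX|hX] := leP X0 X.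
  have hX1 : X1 <= X by apply: le_trans hX; rewrite le_max lexx.
  have cX : c <= X by apply: le_trans hX; rewrite le_max lexx orbT.
  have xQ : x <= X ^+ A' * Q.
    apply: le_trans XA _; apply: ler_wpM2r; first exact: ltW.
    by rewrite -powR_mulrn ?(ltW Xp) // powR_monoD.
  have Q1 : 1 <= Q.
    have := hc x (ltW x1); rewrite powRr1 ?(ltW x0) // -/X exprS => h.
    have XA'0 : 0 < X ^+ A' by exact: exprn_gt0.
    have h1 : X * X ^+ A' <= X * (X ^+ A' * Q).
      apply: le_trans h (le_trans (ler_wpM2l (le_trans ler01 c1) xQ) _).
      by apply: ler_wpM2r => //; rewrite mulr_ge0 ?ltW.
    by move: h1; rewrite ler_pM2l // ler_pMr.
  set W := Num.truncn Q.
  have WQ : W%:R <= Q by rewrite /W truncn_le ltW.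
  have W1 : 1 <= W%:R :> R by rewrite ler1n /W truncn_ge_nat // ltW.
  have QW : Q <= 2 * W%:R.
    clear -xQ0 hX hX1 cX xQ Q1 WQ W1; by apply: le_trans (ltW (truncnS_gt Q)) _; rewrite -/W -natr1; move: W1; lra.
  have xW : x <= 2 * X ^+ A' * W%:R.
    apply: le_trans xQ _; rewrite [2 * _]mulrC -mulrA; apply: ler_wpM2l => //.
    by rewrite exprn_ge0 // ltW.
  apply: le_trans (large x W x1 hX1 xW (le_trans WQ Qx)) _.
  apply: le_trans (_ : C1 * (x * Q * X ^+ 3) <= _).
    apply: ler_wpM2l; first exact: le_trans C11.
    apply: ler_wpM2r; first by rewrite exprn_ge0 // ltW.
    by apply: ler_wpM2l => //; exact: ltW.
  by rewrite lerDl !mulr_ge0 ?exprn_ge0 // ltW.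
have xe : x <= expR X0 by rewrite -(@lnK _ x) ?posrE // ler_expR ltW.
have tn y : 0 <= y -> y <= expR X0 -> (Num.truncn y < n0)%N.
  by move=> y0 ye; rewrite ltnS truncn_le_nat //; apply: le_lt_trans ye (truncnS_gt _).
apply: le_trans (_ : B <= _).
  have wn := tn Q (ltW Q0) (le_trans Qx xe); have xn := tn x (ltW x0) xe.
  apply: le_trans (term_le_sum xn (LHS0 _)) (term_le_sum (f := fun w => \sum_(0 <= N < n0) LHS w N) wn _).
  by move=> w; apply: sumr_ge0 => *; exact: LHS0.
rewrite -[X in X <= _]mulr1; apply: le_trans (_ : B * (X0 `^ A * (x * Q * X ^+ 3)) <= _); last first.
  by rewrite lerDr mulr_ge0 // (le_trans ler01).
apply: ler_wpM2l => //.
apply: le_trans (_ : X0 `^ A * Q <= _).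
  apply: le_trans (ltW x1) (le_trans XA _); apply: ler_wpM2r; first exact: ltW.
  by rewrite ge0_ler_powR ?nnegrE ?ltW // (lt_le_trans ltr01).
apply: ler_wpM2l; first exact: ltW.
rewrite mulrC mulrA ler_peMl // ?(ltW Q0) //.
by rewrite mulr_ege1 ?(ltW x1) // exprn_ege1.
Qed.
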